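(* Let $\Omega\subset\mathbb{R}^2$ be a bounded convex domain. There exists $\omega_0\in L^\infty(\Omega)$ with $\omega_0\ge0$ such that: the set $\{\omega_0<s\}$ is simply connected for every $s\in(\inf\omega_0,\sup\omega_0)$; $\omega_0$ is constant on the boundary $\partial\Omega$; and the kinetic energy functional $E$ has no global minimizer in the $L^\infty$-closure of the coadjoint orbit $\mathcal{O}_{\omega_0}$.
   Context: $\Delta^{-1}$ denotes the solution operator of the Laplace equation with zero Dirichlet boundary condition on $\partial\Omega$. The kinetic energy functional is $E(\omega):=\frac12\int_\Omega|\nabla\Delta^{-1}\omega|^2\,dx$. The coadjoint orbit of $\omega_0$ is $\mathcal{O}_{\omega_0}:=\{\omega_0\circ\eta^{-1}:\eta\in\mathcal{D}_{\mathrm{vol}}(\Omega)\}$, where $\mathcal{D}_{\mathrm{vol}}(\Omega)$ is the group of volume-preserving diffeomorphisms from $\Omega$ to $\Omega$. The $L^\infty$-closure is the closure in the $L^\infty(\Omega)$ norm. The conditions on sublevel sets and on boundary values refer to a pointwise defined representative of $\omega_0$ on $\bar\Omega$. *)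

(* Defs.v *)
From HB Require Import structures.
From mathcomp Require Import all_boot all_order all_algebra.
From mathcomp Require Import all_classical all_reals all_analysis.
Set Implicit Arguments.
Unset Strict Implicit.
Unset Printing Implicit Defensive.
Import Order.TTheory GRing.Theory Num.Theory.
Import numFieldNormedType.Exports.
Local Open Scope classical_set_scope.
Local Open Scope ring_scope.

(* [lebesgue_measure] lives on [measurableTypeR R], whose sigma-algebra is the
   Borel one but is not the instance inferred for [R] itself; [mplane R] and
   [R * R] are convertible as types, and the former is used wherever a
   measurable structure is needed. *)
Definition mline (R : realType) : measurableType _ := measurableTypeR R.
Definition mplane (R : realType) : measurableType _ := (mline R * mline R)%type.

Definition leb2 {R : realType} : {measure set (mplane R) -> \bar R} :=
  (@lebesgue_measure R \x @lebesgue_measure R)%E.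

Section Planar.
Variable R : realType.
Local Notation plane := (R * R)%type.
Implicit Types (Omega A : set plane) (f : plane -> R).

Definition bounded_convex_domain Omega :=
  [/\ open Omega, Omega !=set0, bounded_set Omega & convex_set Omega].

Definition boundary A : set plane := closure A `\` interior A.

Definition path_connected A :=
  forall x y, A x -> A y -> exists c : R -> plane,
    [/\ {within `[0, 1], continuous c}, c 0 = x, c 1 = y &
        forall t, 0 <= t <= 1 -> A (c t)].

(* Every loop in [A] is contracted inside [A], relative to its base point. *)
Definition simply_connected A :=
  path_connected A /\
  forall c : R -> plane,
    {within `[0, 1], continuous c} -> c 0 = c 1 ->
    (forall t, 0 <= t <= 1 -> A (c t)) ->
    exists H : plane -> plane,
      [/\ {within `[0, 1] `*` `[0, 1], continuous H},
          forall t u, 0 <= t <= 1 -> 0 <= u <= 1 -> A (H (t, u)),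
          forall t, 0 <= t <= 1 -> H (t, 0) = c t,
          forall t, 0 <= t <= 1 -> H (t, 1) = c 0 &
          forall u, 0 <= u <= 1 -> H (0, u) = c 0 /\ H (1, u) = c 0].

Definition partial1 f : plane -> R := 'D_((1, 0) : plane) f.
Definition partial2 f : plane -> R := 'D_((0, 1) : plane) f.

Fixpoint Ck Omega (k : nat) f : Prop :=
  (forall x, Omega x -> {for x, continuous f}) /\
  if k is k'.+1 then
    [/\ forall x, Omega x -> derivable f x ((1, 0) : plane),
        forall x, Omega x -> derivable f x ((0, 1) : plane),
        Ck Omega k' (partial1 f) & Ck Omega k' (partial2 f)]
  else True.

Definition smooth Omega f := forall k, Ck Omega k f.

(* C_c^oo(Omega), each function being extended by zero to the plane. *)
Definition test_function Omega f :=
  smooth setT f /\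
  exists K : set plane,
    [/\ compact K, K `<=` Omega & forall x, ~ K x -> f x = 0].

(* Functions on [Omega] are total functions on the plane whose values outside
   [Omega] are ignored: they are replaced by zero in norms. *)
Definition Lp_on (p : \bar R) Omega f : Prop :=
  (f \_ Omega) \in Lfun (@leb2 R) p.

Definition Lp_norm_on (p : \bar R) Omega f : \bar R :=
  ('N[@leb2 R]_p[EFin \o (f \_ Omega)])%E.

Definition is_weak_gradient Omega f (g : (plane -> R) * (plane -> R)) :=
  [/\ Lp_on 2%:E Omega g.1, Lp_on 2%:E Omega g.2 &
      forall phi, test_function Omega phi ->
        (\int[leb2]_(x in Omega) (f x * partial1 phi x) =
          - (\int[leb2]_(x in Omega) (g.1 x * phi x))) /\
        (\int[leb2]_(x in Omega) (f x * partial2 phi x) =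
          - (\int[leb2]_(x in Omega) (g.2 x * phi x)))].

Definition weak_gradient Omega f : (plane -> R) * (plane -> R) :=
  get [set g | is_weak_gradient Omega f g].

(* H^1_0(Omega): the closure of the test functions in H^1(Omega). *)
Definition H10 Omega f :=
  let g := weak_gradient Omega f in
  [/\ Lp_on 2%:E Omega f, is_weak_gradient Omega f g &
      forall e : R, 0 < e -> exists phi, test_function Omega phi /\
        [/\ (Lp_norm_on 2%:E Omega (fun x => (f x - phi x)%R) < e%:E)%E,
            (Lp_norm_on 2%:E Omega
               (fun x => (g.1 x - partial1 phi x)%R) < e%:E)%E &
            (Lp_norm_on 2%:E Omega
               (fun x => (g.2 x - partial2 phi x)%R) < e%:E)%E]].

(* psi is the weak solution of Laplacian psi = w in Omega, psi = 0 on the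
   boundary; it is unique up to a null set. *)
Definition dirichlet_solution Omega (w psi : plane -> R) :=
  let g := weak_gradient Omega psi in
  H10 Omega psi /\
  forall phi, test_function Omega phi ->
    \int[leb2]_(x in Omega)
        (g.1 x * partial1 phi x + g.2 x * partial2 phi x) =
      - (\int[leb2]_(x in Omega) (w x * phi x)).

Definition inv_laplacian Omega (w : plane -> R) : plane -> R :=
  get [set psi | dirichlet_solution Omega w psi].

Definition kinetic_energy Omega (w : plane -> R) : R :=
  let g := weak_gradient Omega (inv_laplacian Omega w) in
  2^-1 * \int[leb2]_(x in Omega) (g.1 x ^+ 2 + g.2 x ^+ 2).

Definition smooth_map Omega (h : plane -> plane) :=
  smooth Omega (fun x => (h x).1) /\ smooth Omega (fun x => (h x).2).

(* eta is a volume-preserving diffeomorphism of Omega, with inverse zeta. *)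
Definition vol_diffeo Omega (eta zeta : plane -> plane) :=
  [/\ smooth_map Omega eta /\ smooth_map Omega zeta,
      (forall x, Omega x -> Omega (eta x)) /\
        (forall x, Omega x -> Omega (zeta x)),
      (forall x, Omega x -> zeta (eta x) = x) /\
        (forall x, Omega x -> eta (zeta x) = x) &
      forall A, @measurable _ (mplane R) A -> A `<=` Omega ->
        leb2 (eta @` A) = leb2 A].

Definition coadjoint_orbit Omega (w0 : plane -> R) : set (plane -> R) :=
  [set w | exists eta zeta, vol_diffeo Omega eta zeta /\ w = w0 \o zeta].

Definition Linfty_closure Omega (S : set (plane -> R)) : set (plane -> R) :=
  [set w | Lp_on +oo%E Omega w /\
    forall e : R, 0 < e -> exists v, S v /\
      (Lp_norm_on +oo%E Omega (fun x => (w x - v x)%R) < e%:E)%E].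

Definition global_minimizer (S : set (plane -> R)) (E : (plane -> R) -> R)
    (w : plane -> R) :=
  S w /\ forall v, S v -> E w <= E v.

End Planar.

(* Main.v *)
Require Import Defs.
From HB Require Import structures.
From mathcomp Require Import all_boot all_order all_algebra.
From mathcomp Require Import all_classical all_reals all_analysis.
From mathcomp Require Import measurable_realfun.
From mathcomp Require Import ring lra.
From mathcomp Require Import ess_sup_inf.
Set Implicit Arguments.
Unset Strict Implicit.
Unset Printing Implicit Defensive.
Import Order.TTheory GRing.Theory Num.Theory.
Import numFieldNormedType.Exports.
Local Open Scope classical_set_scope.
Local Open Scope ring_scope.

(** The vorticity is [2 - 1_K], where [K] is the double lobe
    [(x2 - a2)^4 <= |x1 - a1| <= e^4].  It takes only two values, so every
    element of the L^oo-closure of its orbit agrees almost everywhere with an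
    element [W = 2 - 1_(eta K)] of the orbit.  If [W] minimises the energy, it
    is stationary under twists, the area-preserving maps that rotate small
    circles by angles depending on the radius: the integral of [W V.grad psi]
    vanishes, where [psi] is the stream function and [V] generates the twist.

    Concentrating the twists at a regular boundary point of [eta K] shows that
    the tangential derivative of [psi] vanishes there.  All boundary arcs of [K]
    are connected to each other, the inner ones through [a], so [psi] is equal
    to a constant [c] on the boundary of [eta K], and [psi <= c] on [eta K]
    since the Laplacian of [psi] is positive.  The complement of [eta K] has
    area [O(r^5)] in the ball of radius [r] about [eta a], so that the mean of
    [psi] there is at most [c + O(r^4)]; but it is at least [c + C r^2] because
    the Laplacian of [psi] is at least 1. *)

(** With only two values, orbit elements that are close in the supremum norm agree almost
    everywhere; this is why the closure can be ignored. As 1 is taken on [K] and 2 elsewhere, the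
    only sublevel set to examine is [K], which is star-shaped.

    Twists serve as competitors because they are explicit: they rotate circles, so their
    preservation of area follows from that of rotations, without Jacobians or flows of general
    fields.

    The stream function is only in H^1_0, while the argument needs it and its gradient at points. A
    radial profile whose Laplacian is the difference of the mollifiers of scales [2^-n] and
    [2^-(n+1)] makes successive mollifications of [psi] differ by an average of the bounded
    vorticity. Geometric convergence gives a C^1 representative, and positivity of the differences
    gives the mean-value inequality.

    The exponent 4: for lobes touching to order k, the complement has area O(r^(k+1)), a mollifier
    has height O(r^-2) and [psi - c] is O(r), so the excess is O(r^k). It has to be smaller than
    r^2, and 4 is the first even k above 2. *)

(** * Affine changes of variable for Lebesgue measure on the line *)

Section LebesgueLine.
Context {R : realType}.
Local Notation leb := (@lebesgue_measure R).
Implicit Types A : set (mline R).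

Lemma measurable_shift (p : R) :
  measurable_fun setT (fun x : mline R => (p + x)%R : mline R).
Proof. exact: measurable_funD. Qed.

Lemma measurable_scale (s : R) :
  measurable_fun setT (fun x : mline R => (s * x)%R : mline R).
Proof. exact: measurable_funM. Qed.

(** Lebesgue measure is the only measure with the right values on half-open intervals []a, b]], and
    translates of these are again half-open. *)
Lemma lebesgue_shift (p : R) A : measurable A ->
  leb ((fun x : mline R => (p + x)%R : mline R) @^-1` A) = leb A.
Proof.
move=> mA; apply/esym.
have mp := measurable_shift p.
apply: (@lebesgue_measure_unique R
  (pushforward leb (fun x : mline R => (p + x)%R : mline R))) => //.
move=> _ [[a b]] _ <-.
transitivity (leb `]a - p, b - p]%classic); last first.
  rewrite /pushforward; congr (leb _).
  by apply/seteqP; split => x /=; rewrite !in_itv/= => /andP[h1 h2]; apply/andP; split; lra.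
rewrite !lebesgue_measure_itv/= !lte_fin ltrD2r.
by case: ifP => // _; rewrite -!EFinB; congr (_%:E); ring.
Qed.

(** The same uniqueness argument. The sign of [s] matters: for [s < 0] the preimage of []a, b]] is
    closed on the left, so that case is reduced to this one through the reflection [x -> -x]. *)
Lemma lebesgue_scale_gt0 (s : R) A : 0 < s -> measurable A ->
  (s%:E * leb ((fun x : mline R => (s * x)%R : mline R) @^-1` A))%E = leb A.
Proof.
move=> s0 mA; apply/esym.
have ms := measurable_scale s.
apply: (@lebesgue_measure_unique R (mscale (NngNum (ltW s0))
  (pushforward leb (fun x : mline R => (s * x)%R : mline R)))) => //.
move=> _ [[a b]] _ <-.
transitivity (s%:E * leb `](a / s)%R, (b / s)%R]%classic)%E; last first.
  rewrite /mscale /pushforward; congr (_ * leb _)%E.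
  by apply/seteqP; split => x /=;
    rewrite !in_itv/= ltr_pdivrMr// ler_pdivlMr// ![_ * s]mulrC.
rewrite !lebesgue_measure_itv/= !lte_fin ltr_pM2r ?invr_gt0//.
case: ifP => _; last by rewrite mule0.
by rewrite -!EFinB -EFinM; congr (_%:E); field; rewrite gt_eqF.
Qed.

Lemma lebesgue_scale (s : R) A : s != 0 -> measurable A ->
  (`|s|%:E * leb ((fun x : mline R => (s * x)%R : mline R) @^-1` A))%E = leb A.
Proof.
move=> s0 mA; case: (ltgtP s 0) (s0) => // sx _.
- rewrite -[RHS](lebesgue_measureN mA) /pushforward.
  rewrite -[RHS](@lebesgue_scale_gt0 (- s)) ?oppr_gt0//; last first.
    by rewrite -[X in measurable X]setTI; exact: oppr_measurable.
  rewrite ltr0_norm//; congr (_ * leb _)%E.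
  by apply/funext => x /=; rewrite mulNr opprK.
- by rewrite gtr0_norm//; exact: lebesgue_scale_gt0.
Qed.

End LebesgueLine.

(** * Planar Lebesgue measure under diagonal affine maps and shears *)

Section LebesguePlane.
Context {R : realType}.
Local Notation leb := (@lebesgue_measure R).
Local Notation mu := (@leb2 R).
Implicit Types A B : set (mplane R).

Lemma leb2X (A B : set (mline R)) : measurable A -> measurable B ->
  mu (A `*` B) = (leb A * leb B)%E.
Proof. by move=> mA mB; rewrite /leb2 /= product_measure1E. Qed.

Lemma measurable_diag (p s : R * R) :
  measurable_fun setT
   (fun x : mplane R => ((p.1 + s.1 * x.1)%R, (p.2 + s.2 * x.2)%R) : mplane R).
Proof.
apply: measurable_fun_pair => /=.
  apply: (measurableT_comp (@measurable_shift R p.1)).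
  by apply: (measurableT_comp (@measurable_scale R s.1)) => //; exact: measurable_fst.
apply: (measurableT_comp (@measurable_shift R p.2)).
by apply: (measurableT_comp (@measurable_scale R s.2)) => //; exact: measurable_snd.
Qed.

(** A product measure is determined by its values on measurable rectangles, and there the claim is
    the product of two one-dimensional scalings. *)
Lemma leb2_diag (p s : R * R) A : s.1 != 0 -> s.2 != 0 -> measurable A ->
  (`|s.1 * s.2|%:E * mu ((fun x : mplane R =>
    ((p.1 + s.1 * x.1)%R, (p.2 + s.2 * x.2)%R) : mplane R) @^-1` A))%E = mu A.
Proof.
move=> s1 s2 mA.
pose F : mplane R -> mplane R := fun x =>
  ((p.1 + s.1 * x.1)%R, (p.2 + s.2 * x.2)%R).
rewrite -[X in X @^-1` _]/F.
have mF : measurable_fun setT F := measurable_diag p s.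
pose m' : {measure set (mplane R) -> \bar R} :=
  mscale (NngNum (normr_ge0 (s.1 * s.2))) (pushforward mu F).
apply/esym; apply: (product_measure_unique (m' := m' mF)) => // X Y mX mY.
have sep (r : R) (q : R) (Z : set (mline R)) : r != 0 -> measurable Z ->
   measurable ((fun x : mline R => (q + r * x)%R : mline R) @^-1` Z) /\
   (`|r|%:E * leb ((fun x : mline R => (q + r * x)%R : mline R) @^-1` Z))%E = leb Z.
  move=> r0 mZ.
  have mZ1 : measurable ((fun x : mline R => (q + x)%R : mline R) @^-1` Z).
    by rewrite -[X in measurable X]setTI; exact: measurable_shift.
  split.
    by rewrite -[X in measurable X]setTI;
       apply: (measurable_scale r _ mZ1).
  by rewrite -(lebesgue_shift q mZ) -(lebesgue_scale r0 mZ1).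
have [mX1 EX] := sep s.1 p.1 X s1 mX.
have [mY1 EY] := sep s.2 p.2 Y s2 mY.
transitivity (`|s.1 * s.2|%:E * mu (
   ((fun x : mline R => (p.1 + s.1 * x)%R : mline R) @^-1` X) `*`
   ((fun x : mline R => (p.2 + s.2 * x)%R : mline R) @^-1` Y)))%E; first by [].
suff E : (`|s.1 * s.2|%:E * mu (
   ((fun x : mline R => (p.1 + s.1 * x)%R : mline R) @^-1` X) `*`
   ((fun x : mline R => (p.2 + s.2 * x)%R : mline R) @^-1` Y)))%E
   = (leb X * leb Y)%E by exact: E.
rewrite leb2X// -EX -EY normrM EFinM.
by rewrite !muleA; congr (_ * _)%E; rewrite -!muleA; congr (_ * _)%E; rewrite muleC.
Qed.

Lemma measurable_vshear (f : mline R -> R) : measurable_fun setT f ->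
  measurable_fun setT (fun x : mplane R => (x.1, (f x.1 + x.2)%R) : mplane R).
Proof.
move=> mf; apply: measurable_fun_pair => /=; first exact: measurable_fst.
apply: measurable_funD; last exact: measurable_snd.
by apply: measurableT_comp => //; exact: measurable_fst.
Qed.

Lemma measurable_hshear (f : mline R -> R) : measurable_fun setT f ->
  measurable_fun setT (fun x : mplane R => ((f x.2 + x.1)%R, x.2) : mplane R).
Proof.
move=> mf; apply: measurable_fun_pair => /=; last exact: measurable_snd.
apply: measurable_funD; last exact: measurable_fst.
by apply: measurableT_comp => //; exact: measurable_snd.
Qed.

(** Cavalieri: a vertical section of the preimage is a translate of the corresponding section of
    [A]. *)
Lemma leb2_vshear (f : mline R -> R) A : measurable_fun setT f -> measurable A ->
  mu ((fun x : mplane R => (x.1, (f x.1 + x.2)%R) : mplane R) @^-1` A) = mu A.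
Proof.
move=> mf mA; rewrite /leb2 /= /product_measure1; apply: eq_integral => x _ /=.
rewrite -(lebesgue_shift (f x) (measurable_xsection x mA)); congr (leb _).
Qed.

(** Here the horizontal sections are translated, so the measure has first to be rewritten as the
    iterated integral in the other order. *)
Lemma leb2_hshear (f : mline R -> R) A : measurable_fun setT f -> measurable A ->
  mu ((fun x : mplane R => ((f x.2 + x.1)%R, x.2) : mplane R) @^-1` A) = mu A.
Proof.
move=> mf mA.
have E X : measurable X -> mu X = (leb \x^ leb)%E X.
  move=> mX; rewrite /leb2 /=.
  apply: (product_measure_unique (m' := (leb \x^ leb)%E)) => // C D mC mD.
  exact: product_measure2E.
have mS := measurable_hshear mf.
rewrite E; last by rewrite -[X in measurable X]setTI; exact: mS.
rewrite (E A mA) /product_measure2; apply: eq_integral => x _ /=.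
rewrite -(lebesgue_shift (f x) (measurable_ysection x mA)); congr (leb _).
Qed.

End LebesguePlane.

(** * Differential calculus in the plane and in one variable *)

Section Calculus.
Context {R : realType}.
Local Notation plane := (R * R)%type.
Implicit Types (Omega : set plane) (f g : plane -> R).

(** The two difference quotients are the same function of the increment; this carries one-variable
    calculus over to directional derivatives. *)
Lemma is_derive_line f (x v : plane) (t : R) : derivable f (x + t *: v) v ->
  is_derive t 1 (fun s : R => f (x + s *: v)) ('D_v f (x + t *: v)).
Proof.
have E : (fun h : R => h^-1 *: (((fun s : R => f (x + s *: v)) \o shift t) (h *: 1)
           - f (x + t *: v))) =
   (fun h : R => h^-1 *: ((f \o shift (x + t *: v)) (h *: v) - f (x + t *: v))).
  apply/funext => h /=; congr (_ *: (f _ - _)).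
  by rewrite [h *: 1]mulr1 scalerDl addrCA.
by move=> df; apply: DeriveDef; rewrite /derivable /derive E.
Qed.

Lemma is_derive_slice1 f (t y : R) : derivable f (t, y) ((1, 0) : plane) ->
  is_derive t 1 (fun s : R => f (s, y)) (partial1 f (t, y)).
Proof.
have E s : (0, y) + s *: (1, 0) = (s, y) :> plane.
  by congr pair; rewrite /= ?add0r ?[_ *: _]mulr1 ?[_ *: _]mulr0 ?addr0.
move=> df; have := @is_derive_line f (0, y) (1, 0) t; rewrite E => /(_ df).
by under eq_fun do rewrite E.
Qed.

Lemma is_derive_slice2 f (x t : R) : derivable f (x, t) ((0, 1) : plane) ->
  is_derive t 1 (fun s : R => f (x, s)) (partial2 f (x, t)).
Proof.
have E s : (x, 0) + s *: (0, 1) = (x, s) :> plane.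
  by congr pair; rewrite /= ?add0r ?[_ *: _]mulr1 ?[_ *: _]mulr0 ?addr0.
move=> df; have := @is_derive_line f (x, 0) (0, 1) t; rewrite E => /(_ df).
by under eq_fun do rewrite E.
Qed.

(** The end points may come in either order and the derivative is needed only near [a]; increments
    of unknown sign call for this form. *)
Lemma MVT_unordered (g dg : R -> R) (a b e : R) : `|b - a| < e ->
  (forall t, `|t - a| < e -> is_derive t 1 g (dg t)) ->
  exists2 c, `|c - a| <= `|b - a| & g b - g a = dg c * (b - a).
Proof.
move=> abe dg_.
have cg t : `|t - a| < e -> {for t, continuous g}.
  by move=> te; apply/differentiable_continuous/derivable1_diffP; have [] := dg_ t te.
have [ab|ba|<-] := ltgtP a b; last first.
- by exists a; rewrite ?subrr ?mulr0.
- have in_e x : x \in `[b, a] -> `|x - a| <= `|b - a|.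
    rewrite in_itv/= => /andP[bx xa].
    by rewrite !ler0_norm ?subr_le0 ?(ltW ba)//; lra.
  have [c cab E] : exists2 c, c \in `]b, a[ & g a - g b = dg c * (a - b).
    apply: MVT => //.
      move=> x /subset_itv_oo_cc xab; apply: dg_.
      exact: le_lt_trans (in_e x xab) abe.
    apply: continuous_in_subspaceT => x /[!inE] xab; apply: cg.
    exact: le_lt_trans (in_e x xab) abe.
  exists c; first exact/in_e/subset_itv_oo_cc.
  by rewrite -[LHS]opprB E -mulrN opprB.
- have in_e x : x \in `[a, b] -> `|x - a| <= `|b - a|.
    rewrite in_itv/= => /andP[ax xb].
    by rewrite !ger0_norm ?subr_ge0 ?(ltW ab)//; lra.
  have [c cab E] : exists2 c, c \in `]a, b[ & g b - g a = dg c * (b - a).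
    apply: MVT => //.
      move=> x /subset_itv_oo_cc xab; apply: dg_.
      exact: le_lt_trans (in_e x xab) abe.
    apply: continuous_in_subspaceT => x /[!inE] xab; apply: cg.
    exact: le_lt_trans (in_e x xab) abe.
  by exists c => //; exact/in_e/subset_itv_oo_cc.
Qed.

Lemma plane_ballP (x y : plane) (e : R) :
  ball x e y <-> `|x.1 - y.1| < e /\ `|x.2 - y.2| < e.
Proof. by []. Qed.

Lemma plane_norm_lt (v : plane) (e : R) : `|v| < e <-> `|v.1| < e /\ `|v.2| < e.
Proof. by rewrite /Num.norm/= gt_max; split => /andP. Qed.

Lemma plane_norm_le (v : plane) (e : R) : `|v| <= e <-> `|v.1| <= e /\ `|v.2| <= e.
Proof. by rewrite /Num.norm/= ge_max; split => /andP. Qed.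

Definition lin2 (a b : R) (v : plane) : R := a * v.1 + b * v.2.

Lemma lin2_linear a b : linear (lin2 a b).
Proof. by move=> k u v; rewrite /lin2 /= /GRing.scale/=; ring. Qed.
HB.instance Definition _ a b := GRing.isLinear.Build R plane R _ (lin2 a b) (lin2_linear a b).

Lemma lin2_continuous a b : continuous (lin2 a b).
Proof.
move=> x; apply: (@cvgD _ _ _ _ _ (fun v : plane => a * v.1) (fun v => b * v.2)).
  by apply: cvgM; [exact: cvg_cst|exact: cvg_fst].
by apply: cvgM; [exact: cvg_cst|exact: cvg_snd].
Qed.

Lemma frechet_is_diff f (x : plane) a b :
  (forall e, 0 < e -> exists2 d, 0 < d & forall y, `|y - x| < d ->
     `|f y - f x - lin2 a b (y - x)| <= e * `|y - x|) ->
  is_diff x f (lin2 a b).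
Proof.
move=> H.
have E : f \o shift x = cst (f x) + lin2 a b +o_ (0 : plane) id.
  apply/eqaddoP => e e0.
  have [d d0 Hd] := H e e0.
  apply/nbhs_ballP; exists d => //= h; rewrite -ball_normE /= sub0r normrN => hd.
  have := Hd (h + x); rewrite addrK => Hd'.
  have -> : (f \o shift x - (cst (f x) + lin2 a b)) h = f (h + x) - f x - lin2 a b h.
    by rewrite -[LHS]/(f (h + x) - (f x + lin2 a b h)) opprD addrA.
  exact: Hd'.
have D : 'd f x = lin2 a b :> (plane -> R).
  by apply: diff_unique => //; exact: lin2_continuous.
apply: DiffDef => //.
by apply/diff_locallyP; rewrite D; split => //; exact: lin2_continuous.
Qed.

Lemma plane_decomp (a b : R) : (a, b) = a *: (1, 0) + b *: (0, 1) :> plane.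
Proof. by congr pair; rewrite /= ?[_ *: 1]mulr1 ?[_ *: 0]mulr0 ?addr0 ?add0r. Qed.

Lemma diff_lin2 f (x : plane) : differentiable f x ->
  'd f x = lin2 (partial1 f x) (partial2 f x) :> (plane -> R).
Proof.
move=> df; apply/funext => -[v1 v2].
rewrite plane_decomp linearD !linearZ /= /partial1 /partial2 !deriveE// /lin2 /= /GRing.scale/=.
by ring.
Qed.

Lemma diff_frechet f (x : plane) : differentiable f x -> forall e, 0 < e ->
  exists2 d, 0 < d & forall y, `|y - x| < d ->
     `|f y - f x - lin2 (partial1 f x) (partial2 f x) (y - x)| <= e * `|y - x|.
Proof.
move=> df e e0.
have D := diff_lin2 df.
have /diff_locallyP[_] := df.
rewrite D => /eqaddoP/(_ e e0)/nbhs_ballP[d /= d0 Hd].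
exists d => // y yx.
have := Hd (y - x).
have -> : (f \o shift x - (cst (f x) + lin2 (partial1 f x) (partial2 f x))) (y - x)
   = f y - f x - lin2 (partial1 f x) (partial2 f x) (y - x).
  rewrite -[LHS]/(f (y - x + x) - (f x + lin2 (partial1 f x) (partial2 f x) (y - x))).
  by rewrite subrK opprD addrA.
by apply; rewrite -ball_normE /ball_ /= sub0r normrN.
Qed.

(** The increment is split into a horizontal and a vertical leg, and the mean value theorem is
    applied on each. Balls of the product norm are squares, so both legs stay in the ball where the
    partial derivatives are controlled. *)
Lemma C1_is_diff Omega f x : open Omega -> Omega x ->
  (forall y, Omega y -> derivable f y ((1, 0) : plane)) ->
  (forall y, Omega y -> derivable f y ((0, 1) : plane)) ->
  {for x, continuous (partial1 f)} -> {for x, continuous (partial2 f)} ->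
  is_diff x f (lin2 (partial1 f x) (partial2 f x)).
Proof.
move=> oO Ox d1 d2 c1 c2; apply: frechet_is_diff => e e0.
have e20 : 0 < e / 2 by rewrite divr_gt0.
have /nbhs_ballP[r0 /= r00 Hr0] : nbhs x Omega by exact: open_nbhs_nbhs.
move/cvgrPdist_lt : c1 => /(_ _ e20)/nbhs_ballP[r1 /= r10 Hr1].
move/cvgrPdist_lt : c2 => /(_ _ e20)/nbhs_ballP[r2 /= r20 Hr2].
pose d := Num.min r0 (Num.min r1 r2).
have d0 : 0 < d by rewrite !lt_min r00 r10.
have [dr0 dr1 dr2] : [/\ d <= r0, d <= r1 & d <= r2].
  by rewrite /d; split; rewrite ?ge_min ?lexx ?orbT//.
exists d => // -[y1 y2]; case: x => x1 x2 /= in Ox Hr0 Hr1 Hr2 *.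
move=> /plane_norm_lt /= [h1 h2].
have [c1 c1y E1] : exists2 c, `|c - x1| <= `|y1 - x1| &
    f (y1, y2) - f (x1, y2) = partial1 f (c, y2) * (y1 - x1).
  apply: (MVT_unordered (g := fun s => f (s, y2)) h1) => t tx.
  apply: is_derive_slice1; apply: d1; apply: Hr0; apply/plane_ballP; split => /=; rewrite distrC.
    exact: lt_le_trans tx dr0.
  exact: lt_le_trans h2 dr0.
have [c2 c2y E2] : exists2 c, `|c - x2| <= `|y2 - x2| &
    f (x1, y2) - f (x1, x2) = partial2 f (x1, c) * (y2 - x2).
  apply: (MVT_unordered (g := fun s => f (x1, s)) h2) => t tx.
  apply: is_derive_slice2; apply: d2; apply: Hr0; apply/plane_ballP; split => /=; rewrite distrC.
    by rewrite subrr normr0.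
  exact: lt_le_trans tx dr0.
rewrite (_ : f (y1, y2) - _ - _ = (partial1 f (c1, y2) - partial1 f (x1, x2)) * (y1 - x1)
   + (partial2 f (x1, c2) - partial2 f (x1, x2)) * (y2 - x2)); last first.
  rewrite -[f (y1, y2)](subrK (f (x1, y2))) E1 -[f (x1, y2)](subrK (f (x1, x2))) E2.
  by rewrite /lin2/=; ring.
have /plane_norm_le[/= n1 n2] : `|(y1 - x1, y2 - x2)| <= `|((y1, y2) : plane) - (x1, x2)|.
  by [].
apply: le_trans (ler_normD _ _) _; rewrite !normrM (splitr e) mulrDl.
apply: lerD; apply: ler_pM => //.
- rewrite distrC ltW//; apply: Hr1; apply/plane_ballP; split => /=; rewrite distrC.
    by apply: le_lt_trans c1y _; exact: lt_le_trans h1 dr1.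
  exact: lt_le_trans h2 dr1.
- rewrite distrC ltW//; apply: Hr2; apply/plane_ballP; split => /=; rewrite distrC.
    by rewrite subrr normr0.
  by apply: le_lt_trans c2y _; exact: lt_le_trans h2 dr2.
Qed.

Lemma Ck_continuous Omega k f x : Ck Omega k f -> Omega x -> {for x, continuous f}.
Proof. by case: k => [|k] [cf _]; exact: cf. Qed.

Lemma CkW Omega k f : Ck Omega k.+1 f -> Ck Omega k f.
Proof.
elim: k f => [|k IH] f; first by case.
move=> [cf [d1 d2 h1 h2]]; split; first exact: cf.
by split; [exact: d1|exact: d2|exact: IH h1|exact: IH h2].
Qed.

Lemma Ck_sub Omega Omega' k f : Omega' `<=` Omega -> Ck Omega k f -> Ck Omega' k f.
Proof.
move=> OO; elim: k f => [|k IH] f [cf H]; split => //; first by move=> x /OO/cf.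
  by move=> x /OO/cf.
by case: H => d1 d2 h1 h2; split; [move=> x /OO/d1|move=> x /OO/d2|exact: IH|exact: IH].
Qed.

Lemma eq_open_near Omega f g x : open Omega -> Omega x ->
  (forall y, Omega y -> f y = g y) -> \near x, f x = g x.
Proof.
move=> oO Ox fg; have : nbhs x Omega by exact: open_nbhs_nbhs.
by apply: filterS.
Qed.

Lemma partial_ext Omega f g (v x : plane) : open Omega -> Omega x -> v != 0 ->
  (forall y, Omega y -> f y = g y) -> 'D_v f x = 'D_v g x.
Proof. by move=> oO Ox v0 fg; apply: near_eq_derive => //; exact: eq_open_near fg. Qed.

Lemma e1_neq0 : (1, 0) != 0 :> plane.
Proof. by apply/eqP => -[/eqP]; rewrite oner_eq0. Qed.
Lemma e2_neq0 : (0, 1) != 0 :> plane.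
Proof. by apply/eqP => -[/eqP]; rewrite oner_eq0. Qed.
Hint Resolve e1_neq0 e2_neq0 : core.

(** On an open set, equal functions have equal difference quotients for small increments, hence
    equal partial derivatives of every order. *)
Lemma Ck_ext Omega k f g : open Omega -> (forall y, Omega y -> f y = g y) ->
  Ck Omega k f -> Ck Omega k g.
Proof.
move=> oO; elim: k f g => [|k IH] f g fg [cf H]; split => //.
- move=> x Ox; rewrite /prop_for /continuous_at -(fg x Ox); apply: cvg_trans (cf x Ox).
  by apply: near_eq_cvg; apply: eq_open_near fg.
- move=> x Ox; rewrite /prop_for /continuous_at -(fg x Ox); apply: cvg_trans (cf x Ox).
  by apply: near_eq_cvg; apply: eq_open_near fg.
- case: H => d1 d2 h1 h2; split.
  + move=> x Ox; apply: near_eq_derivable (d1 x Ox) => //; exact: eq_open_near fg.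
  + move=> x Ox; apply: near_eq_derivable (d2 x Ox) => //; exact: eq_open_near fg.
  + by apply: IH h1 => y Oy; exact: partial_ext fg.
  + by apply: IH h2 => y Oy; exact: partial_ext fg.
Qed.

Lemma Ck_cst Omega k (c : R) : Ck Omega k (cst c).
Proof.
have E (v : plane) d : 'D_v (cst d : plane -> R) = cst 0 by apply/funext => x; rewrite derive_cst.
elim: k c => [|k IH] c; split; try by move=> x _; exact: cvg_cst.
  by [].
split; rewrite /partial1 /partial2 ?E; try exact: IH.
  by move=> x _; exact: derivable_cst.
by move=> x _; exact: derivable_cst.
Qed.

Lemma Ck_add Omega k f g : open Omega -> Ck Omega k f -> Ck Omega k g ->
  Ck Omega k (fun x => f x + g x).
Proof.
move=> oO; elim: k f g => [|k IH] f g [cf Hf] [cg Hg]; split => //.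
- by move=> x Ox; apply: cvgD; [exact: cf|exact: cg].
- by move=> x Ox; apply: cvgD; [exact: cf|exact: cg].
- case: Hf Hg => f1 f2 hf1 hf2 [g1 g2 hg1 hg2]; split.
  + by move=> x Ox; apply: derivableD; [exact: f1|exact: g1].
  + by move=> x Ox; apply: derivableD; [exact: f2|exact: g2].
  + apply: Ck_ext (IH _ _ hf1 hg1) => // x Ox; rewrite /partial1.
    by rewrite -deriveD; [|exact: f1|exact: g1].
  + apply: Ck_ext (IH _ _ hf2 hg2) => // x Ox; rewrite /partial2.
    by rewrite -deriveD; [|exact: f2|exact: g2].
Qed.

Lemma Ck_mul Omega k f g : open Omega -> Ck Omega k f -> Ck Omega k g ->
  Ck Omega k (fun x => f x * g x).
Proof.
move=> oO; elim: k f g => [|k IH] f g Cf Cg.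
  have [[cf Hf] [cg Hg]] := (Cf, Cg); split => //.
  by move=> x Ox; apply: cvgM; [exact: cf|exact: cg].
have [[cf [f1 f2 hf1 hf2]] [cg [g1 g2 hg1 hg2]]] := (Cf, Cg); split.
  by move=> x Ox; apply: cvgM; [exact: cf|exact: cg].
split.
- by move=> x Ox; apply: derivableM; [exact: f1|exact: g1].
- by move=> x Ox; apply: derivableM; [exact: f2|exact: g2].
- have := Ck_add oO (IH _ _ (CkW Cf) hg1) (IH _ _ (CkW Cg) hf1).
  apply: Ck_ext => // x Ox; rewrite /partial1.
  by rewrite -[RHS]/('D__ (f * g) x) deriveM; [|exact: f1|exact: g1].
- have := Ck_add oO (IH _ _ (CkW Cf) hg2) (IH _ _ (CkW Cg) hf2).
  apply: Ck_ext => // x Ox; rewrite /partial2.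
  by rewrite -[RHS]/('D__ (f * g) x) deriveM; [|exact: f2|exact: g2].
Qed.

Lemma is_derive_lin2 a b (x v : plane) : is_derive x v (lin2 a b) (lin2 a b v).
Proof.
have d : is_diff x (lin2 a b) (lin2 a b).
  apply: frechet_is_diff => e e0; exists 1 => // y _.
  by rewrite -linearB subrr normr0 mulr_ge0// ltW.
have df : differentiable (lin2 a b) x by [].
by apply: DeriveDef; [exact: diff_derivable|rewrite deriveE// diff_val].
Qed.

Lemma Ck_lin2 Omega k a b : Ck Omega k (lin2 a b).
Proof.
have E v : 'D_v (lin2 a b) = cst (lin2 a b v).
  by apply/funext => x; have [_ ->] := is_derive_lin2 a b x v.
case: k => [|k]; split; try by move=> x _; exact: lin2_continuous.
  by [].
split; rewrite /partial1 /partial2 ?E.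
- by move=> x _; case: (is_derive_lin2 a b x (1, 0)).
- by move=> x _; case: (is_derive_lin2 a b x (0, 1)).
- exact: Ck_cst.
- exact: Ck_cst.
Qed.

Lemma Ck_fst Omega k : Ck Omega k (fst : plane -> R).
Proof.
have -> : fst = lin2 1 0 :> (plane -> R).
  by apply/funext => x; rewrite /lin2 mul1r mul0r addr0.
exact: Ck_lin2.
Qed.

Lemma Ck_snd Omega k : Ck Omega k (snd : plane -> R).
Proof.
have -> : snd = lin2 0 1 :> (plane -> R).
  by apply/funext => x; rewrite /lin2 mul1r mul0r add0r.
exact: Ck_lin2.
Qed.

Lemma Ck_is_diff Omega k f x : open Omega -> Omega x -> Ck Omega k.+1 f ->
  is_diff x f (lin2 (partial1 f x) (partial2 f x)).
Proof.
move=> oO Ox [_ [d1 d2 /Ck_continuous c1 /Ck_continuous c2]].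
by apply: C1_is_diff oO _ _ _ _ _ => //; [exact: c1|exact: c2].
Qed.

Lemma is_derive_comp2 (f h1 h2 : plane -> R) (x v : plane) :
  differentiable f (h1 x, h2 x) -> differentiable h1 x -> differentiable h2 x ->
  is_derive x v (fun y => f (h1 y, h2 y))
    (partial1 f (h1 x, h2 x) * 'D_v h1 x + partial2 f (h1 x, h2 x) * 'D_v h2 x).
Proof.
move=> df dh1 dh2.
have dp : differentiable (fun y => (h1 y, h2 y)) x by exact: differentiable_pair.
have dc : differentiable (f \o (fun y => (h1 y, h2 y))) x by exact: differentiable_comp.
apply: DeriveDef; first exact: diff_derivable.
transitivity ('D_v (f \o (fun y => (h1 y, h2 y))) x); first by [].
rewrite deriveE// diff_comp//= diff_pair//=.
have E := congr1 (fun F => F ('d h1 x v, 'd h2 x v)) (diff_lin2 df).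
apply: (etrans E); rewrite /lin2 /=.
by rewrite (deriveE v dh1) (deriveE v dh2).
Qed.

(** By the chain rule the partial derivatives of the composite are sums of products of functions of
    class [k], so [Ck_add] and [Ck_mul] close the induction. *)
Lemma Ck_comp Omega Omega' k f h1 h2 : open Omega -> open Omega' ->
  (forall x, Omega x -> Omega' (h1 x, h2 x)) ->
  Ck Omega' k f -> Ck Omega k h1 -> Ck Omega k h2 ->
  Ck Omega k (fun x => f (h1 x, h2 x)).
Proof.
move=> oO oO' hO; elim: k f => [|k IH] f Cf C1 C2.
  split => // x Ox; apply: (@continuous_comp _ _ _ (fun x => (h1 x, h2 x)) f).
    exact: (cvg_pair (Ck_continuous C1 Ox) (Ck_continuous C2 Ox)).
  exact: (Ck_continuous Cf (hO x Ox)).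
have df x : Omega x -> differentiable f (h1 x, h2 x).
  by move=> Ox; have [] := Ck_is_diff oO' (hO x Ox) Cf.
have d1 x : Omega x -> differentiable h1 x.
  by move=> Ox; have [] := Ck_is_diff oO Ox C1.
have d2 x : Omega x -> differentiable h2 x.
  by move=> Ox; have [] := Ck_is_diff oO Ox C2.
have D x v : Omega x -> is_derive x v (fun y => f (h1 y, h2 y))
    (partial1 f (h1 x, h2 x) * 'D_v h1 x + partial2 f (h1 x, h2 x) * 'D_v h2 x).
  by move=> Ox; apply: is_derive_comp2; [exact: df|exact: d1|exact: d2].
have [[_ [_ _ f1 f2]] [[_ [_ _ h11 h12]] [_ [_ _ h21 h22]]]] := (Cf, (C1, C2)).
have C1' := CkW C1; have C2' := CkW C2.
split.
  move=> x Ox; apply: (@differentiable_continuous _ _ _ x (fun x => f (h1 x, h2 x))).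
  apply: (@differentiable_comp _ _ _ _ (fun x => (h1 x, h2 x)) f); last exact: df.
  by apply: differentiable_pair; [exact: d1|exact: d2].
split.
- by move=> x Ox; have [] := D x (1, 0) Ox.
- by move=> x Ox; have [] := D x (0, 1) Ox.
- have := Ck_add oO (Ck_mul oO (IH _ f1 C1' C2') h11) (Ck_mul oO (IH _ f2 C1' C2') h21).
  by apply: Ck_ext => // x Ox; have [_ <-] := D x (1, 0) Ox.
- have := Ck_add oO (Ck_mul oO (IH _ f1 C1' C2') h12) (Ck_mul oO (IH _ f2 C1' C2') h22).
  by apply: Ck_ext => // x Ox; have [_ <-] := D x (0, 1) Ox.
Qed.

(** One-variable analogue of [Ck]. No continuity is recorded: being [k.+1] times derivable
    everywhere already makes the derivative of order [k] continuous. *)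
Fixpoint D1 k (p : R -> R) : Prop :=
  if k is k'.+1 then (forall x, derivable p x 1) /\ D1 k' (derive1 p) else True.

Definition smooth1 (p : R -> R) := forall k, D1 k p.

Lemma smooth1_derivable p x : smooth1 p -> derivable p x 1.
Proof. by move=> sp; have [H _] := sp 1%N; exact: H. Qed.

Lemma smooth1_derive p : smooth1 p -> smooth1 (derive1 p).
Proof. by move=> sp k; have [_] := sp k.+1. Qed.

Lemma smooth1_continuous p : smooth1 p -> continuous p.
Proof.
by move=> sp x; apply/differentiable_continuous/derivable1_diffP; exact: smooth1_derivable.
Qed.

Lemma derive1P (p : R -> R) (x : R) (d : R) : is_derive x (1 : R) p d -> derive1 p x = d.
Proof. by move=> [_ <-]; rewrite derive1E. Qed.

Lemma derivable_is_derive1 (p : R -> R) (x : R) : derivable p x 1 ->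
  is_derive x (1 : R) p (derive1 p x).
Proof. by move=> dp; apply: DeriveDef => //; rewrite derive1E. Qed.

Lemma smooth1_of_derive (p q : R -> R) : (forall x, is_derive x (1 : R) p (q x)) ->
  smooth1 q -> smooth1 p.
Proof.
move=> dp sq [|k] //; split; first by move=> x; case: (dp x).
rewrite (_ : derive1 p = q); first exact: (sq k).
by apply/funext => x; apply: derive1P; exact: dp.
Qed.

Lemma D1W k p : D1 k.+1 p -> D1 k p.
Proof. by elim: k p => [//|k IH] p [d D]; split; [exact: d|exact: IH]. Qed.

Lemma smooth1_cst (c : R) : smooth1 (cst c).
Proof.
move=> k; elim: k c => [//|k IH] c; split; first by move=> x; exact: derivable_cst.
rewrite (_ : derive1 _ = cst 0); first exact: (IH 0).
by apply/funext => x; rewrite derive1_cst.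
Qed.

Lemma smooth1_id : smooth1 (@id R).
Proof.
apply: (@smooth1_of_derive _ (cst 1)); exact: smooth1_cst.
Qed.

Lemma D1_add k p q : D1 k p -> D1 k q -> D1 k (fun x => p x + q x).
Proof.
elim: k p q => [//|k IH] p q [dp Dp] [dq Dq].
have H x : is_derive x (1 : R) (fun x => p x + q x) (derive1 p x + derive1 q x).
  exact: (is_deriveD (derivable_is_derive1 (dp x)) (derivable_is_derive1 (dq x))).
split; first by move=> x; case: (H x).
rewrite (_ : derive1 _ = (fun x => derive1 p x + derive1 q x)); first exact: IH.
by apply/funext => x; apply: derive1P; exact: H.
Qed.

Lemma D1_mul k p q : D1 k p -> D1 k q -> D1 k (fun x => p x * q x).
Proof.
elim: k p q => [//|k IH] p q Cp Cq.
have [[dp Dp] [dq Dq]] := (Cp, Cq).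
have H x : is_derive x (1 : R) (fun x => p x * q x) (p x * derive1 q x + q x * derive1 p x).
  exact: (is_deriveM (derivable_is_derive1 (dp x)) (derivable_is_derive1 (dq x))).
split; first by move=> x; case: (H x).
rewrite (_ : derive1 _ = (fun x => p x * derive1 q x + q x * derive1 p x)).
  by apply: D1_add; apply: IH => //; exact: D1W.
by apply/funext => x; apply: derive1P; exact: H.
Qed.

Lemma is_derive1_comp2 (p q : R -> R) (x dp dq : R) : is_derive (q x) (1 : R) p dp ->
  is_derive x (1 : R) q dq -> is_derive x (1 : R) (fun y => p (q y)) (dp * dq).
Proof.
move=> Dp Dq.
have d1 : derivable p (q x) 1 by case: Dp.
have d2 : derivable q x 1 by case: Dq.
have dc : differentiable (p \o q) x.
  by move/derivable1_diffP: d1 => d1; move/derivable1_diffP: d2 => d2; exact: differentiable_comp d2 d1.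
apply: DeriveDef; first exact/derivable1_diffP.
by rewrite -derive1E (derive1_comp d2 d1) (derive1P Dp) (derive1P Dq).
Qed.

Lemma D1_comp k p q : D1 k p -> D1 k q -> D1 k (fun x => p (q x)).
Proof.
elim: k p => [//|k IH] p Cp Cq.
have [[dp Dp] [dq Dq]] := (Cp, Cq).
have H x := is_derive1_comp2 (derivable_is_derive1 (dp (q x))) (derivable_is_derive1 (dq x)).
split; first by move=> x; case: (H x).
rewrite (_ : derive1 _ = (fun x => derive1 p (q x) * derive1 q x)).
  by apply: D1_mul => //; apply: IH => //; exact: D1W.
by apply/funext => x; apply: derive1P; exact: H.
Qed.

Lemma smooth1_add p q : smooth1 p -> smooth1 q -> smooth1 (fun x => p x + q x).
Proof. by move=> sp sq k; exact: D1_add. Qed.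
Lemma smooth1_mul p q : smooth1 p -> smooth1 q -> smooth1 (fun x => p x * q x).
Proof. by move=> sp sq k; exact: D1_mul. Qed.
Lemma smooth1_comp p q : smooth1 p -> smooth1 q -> smooth1 (fun x => p (q x)).
Proof. by move=> sp sq k; exact: D1_comp. Qed.
Lemma smooth1_affine (a c : R) : smooth1 (fun x => a * x + c).
Proof.
apply: smooth1_add (smooth1_cst c); apply: smooth1_mul (smooth1_cst a) _.
exact: smooth1_id.
Qed.

Lemma is_derive_fst_comp (p : R -> R) (x v : plane) : derivable p x.1 1 ->
  is_derive x v (fun y : plane => p y.1) ((derive1 p) x.1 * v.1).
Proof.
move=> dp.
have dfst : is_diff x (fst : plane -> R) (fst : plane -> R).
  have -> : fst = lin2 1 0 :> (plane -> R).
    by apply/funext => y; rewrite /lin2 mul1r mul0r addr0.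
  apply: frechet_is_diff => e e0; exists 1 => // y _.
  by rewrite -linearB subrr normr0 mulr_ge0// ltW.
have d1 : differentiable (fst : plane -> R) x by [].
have d2 : differentiable p x.1 by apply/derivable1_diffP.
have dc : differentiable (p \o fst) x by exact: differentiable_comp.
apply: DeriveDef; first exact: diff_derivable.
transitivity ('D_v (p \o fst) x); first by [].
rewrite deriveE// diff_comp//= diff_val diff1E//.
by rewrite mulrC.
Qed.

Lemma Ck_fst_comp (p : R -> R) k : smooth1 p -> Ck setT k (fun x : plane => p x.1).
Proof.
elim: k p => [|k IH] p sp.
  split => // x _; apply: (@continuous_comp _ _ _ fst p); first exact: cvg_fst.
  exact: smooth1_continuous.
have D x v := is_derive_fst_comp v (@smooth1_derivable p (x : plane).1 sp).
split.
  move=> x _; apply: (@continuous_comp _ _ _ fst p); first exact: cvg_fst.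
  exact: smooth1_continuous.
split.
- by move=> x _; have [] := D x (1, 0).
- by move=> x _; have [] := D x (0, 1).
- apply: Ck_ext (IH _ (smooth1_derive sp)); first exact: openT.
  by move=> x _; rewrite /partial1; have [_ ->] := D x (1, 0); rewrite mulr1.
- apply: Ck_ext (Ck_cst setT k 0); first exact: openT.
  by move=> x _; rewrite /partial2; have [_ ->] := D x (0, 1); rewrite mulr0.
Qed.

(** A function of one variable is seen as a function on the plane that ignores the second
    coordinate, so that the planar chain rule applies. *)
Lemma Ck_comp1 Omega k (p : R -> R) f : open Omega -> smooth1 p ->
  Ck Omega k f -> Ck Omega k (fun x => p (f x)).
Proof.
move=> oO sp Cf.
exact: (Ck_comp oO openT (fun _ _ => I) (Ck_fst_comp k sp) Cf (Ck_cst _ _ 0)).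
Qed.

End Calculus.
#[global] Hint Resolve e1_neq0 e2_neq0 : core.

(** * Borel sets and area-preserving maps of the plane *)

Section PlaneMeasure.
Context {R : realType}.
Local Notation plane := (R * R)%type.
Local Notation P := (mplane R).
Local Notation mu := (@leb2 R).
Local Notation leb := (@lebesgue_measure R).

Lemma measurable_plane_ball (x : plane) (e : R) : @measurable _ P (ball x e).
Proof.
have -> : ball x e = (ball x.1 e `*` ball x.2 e : set P) by [].
by apply: measurableX; exact: measurable_ball.
Qed.

(** Every open set is a countable union of squares with rational centres and radii [1/(n+1)]. *)
Lemma open_measurable2 (A : set plane) : open A -> @measurable _ P A.
Proof.
move=> oA.
pose F (q : rat * rat * nat) : set P :=
  let B := ball (ratr q.1.1 : R, ratr q.1.2 : R) q.2.+1%:R^-1 in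
  if `[< B `<=` A >] then B else set0.
suff -> : A = \bigcup_q F q.
  apply: countable_bigcupT_measurable => // q; rewrite /F.
  by case: ifP => _ //; exact: measurable_plane_ball.
apply/seteqP; split => [x Ax|x [q _]]; last first.
  by rewrite /F; case: asboolP => // BA /BA.
have /nbhs_ballP[e /= e0 eA] : nbhs x A by exact: open_nbhs_nbhs.
have [n ne] : exists n : nat, n.+1%:R^-1 < e / 2.
  have e20 : 0 < e / 2 by rewrite divr_gt0.
  exists (Num.truncn (e / 2)^-1); rewrite -[ltRHS]invrK ltf_pV2 ?posrE ?invr_gt0//.
  have iv : 0 <= (e / 2)^-1 by rewrite invr_ge0 ltW.
  by have /andP[] := truncn_itv iv.
have n0 : 0 < n.+1%:R^-1 :> R by rewrite invr_gt0.
have appr (r : R) : exists q : rat, `|ratr q - r| < n.+1%:R^-1.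
  have rn : r < r + n.+1%:R^-1 by rewrite ltrDl.
  have [q] := rat_in_itvoo rn; rewrite in_itv/= => /andP[h1 h2]; exists q.
  by rewrite gtr0_norm ?subr_gt0// ltrBlDl.
have [q1 hq1] := appr x.1; have [q2 hq2] := appr x.2.
exists (q1, q2, n) => //; rewrite /F /= asboolT.
  by split => /=; rewrite -ball_normE.
move=> y [/= h1 h2]; apply: eA.
have es : n.+1%:R^-1 + n.+1%:R^-1 < e by rewrite (splitr e) ltrD.
split => /=; rewrite -ball_normE /= in h1 h2 *.
  rewrite -(subrK (ratr q1) x.1) -addrA; apply: le_lt_trans (ler_normD _ _) (lt_trans _ es).
  by rewrite ltrD// distrC.
rewrite -(subrK (ratr q2) x.2) -addrA; apply: le_lt_trans (ler_normD _ _) (lt_trans _ es).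
by rewrite ltrD// distrC.
Qed.

Lemma closed_measurable2 (A : set plane) : closed A -> @measurable _ P A.
Proof. by move=> /closed_openC/open_measurable2/measurableC; rewrite setCK. Qed.

Lemma open_continuous_measurable2 (A : set plane) (f : plane -> R) : open A ->
  (forall x, A x -> {for x, continuous f}) -> measurable_fun (A : set P) (f : P -> R).
Proof.
move=> oA cf; apply: (measurability _ (RGenOpens.measurableE R)).
move=> _ [_ [a [b ->] <-]]; apply: open_measurable2.
rewrite openE => x [Ax /= fx]; rewrite /interior.
apply: filterI; first exact: open_nbhs_nbhs.
by apply: (cf x Ax); apply: open_nbhs_nbhs; split => //; exact: interval_open.
Qed.

Lemma continuous_measurable2 (f : plane -> R) : continuous f ->
  measurable_fun (setT : set P) (f : P -> R).
Proof.
have oT : open (setT : set plane) by exact: openT.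
by move=> cf; exact: (open_continuous_measurable2 oT (fun x _ => cf x)).
Qed.

Lemma plane_pair_measurable (f g : P -> R) : measurable_fun setT f -> measurable_fun setT g ->
  measurable_fun setT (fun x : P => (f x, g x) : P).
Proof. by move=> mf mg; exact: (measurable_fun_pair mf mg). Qed.

Lemma continuous_measurable_map (h : plane -> plane) : continuous h ->
  measurable_fun (setT : set P) (h : P -> P).
Proof.
move=> ch; have -> : h = (fun x => ((h x).1, (h x).2)).
  by apply/funext => x; case: (h x).
apply: plane_pair_measurable; apply: continuous_measurable2 => x.
  by apply: continuous_comp; [exact: ch|exact: cvg_fst].
by apply: continuous_comp; [exact: ch|exact: cvg_snd].
Qed.

Lemma leb2_ball (x : plane) (e : R) : 0 <= e -> mu (ball x e) = ((e *+ 2) ^+ 2)%:E.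
Proof.
move=> e0; rewrite (_ : ball x e = (ball x.1 e `*` ball x.2 e : set P))//.
rewrite leb2X//; try exact: measurable_ball.
by rewrite !lebesgue_measure_ball// -EFinM expr2.
Qed.

(** The open sets, which are stable under finite intersections, thereby serve as generators in
    uniqueness and Dynkin arguments. *)
Lemma plane_borel : @measurable _ P = <<s @open plane >>.
Proof.
apply/seteqP; split; last first.
  apply: smallest_sub; first exact: sigma_algebra_measurable.
  exact: open_measurable2.
rewrite measurable_prod_measurableType.
pose Q := g_sigma_algebraType (@open plane).
have mfst : measurable_fun (setT : set Q) (fst : Q -> mline R).
  apply: (measurability _ (RGenOpens.measurableE R)).
  move=> _ [_ [a [b ->] <-]]; rewrite setTI; apply: sub_sigma_algebra.
  by apply: open_comp; [move=> ? _; exact: cvg_fst|exact: interval_open].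
have msnd : measurable_fun (setT : set Q) (snd : Q -> mline R).
  apply: (measurability _ (RGenOpens.measurableE R)).
  move=> _ [_ [a [b ->] <-]]; rewrite setTI; apply: sub_sigma_algebra.
  by apply: open_comp; [move=> ? _; exact: cvg_snd|exact: interval_open].
apply: smallest_sub; first exact: (@sigma_algebra_measurable _ Q).
move=> _ [A mA [B mB <-]].
have -> : A `*` B = ([set: Q] `&` fst @^-1` A) `&` ([set: Q] `&` snd @^-1` B) :> set Q.
  by rewrite !setTI.
apply: (@measurableI _ Q); [exact: mfst|exact: msnd].
Qed.

Definition mpres (T : P -> P) := measurable_fun setT T /\
  forall A, measurable A -> mu (T @^-1` A) = mu A.

Lemma mpres_comp S T : mpres S -> mpres T -> mpres (S \o T).
Proof.
move=> [mS pS] [mT pT]; split; first exact: measurableT_comp.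
move=> A mA; rewrite comp_preimage pT ?pS//.
by rewrite -[X in measurable X]setTI; exact: mS.
Qed.

Lemma mpres_ext S T : S =1 T -> mpres S -> mpres T.
Proof. by move=> /funext ->. Qed.

Lemma mpres_diag (p s : plane) : `|s.1 * s.2| = 1 ->
  mpres (fun x : P => (p.1 + s.1 * x.1, p.2 + s.2 * x.2) : P).
Proof.
move=> s1; split; first exact: measurable_diag.
have [s10 s20] : s.1 != 0 /\ s.2 != 0.
  by apply/andP; rewrite -negb_or -mulf_eq0 -normr_eq0 s1 oner_eq0.
by move=> A mA; rewrite -[RHS](leb2_diag p s10 s20 mA) s1 mul1e.
Qed.

Lemma mpres_translation (p : plane) : mpres (fun x : P => (p + x)%R : P).
Proof.
apply: mpres_ext (@mpres_diag p (1, 1) _); last by rewrite mul1r normr1.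
by move=> x; rewrite /= !mul1r.
Qed.

Definition planerot (c s : R) (x : plane) : plane := (c * x.1 - s * x.2, s * x.1 + c * x.2).

(** A rotation is a product of three shears, with parameter [t] the tangent of the half angle; the
    half turn, where [t] is undefined, is a diagonal map. *)
Lemma mpres_rot c s : c ^+ 2 + s ^+ 2 = 1 -> mpres (planerot c s : P -> P).
Proof.
move=> cs; have [c1|c1] := eqVneq c (-1).
  have s0 : s = 0.
    move: cs; rewrite c1 sqrrN expr1n => /eqP.
    by rewrite eq_sym addrC -subr_eq subrr eq_sym sqrf_eq0 => /eqP.
  apply: mpres_ext (@mpres_diag (0, 0) (-1, -1) _); last by rewrite mulrNN mul1r normr1.
  by move=> x; rewrite /planerot c1 s0 /= !mul0r !add0r subr0.
pose t := s / (1 + c).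
have c10 : 1 + c != 0 by rewrite addrC -[1]opprK subr_eq0.
have mh : mpres (fun x : P => (- t * x.2 + x.1, x.2) : P).
  have mf : measurable_fun (setT : set (mline R)) (fun y : mline R => - t * y : R).
    exact: measurable_scale.
  split; first exact: (measurable_hshear mf).
  by move=> A mA; exact: (leb2_hshear mf).
have mv : mpres (fun x : P => (x.1, s * x.1 + x.2) : P).
  have mf : measurable_fun (setT : set (mline R)) (fun y : mline R => s * y : R).
    exact: measurable_scale.
  split; first exact: (measurable_vshear mf).
  by move=> A mA; exact: (leb2_vshear mf).
have e1 : t * s = 1 - c.
  have ss : s ^+ 2 = (1 - c) * (1 + c) by rewrite -subr_sqr expr1n -cs; ring.
  by rewrite /t mulrAC -expr2 ss mulfK.
have e2 : t * c = s - t.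
  have : t * (1 + c) = s by rewrite /t mulfVK.
  by rewrite mulrDr mulr1 => <-; ring.
apply: mpres_ext (mpres_comp mh (mpres_comp mv mh)) => x.
clearbody t; rewrite /planerot /=; congr pair.
  transitivity ((1 - t * s) * (x.1 - t * x.2) - t * x.2); first by ring.
  rewrite e1; transitivity (c * x.1 - (t * c + t) * x.2); first by ring.
  by rewrite e2; ring.
by transitivity (s * x.1 + (1 - t * s) * x.2); [ring|rewrite e1; ring].
Qed.


(** The squared Euclidean norm: the norm of the product type is the supremum norm, which rotations
    do not preserve. *)
Definition sqn (x : plane) : R := x.1 ^+ 2 + x.2 ^+ 2.

Lemma sqn_continuous : continuous sqn.
Proof.
move=> x; apply: (@cvgD _ _ _ _ _ (fun v : plane => v.1 ^+ 2) (fun v => v.2 ^+ 2)).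
  by apply: (cvgM (f := fst) (g := fst)); exact: cvg_fst.
by apply: (cvgM (f := snd) (g := snd)); exact: cvg_snd.
Qed.

Lemma sqn_rot c s x : c ^+ 2 + s ^+ 2 = 1 -> sqn (planerot c s x) = sqn x.
Proof. by move=> cs; rewrite /sqn /planerot /= -[RHS]mul1r -cs; ring. Qed.

(** The angle is a function of the squared radius, so that a smooth angle gives a smooth map,
    including at the centre. *)
Definition twist0 (th : R -> R) (x : plane) : plane := planerot (cos (th (sqn x))) (sin (th (sqn x))) x.

(* The angle of the twist is approximated by step functions, for which the twist
   acts by a rotation on each annulus. *)
Lemma mpres_twist_step (b : R -> R) (r : R) :
  measurable_fun (setT : set P) (fun x : P => b (sqn x)) -> 0 < r ->
  (forall s, 0 <= b s) ->
  mpres (twist0 (fun s => r * (Num.truncn (b s / r))%:R) : P -> P).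
Proof.
move=> mb r0 b0; set th := fun s => _.
pose B k : set P := [set x | k%:R <= b (sqn x) / r < k.+1%:R].
have mB k : measurable (B k).
  rewrite (_ : B k = (fun x : P => b (sqn x) / r) @^-1` `[k%:R, k.+1%:R[%classic).
    by rewrite -[X in measurable X]setTI; apply: (measurable_funM mb (measurable_cst _)).
  by apply/seteqP; split => x /=; rewrite in_itv.
have BT x : B (Num.truncn (b (sqn x) / r)) x.
  by apply: truncn_itv; rewrite divr_ge0// ltW.
have BE k x : B k x -> Num.truncn (b (sqn x) / r) = k.
  by move=> Bk; apply: truncn_def.
have tB : trivIset setT B.
  apply/trivIsetP => i j _ _ ij; apply/seteqP; split => // x [/BE Ei /BE Ej].
  by move: ij; rewrite -Ei -Ej eqxx.
pose Rk k : P -> P := planerot (cos (r * k%:R)) (sin (r * k%:R)).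
have mRk k : mpres (Rk k) by apply: mpres_rot; rewrite cos2Dsin2.
have RB k x : B k (Rk k x) <-> B k x.
  by rewrite /B /= sqn_rot// cos2Dsin2.
have TE A : (twist0 th : P -> P) @^-1` A = \bigcup_k (Rk k @^-1` (B k `&` A)).
  apply/seteqP; split => x /=.
    move=> Ax; exists (Num.truncn (b (sqn x) / r)) => //=.
    by split => //; apply/RB.
  by move=> [k _ /= [/RB Bk Ax]]; rewrite /twist0 /th (BE _ _ Bk).
have mR k A : measurable A -> measurable (Rk k @^-1` A).
  by move=> mA; rewrite -[X in measurable X]setTI; exact: (mRk k).1.
split.
  move=> _ A mA; rewrite setTI TE; apply: bigcupT_measurable => k.
  by apply: mR; exact: measurableI.
move=> A mA; rewrite TE (@measure_bigcup _ _ _ mu setT); first last.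
- apply/trivIsetP => i j _ _ ij; apply/seteqP; split => // x [/= [/RB Bi _] [/RB Bj _]].
  by move: ij; rewrite -(BE _ _ Bi) -(BE _ _ Bj) eqxx.
- by move=> k _; apply: mR; exact: measurableI.
transitivity (mu (\bigcup_k (B k `&` A))).
  rewrite (@measure_bigcup _ _ _ mu setT).
  - by apply: eq_eseriesr => k _; apply: (mRk k).2; exact: measurableI.
  - by move=> k _; exact: measurableI.
  - apply/trivIsetP => i j _ _ ij; apply/seteqP; split => // x [[/BE Ei _] [/BE Ej _]].
    by move: ij; rewrite -Ei -Ej eqxx.
by congr (mu _); apply/seteqP; split => [x [k _ []]//|x Ax]; exists (Num.truncn (b (sqn x) / r)).
Qed.

(** If [T x] lies in an open set, so does [Tn n x] for all large [n]. The preimage is thus contained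
    in the increasing union of the sets [E m], each of measure at most [mu O]. *)
Lemma mpres_open_le (T : P -> P) (Tn : nat -> P -> P) : measurable_fun setT T ->
  (forall n, mpres (Tn n)) -> (forall x : plane, (fun n => Tn n x : plane) @ \oo --> (T x : plane)) ->
  forall O : set plane, open O -> (mu (T @^-1` O) <= mu O)%E.
Proof.
move=> mT pTn cT O oO.
have mO : @measurable _ P O := open_measurable2 oO.
have mTn n : measurable (Tn n @^-1` O).
  by rewrite -[X in measurable X]setTI; exact: (pTn n).1.
pose E m : set P := \bigcap_(n in [set n | (m <= n)%N]) (Tn n @^-1` O).
have mE m : measurable (E m) by apply: bigcap_measurable => //; exists m => /=.
have sub : T @^-1` O `<=` \bigcup_m E m.
  move=> x /= Tx; have : \forall n \near \oo, O (Tn n x).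
    by apply: (cT x); exact: open_nbhs_nbhs.
  by move=> [m _ Hm]; exists m => // n /= mn; exact: Hm.
apply: (@le_trans _ _ (mu (\bigcup_m E m))).
  apply: le_measure => //; rewrite inE; last exact: bigcupT_measurable.
  by rewrite -[X in measurable X]setTI; exact: mT.
have ndE : nondecreasing_seq E.
  by move=> m n mn; apply/subsetPset => x Ex k /= nk; apply: Ex => /=; exact: leq_trans nk.
have cE := @nondecreasing_cvg_mu _ _ _ mu E mE (bigcupT_measurable _ mE) ndE.
rewrite -(cvg_lim _ cE)//; apply: lime_le; first exact/cvgP/cE.
apply: nearW => m; rewrite /= -((pTn m).2 O mO).
by apply: le_measure; rewrite ?inE// => x; apply => /=.
Qed.

(** The inequality for [S], applied to the preimage of [O] under [T], is the converse of the one for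
    [T]; the values on open sets then determine the measure. *)
Lemma mpres_of_open (S T : plane -> plane) : continuous S -> continuous T ->
  cancel S T -> cancel T S ->
  (forall O, open O -> (mu (S @^-1` O) <= mu O)%E) ->
  (forall O, open O -> (mu (T @^-1` O) <= mu O)%E) -> mpres (T : P -> P).
Proof.
move=> cS cT ST TS HS HT.
have mT := continuous_measurable_map cT.
split => // A mA.
pose m' : {measure set P -> \bar R} := pushforward mu (T : P -> P).
have [g [og gT goo]] : exists g : nat -> set plane, [/\ forall n, open (g n),
    \bigcup_n g n = setT & forall n, (mu (g n) < +oo)%E].
  exists (fun n => ball (0 : plane) n.+1%:R); split=> [n| |n]; first exact: ball_open.
    apply/seteqP; split => // x _; exists (Num.truncn `|x|) => //.
    rewrite -ball_normE /= sub0r normrN.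
    by have /andP[] := truncn_itv (normr_ge0 x).
  by rewrite leb2_ball// ltry.
apply: (@measure_unique _ R P (@open plane) g plane_borel _ og gT (m' mT) mu) => //.
- by move=> B C oB oC; exact: openI.
- move=> O oO; apply/eqP; rewrite eq_le HT//=.
  have oTO : open (T @^-1` O) by move/continuousP : cT; apply.
  have E : S @^-1` (T @^-1` O) = O by apply/seteqP; split => x /=; rewrite ST.
  by have := HS _ oTO; rewrite E.
- by move=> k; exact: le_lt_trans (HT (g k) (og k)) (goo k).
Qed.

Definition reflection (x : plane) : plane := (x.1, - x.2).

Lemma mpres_reflection : mpres (reflection : P -> P).
Proof.
apply: mpres_ext (@mpres_diag (0, 0) (1, -1) _); last by rewrite mul1r normrN normr1.
by move=> x; rewrite /reflection /= !add0r mul1r mulN1r.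
Qed.

(** Conjugation by a reflection reverses the angle. Hence nonnegative angles suffice, which are the
    ones that [truncn] rounds down. *)
Lemma twist0_reflection b x :
  twist0 (fun s => - b s) x = reflection (twist0 b (reflection x)).
Proof.
rewrite /twist0 /reflection /sqn /= sqrrN cosN sinN /planerot /=.
by congr pair; ring.
Qed.

Lemma twist0_continuous b : continuous b -> continuous (twist0 b).
Proof.
move=> cb x; have cth : (b \o sqn) y @[y --> x] --> b (sqn x).
  by apply: (@continuous_comp _ _ _ sqn b x); [exact: sqn_continuous|exact: cb].
have cc : cos (b (sqn y)) @[y --> x] --> cos (b (sqn x)).
  by apply: (@continuous_comp _ _ _ (b \o sqn) cos) => //; exact: continuous_cos.
have cs : sin (b (sqn y)) @[y --> x] --> sin (b (sqn x)).
  by apply: (@continuous_comp _ _ _ (b \o sqn) sin) => //; exact: continuous_sin.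
have c1 : (fst : plane -> R) y @[y --> x] --> x.1 by exact: cvg_fst.
have c2 : (snd : plane -> R) y @[y --> x] --> x.2 by exact: cvg_snd.
apply: (cvg_pair (G := nbhs _) (H := nbhs _)).
  exact: (cvgB (cvgM cc c1) (cvgM cs c2)).
exact: (cvgD (cvgM cs c1) (cvgM cc c2)).
Qed.

Lemma sqn_twist0 b x : sqn (twist0 b x) = sqn x.
Proof. by rewrite sqn_rot// cos2Dsin2. Qed.

Lemma twist0D b b' x : twist0 b (twist0 b' x) = twist0 (fun s => b s + b' s) x.
Proof.
by rewrite {1}/twist0 sqn_twist0 /twist0 /planerot cosD sinD /=; congr pair; ring.
Qed.

Lemma twist0_0 x : twist0 (fun=> 0) x = x.
Proof.
by case: x => x1 x2; rewrite /twist0 /planerot cos0 sin0 /= !mul1r !mul0r subr0 add0r.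
Qed.

Lemma twist0K b : cancel (twist0 (fun s => - b s)) (twist0 b).
Proof.
by move=> x; rewrite twist0D; under [X in twist0 X]eq_fun do rewrite subrr; exact: twist0_0.
Qed.

(** The angle is rounded down to multiples of [1/(n+1)]; the resulting step twists preserve the
    measure and converge pointwise. The two inequalities on open sets come from the twist and from
    its inverse, the latter by reflection. *)
Lemma mpres_twist0 (b : R -> R) : continuous b -> (forall s, 0 <= b s) ->
  mpres (twist0 b : P -> P).
Proof.
move=> cb b0.
have cT := twist0_continuous cb.
have mb : measurable_fun (setT : set P) (fun x : P => b (sqn x)).
  apply: continuous_measurable2 => x; apply: continuous_comp; last exact: cb.
  exact: sqn_continuous.
have HT (O : set plane) : open O -> (mu ((twist0 b : P -> P) @^-1` O) <= mu O)%E.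
  apply: (@mpres_open_le _ (fun n =>
    twist0 (fun s => n.+1%:R^-1 * (Num.truncn (b s / n.+1%:R^-1))%:R))).
  - exact: continuous_measurable_map.
  - by move=> n; exact: mpres_twist_step.
  - move=> x; set s := sqn x.
    have ca : n.+1%:R^-1 * (Num.truncn (b s / n.+1%:R^-1))%:R @[n --> \oo] --> b s.
      apply/cvgrPdist_le => e e0; near=> n.
      have n0 : 0 < n.+1%:R^-1 :> R by rewrite invr_gt0.
      have /truncn_itv/andP[h1 h2] : 0 <= b s / n.+1%:R^-1 by rewrite divr_ge0// ltW.
      set k := (X in n.+1%:R^-1 * X%:R) in h1 h2 *.
      move: h1 h2; rewrite ler_pdivlMr// ltr_pdivrMr// => h1 h2.
      have ne : n.+1%:R^-1 <= e by near: n; have := near_infty_natSinv_lt (PosNum e0); apply: filterS => m /ltW.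
      move: h2; rewrite -natr1 mulrDl mul1r => h2.
      rewrite [n.+1%:R^-1 * _]mulrC ger0_norm ?subr_ge0// lerBlDr; apply: ltW.
      by apply: lt_le_trans h2 _; rewrite addrC lerD2r.
    have cc : cos (n.+1%:R^-1 * (Num.truncn (b s / n.+1%:R^-1))%:R) @[n --> \oo] --> cos (b s).
      exact: (cvg_comp _ _ ca (@continuous_cos R (b s))).
    have cs : sin (n.+1%:R^-1 * (Num.truncn (b s / n.+1%:R^-1))%:R) @[n --> \oo] --> sin (b s).
      exact: (cvg_comp _ _ ca (@continuous_sin R (b s))).
    apply: (cvg_pair (G := nbhs _) (H := nbhs _)).
      by apply: cvgB; apply: cvgMr_tmp.
    by apply: cvgD; apply: cvgMr_tmp.
apply: (@mpres_of_open (twist0 (fun s => - b s))) => //.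
- by apply: twist0_continuous => x; apply: cvgN; exact: cb.
- exact: twist0K.
- move=> x; rewrite -[in RHS](twist0_0 x) twist0D.
  by under eq_fun do rewrite addNr.
move=> O oO.
have [mr pr] := mpres_reflection.
have cr : continuous reflection.
  by move=> x; apply: (cvg_pair (G := nbhs _) (H := nbhs _)); [exact: cvg_fst|apply: cvgN; exact: cvg_snd].
have oR : open (reflection @^-1` O) by move/continuousP : cr; apply.
have -> : twist0 (fun s => - b s) @^-1` O = reflection @^-1` (twist0 b @^-1` (reflection @^-1` O)).
  by apply/seteqP; split => x /=; rewrite twist0_reflection.
have mT := continuous_measurable_map cT.
have mRO : @measurable _ P (reflection @^-1` O) := open_measurable2 oR.
rewrite pr; last by rewrite -[X in measurable X]setTI; exact: mT.
by rewrite -(pr O (open_measurable2 oO)); exact: HT.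
Unshelve. all: by end_near. Qed.

Definition twist (c : plane) (b : R -> R) (x : plane) : plane := c + twist0 b (x - c).

Lemma mpres_twist (c : plane) (t : R) (b : R -> R) : continuous b ->
  (forall s, 0 <= b s) -> mpres (twist c (fun s => t * b s) : P -> P).
Proof.
move=> cb b0.
have H : mpres (twist0 (fun s => t * b s) : P -> P).
  have [t0|t0] := leP 0 t.
    apply: mpres_twist0 => [x|s]; last by rewrite mulr_ge0.
    by apply: cvgMl_tmp; exact: cb.
  have mN : mpres (twist0 (fun s => (- t) * b s) : P -> P).
    apply: mpres_twist0 => [x|s]; last by rewrite mulr_ge0// oppr_ge0 ltW.
    by apply: cvgMl_tmp; exact: cb.
  apply: mpres_ext (mpres_comp mpres_reflection (mpres_comp mN mpres_reflection)) => x.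
  by rewrite /= -twist0_reflection; under eq_fun do rewrite mulNr opprK.
apply: mpres_ext (mpres_comp (mpres_translation c) (mpres_comp H (mpres_translation (- c)))) => x.
by rewrite /twist /= [- c + x]addrC.
Qed.

End PlaneMeasure.

(** * Integration over the plane *)

Section PlaneIntegral.
Context {R : realType}.
Local Notation plane := (R * R)%type.
Local Notation P := (mplane R).
Local Notation mu := (@leb2 R).
Implicit Types f g : plane -> R.

Definition L1 f : Prop := mu.-integrable setT (EFin \o (f : P -> R)).
Definition I2 f : R := \int[mu]_x (f : P -> R) x.
Definition mfun2 f : Prop := measurable_fun (setT : set P) (f : P -> R).

Lemma mfun2_EFin f : mfun2 f -> measurable_fun (setT : set P) (EFin \o (f : P -> R)).
Proof. by move=> mf; apply/measurable_EFinP. Qed.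

Lemma L1_mfun f : L1 f -> mfun2 f.
Proof. by move=> /integrableP[/measurable_EFinP]. Qed.

Lemma L1D f g : L1 f -> L1 g -> L1 (fun x => f x + g x).
Proof.
move=> lf lg; have := integrableD measurableT lf lg.
by apply: eq_integrable => // x _ /=; rewrite EFinD.
Qed.

Lemma L1Z k f : L1 f -> L1 (fun x => k * f x).
Proof.
move=> lf; have := @integrableZl _ _ _ mu setT measurableT k _ lf.
by apply: eq_integrable => // x _ /=; rewrite EFinM.
Qed.

Lemma L1N f : L1 f -> L1 (fun x => - f x).
Proof. by move=> /(L1Z (-1)); apply: eq_integrable => // x _ /=; rewrite mulN1r. Qed.

Lemma L1B f g : L1 f -> L1 g -> L1 (fun x => f x - g x).
Proof. by move=> lf /L1N; exact: L1D. Qed.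

Lemma L1_abs f : L1 f -> L1 (fun x => `|f x|).
Proof. by move=> lf; have := integrable_abse lf; apply: eq_integrable. Qed.

Lemma L1_0 : L1 (fun=> 0).
Proof. exact: integrable0. Qed.

Lemma L1_dom f g : mfun2 f -> L1 g -> (forall x, `|f x| <= g x) -> L1 f.
Proof.
move=> mf lg fg; apply: le_integrable lg => //; first exact: mfun2_EFin.
by move=> x _ /=; rewrite lee_fin (le_trans (fg x))// ler_norm.
Qed.

Lemma I2D f g : L1 f -> L1 g -> I2 (fun x => f x + g x) = I2 f + I2 g.
Proof. by move=> lf lg; rewrite /I2 RintegralD. Qed.

Lemma I2Z k f : L1 f -> I2 (fun x => k * f x) = k * I2 f.
Proof. by move=> lf; rewrite /I2 RintegralZl. Qed.

Lemma I2N f : L1 f -> I2 (fun x => - f x) = - I2 f.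
Proof.
by move=> lf; rewrite -mulN1r -I2Z//; apply: eq_Rintegral => x _; rewrite mulN1r.
Qed.

Lemma I2B f g : L1 f -> L1 g -> I2 (fun x => f x - g x) = I2 f - I2 g.
Proof. by move=> lf lg; rewrite I2D ?I2N//; exact: L1N. Qed.

Lemma I2_0 : I2 (fun=> 0) = 0.
Proof. by rewrite /I2 /Rintegral integral0. Qed.

Lemma I2_le f g : L1 f -> L1 g -> (forall x, f x <= g x) -> I2 f <= I2 g.
Proof. by move=> lf lg fg; apply: le_Rintegral. Qed.

Lemma I2_ge0 f : (forall x, 0 <= f x) -> 0 <= I2 f.
Proof. by move=> f0; apply: Rintegral_ge0 => x _. Qed.

Lemma I2_abs f : L1 f -> `|I2 f| <= I2 (fun x => `|f x|).
Proof. by move=> lf; apply: le_normr_Rintegral. Qed.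

Lemma I2_dist_le f g h (c : R) : L1 f -> L1 g -> L1 h ->
  (forall x, `|f x - g x| <= c * h x) -> `|I2 f - I2 g| <= c * I2 h.
Proof.
move=> lf lg lh fgh; rewrite -(I2B lf lg) -(I2Z c lh).
apply: le_trans (I2_abs (L1B lf lg)) _.
exact: (I2_le (L1_abs (L1B lf lg)) (L1Z c lh)).
Qed.
Lemma I2_eq f g : f =1 g -> I2 f = I2 g.
Proof. by move=> /funext ->. Qed.

Lemma L1_eq f g : f =1 g -> L1 f -> L1 g.
Proof. by move=> /funext ->. Qed.

Lemma mfun2_cst c : mfun2 (cst c). Proof. exact: measurable_cst. Qed.
Lemma mfun2D f g : mfun2 f -> mfun2 g -> mfun2 (fun x => f x + g x).
Proof. exact: measurable_funD. Qed.
Lemma mfun2B f g : mfun2 f -> mfun2 g -> mfun2 (fun x => f x - g x).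
Proof. exact: measurable_funB. Qed.
Lemma mfun2M f g : mfun2 f -> mfun2 g -> mfun2 (fun x => f x * g x).
Proof. exact: measurable_funM. Qed.
Lemma mfun2_abs f : mfun2 f -> mfun2 (fun x => `|f x|).
Proof. by move=> mf; apply: (measurableT_comp (@normr_measurable R setT)). Qed.
Lemma mfun2_indic (A : set plane) : @measurable _ P A -> mfun2 \1_A.
Proof. by move=> mA; exact: measurable_indic. Qed.

Lemma I2_indic (A : set plane) : @measurable _ P A -> I2 \1_A = fine (mu A).
Proof. by move=> mA; rewrite /I2 /Rintegral integral_indic// setIT. Qed.

Lemma L1_indic (A : set plane) : @measurable _ P A -> (mu A < +oo)%E -> L1 \1_A.
Proof.
move=> mA Aoo; apply/integrableP; split; first by apply: mfun2_EFin; apply: mfun2_indic.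
rewrite (eq_integral (fun x : P => (\1_A x)%:E)); last first.
  by move=> x _ /=; rewrite ger0_norm// indicE.
by rewrite integral_indic// setIT.
Qed.

Lemma L1_bounded_supp f (M : R) (x : plane) (r : R) : mfun2 f -> (forall y, `|f y| <= M) ->
  (forall y, ~ ball x r y -> f y = 0) -> L1 f.
Proof.
move=> mf fM f0.
have [r0|r0] := leP r 0.
  apply: L1_eq L1_0 => y; rewrite f0// => -[h _].
  by move: (le_lt_trans (normr_ge0 _) h); rewrite ltNge r0.
have L := L1_indic (measurable_plane_ball x r) _.
apply: (L1_dom (g := fun y => M * \1_(ball x r : set plane) y)) => //.
  by apply/L1Z/L; rewrite leb2_ball ?ltry// ltW.
move=> y; rewrite indicE; case: (boolP (y \in (ball x r : set plane))) => [_|/negP yb].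
  by rewrite mulr1.
by rewrite f0 ?normr0 ?mulr0// => /mem_set.
Qed.

Lemma I2_bounded_supp f (M : R) (x : plane) (r : R) : 0 <= r -> mfun2 f -> (forall y, `|f y| <= M) ->
  (forall y, ~ ball x r y -> f y = 0) -> `|I2 f| <= M * (r *+ 2) ^+ 2.
Proof.
move=> r0 mf fM f0; have lf := L1_bounded_supp mf fM f0.
have L : L1 \1_(ball x r : set plane).
  by apply: L1_indic; [exact: measurable_plane_ball|rewrite leb2_ball ?ltry].
apply: le_trans (I2_abs lf) _.
have -> : M * (r *+ 2) ^+ 2 = I2 (fun y => M * \1_(ball x r : set plane) y).
  by rewrite I2Z// I2_indic ?leb2_ball//; exact: measurable_plane_ball.
apply: I2_le; [exact: L1_abs|exact: L1Z|] => y.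
rewrite indicE; case: (boolP (y \in (ball x r : set plane))) => [_|/negP yb].
  by rewrite mulr1.
by rewrite f0 ?normr0 ?mulr0// => /mem_set.
Qed.

Lemma mfun2_comp f (T : P -> P) : mfun2 f -> measurable_fun setT T -> mfun2 (f \o T).
Proof. by move=> mf mT; exact: (measurableT_comp mf mT). Qed.

Lemma mpres_L1 T f : mpres T -> L1 f -> L1 (f \o T).
Proof.
move=> [mT pT] lf.
have mf := L1_mfun lf.
apply/integrableP; split; first by apply: mfun2_EFin; apply: mfun2_comp.
have /integrableP[_] := lf; apply: le_lt_trans.
rewrite [leRHS](eq_measure_integral (pushforward mu T)); last first.
  by move=> A mA _; rewrite -(pT A mA).
rewrite ge0_integral_pushforward//.
by apply: measurableT_comp => //; exact: mfun2_EFin.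
Qed.

Lemma mpres_I2 T f : mpres T -> L1 f -> I2 (f \o T) = I2 f.
Proof.
move=> mpT lf; have [mT pT] := mpT; rewrite /I2 /Rintegral; congr fine; apply/esym.
rewrite (eq_measure_integral (pushforward mu T)); last first.
  by move=> A mA _; rewrite -(pT A mA).
rewrite integral_pushforward//; first by apply: mfun2_EFin; apply: L1_mfun.
exact: mpres_L1.
Qed.

(** The image of the planar measure under [x -> p + r x], multiplied by [r^2], is the planar
    measure. *)
Lemma ge0_integral_scale (h : P -> \bar R) (p : plane) (r : R) : 0 < r ->
  measurable_fun setT h -> (forall x, 0 <= h x)%E ->
  (\int[mu]_x h x = (r ^+ 2)%:E * \int[mu]_x h ((p + r *: (x : plane))%R : P))%E.
Proof.
move=> r0 mh h0.
pose S : P -> P := fun x => (p.1 + r * x.1, p.2 + r * x.2).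
have mS : measurable_fun setT S := measurable_diag p (r, r).
have rr : r != 0 by rewrite gt_eqF.
pose k := NngNum (sqr_ge0 r).
pose m' : {measure set P -> \bar R} := pushforward mu S.
transitivity (\int[mscale k (m' mS)]_x h x)%E.
  apply: eq_measure_integral => A mA _.
  rewrite [RHS]/(mscale _ _ _) /m' /pushforward.
  have := leb2_diag p (s := (r, r)) rr rr mA.
  by rewrite /= ger0_norm -?expr2 ?sqr_ge0// => E; exact/esym/E.
rewrite (@ge0_integral_mscale _ _ _ (m' mS) setT measurableT k h mh (fun x _ => h0 x)).
apply: (f_equal (mule (r ^+ 2)%:E)).
exact: (@ge0_integral_pushforward _ _ _ _ _ S mS mu setT h measurableT mh (fun x _ => h0 x)).
Qed.

Lemma L1_scale f (p : plane) (r : R) : 0 < r -> L1 f -> L1 (fun x => f (p + r *: x)).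
Proof.
move=> r0 lf; have mf := L1_mfun lf.
pose S : P -> P := fun x => (p.1 + r * x.1, p.2 + r * x.2).
have mS : measurable_fun setT S := measurable_diag p (r, r).
apply/integrableP; split; first by apply: mfun2_EFin; apply: (mfun2_comp mf mS).
have /integrableP[_ l] := lf.
have mh : measurable_fun (setT : set P) (fun x : P => `|(f x)%:E|%E).
  by apply: measurableT_comp => //; exact: mfun2_EFin.
rewrite (ge0_integral_scale p r0 mh (fun x => abse_ge0 _)) in l.
rewrite ltNge; apply/negP; rewrite leye_eq => /eqP h.
by move: l; rewrite /= in h *; rewrite h gt0_muley ?lte_fin ?exprn_gt0.
Qed.

Let I2_scale_ge0 f (p : plane) (r : R) : 0 < r -> (forall x, 0 <= f x) -> L1 f ->
  I2 (fun x => f (p + r *: x)) = r ^- 2 * I2 f.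
Proof.
move=> r0 f0 lf; have mf := L1_mfun lf; have lfs := L1_scale p r0 lf.
have rr : r != 0 by rewrite gt_eqF.
have h0 (x : P) : (0 <= (EFin \o (f : P -> R)) x)%E by rewrite lee_fin.
have E := ge0_integral_scale p r0 (mfun2_EFin mf) h0.
rewrite /I2 /Rintegral E fineM//; last exact: integrable_fin_num.
by rewrite mulKf// expf_neq0.
Qed.

(** [f] is the difference of the nonnegative functions [f + |f|] and [|f|], for which the formula is
    known. *)
Lemma I2_scale f (p : plane) (r : R) : 0 < r -> L1 f ->
  I2 (fun x => f (p + r *: x)) = r ^- 2 * I2 f.
Proof.
move=> r0 lf; have la := L1_abs lf; have ls := L1D lf la.
have E g h : L1 g -> L1 h -> I2 g = I2 (fun x => g x + h x) - I2 h.
  by move=> lg lh; rewrite I2D// addrK.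
rewrite (E f _ lf la) (E _ _ (L1_scale p r0 lf) (L1_scale p r0 la)) mulrBr.
rewrite -(@I2_scale_ge0 (fun x => `|f x|) p)// -(@I2_scale_ge0 (fun x => f x + `|f x|) p)//.
by move=> x; rewrite -lerBlDl sub0r -normrN ler_norm.
Qed.

Lemma I2_dct (fn : nat -> plane -> R) f g : (forall n, mfun2 (fn n)) -> L1 g ->
  (forall n x, `|fn n x| <= g x) -> (forall x, fn n x @[n --> \oo] --> f x) ->
  L1 f /\ I2 (fn n) @[n --> \oo] --> I2 f.
Proof.
move=> mfn lg fg cf.
have mf : mfun2 f by apply: (measurable_fun_cvg mfn) => x _; exact: cf.
have [] := @dominated_convergence _ _ _ mu setT measurableT
  (fun n => EFin \o (fn n : P -> R)) (EFin \o f) (EFin \o g).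
- by move=> n; exact: mfun2_EFin.
- exact: mfun2_EFin.
- by apply: aeW => x _; apply: cvg_EFin; [exact: nearW|exact: cf].
- exact: lg.
- by apply: aeW => x n _ /=; rewrite lee_fin.
move=> lf _ c; split => //.
by apply: fine_cvg; rewrite fineK//; exact: integrable_fin_num.
Qed.

Lemma I2_ae f g : mfun2 f -> mfun2 g -> {ae mu, forall x, f x = g x} -> I2 f = I2 g.
Proof.
move=> mf mg fg; congr fine; apply: ae_eq_integral => //; try exact: mfun2_EFin.
by apply: (@filterS _ _ (ae_filter_ringOfSetsType mu) _ _ _ fg) => x /= -> _.
Qed.

Lemma L1_ae f g : mfun2 g -> {ae mu, forall x, f x = g x} -> L1 f -> L1 g.
Proof.
move=> mg fg lf; have mf := L1_mfun lf.
apply/integrableP; split; first exact: mfun2_EFin.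
have /integrableP[_] := lf; apply: le_lt_trans.
rewrite le_eqVlt; apply/orP; left; apply/eqP.
apply: ae_eq_integral => //.
- by apply: measurableT_comp => //; exact: mfun2_EFin.
- by apply: measurableT_comp => //; exact: mfun2_EFin.
- by apply: (@filterS _ _ (ae_filter_ringOfSetsType mu) _ _ _ fg) => x /= -> _.
Qed.

Lemma setI2 (D : set plane) f : \int[mu]_(x in D) f x = I2 (f \_ D).
Proof. exact: Rintegral_mkcond. Qed.

End PlaneIntegral.

(** * Flat functions and the radial mollifier profile *)

Section Flat.
Context {R : realType}.
Local Notation leb := (@lebesgue_measure R).

(** The functions [p(1/x) exp(-1/x)], extended by 0 to [x <= 0]. Allowing all polynomials [p] makes
    the family closed under differentiation. *)
Definition flatp (p : {poly R}) (x : R) : R :=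
  if 0 < x then p.[x^-1] * expR (- x^-1) else 0.

Lemma flatp_bound p : exists2 C, 0 <= C & forall x, `|x| <= 1 -> `|flatp p x| <= C * `|x|.
Proof.
pose n := size p; pose C0 := \sum_(i < n) `|p`_i|.
have C00 : 0 <= C0 by apply: sumr_ge0.
exists (C0 * n.+1%:R ^+ n.+1); first by rewrite mulr_ge0// exprn_ge0.
move=> x x1; rewrite /flatp; case: ifPn => [x0|_]; last first.
  by rewrite normr0 mulr_ge0// mulr_ge0// exprn_ge0.
rewrite gtr0_norm// in x1; rewrite (gtr0_norm x0).
pose y := x^-1.
have y0 : 0 < y by rewrite invr_gt0.
have y1 : 1 <= y by rewrite /y invf_ge1.
have py : `|p.[y]| <= C0 * y ^+ n.
  rewrite horner_coef mulr_suml; apply: le_trans (ler_norm_sum _ _ _) _.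
  apply: ler_sum => i _; rewrite normrM normrX (gtr0_norm y0) ler_wpM2l//.
  by rewrite ler_weXn2l// ltnW.
(* [exp y] is the power of exponent [n+1] of [exp (y / (n+1))], hence at least [(y / (n+1))^(n+1)]:
   one power of [y] more than in the bound for [p]. *)
have ey : expR (- y) <= (n.+1%:R / y) ^+ n.+1.
  rewrite expRN -[leRHS]invrK lef_pV2 ?posrE ?expR_gt0 ?invr_gt0 ?exprn_gt0 ?divr_gt0//.
  rewrite -exprVn invf_div.
  have -> : expR y = expR (y / n.+1%:R) ^+ n.+1.
    by rewrite -expRM_natl mulrC divfK.
  rewrite lerXn2r ?nnegrE ?expR_ge0 ?divr_ge0 ?ltW//.
  by apply: lt_le_trans (expR_ge1Dx _); rewrite ltrDr.
rewrite -/y normrM (ger0_norm (expR_ge0 _)).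
have H := ler_pM (normr_ge0 _) (expR_ge0 _) py ey.
apply: le_trans H _.
rewrite expr_div_n le_eqVlt; apply/orP; left; apply/eqP.
rewrite [y ^+ n.+1]exprS /y; field.
by rewrite gt_eqF// expf_neq0// invr_neq0// gt_eqF.
Qed.

Lemma is_derive_quadratic (f : R -> R) (x a C d : R) : 0 < d -> 0 <= C ->
  (forall h, `|h| < d -> `|f (x + h) - f x - h * a| <= C * h ^+ 2) ->
  is_derive x (1 : R) f a.
Proof.
move=> d0 C0 H.
have cv : h^-1 *: (f (h *: 1 + x) - f x) @[h --> 0^'] --> a.
  apply/cvgrPdist_le => e e0.
  have C1 : 0 < C + 1 by rewrite ltr_wpDl.
  near=> h.
  have h0 : h != 0 by near: h; exact: nbhs_dnbhs_neq.
  have hd : `|h| < d by near: h; apply: dnbhs0_lt.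
  have he : `|h| <= e / (C + 1).
    by near: h; apply: dnbhs0_le; rewrite divr_gt0.
  have := H h hd; rewrite [h *: 1]mulr1 [h + x]addrC => Hh.
  rewrite /GRing.scale /= -(ler_pM2l (_ : 0 < `|h|)) ?normr_gt0// -normrM.
  rewrite mulrBr mulVKf// distrC.
  apply: le_trans Hh _; rewrite -(real_normK (num_real h)) expr2 mulrCA ler_wpM2l//.
  have : (C + 1) * `|h| <= e by rewrite mulrC -ler_pdivlMr.
  by apply: le_trans; rewrite ler_wpM2r// lerDl.
by apply: DeriveDef; [apply/cvg_ex; exists a|exact: cvg_lim cv].
Unshelve. all: by end_near. Qed.

Lemma is_derive_near0 (f : R -> R) (x : R) : (\forall y \near x, f y = 0) ->
  is_derive x (1 : R) f 0.
Proof.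
move=> H; have H' : \forall y \near x, (cst 0 : R -> R) y = f y by apply: filterS H.
exact: (@near_eq_is_derive R R R (cst 0) f x 1 0 H' (is_derive_cst _ _ _)).
Qed.

Lemma MVT_derive (F f : R -> R) (x y : R) : (forall t, is_derive t (1 : R) F (f t)) ->
  x < y -> exists2 c, x < c < y & F y - F x = f c * (y - x).
Proof.
move=> dF xy; have [|c + E] := @MVT R F f x y xy (fun t _ => dF t).
  apply: continuous_subspaceT => t; apply/differentiable_continuous/derivable1_diffP.
  by case: (dF t).
by rewrite in_itv/= => ?; exists c.
Qed.

Lemma derD (f g : R -> R) (x a b : R) : is_derive x (1 : R) f a ->
  is_derive x (1 : R) g b -> is_derive x (1 : R) (fun y => f y + g y) (a + b).
Proof. by move=> Df Dg; exact: is_deriveD. Qed.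

Lemma derM (f g : R -> R) (x a b : R) : is_derive x (1 : R) f a ->
  is_derive x (1 : R) g b -> is_derive x (1 : R) (fun y => f y * g y) (f x * b + g x * a).
Proof. by move=> Df Dg; exact: is_deriveM. Qed.

Lemma derZ (f : R -> R) (x k a : R) : is_derive x (1 : R) f a ->
  is_derive x (1 : R) (fun y => k * f y) (k * a).
Proof.
move=> Df; have := derM (is_derive_cst k x (1 : R)) Df.
by rewrite mulr0 addr0.
Qed.

Lemma derN (f : R -> R) (x a : R) : is_derive x (1 : R) f a ->
  is_derive x (1 : R) (fun y => - f y) (- a).
Proof. by move=> Df; exact: is_deriveN. Qed.

Lemma derV (f : R -> R) (x a : R) : f x != 0 -> is_derive x (1 : R) f a ->
  is_derive x (1 : R) (fun y => (f y)^-1) (- (f x) ^- 2 * a).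
Proof. by move=> f0 Df; exact: is_deriveV. Qed.

Lemma derX n (x : R) : is_derive x (1 : R) (fun y => y ^+ n) (n%:R * x ^+ n.-1).
Proof.
elim: n => [|n IH]; first by rewrite mul0r; under eq_fun do rewrite expr0; exact: is_derive_cst.
under eq_fun do rewrite exprS.
have := derM (is_derive_id x (1 : R)) IH.
rewrite mulr1 (_ : x * _ + _ = n.+1%:R * x ^+ n.+1.-1) //=.
case: n {IH} => [|n] /=; first by rewrite mul0r mulr0 add0r expr0 mulr1.
by rewrite mulrCA -exprS -[n.+2%:R]natr1 mulrDl mul1r.
Qed.

(** For [x > 0] this is the product rule. At 0, [flatp p h] is [h] times [flatp ('X * p) h], hence
    O(h^2). *)
Lemma is_derive_flatp p x :
  is_derive x (1 : R) (flatp p) (flatp ('X^2 * (p - p^`())) x).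
Proof.
have [x0|x0|->] := ltgtP x 0.
- have -> : flatp ('X^2 * (p - p^`())) x = 0 by rewrite /flatp ltNge (ltW x0).
  apply: is_derive_near0.
  near=> y; rewrite /flatp ifN// -leNgt ltW//; near: y; exact: lt_nbhsl.
- have xn0 : x != 0 by rewrite gt_eqF.
  have Dinv : is_derive x (1 : R) (fun y : R => y^-1) (- x ^- 2).
    by have := derV (f := id) xn0 (is_derive_id x (1 : R)); rewrite mulr1.
  have DNinv : is_derive x (1 : R) (fun y : R => - y^-1) (x ^- 2).
    by have := derN Dinv; rewrite opprK.
  have Dp : is_derive x^-1 (1 : R) (horner p) p^`().[x^-1].
    have dh : derivable (horner p) x^-1 1 by exact: derivable_horner.
    by have := derivable_is_derive1 dh; rewrite -derivE.
  have D1 := is_derive1_comp2 Dp Dinv.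
  have D2 := @is_derive1_comp2 _ expR (fun y => - y^-1) _ _ _ (is_derive_expR (- x^-1)) DNinv.
  have D := derM D1 D2.
  rewrite (_ : flatp _ x = p.[x^-1] * (expR (- x^-1) * x ^- 2) +
      expR (- x^-1) * (p^`().[x^-1] * - x ^- 2)).
    apply: near_eq_is_derive D; near=> y.
    have y0 : 0 < y by near: y; exact: lt_nbhsr.
    by rewrite /flatp y0.
  rewrite /flatp x0 !hornerE /GRing.scale/= exprVn.
  by ring.
- have -> : flatp ('X^2 * (p - p^`())) 0 = 0 by rewrite /flatp ltxx.
  have [C C0 HC] := flatp_bound ('X * p).
  apply: (@is_derive_quadratic _ _ _ C 1) => // h h1.
  have -> : flatp p 0 = 0 by rewrite /flatp ltxx.
  rewrite add0r subr0 mulr0 subr0.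
  have -> : flatp p h = h * flatp ('X * p) h.
    rewrite /flatp; case: ifP => [h0|_]; last by rewrite mulr0.
    by rewrite hornerM hornerX !mulrA mulfV ?gt_eqF// mul1r.
  rewrite normrM -(real_normK (num_real h)) expr2 mulrCA ler_wpM2l//.
  by apply: HC; exact: ltW.
Unshelve. all: by end_near. Qed.

Lemma smooth1_flatp p : smooth1 (flatp p).
Proof.
move=> k; elim: k p => [//|k IH] p; split.
  by move=> x; case: (is_derive_flatp p x).
rewrite (_ : derive1 _ = flatp ('X^2 * (p - p^`()))); first exact: IH.
by apply/funext => x; apply: derive1P; exact: is_derive_flatp.
Qed.

Definition flat : R -> R := flatp 1.

Lemma smooth1_flat : smooth1 flat. Proof. exact: smooth1_flatp. Qed.

Lemma flat_gt0 x : 0 < x -> flat x = expR (- x^-1).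
Proof. by move=> x0; rewrite /flat /flatp x0 hornerC mul1r. Qed.

Lemma flat_le0 x : x <= 0 -> flat x = 0.
Proof. by move=> x0; rewrite /flat /flatp ltNge x0. Qed.

Lemma flat_pos x : 0 < x -> 0 < flat x.
Proof. by move=> x0; rewrite flat_gt0// expR_gt0. Qed.

Lemma flat_ge0 x : 0 <= flat x.
Proof. by have [/flat_le0 ->|/flat_pos/ltW] := leP x 0. Qed.

Lemma flat_le1 x : flat x <= 1.
Proof.
have [/flat_le0 -> //|x0] := leP x 0.
by rewrite flat_gt0// -[leRHS]expR0 ler_expR oppr_le0 invr_ge0 ltW.
Qed.

Lemma antiderivative (f : R -> R) (a : R) : continuous f ->
  (forall x, x <= a -> f x = 0) ->
  exists F : R -> R, (forall x, is_derive x (1 : R) F (f x)) /\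
    (forall x, x <= a -> F x = 0).
Proof.
move=> cf f0.
(* The lower end point is [a - 1] because the fundamental theorem wants it strictly below [x], and
   [x = a] has to be covered. *)
pose F x := \int[leb]_(t in `[a - 1, x]) f t.
have F0 x : x <= a -> F x = 0.
  move=> xa; rewrite /F /Rintegral integral0_eq// => t /=.
  by rewrite in_itv/= => /andP[_ tx]; rewrite f0// (le_trans tx).
exists F; split => // x.
have [xa|xa] := ltP x a.
  rewrite f0 ?ltW//; apply: is_derive_near0.
  near=> y; rewrite F0// ltW//; near: y; exact: lt_nbhsl.
have xu : x < x + 1 by rewrite ltrDl.
have ax : a - 1 < x by apply: lt_le_trans xa; rewrite ltrBlDr ltrDl.
have intf : leb.-integrable `[a - 1, x + 1] (EFin \o f).
  apply: continuous_compact_integrable; first exact: segment_compact.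
  exact: continuous_subspaceT.
have [d E] := continuous_FTC1_closed xu intf ax (cf x).
have -> : f x = derive1 F x by rewrite -E.
exact: derivable_is_derive1 d.
Unshelve. all: by end_near. Qed.

Lemma derive_ge0_nondecreasing (F f : R -> R) : (forall x, is_derive x (1 : R) F (f x)) ->
  (forall x, 0 <= f x) -> forall x y, x <= y -> F x <= F y.
Proof.
move=> dF f0 x y; rewrite le_eqVlt => /predU1P[->//|xy].
have [c _ E] := MVT_derive dF xy.
by rewrite -subr_ge0 E mulr_ge0// subr_ge0 ltW.
Qed.

(** The derivative is again of the form [ga x / x ^+ n.+1] with [ga] smooth and vanishing below [d];
    the induction is on the order of differentiation, for all [be] and [n] at once. *)
Lemma smooth1_div (be : R -> R) (d : R) n : 0 < d -> smooth1 be ->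
  (forall x, x < d -> be x = 0) -> smooth1 (fun x => be x / x ^+ n).
Proof.
move=> d0 sb b0 k; elim: k n be sb b0 => [//|k IH] n be sb b0.
pose ga x := x * derive1 be x + (- n%:R) * be x.
have sg : smooth1 ga.
  apply: smooth1_add; first exact: smooth1_mul smooth1_id (smooth1_derive sb).
  exact: smooth1_mul (smooth1_cst _) sb.
have b0' x : x < d -> derive1 be x = 0.
  move=> xd; apply: derive1P; apply: is_derive_near0.
  near=> y; rewrite b0//; near: y; exact: lt_nbhsl.
have g0 x : x < d -> ga x = 0 by move=> xd; rewrite /ga b0'// b0// !mulr0 addr0.
have D x : is_derive x (1 : R) (fun x => be x / x ^+ n) (ga x / x ^+ n.+1).
  have [xd|xd] := ltP x d.
    rewrite g0// mul0r; apply: is_derive_near0.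
    near=> y; rewrite b0 ?mul0r//; near: y; exact: lt_nbhsl.
  have x0 : x != 0 by rewrite gt_eqF// (lt_le_trans d0).
  have Db := derivable_is_derive1 (smooth1_derivable (x := x) sb).
  have xn0 : x ^+ n != 0 by rewrite expf_neq0.
  have := derM Db (derV (f := fun y : R => y ^+ n) xn0 (derX n x)).
  rewrite (_ : _ + _ = ga x / x ^+ n.+1)//.
  rewrite /ga exprS; case: n {sg b0' g0 ga} xn0 => [|n] xn0 /=.
    by rewrite expr0; field.
  by rewrite !exprS; field; rewrite x0 expf_neq0.
split; first by move=> x; case: (D x).
rewrite (_ : derive1 _ = (fun x => ga x / x ^+ n.+1)); first exact: IH.
by apply/funext => x; apply: derive1P; exact: D.
Unshelve. all: by end_near. Qed.

(* Radial profiles: [B] is the primitive of [b], the profile [p] satisfies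
   [4 s p'(s) = B(s) - B(4s)], so that for [N x = |x|^2] the Laplacian of [p (N x)]
   is [b (N x) - 4 b (4 N x)]. *)
Lemma mollifier_profile : exists b p : R -> R,
  [/\ smooth1 b /\ smooth1 p, (forall s, 0 <= b s) /\ (forall s, 0 <= p s),
      (forall s, 1 <= s -> b s = 0) /\ (forall s, 1 <= s -> p s = 0),
      (forall s, 2^-1 < s < 1 -> 0 < b s) /\ (exists2 c, 0 < c & forall s, s <= 8^-1 -> p s = c) &
      forall s, 4 * (derive1 p s + s * derive1 (derive1 p) s) = b s - 4 * b (4 * s)].
Proof.
(* A bump that is positive exactly on []1/2, 1[]. *)
pose b s := flat (1 * s + (- 2^-1)) * flat ((-1) * s + 1).
have sb : smooth1 b.
  by apply: smooth1_mul; apply: smooth1_comp smooth1_flat (smooth1_affine _ _).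
have b0 s : 0 <= b s by rewrite mulr_ge0// flat_ge0.
have bz s : 1 <= s -> b s = 0 by move=> s1; rewrite /b [X in _ * X]flat_le0 ?mulr0//; lra.
have bl s : s <= 2^-1 -> b s = 0 by move=> s1; rewrite /b flat_le0 ?mul0r//; lra.
have bp s : 2^-1 < s < 1 -> 0 < b s.
  by move=> /andP[h1 h2]; rewrite mulr_gt0// flat_pos//; lra.
have [B [DB B0]] := antiderivative (smooth1_continuous sb) bl.
have sB : smooth1 B := smooth1_of_derive DB sb.
have Bnd := derive_ge0_nondecreasing DB b0.
have Bc s : 1 <= s -> B s = B 1.
  rewrite le_eqVlt => /predU1P[<-//|s1]; apply/eqP; rewrite -subr_eq0.
  by have [c /andP[/ltW c1 _] ->] := MVT_derive DB s1; rewrite bz ?mul0r.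
have Bge0 s : 0 <= B s.
  have [/B0 -> //|/ltW s2] := leP s 2^-1.
  by rewrite -(B0 2^-1)//; exact: Bnd.
have Bpos s : 2^-1 < s -> 0 < B s.
  move=> s2; pose m := Num.min s 1.
  have m2 : 2^-1 < m by rewrite lt_min s2; lra.
  apply: (@lt_le_trans _ _ (B m)); last by apply: Bnd; rewrite ge_min lexx.
  have [c /andP[c1 cm] E] := MVT_derive DB m2.
  suff : 0 < B m - B 2^-1 by rewrite (B0 2^-1)// subr0.
  rewrite E mulr_gt0 ?subr_gt0// bp// c1 (lt_le_trans cm)//.
  by rewrite ge_min lexx orbT.
pose be s := B (4 * s + 0) + (-1) * B s.
have sbe : smooth1 be.
  apply: smooth1_add; first exact: smooth1_comp sB (smooth1_affine _ _).
  exact: smooth1_mul (smooth1_cst _) sB.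
have be0 s : s < 8^-1 -> be s = 0 by move=> s8; rewrite /be !B0 ?mulr0 ?addr0//; lra.
(* This will be the opposite of the derivative of [p]. Vanishing of [be] below 1/8 makes the
   quotient smooth, and constancy of [B] from 1 on bounds its support. *)
pose c s := 4^-1 * (be s / s ^+ 1).
have d8 : 0 < 8^-1 :> R by rewrite invr_gt0.
have sc : smooth1 c.
  by apply: smooth1_mul (smooth1_cst _) _; exact: smooth1_div d8 sbe be0.
have c0 s : 0 <= c s.
  rewrite mulr_ge0//; have [s0|s0] := leP s 0.
    by rewrite be0 ?mul0r// (le_lt_trans s0).
  rewrite divr_ge0//; last by rewrite exprn_ge0// ltW.
  rewrite /be mulN1r subr_ge0 addr0; apply: Bnd; lra.
have cl s : s <= 8^-1 -> c s = 0.
  by move=> s8; rewrite /c /be !B0 ?mulr0 ?addr0 ?mul0r ?mulr0//; lra.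
have cz s : 1 <= s -> c s = 0.
  by move=> s1; rewrite /c /be !Bc ?mulN1r ?subrr ?mul0r ?mulr0//; lra.
have [Q [DQ Q0]] := antiderivative (smooth1_continuous sc) cl.
have sQ : smooth1 Q := smooth1_of_derive DQ sc.
have Qnd := derive_ge0_nondecreasing DQ c0.
have Qc s : 1 <= s -> Q s = Q 1.
  rewrite le_eqVlt => /predU1P[<-//|s1]; apply/eqP; rewrite -subr_eq0.
  by have [t /andP[/ltW t1 _] ->] := MVT_derive DQ s1; rewrite cz ?mul0r.
have Qpos : 0 < Q 1.
  apply: (@lt_le_trans _ _ (Q 4^-1)); last by apply: Qnd; lra.
  have q48 : 8^-1 < 4^-1 :> R by lra.
  have [t /andP[t8 t4] E] := MVT_derive DQ q48.
  suff : 0 < Q 4^-1 - Q 8^-1 by rewrite (Q0 8^-1)// subr0.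
  rewrite E mulr_gt0 ?subr_gt0//.
  rewrite /c mulr_gt0 ?invr_gt0// divr_gt0//; last by rewrite expr1; lra.
  rewrite /be (B0 t) ?mulr0 ?addr0; last lra.
  by apply: Bpos; lra.
pose p s := Q 1 + (-1) * Q s.
have sp : smooth1 p.
  by apply: smooth1_add (smooth1_cst _) _; exact: smooth1_mul (smooth1_cst _) sQ.
exists b, p; split; [by []| | | |].
- split => // s; rewrite /p mulN1r subr_ge0.
  have [s1|/ltW s1] := leP s 1; first exact: Qnd.
  by rewrite Qc.
- by split => // s s1; rewrite /p Qc// mulN1r subrr.
- by split => //; exists (Q 1) => // s s8; rewrite /p (Q0 _ s8) mulr0 addr0.
have Dp s : is_derive s (1 : R) p (- c s).
  have := derD (is_derive_cst (Q 1) s (1 : R)) (derZ (-1) (DQ s)).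
  by rewrite add0r mulN1r.
have -> : derive1 p = (fun s => - c s) by apply/funext => s; apply: derive1P; exact: Dp.
have sNc : smooth1 (fun s => - c s).
  rewrite (_ : (fun s => - c s) = (fun s => (-1) * c s)).
    exact: smooth1_mul (smooth1_cst _) sc.
  by apply/funext => s; rewrite mulN1r.
move=> s.
(* [s c(s) = (B(4s) - B(s)) / 4] also at [s = 0], where the division is junk. *)
have E t : 4 * (t * - c t) = B t - B (4 * t).
  have [->|t0] := eqVneq t 0; first by rewrite !mulr0 mul0r mulr0 subrr.
  by rewrite /c /be addr0 expr1; field.
have D1 : is_derive s (1 : R) (fun t => 4 * (t * - c t)) (4 * (- c s + s * derive1 (fun t => - c t) s)).
  have H := derM (is_derive_id s (1 : R)) (derivable_is_derive1 (smooth1_derivable (x := s) sNc)).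
  have := derZ 4 H.
  by rewrite mulr1 [_ + - c s]addrC.
have D2 : is_derive s (1 : R) (fun t => B t - B (4 * t)) (b s - 4 * b (4 * s)).
  have D4 : is_derive s (1 : R) (fun t : R => 4 * t) 4.
    by have := derZ 4 (is_derive_id s (1 : R)); rewrite mulr1.
  have := derD (DB s) (derN (is_derive1_comp2 (DB (4 * s)) D4)).
  by rewrite [_ * 4]mulrC.
move: D1; under eq_fun do rewrite E.
by move=> D1; rewrite -(derive1P D1) -(derive1P D2).
Qed.

End Flat.

(** * Test functions and integration by parts *)

Section TestFunctions.
Context {R : realType}.
Local Notation plane := (R * R)%type.
Local Notation P := (mplane R).
Local Notation mu := (@leb2 R).
Implicit Types (f g phi : plane -> R) (Omega : set plane).

Lemma setTo : open (setT : set plane). Proof. exact: openT. Qed.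
Hint Resolve setTo : core.

Lemma smooth_continuous f : smooth setT f -> continuous f.
Proof. by move=> sf x; exact: (Ck_continuous (sf 0%N)). Qed.

Lemma smooth_mfun2 f : smooth setT f -> mfun2 f.
Proof. by move=> /smooth_continuous; exact: continuous_measurable2. Qed.

Lemma smooth_add f g : smooth setT f -> smooth setT g -> smooth setT (fun x => f x + g x).
Proof. by move=> sf sg k; exact: Ck_add. Qed.
Lemma smooth_mul f g : smooth setT f -> smooth setT g -> smooth setT (fun x => f x * g x).
Proof. by move=> sf sg k; exact: Ck_mul. Qed.
Lemma smooth_cst (c : R) : smooth setT (cst c : plane -> R).
Proof. by move=> k; exact: Ck_cst. Qed.
Lemma smooth_comp1 (p : R -> R) f : smooth1 p -> smooth setT f -> smooth setT (fun x => p (f x)).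
Proof. by move=> sp sf k; exact: Ck_comp1. Qed.
Lemma smooth_partial1 f : smooth setT f -> smooth setT (partial1 f).
Proof. by move=> sf k; have [_ []] := sf k.+1. Qed.
Lemma smooth_partial2 f : smooth setT f -> smooth setT (partial2 f).
Proof. by move=> sf k; have [_ []] := sf k.+1. Qed.
Lemma smooth_fst : smooth setT (fst : plane -> R).
Proof. by move=> k; exact: Ck_fst. Qed.
Lemma smooth_snd : smooth setT (snd : plane -> R).
Proof. by move=> k; exact: Ck_snd. Qed.

Lemma smooth_diff f x : smooth setT f ->
  is_diff x f (lin2 (partial1 f x) (partial2 f x)).
Proof. by move=> sf; exact: (@Ck_is_diff _ setT 0 f x setTo I (sf 1%N)). Qed.

Lemma smooth_derivable f x v : smooth setT f -> derivable f x v.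
Proof. by move=> sf; have [+ _] := smooth_diff x sf; exact: diff_derivable. Qed.

Lemma smooth_derive f (x v : plane) : smooth setT f ->
  'D_v f x = partial1 f x * v.1 + partial2 f x * v.2.
Proof. by move=> sf; have [d E] := smooth_diff x sf; rewrite deriveE// E. Qed.

Lemma partial1M f g x : smooth setT f -> smooth setT g ->
  partial1 (fun y => f y * g y) x = f x * partial1 g x + g x * partial1 f x.
Proof.
move=> sf sg; rewrite /partial1 -[LHS]/('D__ (f * g) x).
by rewrite deriveM//; exact: smooth_derivable.
Qed.
Lemma partial2M f g x : smooth setT f -> smooth setT g ->
  partial2 (fun y => f y * g y) x = f x * partial2 g x + g x * partial2 f x.
Proof.
move=> sf sg; rewrite /partial2 -[LHS]/('D__ (f * g) x).
by rewrite deriveM//; exact: smooth_derivable.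
Qed.
Lemma partial1D f g x : smooth setT f -> smooth setT g ->
  partial1 (fun y => f y + g y) x = partial1 f x + partial1 g x.
Proof.
move=> sf sg; rewrite /partial1 -[LHS]/('D__ (f + g) x).
by rewrite deriveD//; exact: smooth_derivable.
Qed.
Lemma partial2D f g x : smooth setT f -> smooth setT g ->
  partial2 (fun y => f y + g y) x = partial2 f x + partial2 g x.
Proof.
move=> sf sg; rewrite /partial2 -[LHS]/('D__ (f + g) x).
by rewrite deriveD//; exact: smooth_derivable.
Qed.
Lemma partial1_cst (c : R) x : partial1 (cst c : plane -> R) x = 0.
Proof. by rewrite /partial1 derive_cst. Qed.
Lemma partial2_cst (c : R) x : partial2 (cst c : plane -> R) x = 0.
Proof. by rewrite /partial2 derive_cst. Qed.
Lemma partial1Z (c : R) f x : smooth setT f ->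
  partial1 (fun y => c * f y) x = c * partial1 f x.
Proof.
by move=> sf; rewrite (@partial1M (cst c))//; [rewrite partial1_cst mulr0 addr0|exact: smooth_cst].
Qed.
Lemma partial2Z (c : R) f x : smooth setT f ->
  partial2 (fun y => c * f y) x = c * partial2 f x.
Proof.
by move=> sf; rewrite (@partial2M (cst c))//; [rewrite partial2_cst mulr0 addr0|exact: smooth_cst].
Qed.

Lemma T_smooth Omega phi : test_function Omega phi -> smooth setT phi.
Proof. by case. Qed.

Lemma T_sub Omega Omega' phi : Omega `<=` Omega' ->
  test_function Omega phi -> test_function Omega' phi.
Proof.
move=> OO [s [K [cK KO K0]]]; split => //; exists K; split => //.
exact: subset_trans KO OO.
Qed.

Lemma T_supp Omega phi : test_function Omega phi ->
  exists2 r : R, 0 < r & forall y, ~ ball (0 : plane) r y -> phi y = 0.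
Proof.
move=> [_ [K [cK _ K0]]].
have [M [Mr HM]] := compact_bounded cK.
exists (`|M| + 1 + 1); first by rewrite ltr_wpDl// addr_ge0.
move=> y yb; apply: K0 => Ky; apply: yb.
rewrite -ball_normE /= sub0r normrN; apply: (@le_lt_trans _ _ (`|M| + 1)).
  by apply: (HM (`|M| + 1)) => //; rewrite ltr_pwDr// ler_norm.
by rewrite ltrDl.
Qed.

Lemma T_out Omega phi x : test_function Omega phi -> ~ Omega x -> phi x = 0.
Proof. by move=> [_ [K [_ KO K0]]] xO; apply: K0 => /KO. Qed.

Lemma T_bounded Omega phi : test_function Omega phi ->
  exists2 M : R, 0 <= M & forall y, `|phi y| <= M.
Proof.
move=> [s [K [cK _ K0]]].
have cf : {within K, continuous phi}.
  by apply: continuous_subspaceT; exact: smooth_continuous.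
have [M [Mr HM]] := compact_bounded (continuous_compact cf cK).
exists (`|M| + 1); first by rewrite addr_ge0.
move=> y; have [Ky|nKy] := pselect (K y).
  by apply: (HM (`|M| + 1)); [rewrite ltr_pwDr// ler_norm|exists y].
by rewrite K0// normr0 addr_ge0.
Qed.

Lemma T_L1 Omega phi : test_function Omega phi -> L1 phi.
Proof.
move=> T; have [r r0 Hr] := T_supp T; have [M M0 HM] := T_bounded T.
by apply: (L1_bounded_supp (smooth_mfun2 (T_smooth T)) HM Hr).
Qed.

Lemma T_partial_out Omega phi (v : plane) : v != 0 -> test_function Omega phi ->
  exists K : set plane, [/\ compact K, K `<=` Omega & forall x, ~ K x -> 'D_v phi x = 0].
Proof.
move=> v0 [s [K [cK KO K0]]]; exists K; split => // x nKx.
have oK : open (~` K) by apply: closed_openC; apply: compact_closed => //; exact: norm_hausdorff.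
by rewrite (@partial_ext _ (~` K) _ (cst 0) v x) ?derive_cst.
Qed.

Lemma T_partial1 Omega phi : test_function Omega phi -> test_function Omega (partial1 phi).
Proof.
move=> T; split; first exact/smooth_partial1/(T_smooth T).
exact: (T_partial_out e1_neq0 T).
Qed.

Lemma T_partial2 Omega phi : test_function Omega phi -> test_function Omega (partial2 phi).
Proof.
move=> T; split; first exact/smooth_partial2/(T_smooth T).
exact: (T_partial_out e2_neq0 T).
Qed.

Lemma T_mul Omega f phi : smooth setT f -> test_function Omega phi ->
  test_function Omega (fun x => f x * phi x).
Proof.
move=> sf [s [K [cK KO K0]]]; split; first exact: smooth_mul.
by exists K; split => // x /K0 ->; rewrite mulr0.
Qed.

Lemma T_scale Omega (c : R) phi : test_function Omega phi ->
  test_function Omega (fun x => c * phi x).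
Proof. by move=> T; apply: (@T_mul Omega (cst c)) => //; exact: smooth_cst. Qed.

Lemma T_add Omega f phi : test_function Omega f -> test_function Omega phi ->
  test_function Omega (fun x => f x + phi x).
Proof.
move=> [sf [L [cL LO L0]]] [s [K [cK KO K0]]]; split; first exact: smooth_add.
exists (L `|` K); split; [exact: compactU|by move=> x [/LO|/KO]|].
by move=> x /not_orP[/L0 -> /K0 ->]; rewrite addr0.
Qed.

Lemma T_zero Omega : test_function Omega (cst 0).
Proof.
split; first exact: smooth_cst.
by exists set0; split => //; exact: compact0.
Qed.

Lemma smooth_is_derive_line f (x v : plane) (t : R) : smooth setT f ->
  is_derive t 1 (fun s : R => f (x + s *: v)) ('D_v f (x + t *: v)).
Proof. by move=> sf; apply: is_derive_line; exact: smooth_derivable. Qed.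

(* Translation invariance of the integral, differentiated at the origin. *)
Lemma I2_derive0 Omega phi (v : plane) : test_function Omega phi -> I2 ('D_v phi) = 0.
Proof.
move=> T; have sf := T_smooth T.
have TD : test_function Omega ('D_v phi).
  have -> : 'D_v phi = (fun x => v.1 * partial1 phi x + v.2 * partial2 phi x).
    by apply/funext => x; rewrite smooth_derive// ![_ * v.1]mulrC ![_ * v.2]mulrC.
  by apply: T_add; apply: T_scale; [exact: T_partial1|exact: T_partial2].
have [r r0 Hr] := T_supp TD.
have [M M0 HM] := T_bounded TD.
pose f (t : R) (x : P) : R := phi ((x : plane) + t *: v).
have I0 : `]-1, 1[%classic (0 : R) by rewrite /= in_itv/=; apply/andP; split; lra.
have df1 (t : R) (x : P) : is_derive t (1 : R) (fun s : R => f s x) ('D_v phi ((x : plane) + t *: v)).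
  exact: smooth_is_derive_line.
have trans t : mpres (fun x : P => ((x : plane) + t *: v : plane)).
  by apply: mpres_ext (mpres_translation (t *: v)) => x; rewrite addrC.
have intf t : `]-1, 1[%classic t -> mu.-integrable setT (EFin \o f t).
  by move=> _; exact: (mpres_L1 (trans t) (T_L1 T)).
have derf t (y : P) : `]-1, 1[%classic t -> [set: P] y -> derivable (f^~ y) t 1.
  by move=> _ _; case: (df1 t y).
(* For [|t| < 1] the translates of the support stay in the ball enlarged by [|v|], which gives an
   integrable bound independent of [t]. *)
pose rr := r + `|v|.
pose G (x : P) : R := M * \1_(ball (0 : plane) rr : set plane) x.
have G0 y : 0 <= G y by rewrite mulr_ge0// indicE.
have rr0 : 0 <= rr by rewrite addr_ge0// ltW.
have intG : mu.-integrable setT (EFin \o G).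
  apply: (L1Z M (L1_indic (measurable_plane_ball 0 rr) _)).
  by rewrite leb2_ball ?ltry.
have D1E t y : partial1of2 f t y = 'D_v phi ((y : plane) + t *: v).
  by rewrite /partial1of2; exact: derive1P (df1 t y).
have Gub t (y : P) : `]-1, 1[%classic t -> [set: P] y -> `|partial1of2 f t y| <= G y.
  rewrite /= in_itv/= => t1 _; rewrite D1E /G indicE.
  case: (boolP (y \in (ball (0 : plane) rr : set plane))) => [_|/negP yb].
    by rewrite mulr1.
  rewrite mulr0 Hr ?normr0// => yt; apply: yb; rewrite inE.
  move: yt; rewrite -!ball_normE /= !sub0r !normrN => yt.
  rewrite -[y : plane](addrK (t *: v)); apply: le_lt_trans (ler_normB _ _) _.
  rewrite ltr_leD// normrZ ler_piMl//.
  by rewrite ler_norml; case/andP: t1 => h1 h2; rewrite !ltW.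
have E := @differentiation_under_integral _ _ _ mu f setT measurableT 0 (-1) 1 I0
  intf derf G G0 intG Gub.
move: E; have -> : (fun x' : R => \int[mu]_y f x' y) = cst (I2 phi).
  by apply/funext => t; rewrite -(mpres_I2 (trans t) (T_L1 T)).
rewrite derive1_cst => E; rewrite E; apply: eq_Rintegral => y _.
by rewrite -/(partial1of2 f 0 y) D1E scale0r addr0.
Qed.

Lemma I2_partial1 Omega phi : test_function Omega phi -> I2 (partial1 phi) = 0.
Proof. exact: I2_derive0. Qed.
Lemma I2_partial2 Omega phi : test_function Omega phi -> I2 (partial2 phi) = 0.
Proof. exact: I2_derive0. Qed.

Lemma T_mul_L1 Omega f phi : smooth setT f -> test_function Omega phi ->
  L1 (fun x => f x * phi x).
Proof. by move=> sf T; exact: T_L1 (T_mul sf T). Qed.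

(** The derivative of the test function [f * phi] has integral 0. *)
Lemma ibp1 Omega f phi : smooth setT f -> test_function Omega phi ->
  I2 (fun x => f x * partial1 phi x) = - I2 (fun x => partial1 f x * phi x).
Proof.
move=> sf T; apply/eqP; rewrite -subr_eq0 opprK -I2D; first last.
- exact: T_mul_L1 (smooth_partial1 sf) T.
- exact: T_mul_L1 sf (T_partial1 T).
rewrite -(I2_partial1 (T_mul sf T)); apply/eqP/I2_eq => x.
by rewrite partial1M ?[partial1 f x * _]mulrC//; exact: T_smooth T.
Qed.

Lemma ibp2 Omega f phi : smooth setT f -> test_function Omega phi ->
  I2 (fun x => f x * partial2 phi x) = - I2 (fun x => partial2 f x * phi x).
Proof.
move=> sf T; apply/eqP; rewrite -subr_eq0 opprK -I2D; first last.
- exact: T_mul_L1 (smooth_partial2 sf) T.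
- exact: T_mul_L1 sf (T_partial2 T).
rewrite -(I2_partial2 (T_mul sf T)); apply/eqP/I2_eq => x.
by rewrite partial2M ?[partial2 f x * _]mulrC//; exact: T_smooth T.
Qed.

(* Integrate the derivative of [x_1 phi^2]. *)
Lemma poincare Omega phi (M : R) : 0 < M -> (forall x, Omega x -> `|x.1| <= M) ->
  test_function Omega phi ->
  I2 (fun x => phi x ^+ 2) <= 4 * M ^+ 2 * I2 (fun x => partial1 phi x ^+ 2).
Proof.
move=> M0 OM T; have sp := T_smooth T.
have L2p : L1 (fun x => phi x ^+ 2) by exact: T_mul_L1 sp T.
have L2d : L1 (fun x => partial1 phi x ^+ 2).
  by exact: T_mul_L1 (smooth_partial1 sp) (T_partial1 T).
have T2 : test_function Omega (fun x => phi x * phi x) by exact: T_mul.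
have E := ibp1 smooth_fst T2.
have p1 (x : plane) : partial1 (fst : plane -> R) x = 1.
  rewrite (_ : (fst : plane -> R) = lin2 1 0); last first.
    by apply/funext => y; rewrite /lin2 mul1r mul0r addr0.
  by rewrite /partial1; have [_ ->] := is_derive_lin2 1 0 x (1, 0); rewrite /lin2 mul1r mul0r addr0.
have EL : I2 (fun x => phi x ^+ 2) = I2 (fun x => - 2 * (x.1 * (phi x * partial1 phi x))).
  have -> : I2 (fun x => phi x ^+ 2) = I2 (fun x => partial1 (fst : plane -> R) x * (phi x * phi x)).
    by apply: I2_eq => x; rewrite p1 mul1r expr2.
  rewrite -[LHS]opprK -E -I2N.
    by apply: I2_eq => x; rewrite partial1M//; ring.
  exact: T_mul_L1 smooth_fst (T_partial1 T2).
have Lr : L1 (fun x => - 2 * (x.1 * (phi x * partial1 phi x))).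
  by apply: L1Z; exact: T_mul_L1 smooth_fst (T_mul sp (T_partial1 T)).
have Lb : L1 (fun x => 2^-1 * phi x ^+ 2 + 2 * M ^+ 2 * partial1 phi x ^+ 2).
  by apply: L1D; exact: L1Z.
have H : I2 (fun x => phi x ^+ 2) <= 2^-1 * I2 (fun x => phi x ^+ 2) +
    2 * M ^+ 2 * I2 (fun x => partial1 phi x ^+ 2).
  rewrite {1}EL -!I2Z// -I2D//; try exact: L1Z.
  apply: I2_le => // x.
  have [Ox|nOx] := pselect (Omega x); last first.
    by rewrite (T_out T nOx) mul0r mulr0 mulr0 expr0n mulr0 add0r mulr_ge0 ?sqr_ge0// mulr_ge0// sqr_ge0.
  have x1 := OM x Ox; set a := phi x; set d := partial1 phi x.
  have xM : x.1 ^+ 2 <= M ^+ 2.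
    by rewrite -(real_normK (num_real x.1)) lerXn2r// nnegrE// ltW.
  have d2 : x.1 ^+ 2 * d ^+ 2 <= M ^+ 2 * d ^+ 2 by rewrite ler_wpM2r// sqr_ge0.
  (* Nonnegativity of this square is Young's inequality for [- 2 x.1 a d]; half of the integral of
     [phi^2] is then absorbed on the left. *)
  have := sqr_ge0 (a + 2 * x.1 * d).
  have -> : (a + 2 * x.1 * d) ^+ 2 = a ^+ 2 + 4 * (x.1 * (a * d)) + 4 * (x.1 ^+ 2 * d ^+ 2) by ring.
  by move=> h; lra.
move: H; move: (I2 _) (I2 _) => d a H; clear -H.
have -> : 4 * M ^+ 2 * d = 2 * (2 * M ^+ 2 * d) by ring.
by move: (2 * M ^+ 2 * d) H => m H; lra.
Qed.

End TestFunctions.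

(** * Square-integrable functions *)

Section SquareIntegrable.
Context {R : realType}.
Local Notation plane := (R * R)%type.
Local Notation P := (mplane R).
Local Notation mu := (@leb2 R).
Implicit Types (f g h : plane -> R) (Omega : set plane).

Definition L2 f := mfun2 f /\ L1 (fun x => f x ^+ 2).
Definition nrm f : R := Num.sqrt (I2 (fun x => f x ^+ 2)).

Lemma L2_mul f g : L2 f -> L2 g -> L1 (fun x => f x * g x).
Proof.
move=> [mf lf] [mg lg]; apply: (L1_dom (mfun2M mf mg) (L1D lf lg)) => x.
rewrite normrM -(real_normK (num_real (f x))) -(real_normK (num_real (g x))).
have := sqr_ge0 (`|f x| - `|g x|); have := normr_ge0 (f x); have := normr_ge0 (g x).
move: `|f x| `|g x| => a b b0 a0; rewrite sqrrB => h.
have : 0 <= a * b by rewrite mulr_ge0.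
by rewrite -mulr_natl in h; lra.
Qed.

Lemma L2_mfun f : L2 f -> mfun2 f. Proof. by case. Qed.

Lemma L2Z c f : L2 f -> L2 (fun x => c * f x).
Proof.
move=> [mf lf]; split; first exact: (mfun2M (mfun2_cst c) mf).
by apply: L1_eq (L1Z (c ^+ 2) lf) => x; rewrite exprMn.
Qed.

Lemma L2D f g : L2 f -> L2 g -> L2 (fun x => f x + g x).
Proof.
move=> lf lg; split; first exact: (mfun2D lf.1 lg.1).
apply: L1_eq (L1D (L1D lf.2 (L1Z 2 (L2_mul lf lg))) lg.2) => x.
by ring.
Qed.

Lemma L2N f : L2 f -> L2 (fun x => - f x).
Proof.
move=> lf; rewrite (_ : (fun x => _) = fun x => -1 * f x); first exact: L2Z.
by apply/funext => x; rewrite mulN1r.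
Qed.

Lemma L2B f g : L2 f -> L2 g -> L2 (fun x => f x - g x).
Proof. by move=> lf lg; exact: (L2D lf (L2N lg)). Qed.

Lemma L2_0 : L2 (fun=> 0).
Proof. by split; [exact: mfun2_cst|apply: L1_eq L1_0 => x; rewrite expr0n]. Qed.

Lemma L2_abs f : L2 f -> L2 (fun x => `|f x|).
Proof.
move=> [mf lf]; split; first exact: mfun2_abs.
by apply: L1_eq lf => x; rewrite real_normK ?num_real.
Qed.

Lemma L2_eq f g : f =1 g -> L2 f -> L2 g. Proof. by move=> /funext->. Qed.

Lemma L2_dom f g : mfun2 f -> L2 g -> (forall x, `|f x| <= g x) -> L2 f.
Proof.
move=> mf [mg lg] fg; split=> //.
apply: (L1_dom (mfun2M mf mf) lg) => x; rewrite -expr2 normrX.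
by rewrite lerXn2r// ?nnegrE//; exact: le_trans (fg x).
Qed.

Lemma L2_sum (F : nat -> plane -> R) n : (forall i, L2 (F i)) ->
  L2 (fun x => \sum_(0 <= i < n) F i x).
Proof.
move=> lF; elim: n => [|n IH].
  by apply: L2_eq L2_0 => x; rewrite big_geq.
by apply: L2_eq (L2D IH (lF n)) => x; rewrite big_nat_recr.
Qed.

Lemma L2_bounded_supp f (M : R) (x : plane) (r : R) : mfun2 f ->
  (forall y, `|f y| <= M) -> (forall y, ~ ball x r y -> f y = 0) -> L2 f.
Proof.
move=> mf fM f0; split => //.
apply: (@L1_bounded_supp _ _ (M ^+ 2) x r) => [|y|y /f0->]; last by rewrite expr0n.
  exact: (mfun2M mf mf).
by rewrite normrX lerXn2r// ?nnegrE//; exact: le_trans (fM y).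
Qed.

Lemma T_L2 Omega phi : test_function Omega phi -> L2 phi.
Proof.
move=> T; have [r r0 Hr] := T_supp T; have [M M0 HM] := T_bounded T.
exact: (L2_bounded_supp (smooth_mfun2 (T_smooth T)) HM Hr).
Qed.

Lemma n2_ge0 f : 0 <= I2 (fun x => f x ^+ 2).
Proof. by apply: I2_ge0 => x; exact: sqr_ge0. Qed.

Lemma nrm_ge0 f : 0 <= nrm f. Proof. exact: sqrtr_ge0. Qed.

Lemma nrm_sqr f : nrm f ^+ 2 = I2 (fun x => f x ^+ 2).
Proof. by rewrite sqr_sqrtr// n2_ge0. Qed.

Lemma nrm_le f c : 0 <= c -> (nrm f <= c) = (I2 (fun x => f x ^+ 2) <= c ^+ 2).
Proof.
move=> c0; rewrite -nrm_sqr; apply/idP/idP => [h|]; last by rewrite ler_pXn2r// nnegrE// nrm_ge0.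
by rewrite lerXn2r// nnegrE// nrm_ge0.
Qed.

Lemma nrmN f : nrm (fun x => - f x) = nrm f.
Proof. by congr Num.sqrt; apply: I2_eq => x; rewrite sqrrN. Qed.

Lemma nrmBC f g : nrm (fun x => f x - g x) = nrm (fun x => g x - f x).
Proof. by rewrite -nrmN; congr Num.sqrt; apply: I2_eq => x; rewrite opprB. Qed.

Lemma nrm_eq f g : f =1 g -> nrm f = nrm g. Proof. by move=> /funext->. Qed.

Lemma nrm_abs f : nrm (fun x => `|f x|) = nrm f.
Proof. by congr Num.sqrt; apply: I2_eq => x; rewrite real_normK ?num_real. Qed.

(** A nonnegative quadratic polynomial has nonpositive discriminant; when [c = 0], a nonzero slope
    [b] would make it equal to -1 at the chosen point. *)
Let quad_disc (a b c : R) : 0 <= c -> (forall t, 0 <= a + 2 * t * b + t ^+ 2 * c) ->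
  b ^+ 2 <= a * c.
Proof.
rewrite le_eqVlt => /predU1P[<- H|c0 H].
  have [->|b0] := eqVneq b 0; first by rewrite expr0n mulr0.
  have := H (- (a + 1) / (2 * b)).
  have -> : 2 * (- (a + 1) / (2 * b)) * b = - (a + 1) by field.
  by rewrite mulr0; lra.
have := H (- b / c).
have -> : a + 2 * (- b / c) * b + (- b / c) ^+ 2 * c = (a * c - b ^+ 2) / c by field; exact: lt0r_neq0.
by rewrite pmulr_lge0 ?invr_gt0// subr_ge0.
Qed.

Lemma cauchy_schwarz f g : L2 f -> L2 g ->
  `|I2 (fun x => f x * g x)| <= nrm f * nrm g.
Proof.
move=> lf lg; rewrite -sqrtrM ?n2_ge0// -sqrtr_sqr; apply: ler_wsqrtr.
apply: quad_disc => [|t]; first exact: n2_ge0.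
have -> : I2 (fun x => f x ^+ 2) + 2 * t * I2 (fun x => f x * g x) + t ^+ 2 * I2 (fun x => g x ^+ 2)
   = I2 (fun x => (f x + t * g x) ^+ 2).
  have l1 := L1Z (2 * t) (L2_mul lf lg); have l2 := L1Z (t ^+ 2) lg.2.
  rewrite -!I2Z//; [|exact: lg.2|exact: L2_mul].
  rewrite -I2D//; last exact: lf.2.
  rewrite -I2D//; last by apply: L1D => //; exact: lf.2.
  by apply: I2_eq => x; ring.
exact: n2_ge0.
Qed.

Lemma nrm_triangle f g : L2 f -> L2 g -> nrm (fun x => f x + g x) <= nrm f + nrm g.
Proof.
move=> lf lg; rewrite nrm_le ?addr_ge0 ?nrm_ge0//.
have -> : I2 (fun x => (f x + g x) ^+ 2) = nrm f ^+ 2 + 2 * I2 (fun x => f x * g x) + nrm g ^+ 2.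
  rewrite !nrm_sqr -I2Z; last exact: L2_mul.
  have l1 := L1Z 2 (L2_mul lf lg).
  rewrite -I2D//; last exact: lf.2.
  rewrite -I2D//; [|by apply: L1D => //; exact: lf.2|exact: lg.2].
  by apply: I2_eq => x; ring.
have := cauchy_schwarz lf lg => /ler_normlW h.
have -> : (nrm f + nrm g) ^+ 2 = nrm f ^+ 2 + 2 * (nrm f * nrm g) + nrm g ^+ 2 by ring.
by lra.
Qed.

Lemma nrm_dist f g : L2 f -> L2 g -> nrm f <= nrm g + nrm (fun x => f x - g x).
Proof.
move=> lf lg; rewrite -[leLHS](@nrm_eq (fun x => g x + (f x - g x))).
  by apply: nrm_triangle => //; exact: L2B.
by move=> x; ring.
Qed.

Lemma nrm_sum_le (F : nat -> plane -> R) (c : nat -> R) n : (forall i, L2 (F i)) ->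
  (forall i, nrm (F i) <= c i) ->
  nrm (fun x => \sum_(0 <= i < n) F i x) <= \sum_(0 <= i < n) c i.
Proof.
move=> lF Fc; elim: n => [|n IH].
  rewrite big_geq// /nrm (@I2_eq _ _ (fun=> 0)) ?I2_0 ?sqrtr0//.
  by move=> x; rewrite big_geq// expr0n.
rewrite big_nat_recr//=.
rewrite (@nrm_eq _ (fun x => \sum_(0 <= i < n) F i x + F n x)).
  by apply: le_trans (nrm_triangle (L2_sum _ lF) (lF n)) _; rewrite lerD.
by move=> x; rewrite big_nat_recr.
Qed.

Lemma L2_ae f g : mfun2 g -> {ae mu, forall x, f x = g x} -> L2 f -> L2 g.
Proof.
move=> mg fg [mf lf]; split => //; apply: L1_ae lf; first exact: (mfun2M mg mg).
by apply: (@filterS _ _ (ae_filter_ringOfSetsType mu) _ _ _ fg) => x ->.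
Qed.

Lemma nrm_ae f g : mfun2 f -> mfun2 g -> {ae mu, forall x, f x = g x} -> nrm f = nrm g.
Proof.
move=> mf mg fg; congr Num.sqrt; apply: I2_ae; [exact: (mfun2M mf mf)|exact: (mfun2M mg mg)|].
by apply: (@filterS _ _ (ae_filter_ringOfSetsType mu) _ _ _ fg) => x ->.
Qed.

Lemma fatou_I2 (u : nat -> plane -> R) v c : (forall n, L1 (u n)) ->
  (forall n x, 0 <= u n x) -> (forall x, u n x @[n --> \oo] --> v x) ->
  (forall n, I2 (u n) <= c) -> L1 v /\ I2 v <= c.
Proof.
move=> lu u0 uv uc.
have mv : mfun2 v by apply: (measurable_fun_cvg (fun n => L1_mfun (lu n))) => x _; exact: uv.
have v0 x : 0 <= v x.
  rewrite -(cvg_lim (@Rhausdorff R) (uv x)).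
  by apply: limr_ge; [exact: cvgP (uv x)|exact: nearW].
have E n : (\int[mu]_x (u n x)%:E = (I2 (u n))%:E)%E.
  by rewrite /I2 /Rintegral fineK//; exact: (integrable_fin_num measurableT (lu n)).
have F : (\int[mu]_x (v x)%:E <= c%:E)%E.
  have := @fatou _ _ _ mu setT measurableT (fun n => EFin \o (u n : P -> R)).
  rewrite (_ : (fun x => limn_einf _) = EFin \o (v : P -> R)); last first.
    apply/funext => x; apply: (cvg_limn_einf_sup _).1.
    by apply: cvg_EFin; [exact: nearW|exact: uv].
  move=> H; apply: le_trans (H _ _) _.
  - by move=> n; apply: mfun2_EFin; exact: L1_mfun.
  - by move=> n x _; rewrite lee_fin.
  rewrite limn_einf_lim; apply: lime_le; first exact: is_cvg_einfs.
  apply: nearW => n; apply: (@le_trans _ _ (\int[mu]_x (u n x)%:E)%E).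
    by apply: ereal_inf_lbound; exists n => //=.
  by rewrite E lee_fin.
have lv : L1 v.
  apply/integrableP; split; first exact: mfun2_EFin.
  rewrite (eq_integral (fun x : P => (v x)%:E)).
    by apply: le_lt_trans F _; exact: ltry.
  by move=> x _ /=; rewrite ger0_norm.
split => //; rewrite -lee_fin; apply: le_trans F.
by rewrite /I2 /Rintegral fineK//; exact: (integrable_fin_num measurableT lv).
Qed.

(* A subsequence with summable increments converges almost everywhere. *)
Lemma L2_complete (f : nat -> plane -> R) : (forall n, L2 (f n)) ->
  (forall e : R, 0 < e -> exists N, forall m n, (N <= m)%N -> (N <= n)%N ->
     nrm (fun x => f m x - f n x) <= e) ->
  exists g, L2 g /\ nrm (fun x => f n x - g x) @[n --> \oo] --> 0.
Proof.
move=> lf cf.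
have e0 k : 0 < (2^-1 : R) ^+ k by rewrite exprn_gt0.
have [N NP] := choice (fun k => cf _ (e0 k)).
(* Partial sums of [N] are indices above every earlier [N k], so that any two terms of [g] from [k]
   on differ by at most [2^-k]. *)
pose M k := (\sum_(0 <= i < k.+1) N i)%N.
have NM k j : (k <= j)%N -> (N k <= M j)%N.
  move=> kj; rewrite /M (@big_cat_nat _ _ _ k.+1)//=.
  by rewrite (big_nat_recr k)//= -addnA addnCA leq_addr.
pose g k := f (M k).
have lg k : L2 (g k) by exact: lf.
have gg k i j : (k <= i)%N -> (k <= j)%N -> nrm (fun x => g i x - g j x) <= 2^-1 ^+ k.
  by move=> ki kj; apply: NP; exact: NM.
pose d k x : R := `|g k.+1 x - g k x|.
have ld k : L2 (d k) by apply: L2_abs; exact: L2B.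
pose S n x : R := \sum_(0 <= k < n) d k x.
have S0 n x : 0 <= S n x by apply: sumr_ge0 => k _; exact: normr_ge0.
have lS n : L2 (S n) by exact: L2_sum.
have nS n : nrm (S n) <= 2.
  apply: (@le_trans _ _ (\sum_(0 <= k < n) 2^-1 ^+ k)).
    by apply: nrm_sum_le => // k; rewrite nrm_abs gg.
  have -> : \sum_(0 <= k < n) (2^-1 : R) ^+ k = 2 - 2 * 2^-1 ^+ n.
    elim: n => [|n IH]; first by rewrite big_geq// expr0 mulr1 subrr.
    by rewrite big_nat_recr//= IH exprS; lra.
  by rewrite gerBl mulr_ge0// ltW.
have ndS x : {homo (fun n => S n x) : m n / (m <= n)%N >-> m <= n}.
  move=> m n mn; rewrite /S (@big_cat_nat _ _ _ m 0 n)//= lerDl.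
  by apply: sumr_ge0 => k _; exact: normr_ge0.
pose u n : P -> \bar R := fun x => (S n x ^+ 2)%:E.
have mu_ n : measurable_fun setT (u n) by apply: mfun2_EFin; exact: L1_mfun (lS n).2.
have u0 n x : (0 <= u n x)%E by rewrite lee_fin sqr_ge0.
have ndu x : nondecreasing_seq (fun n => u n x).
  by move=> m n mn; rewrite lee_fin lerXn2r// ?nnegrE//; exact: ndS.
pose U (x : P) : \bar R := limn (fun n => u n x).
have Ule n x : (u n x <= U x)%E.
  by rewrite /U (cvg_lim _ (ereal_nondecreasing_cvgn (ndu x)))//; apply: ereal_sup_ubound; exists n.
have mU : measurable_fun (setT : set P) U.
  apply: (@emeasurable_fun_cvg _ _ _ setT u U mu_) => x _.
  exact: ereal_nondecreasing_is_cvgn (ndu x).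
have U0 x : (0 <= U x)%E by apply: le_trans (Ule 0%N x); exact: u0.
have IU : (\int[mu]_x U x <= 4%:E)%E.
  rewrite /U (@monotone_convergence _ _ _ mu setT measurableT u)//.
    apply: lime_le.
      apply: ereal_nondecreasing_is_cvgn => m n mn.
      by apply: ge0_le_integral => // x _; exact: ndu.
    apply: nearW => n.
    have -> : (\int[mu]_x u n x = (I2 (fun x => S n x ^+ 2))%:E)%E.
      by rewrite /I2 /Rintegral fineK//; exact: (integrable_fin_num measurableT (lS n).2).
    by rewrite lee_fin -nrm_sqr (_ : 4 = 2 ^+ 2)//; [rewrite lerXn2r// nnegrE// nrm_ge0|ring].
have iU : mu.-integrable setT U.
  apply/integrableP; split => //.
  rewrite (eq_integral U); first by apply: le_lt_trans IU _; rewrite ltry.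
  by move=> x _; rewrite gee0_abs.
pose A : set P := ~` (U @^-1` [set +oo%E]).
have mA : measurable A.
  by apply: measurableC; rewrite -[X in measurable X]setTI; apply: mU => //; exact: emeasurable_set1.
have aeA : {ae mu, forall x, A x}.
  apply: (@filterS _ _ (ae_filter_ringOfSetsType mu) _ _ _ (integrable_ae measurableT iU)) => x /(_ I).
  by move=> h E; move: h; rewrite E.
(* Multiplication by the indicator of the set [A] of full measure makes the sequence converge at
   every point. *)
pose h k (x : plane) := g k x * \1_A x.
have ch x : cvgn (fun k => h k x).
  have [Ax|nAx] := pselect (A x); last first.
    rewrite (_ : (fun k => _) = cst 0); first exact: is_cvg_cst.
    by apply/funext => k; rewrite /h indicE memNset// mulr0.
  have -> : (fun k => h k x) = (fun k => g k x).
    by apply/funext => k; rewrite /h indicE mem_set// mulr1.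
  have -> : (fun k => g k x) = (fun k => g 0%N x + series (telescope (fun k => g k x)) k).
    by apply/funext => k; exact: eq_sum_telescope.
  apply: is_cvgD; first exact: is_cvg_cst.
  apply: normed_cvg.
  apply: (@nondecreasing_is_cvgn _ (fun n => S n x) (ndS x)).
  move: Ax; rewrite /A /=.
  have Ufin : (0 <= U x)%E := U0 x.
  case E : (U x) Ufin => [y| |]//.
  move=> y0 _.
  exists (Num.sqrt y) => _ [n _ <-].
  rewrite -[S n x]ger0_norm// -sqrtr_sqr; apply: ler_wsqrtr.
  by rewrite -lee_fin -E; exact: Ule.
pose G x := limn (fun k => h k x).
have aeh k : {ae mu, forall x, g k x = h k x}.
  apply: (@filterS _ _ (ae_filter_ringOfSetsType mu) _ _ _ aeA) => x Ax.
  by rewrite /h indicE mem_set// mulr1.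
have mh k : mfun2 (h k) by apply: mfun2M; [exact: (lg k).1|exact: mfun2_indic].
have mG : mfun2 G by apply: (measurable_fun_cvg mh) => x _; exact: ch.
(* Fatou's lemma along the selected indices bounds the distance of each late [f n] to the limit, and
   so gives convergence of the whole sequence. *)
have key k n : (N k <= n)%N -> L2 (fun x => f n x - G x) /\ nrm (fun x => f n x - G x) <= 2^-1 ^+ k.
  move=> kn.
  have aed j : {ae mu, forall x, f n x - g (j + k)%N x = f n x - h (j + k)%N x}.
    by apply: (@filterS _ _ (ae_filter_ringOfSetsType mu) _ _ _ (aeh (j + k)%N)) => x ->.
  have lh j : L2 (fun x => f n x - h (j + k)%N x).
    apply: L2_ae (aed j) (L2B (lf n) (lg _)); exact: mfun2B (lf n).1 (mh _).
  have ld' x : (f n x - h (j + k)%N x) ^+ 2 @[j --> \oo] --> (f n x - G x) ^+ 2.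
    have c : f n x - h (j + k)%N x @[j --> \oo] --> f n x - G x.
      by apply: cvgB; [exact: cvg_cst|rewrite (cvg_shiftn k (fun j => h j x)); exact: ch].
    by rewrite expr2; under eq_fun do rewrite expr2; exact: cvgM.
  have le j : I2 (fun x => (f n x - h (j + k)%N x) ^+ 2) <= (2^-1 ^+ k) ^+ 2.
    rewrite -nrm_le ?exprn_ge0//.
    rewrite -(nrm_ae (mfun2B (lf n).1 (lg _).1) (lh j).1 (aed j)).
    by apply: NP => //; apply: NM; exact: leq_addl.
  have [l lle] := fatou_I2 (fun j => (lh j).2) (fun j x => sqr_ge0 _) ld' le.
  split; first by split => //; exact: mfun2B (lf n).1 mG.
  by rewrite nrm_le ?exprn_ge0.
exists G; split.
  have [l _] := key 0%N (N 0%N) (leqnn _).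
  by apply: L2_eq (L2B (lf (N 0%N)) l) => x; rewrite opprB addrC subrK.
apply/cvgrPdist_le => e e1.
have [k ke] : exists k, (2^-1 : R) ^+ k <= e.
  have := @cvg_expr R (2^-1); rewrite ger0_norm// => /(_ _).
  have h1 : (2^-1 : R) < 1 by lra.
  move=> /(_ h1)/cvgrPdist_le/(_ _ e1)[k _ /(_ k (leqnn _))].
  by rewrite /= sub0r normrN ger0_norm ?exprn_ge0// => ?; exists k.
exists (N k) => // n /= kn; rewrite sub0r normrN ger0_norm ?nrm_ge0//.
by apply: le_trans ke; exact: (key k n kn).2.
Qed.

Lemma nrm_cvg_I2 (f : nat -> plane -> R) g h : (forall n, L2 (f n)) -> L2 g -> L2 h ->
  nrm (fun x => f n x - g x) @[n --> \oo] --> 0 ->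
  I2 (fun x => f n x * h x) @[n --> \oo] --> I2 (fun x => g x * h x).
Proof.
move=> lf lg lh c; apply/cvgrPdist_le => e e0.
have : nrm (fun x => f n x - g x) * nrm h @[n --> \oo] --> 0 * nrm h.
  by apply: cvgM => //; exact: cvg_cst.
rewrite mul0r => /cvgrPdist_le/(_ _ e0); apply: filterS => n.
rewrite sub0r normrN ger0_norm ?mulr_ge0 ?nrm_ge0//; apply: le_trans.
rewrite -I2B; [|exact: L2_mul|exact: L2_mul].
rewrite (@I2_eq _ _ (fun x => (g x - f n x) * h x)); last by move=> x; ring.
by rewrite nrmBC; apply: cauchy_schwarz => //; exact: L2B.
Qed.

Lemma nrm_cvg_sqr (f : nat -> plane -> R) g : (forall n, L2 (f n)) -> L2 g ->
  nrm (fun x => f n x - g x) @[n --> \oo] --> 0 ->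
  nrm (f n) @[n --> \oo] --> nrm g.
Proof.
move=> lf lg c; apply/cvgrPdist_le => e e0.
move/cvgrPdist_le: c => /(_ _ e0); apply: filterS => n.
rewrite sub0r normrN [in X in X -> _]ger0_norm ?nrm_ge0//; apply: le_trans.
rewrite ler_norml lerBrDl lerBlDl; apply/andP; split.
  by rewrite addrC; exact: nrm_dist.
by rewrite lerBlDl nrmBC; exact: nrm_dist.
Qed.

Lemma Lp_on2P Omega f : Lp_on 2%:E Omega f <-> L2 (f \_ Omega).
Proof.
split=> [h|[mf lf]].
  split; last exact: Lfun2_integrable_sqr h.
  by move: h; rewrite /Lp_on inE => /andP[]; rewrite inE.
rewrite /Lp_on inE; apply/andP; split; rewrite inE//=.
rewrite /finite_norm unlock; apply: poweR_lty.
rewrite (eq_integral (fun x : P => ((f \_ Omega) x ^+ 2)%:E)).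
  have /integrableP[_] := lf; apply: le_lt_trans.
  rewrite le_eqVlt; apply/orP; left; apply/eqP; apply: eq_integral => x _ /=.
  by rewrite ger0_norm// sqr_ge0.
by move=> x _ /=; rewrite powR_mulrn// -normrX ger0_norm// sqr_ge0.
Qed.

Lemma Lp_norm_on2 Omega f : L2 (f \_ Omega) ->
  Lp_norm_on 2%:E Omega f = (nrm (f \_ Omega))%:E.
Proof.
move=> [mf lf]; rewrite /Lp_norm_on unlock.
rewrite (eq_integral (fun x : P => ((f \_ Omega) x ^+ 2)%:E)); last first.
  by move=> x _ /=; rewrite powR_mulrn// -normrX ger0_norm// sqr_ge0.
have -> : (\int[mu]_x ((f \_ Omega) x ^+ 2)%:E = (I2 (fun x => (f \_ Omega) x ^+ 2))%:E)%E.
  by rewrite /I2 /Rintegral fineK//; exact: (integrable_fin_num measurableT lf).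
by rewrite poweR_EFin powR12_sqrt// n2_ge0.
Qed.

End SquareIntegrable.

(** * The fundamental lemma of the calculus of variations *)

Section FundamentalLemma.
Context {R : realType}.
Local Notation plane := (R * R)%type.
Local Notation P := (mplane R).
Local Notation mu := (@leb2 R).
Implicit Types (f g h phi : plane -> R) (Omega : set plane).

(** Positive exactly on the open square of centre [c] and half-side [r], which is the ball for the
    norm of the product. *)
Definition box_bump (c : plane) (r : R) (x : plane) : R :=
  (flat (-1 * x.1 + (r + c.1)) * flat (1 * x.1 + (r - c.1))) *
  (flat (-1 * x.2 + (r + c.2)) * flat (1 * x.2 + (r - c.2))).

Lemma smooth_box_bump c r : smooth setT (box_bump c r).
Proof.
have s1 a b : smooth setT (fun x : plane => flat (a * x.1 + b)).
  apply: (@smooth_comp1 _ (fun t => flat (a * t + b))); last exact: smooth_fst.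
  exact: smooth1_comp smooth1_flat (smooth1_affine _ _).
have s2 a b : smooth setT (fun x : plane => flat (a * x.2 + b)).
  apply: (@smooth_comp1 _ (fun t => flat (a * t + b))); last exact: smooth_snd.
  exact: smooth1_comp smooth1_flat (smooth1_affine _ _).
by apply: smooth_mul; apply: smooth_mul.
Qed.

Lemma box_bump_bounds c r x : 0 <= box_bump c r x <= 1.
Proof.
rewrite /box_bump !mulr_ge0 ?flat_ge0//=.
by rewrite !mulr_ile1 ?mulr_ge0 ?flat_ge0 ?flat_le1.
Qed.

Lemma box_bump_gt0 c r x : (ball c r : set plane) x -> 0 < box_bump c r x.
Proof.
move/plane_ballP => []; rewrite !ltr_norml => /andP[h1 h2] /andP[h3 h4].
by rewrite /box_bump !mulr_gt0 ?flat_pos//; lra.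
Qed.

Lemma box_bump_out c r x : ~ (ball c r : set plane) x -> box_bump c r x = 0.
Proof.
move=> nb; rewrite /box_bump.
have [h1|h1] := leP (-1 * x.1 + (r + c.1)) 0; first by rewrite flat_le0// !mul0r.
have [h2|h2] := leP (1 * x.1 + (r - c.1)) 0; first by rewrite (flat_le0 h2) mulr0 mul0r.
have [h3|h3] := leP (-1 * x.2 + (r + c.2)) 0; first by rewrite (flat_le0 h3) mul0r mulr0.
have [h4|h4] := leP (1 * x.2 + (r - c.2)) 0; first by rewrite (flat_le0 h4) !mulr0.
by exfalso; apply: nb; apply/plane_ballP; rewrite !ltr_norml; split; apply/andP; split; lra.
Qed.

Lemma compact_box (c : plane) (r : R) :
  compact [set x : plane | `|c.1 - x.1| <= r /\ `|c.2 - x.2| <= r].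
Proof.
have -> : [set x : plane | `|c.1 - x.1| <= r /\ `|c.2 - x.2| <= r] =
    `[c.1 - r, c.1 + r]%classic `*` `[c.2 - r, c.2 + r]%classic.
  apply/seteqP; split => -[x y] /=; rewrite !in_itv/= !ler_norml.
    by move=> [/andP[h1 h2] /andP[h3 h4]]; split; apply/andP; split; lra.
  by move=> [/andP[h1 h2] /andP[h3 h4]]; split; apply/andP; split; lra.
by apply: compact_setX; exact: segment_compact.
Qed.

Lemma T_box_bump (O : set plane) c r : 0 < r -> (ball c (r + r) : set plane) `<=` O ->
  test_function O (box_bump c r).
Proof.
move=> r0 bO; split; first exact: smooth_box_bump.
exists [set x : plane | `|c.1 - x.1| <= r /\ `|c.2 - x.2| <= r]; split.
- exact: compact_box.
- by move=> x [h1 h2]; apply: bO; apply/plane_ballP; split; lra.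
- by move=> x nK; apply: box_bump_out => /plane_ballP[h1 h2]; apply: nK; split; exact: ltW.
Qed.

(** The doubled square is also kept inside [O], to leave room for the support of a bump. A radius
    below a third of [e] is enough: [x] is within [r] of the centre, the points of the doubled
    square within [2 r]. *)
Lemma rat_ball_basis (O : set plane) (x : plane) : open O -> O x ->
  exists q : rat * rat * nat, let c : plane := (ratr q.1.1, ratr q.1.2) in
   let r : R := q.2.+1%:R^-1 in
   (ball c (r + r) : set plane) `<=` O /\ (ball c r : set plane) x.
Proof.
move=> oO Ox.
have /nbhs_ballP[e /= e0 eO] : nbhs x O by exact: open_nbhs_nbhs.
have [n ne] : exists n : nat, n.+1%:R^-1 < e / 3.
  have e20 : 0 < e / 3 by rewrite divr_gt0.
  exists (Num.truncn (e / 3)^-1); rewrite -[ltRHS]invrK ltf_pV2 ?posrE ?invr_gt0//.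
  have iv : 0 <= (e / 3)^-1 by rewrite invr_ge0 ltW.
  by have /andP[] := truncn_itv iv.
have n0 : 0 < n.+1%:R^-1 :> R by rewrite invr_gt0.
have appr (r : R) : exists q : rat, `|ratr q - r| < n.+1%:R^-1.
  have rn : r < r + n.+1%:R^-1 by rewrite ltrDl.
  have [q] := rat_in_itvoo rn; rewrite in_itv/= => /andP[h1 h2]; exists q.
  by rewrite gtr0_norm ?subr_gt0// ltrBlDl.
have [q1 hq1] := appr x.1; have [q2 hq2] := appr x.2.
exists (q1, q2, n) => /=; split; last by apply/plane_ballP.
move=> y /plane_ballP[/= h1 h2]; apply: eO; apply/plane_ballP.
move: hq1 hq2 h1 h2 ne; rewrite !ltr_norml; move: (n.+1%:R^-1) (ratr q1) (ratr q2) => r u v.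
by move=> /andP[? ?] /andP[? ?] /andP[? ?] /andP[? ?] ?; split; apply/andP; split; lra.
Qed.

(** The analogue of a union for functions with values in [[0, 1]]. *)
Lemma T_union (O : set plane) f g : test_function O f -> test_function O g ->
  test_function O (fun x => 1 - (1 - f x) * (1 - g x)).
Proof.
move=> Tf Tg.
have -> : (fun x => 1 - (1 - f x) * (1 - g x)) = (fun x => f x + (1 + -1 * f x) * g x).
  by apply/funext => x; ring.
apply: T_add => //; apply: (@T_mul _ _ (fun x => 1 + -1 * f x)) => //.
apply: (@smooth_add _ (cst 1)); first exact: smooth_cst.
by apply: (@smooth_mul _ (cst (-1))); [exact: smooth_cst|exact: T_smooth Tf].
Qed.

(* [1 - prod_i (1 - be_i)^n], over countably many box bumps exhausting the open set. *)
Lemma open_approx (O : set plane) : open O -> exists phi : nat -> plane -> R,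
  [/\ forall n, test_function O (phi n), forall n x, 0 <= phi n x <= 1 &
      forall x, phi n x @[n --> \oo] --> (\1_O x : R)].
Proof.
move=> oO.
pose be i (x : plane) : R :=
  if unpickle i is Some q then
    let c : plane := (ratr (q : rat * rat * nat).1.1, ratr q.1.2) in
    let r : R := q.2.+1%:R^-1 in
    if `[< (ball c (r + r) : set plane) `<=` O >] then box_bump c r x else 0
  else 0.
have Tbe i : test_function O (be i).
  rewrite /be; case: (unpickle i) => [q|]; last exact: T_zero.
  case: asboolP => [h|_]; last exact: T_zero.
  by apply: T_box_bump => //; rewrite invr_gt0.
have be01 i x : 0 <= be i x <= 1.
  rewrite /be; case: (unpickle i) => [q|]; last by rewrite lexx ler01.
  case: asboolP => [h|_]; first exact: box_bump_bounds.
  by rewrite lexx ler01.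
have beO x : ~ O x -> forall i, be i x = 0.
  by move=> nO i; exact: T_out (Tbe i) nO.
have bep x : O x -> exists i, 0 < be i x.
  move=> Ox; have [q [qO qx]] := rat_ball_basis oO Ox.
  exists (pickle q); rewrite /be pickleK asboolT//; exact: box_bump_gt0.
have Tpow n i : test_function O (fun x => 1 - (1 - be i x) ^+ n).
  elim: n => [|n IH].
    rewrite (_ : (fun x => _) = cst 0); first exact: T_zero.
    by apply/funext => x; rewrite expr0 subrr.
  rewrite (_ : (fun x => _) = (fun x => 1 - (1 - be i x) * (1 - (1 - (1 - be i x) ^+ n)))).
    exact: T_union.
  by apply/funext => x; rewrite exprS; ring.
have Tprod n m : test_function O (fun x => 1 - \prod_(0 <= i < m) (1 - be i x) ^+ n).
  elim: m => [|m IH].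
    rewrite (_ : (fun x => _) = cst 0); first exact: T_zero.
    by apply/funext => x; rewrite big_geq// subrr.
  rewrite (_ : (fun x => _) = (fun x => 1 - (1 - (1 - \prod_(0 <= i < m) (1 - be i x) ^+ n))
      * (1 - (1 - (1 - be m x) ^+ n)))).
    exact: T_union.
  by apply/funext => x; rewrite big_nat_recr//=; ring.
have f01 n i x : 0 <= (1 - be i x) ^+ n <= 1.
  have /andP[h1 h2] := be01 i x.
  by rewrite exprn_ge0 ?subr_ge0//= exprn_ile1// ?subr_ge0// gerBl.
have p01 n m x : 0 <= \prod_(0 <= i < m) (1 - be i x) ^+ n <= 1.
  elim: m => [|m /andP[h1 h2]]; first by rewrite big_geq// ler01 lexx.
  have /andP[h3 h4] := f01 n m x.
  by rewrite big_nat_recr//= mulr_ge0//= mulr_ile1.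
exists (fun n x => 1 - \prod_(0 <= i < n) (1 - be i x) ^+ n); split => //.
- by move=> n x; have /andP[h1 h2] := p01 n n x; rewrite subr_ge0 h2/= gerBl.
move=> x; rewrite indicE; case: (boolP (x \in O)) => [|/negP]; rewrite inE => Ox; last first.
  rewrite (_ : (fun n => _) = cst 0); first exact: cvg_cst.
  apply/funext => n; rewrite big1 ?subrr// => i _.
  by rewrite beO// subr0 expr1n.
have [i bi] := bep x Ox.
have le m n : (i < m)%N -> \prod_(0 <= j < m) (1 - be j x) ^+ n <= (1 - be i x) ^+ n.
  elim: m => [//|m IH]; rewrite ltnS leq_eqVlt => /predU1P[<-|im]; rewrite big_nat_recr//=.
    have /andP[h1 h2] := p01 n i x; have /andP[h3 h4] := f01 n i x.
    by rewrite ler_piMl.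
  have /andP[h1 h2] := p01 n m x; have /andP[h3 h4] := f01 n m x.
  by apply: le_trans (IH im); rewrite ler_piMr.
rewrite -[X in _ --> X]subr0; apply: cvgB; first exact: cvg_cst.
apply: (@squeeze_cvgr _ _ _ _ (cst 0) (fun n => (1 - be i x) ^+ n)).
- exists i.+1 => // n /= hn; have /andP[-> _] := p01 n n x; exact: le.
- exact: cvg_cst.
apply: cvg_expr; have /andP[_ h] := be01 i x.
by rewrite ger0_norm ?subr_ge0// ltrBlDl ltrDr.
Qed.

(** Indicators of open sets are limits of test functions under domination; Dynkin's lemma extends
    the vanishing to integrals over all Borel sets, which forces [h] to be 0 almost everywhere. *)
Lemma fundamental_lemma Omega h : open Omega -> L1 h -> (forall x, ~ Omega x -> h x = 0) ->
  (forall phi, test_function Omega phi -> I2 (fun x => h x * phi x) = 0) ->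
  {ae mu, forall x, h x = 0}.
Proof.
move=> oO lh h0 H; have mh := L1_mfun lh; have la := L1_abs lh.
have mult (A : set plane) : @measurable _ P A -> L1 (fun x => h x * \1_A x).
  move=> mA; apply: (L1_dom (mfun2M mh (mfun2_indic mA)) la) => x.
  by rewrite normrM ler_piMr// indicE; case: (_ \in _); rewrite ?normr1 ?normr0.
have IO (O : set plane) : open O -> I2 (fun x => h x * \1_O x) = 0.
  move=> oU; have [phi [Tphi p01 cphi]] := open_approx (openI oU oO).
  have [_ c] := @I2_dct _ (fun n x => h x * phi n x) (fun x => h x * \1_(O `&` Omega) x) _
    (fun n => mfun2M mh (smooth_mfun2 (T_smooth (Tphi n)))) la
    (fun n x => ltac:(rewrite normrM ler_piMr// ger0_norm; by have /andP[] := p01 n x))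
    (fun x => cvgM (cvg_cst _) (cphi x)).
  rewrite (@I2_eq _ _ (fun x => h x * \1_(O `&` Omega) x)); last first.
    move=> x; rewrite !indicE in_setI; have [Ox|nO] := pselect (Omega x).
      by rewrite (mem_set Ox) andbT.
    by rewrite h0// !mul0r.
  have <- := cvg_lim (@Rhausdorff R) c.
  apply/cvg_lim => //; rewrite (_ : (fun n => _) = cst 0); first exact: cvg_cst.
  by apply/funext => n; apply: H; apply: T_sub (Tphi n); exact: subIsetr.
have IT : I2 h = 0.
  by rewrite -(IO setT openT); apply: I2_eq => x; rewrite indicE in_setT mulr1.
have key (A : set P) : measurable A -> I2 (fun x => h x * \1_A x) = 0.
  move=> mA; have sA : <<s @open plane >> A by rewrite -plane_borel.
  apply: (@dynkin_induction _ P (@open plane) (fun A => I2 (fun x => h x * \1_A x) = 0)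
    plane_borel _ _ _ _ _ _ sA) => [B C|||B mB IB|F mF tF IF].
  - exact: openI.
  - by apply: IO; exact: openT.
  - by move=> O; exact: IO.
  - rewrite -[RHS]subr0 -{2}IB -IT -I2B; [|exact: lh|exact: mult].
    apply: I2_eq => x; rewrite !indicE in_setC.
    by case: (_ \in B); rewrite /= ?mulr1 ?mulr0 ?subr0 ?subrr.
  - pose G n : set P := \big[setU/set0]_(i < n) F i.
    have mG n : measurable (G n) by exact: bigsetU_measurable.
    have I0 n : I2 (fun x => h x * \1_(G n) x) = 0.
      elim: n => [|n IH].
        rewrite (@I2_eq _ _ (fun=> 0)) ?I2_0// => x.
        by rewrite /G big_ord0 indicE in_set0 mulr0.
      rewrite -[RHS]addr0 -{1}IH -(IF n) -I2D; [|exact: mult|exact: mult].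
      apply: I2_eq => x; rewrite -mulrDr; congr (_ * _).
      have GS : G n.+1 = G n `|` F n by rewrite /G big_ord_recr.
      rewrite GS !indicE in_setU; have [Fy|nF] := pselect (F n x).
        rewrite (mem_set Fy) orbT memNset ?add0r//.
        rewrite /G -bigcup_mkord => -[m /= mn Fm].
        by have := tF m n I I (ex_intro _ x (conj Fm Fy)) => E; rewrite E ltnn in mn.
      by rewrite (memNset nF) orbF addr0.
    have cG (x : plane) : (\1_(G n) x : R) @[n --> \oo] --> (\1_(\bigcup_k F k) x : R).
      have [[k _ Fk]|nF] := pselect ((\bigcup_k F k) x).
        apply: cvg_near_cst; exists k.+1 => // n /= kn.
        by rewrite !indicE !mem_set//; [exists k|rewrite /G -bigcup_mkord; exists k].
      apply: cvg_near_cst; apply: nearW => n; rewrite !indicE !memNset// /G -bigcup_mkord.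
      by move=> [i _ Fi]; apply: nF; exists i.
    have [_ c] := @I2_dct _ (fun n x => h x * \1_(G n) x) (fun x => h x * \1_(\bigcup_k F k) x) _
      (fun n => mfun2M mh (mfun2_indic (mG n))) la
      (fun n x => ltac:(rewrite normrM ler_piMr// indicE; case: (_ \in _); by rewrite ?normr1 ?normr0))
      (fun x => cvgM (cvg_cst _) (cG x)).
    rewrite -(cvg_lim (@Rhausdorff R) c).
    apply/cvg_lim => //; rewrite (_ : (fun n => _) = cst 0); first exact: cvg_cst.
    by apply/funext => n; exact: I0.
have E := @integral_ae_eq _ _ _ mu setT measurableT (fun=> 0%E) _ lh (measurable_cst _).
apply: (@filterS _ _ (ae_filter_ringOfSetsType mu) _ _ _ (E _)).
  by move=> x /(_ I)[].
move=> A _ mA; rewrite integral0.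
have := key A mA; rewrite /I2.
rewrite (_ : (\int[mu]_x _)%R = \int[mu]_(x in A) h x); last first.
  rewrite [RHS](@setI2 _ A h); apply: I2_eq => x; rewrite patchE indicE.
  by case: ifP => _; rewrite ?mulr1 ?mulr0.
move=> K; rewrite -[LHS]fineK; last first.
  apply: integrable_fin_num => //; exact: integrableS lh.
by rewrite -[fine _]/(\int[mu]_(x in A) h x)%R K.
Qed.

End FundamentalLemma.

(** * The Dirichlet problem and its energy *)

Section Dirichlet.
Context {R : realType}.
Local Notation plane := (R * R)%type.
Local Notation P := (mplane R).
Local Notation mu := (@leb2 R).
Implicit Types (f g h w phi chi psi : plane -> R) (Omega : set plane).

Lemma seq_cvgD (u v : nat -> R) a b : u @ \oo --> a -> v @ \oo --> b ->
  (fun n => u n + v n) @ \oo --> a + b.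
Proof. by move=> ua vb; exact: cvgD. Qed.
Lemma seq_cvgN (u : nat -> R) a : u @ \oo --> a -> (fun n => - u n) @ \oo --> - a.
Proof. by move=> ua; exact: cvgN. Qed.
Lemma seq_cvgZ (u : nat -> R) a c : u @ \oo --> a -> (fun n => c * u n) @ \oo --> c * a.
Proof. by move=> ua; exact: cvgMl_tmp. Qed.

Definition ip f g := I2 (fun x => f x * g x).

Lemma ipC f g : ip f g = ip g f.
Proof. by apply: I2_eq => x; rewrite mulrC. Qed.
Lemma ipDl f g h : L2 f -> L2 g -> L2 h -> ip (fun x => f x + g x) h = ip f h + ip g h.
Proof.
move=> lf lg lh; rewrite /ip -I2D; [|exact: L2_mul|exact: L2_mul].
by apply: I2_eq => x; rewrite mulrDl.
Qed.
Lemma ipBl f g h : L2 f -> L2 g -> L2 h -> ip (fun x => f x - g x) h = ip f h - ip g h.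
Proof.
move=> lf lg lh; rewrite /ip -I2B; [|exact: L2_mul|exact: L2_mul].
by apply: I2_eq => x; rewrite mulrBl.
Qed.
Lemma ipZl c f h : L2 f -> L2 h -> ip (fun x => c * f x) h = c * ip f h.
Proof.
move=> lf lh; rewrite /ip -I2Z; [|exact: L2_mul].
by apply: I2_eq => x; rewrite mulrA.
Qed.
Lemma ipDr f g h : L2 f -> L2 g -> L2 h -> ip h (fun x => f x + g x) = ip h f + ip h g.
Proof. by move=> lf lg lh; rewrite ipC ipDl// ![ip _ h]ipC. Qed.
Lemma ipBr f g h : L2 f -> L2 g -> L2 h -> ip h (fun x => f x - g x) = ip h f - ip h g.
Proof. by move=> lf lg lh; rewrite ipC ipBl// ![ip _ h]ipC. Qed.
Lemma ipZr c f h : L2 f -> L2 h -> ip h (fun x => c * f x) = c * ip h f.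
Proof. by move=> lf lh; rewrite ipC ipZl// ![ip _ h]ipC. Qed.
Lemma ip_nrm f : ip f f = nrm f ^+ 2.
Proof. by rewrite nrm_sqr; apply: I2_eq => x; rewrite expr2. Qed.
Lemma ip_le f g : L2 f -> L2 g -> `|ip f g| <= nrm f * nrm g.
Proof. exact: cauchy_schwarz. Qed.
Lemma ip_ae f f' g : L2 f -> L2 f' -> L2 g -> {ae mu, forall x, f x = f' x} -> ip f g = ip f' g.
Proof.
move=> lf lf' lg ff; apply: I2_ae.
- exact: mfun2M lf.1 lg.1.
- exact: mfun2M lf'.1 lg.1.
by apply: (@filterS _ _ (ae_filter_ringOfSetsType mu) _ _ _ ff) => x ->.
Qed.
Lemma ip_cvg (f : nat -> plane -> R) g h : (forall n, L2 (f n)) -> L2 g -> L2 h ->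
  nrm (fun x => f n x - g x) @[n --> \oo] --> 0 -> ip (f n) h @[n --> \oo] --> ip g h.
Proof. exact: nrm_cvg_I2. Qed.

Lemma setI2M Omega f g : \int[mu]_(x in Omega) (f x * g x) = ip (f \_ Omega) g.
Proof.
rewrite setI2; apply: I2_eq => x; rewrite !patchE.
by case: ifP => _ //; rewrite mul0r.
Qed.

Lemma patch_id Omega f : (forall x, ~ Omega x -> f x = 0) -> f \_ Omega = f.
Proof.
move=> f0; apply/funext => x; rewrite patchE; case: ifPn => // /negP h.
by rewrite f0//; move=> Ox; apply: h; rewrite inE.
Qed.

Lemma patch_out Omega f x : ~ Omega x -> (f \_ Omega) x = 0.
Proof. by move=> nO; rewrite patchE memNset. Qed.
Lemma patch_in Omega f x : Omega x -> (f \_ Omega) x = f x.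
Proof. by move=> nO; rewrite patchE mem_set. Qed.

Lemma mfun2_patch Omega f : @measurable _ P Omega -> mfun2 f -> mfun2 (f \_ Omega).
Proof.
move=> mO mf; rewrite (_ : f \_ Omega = fun x => f x * \1_Omega x).
  exact: mfun2M mf (mfun2_indic mO).
by apply/funext => x; rewrite patchE indicE; case: ifP; rewrite ?mulr1 ?mulr0.
Qed.

Lemma L2_patch Omega f : @measurable _ P Omega -> L2 f -> L2 (f \_ Omega).
Proof.
move=> mO lf; apply: L2_dom (mfun2_patch mO lf.1) (L2_abs lf) _ => x.
by rewrite patchE; case: ifP => _; rewrite ?normr0.
Qed.

Lemma nrm_patch_le Omega f : @measurable _ P Omega -> L2 f -> nrm (f \_ Omega) <= nrm f.
Proof.
move=> mO lf; rewrite nrm_le ?nrm_ge0// nrm_sqr; apply: I2_le.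
- exact: (L2_patch mO lf).2.
- exact: lf.2.
by move=> x; rewrite patchE; case: ifP => _ //; rewrite expr0n sqr_ge0.
Qed.

Lemma patchB Omega f g : (forall x, ~ Omega x -> g x = 0) ->
  (fun x => f x - g x) \_ Omega = (fun x => (f \_ Omega) x - g x).
Proof.
move=> g0; apply/funext => x; rewrite !patchE; case: ifPn => // /negP h.
by rewrite g0 ?subr0//; move=> Ox; apply: h; rewrite inE.
Qed.

Lemma L2_L1_ball f (M : R) : 0 < M -> L2 f ->
  (forall x, ~ (ball (0 : plane) M : set plane) x -> f x = 0) -> L1 f.
Proof.
move=> M0 lf f0.
have l1 : L2 (\1_(ball (0 : plane) M : set plane)).
  split; first by apply: mfun2_indic; exact: measurable_plane_ball.
  apply: L1_eq (L1_indic (measurable_plane_ball 0 M) _).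
    by move=> x; rewrite indicE; case: (_ \in _); rewrite ?expr1n ?expr0n.
  by rewrite leb2_ball ?ltry// ltW.
apply: L1_eq (L2_mul lf l1) => x; rewrite indicE.
have [bx|nb] := pselect ((ball (0 : plane) M : set plane) x); first by rewrite mem_set// mulr1.
by rewrite f0// mul0r.
Qed.

(** The difference of two weak gradients annihilates every test function. Boundedness of [Omega]
    makes it integrable, as the fundamental lemma requires. *)
Lemma weak_gradient_unique Omega (M : R) f (g g' : (plane -> R) * (plane -> R)) : open Omega -> 0 < M ->
  Omega `<=` (ball (0 : plane) M : set plane) ->
  is_weak_gradient Omega f g -> is_weak_gradient Omega f g' ->
  {ae mu, forall x, (g.1 \_ Omega) x = (g'.1 \_ Omega) x} /\
  {ae mu, forall x, (g.2 \_ Omega) x = (g'.2 \_ Omega) x}.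
Proof.
move=> oO M0 OM [/Lp_on2P l1 /Lp_on2P l2 H] [/Lp_on2P l1' /Lp_on2P l2' H'].
have U (u v : plane -> R) : L2 (u \_ Omega) -> L2 (v \_ Omega) ->
    (forall phi, test_function Omega phi -> ip (u \_ Omega) phi = ip (v \_ Omega) phi) ->
    {ae mu, forall x, (u \_ Omega) x = (v \_ Omega) x}.
  move=> lu lv E.
  have := @fundamental_lemma _ Omega (fun x => (u \_ Omega) x - (v \_ Omega) x) oO.
  have z x : ~ Omega x -> (u \_ Omega) x - (v \_ Omega) x = 0.
    by move=> nO; rewrite !patch_out// subrr.
  have lb : L1 (fun x => (u \_ Omega) x - (v \_ Omega) x).
    by apply: (L2_L1_ball M0 (L2B lu lv)) => x nb; apply: z => /OM.
  move=> /(_ lb z) H0.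
  apply: (@filterS _ _ (ae_filter_ringOfSetsType mu) _ _ _ (H0 _)) => [x /eqP|phi T].
    by rewrite subr_eq0 => /eqP.
  by rewrite -/(ip _ _) ipBl//; [rewrite E// subrr|exact: T_L2 T].
split; apply: U => // phi T.
  have [E _] := H _ T; have [E' _] := H' _ T.
  by move: E; rewrite E' !setI2M => /oppr_inj.
have [_ E] := H _ T; have [_ E'] := H' _ T.
by move: E; rewrite E' !setI2M => /oppr_inj.
Qed.

(* The Dirichlet problem in terms of globally defined functions that vanish
   outside the domain, with the gradient as part of the data. *)
Definition dirichlet_data Omega w psi g1 g2 :=
  [/\ [/\ L2 psi, L2 g1 & L2 g2],
      [/\ forall x, ~ Omega x -> psi x = 0, forall x, ~ Omega x -> g1 x = 0 &
          forall x, ~ Omega x -> g2 x = 0],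
      exists phi : nat -> plane -> R, (forall n, test_function Omega (phi n)) /\
        [/\ nrm (fun x => phi n x - psi x) @[n --> \oo] --> 0,
            nrm (fun x => partial1 (phi n) x - g1 x) @[n --> \oo] --> 0 &
            nrm (fun x => partial2 (phi n) x - g2 x) @[n --> \oo] --> 0] &
      forall chi, test_function Omega chi ->
        ip g1 (partial1 chi) + ip g2 (partial2 chi) = - ip w chi].

Let cvg0_of_le (u : nat -> R) : (forall n, 0 <= u n) -> (forall n, u n <= n.+1%:R^-1) ->
  u @ \oo --> 0.
Proof.
move=> u0 u1; apply: (@squeeze_cvgr _ _ _ _ (cst 0) (fun n => n.+1%:R^-1)).
- by apply: nearW => n; rewrite u0 u1.
- exact: cvg_cst.
by have := @cvg_harmonic R.
Qed.

Lemma dirichlet_solution_data Omega w psi : dirichlet_solution Omega w psi ->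
  dirichlet_data Omega (w \_ Omega) (psi \_ Omega)
    ((weak_gradient Omega psi).1 \_ Omega) ((weak_gradient Omega psi).2 \_ Omega).
Proof.
set g := weak_gradient Omega psi; move=> [[/Lp_on2P lp [/Lp_on2P l1 /Lp_on2P l2 wg] ap] eq].
split => //.
- by split=> x nO; rewrite patch_out.
- have n0 n : 0 < n.+1%:R^-1 :> R by rewrite invr_gt0.
  have [phi Hphi] := choice (fun n => ap _ (n0 n)).
  exists phi; split; first by move=> n; have [] := Hphi n.
  have Z1 n := T_out (T_partial1 (Hphi n).1); have Z2 n := T_out (T_partial2 (Hphi n).1).
  have Z n := T_out (Hphi n).1.
  have aux (f h : plane -> R) (e : R) : (forall x, ~ Omega x -> h x = 0) -> L2 (f \_ Omega) -> L2 h ->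
      (Lp_norm_on 2%:E Omega (fun x => (f x - h x)%R) < e%:E)%E ->
      nrm (fun x => h x - (f \_ Omega) x) <= e.
    move=> h0 lf lh; rewrite Lp_norm_on2; last by rewrite patchB//; exact: L2B.
    by rewrite lte_fin patchB// nrmBC => /ltW.
  split; apply: cvg0_of_le => n; try exact: nrm_ge0; have [T [h1 h2 h3]] := Hphi n.
  + by apply: aux h1 => //; [move=> x; exact: Z|exact: T_L2 T].
  + by apply: aux h2 => //; [move=> x; exact: Z1|exact: T_L2 (T_partial1 T)].
  + by apply: aux h3 => //; [move=> x; exact: Z2|exact: T_L2 (T_partial2 T)].
move=> chi T; rewrite -[ip (w \_ _) chi]setI2M -(eq chi T) /ip -I2D.
- rewrite setI2; apply: I2_eq => x; rewrite !patchE.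
  by case: ifP => _ //; rewrite !mul0r addr0.
- by apply: L2_mul => //; exact: T_L2 (T_partial1 T).
- by apply: L2_mul => //; exact: T_L2 (T_partial2 T).
Qed.

(* [d1, d2] is the difference of the gradients of two solutions; the pairing of
   the gradient equation with it is obtained by density of the test functions. *)
Lemma dirichlet_data_pair Omega w w' psi g1 g2 psi' g1' g2' chi c1 c2 : L2 w -> L2 w' ->
  dirichlet_data Omega w psi g1 g2 -> dirichlet_data Omega w' psi' g1' g2' ->
  [/\ L2 chi, L2 c1 & L2 c2] ->
  (exists phi : nat -> plane -> R, (forall n, test_function Omega (phi n)) /\
        [/\ nrm (fun x => phi n x - chi x) @[n --> \oo] --> 0,
            nrm (fun x => partial1 (phi n) x - c1 x) @[n --> \oo] --> 0 &
            nrm (fun x => partial2 (phi n) x - c2 x) @[n --> \oo] --> 0]) ->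
  ip (fun x => g1' x - g1 x) c1 + ip (fun x => g2' x - g2 x) c2 =
    - ip (fun x => w' x - w x) chi.
Proof.
move=> lw lw' [[lp l1 l2] _ _ E] [[lp' l1' l2'] _ _ E'] [lc lc1 lc2] [phi [T [a a1 a2]]].
have ld1 := L2B l1' l1; have ld2 := L2B l2' l2; have lwd := L2B lw' lw.
have lphi n := T_L2 (T n); have lp1 n := T_L2 (T_partial1 (T n)).
have lp2 n := T_L2 (T_partial2 (T n)).
have e n : ip (partial1 (phi n)) (fun x => g1' x - g1 x) +
    ip (partial2 (phi n)) (fun x => g2' x - g2 x) = - ip (phi n) (fun x => w' x - w x).
  rewrite ipC [ip (partial2 _) _]ipC [ip (phi n) _]ipC !ipBl//.
  have := E _ (T n); have := E' _ (T n).
  move: (ip _ _) (ip _ _) (ip _ _) (ip _ _) (ip _ _) (ip _ _) => *; lra.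
have c1' := ip_cvg lp1 lc1 ld1 a1; have c2' := ip_cvg lp2 lc2 ld2 a2.
have c' := ip_cvg lphi lc lwd a.
rewrite ipC [ip _ c2]ipC [ip _ chi]ipC.
have h1 := seq_cvgD c1' c2'; have h2 := seq_cvgN c'.
apply: (cvg_unique (@Rhausdorff R) h1); move: h2.
by under eq_fun do rewrite -e.
Qed.

Lemma dirichlet_data_diff_approx Omega w w' psi g1 g2 psi' g1' g2' :
  dirichlet_data Omega w psi g1 g2 -> dirichlet_data Omega w' psi' g1' g2' ->
  exists phi : nat -> plane -> R, (forall n, test_function Omega (phi n)) /\
        [/\ nrm (fun x => phi n x - (psi' x - psi x)) @[n --> \oo] --> 0,
            nrm (fun x => partial1 (phi n) x - (g1' x - g1 x)) @[n --> \oo] --> 0 &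
            nrm (fun x => partial2 (phi n) x - (g2' x - g2 x)) @[n --> \oo] --> 0].
Proof.
move=> [[lp l1 l2] _ [phi [T [a a1 a2]]] _] [[lp' l1' l2'] _ [phi' [T' [a' a1' a2']]] _].
have Tm n : test_function Omega (fun x => -1 * phi n x) by exact: T_scale.
exists (fun n x => phi' n x + -1 * phi n x); split; first by move=> n; exact: T_add.
have aux (f f' : nat -> plane -> R) (g g' : plane -> R) : (forall n, L2 (f n)) ->
    (forall n, L2 (f' n)) -> L2 g -> L2 g' ->
    nrm (fun x => f n x - g x) @[n --> \oo] --> 0 ->
    nrm (fun x => f' n x - g' x) @[n --> \oo] --> 0 ->
    nrm (fun x => (f' n x + -1 * f n x) - (g' x - g x)) @[n --> \oo] --> 0.
  move=> lf lf' lg lg' c c'.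
  apply: (@squeeze_cvgr _ _ _ _ (cst 0) (fun n => nrm (fun x => f' n x - g' x) +
      nrm (fun x => f n x - g x))); last 2 first.
  - exact: cvg_cst.
  - by rewrite -[X in _ --> X]addr0; exact: seq_cvgD.
  apply: nearW => n; rewrite nrm_ge0/= [in leRHS](nrmBC (f n)).
  rewrite (@nrm_eq _ _ (fun x => (f' n x - g' x) + (g x - f n x))).
    by apply: nrm_triangle; exact: L2B.
  by move=> x; ring.
have lphi n := T_L2 (T n); have lp1 n := T_L2 (T_partial1 (T n)).
have lp2 n := T_L2 (T_partial2 (T n)).
have lphi' n := T_L2 (T' n); have lp1' n := T_L2 (T_partial1 (T' n)).
have lp2' n := T_L2 (T_partial2 (T' n)).
split; first exact: aux.
  have := aux _ _ _ _ lp1 lp1' l1 l1' a1 a1'.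
  rewrite (_ : (fun n => nrm _) = (fun n => nrm (fun x =>
    partial1 (fun x => phi' n x + -1 * phi n x) x - (g1' x - g1 x))))//.
  apply/funext => n; apply: nrm_eq => x.
  by rewrite partial1D ?partial1Z//; [exact: T_smooth (T n)|exact: T_smooth (T' n)|exact: T_smooth (Tm n)].
have := aux _ _ _ _ lp2 lp2' l2 l2' a2 a2'.
rewrite (_ : (fun n => nrm _) = (fun n => nrm (fun x =>
    partial2 (fun x => phi' n x + -1 * phi n x) x - (g2' x - g2 x))))//.
apply/funext => n; apply: nrm_eq => x.
by rewrite partial2D ?partial2Z//; [exact: T_smooth (T n)|exact: T_smooth (T' n)|exact: T_smooth (Tm n)].
Qed.

(** Expanding the squares leaves the cross term of [g' - g] with [g], which is evaluated by the
    difference of the two weak equations tested with [psi]. *)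
Lemma dirichlet_energy_diff Omega w w' psi g1 g2 psi' g1' g2' : L2 w -> L2 w' ->
  dirichlet_data Omega w psi g1 g2 -> dirichlet_data Omega w' psi' g1' g2' ->
  2^-1 * (ip g1' g1' + ip g2' g2') - 2^-1 * (ip g1 g1 + ip g2 g2) =
  - ip (fun x => w' x - w x) psi + 2^-1 * (nrm (fun x => g1' x - g1 x) ^+ 2 +
     nrm (fun x => g2' x - g2 x) ^+ 2).
Proof.
move=> lw lw' D D'.
have [[lp l1 l2] _ ap _] := D; have [[lp' l1' l2'] _ _ _] := D'.
have <- := dirichlet_data_pair lw lw' D D' (And3 lp l1 l2) ap.
have ld1 := L2B l1' l1; have ld2 := L2B l2' l2.
rewrite -!ip_nrm !ipBl// !ipBr// [ip g1' g1]ipC [ip g2' g2]ipC.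
by move: (ip _ _) (ip _ _) (ip _ _) (ip _ _) (ip _ _) (ip _ _) => *; lra.
Qed.

Let sum_sqr_le (a b c : R) : 0 <= a -> 0 <= b -> 0 <= c ->
  a ^+ 2 + b ^+ 2 <= c * (a + b) -> a ^+ 2 + b ^+ 2 <= 2 * c ^+ 2.
Proof.
move=> a0 b0 c0 le.
have h : (a + b) ^+ 2 <= 2 * c * (a + b).
  have E : 2 * (a ^+ 2 + b ^+ 2) = (a + b) ^+ 2 + (a - b) ^+ 2 by ring.
  by have := sqr_ge0 (a - b); lra.
have h2 : a + b <= 2 * c.
  have [/eqP ab0|ab0] := boolP (a + b == 0); first by rewrite ab0 mulr_ge0.
  have ab : 0 < a + b by rewrite lt_neqAle eq_sym ab0 addr_ge0.
  by move: h; rewrite expr2 ler_pM2r.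
apply: (le_trans le); have -> : 2 * c ^+ 2 = c * (2 * c) by ring.
exact: ler_wpM2l.
Qed.

(** The hypothesis bounds [w' - w] as a functional for the gradient norm, that is, in H^-1. Testing
    the difference of the equations with the difference of the solutions turns it into a bound on
    the gradients. *)
Lemma dirichlet_diff_le Omega w w' psi g1 g2 psi' g1' g2' (c : R) : L2 w -> L2 w' -> 0 <= c ->
  dirichlet_data Omega w psi g1 g2 -> dirichlet_data Omega w' psi' g1' g2' ->
  (forall chi, test_function Omega chi ->
     `|ip (fun x => w' x - w x) chi| <= c * (nrm (partial1 chi) + nrm (partial2 chi))) ->
  nrm (fun x => g1' x - g1 x) ^+ 2 + nrm (fun x => g2' x - g2 x) ^+ 2 <= 2 * c ^+ 2.
Proof.
move=> lw lw' c0 D D' H.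
have [[lp l1 l2] _ _ _] := D; have [[lp' l1' l2'] _ _ _] := D'.
have ld := L2B lp' lp; have ld1 := L2B l1' l1; have ld2 := L2B l2' l2.
have [phi [T [a a1 a2]]] := dirichlet_data_diff_approx D D'.
have E := dirichlet_data_pair lw lw' D D' (And3 ld ld1 ld2)
  (ex_intro _ phi (conj T (And3 a a1 a2))).
have lphi n := T_L2 (T n); have lp1 n := T_L2 (T_partial1 (T n)).
have lp2 n := T_L2 (T_partial2 (T n)).
have lwd := L2B lw' lw.
have le : - ip (fun x => w' x - w x) (fun x => psi' x - psi x) <=
    c * (nrm (fun x => g1' x - g1 x) + nrm (fun x => g2' x - g2 x)).
  rewrite ipC.
  have h1 := seq_cvgN (ip_cvg lphi ld lwd a).
  have h2 := @seq_cvgZ _ _ c (seq_cvgD (nrm_cvg_sqr lp1 ld1 a1) (nrm_cvg_sqr lp2 ld2 a2)).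
  apply: (ler_cvg_to h1 h2); apply: nearW => n /=.
  rewrite ipC; apply: le_trans (H _ (T n)); rewrite -normrN; exact: ler_norm.
move: le; rewrite -E !ip_nrm.
by apply: sum_sqr_le => //; exact: nrm_ge0.
Qed.

(** With [w' = w] the preceding estimate holds with constant 0, so both correction terms in the
    energy difference vanish. *)
Lemma dirichlet_data_unique Omega w psi g1 g2 psi' g1' g2' : L2 w ->
  dirichlet_data Omega w psi g1 g2 -> dirichlet_data Omega w psi' g1' g2' ->
  ip g1' g1' + ip g2' g2' = ip g1 g1 + ip g2 g2.
Proof.
move=> lw D D'.
have z f : ip (fun x => w x - w x) f = 0.
  rewrite -[RHS](@I2_0 R); apply: I2_eq => x; by rewrite subrr mul0r.
have := @dirichlet_diff_le _ _ _ _ _ _ _ _ _ 0 lw lw (lexx 0) D D'.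
move=> /(_ _)H; have {}H := H (fun chi _ => ltac:(by rewrite z normr0 mul0r)).
have := dirichlet_energy_diff lw lw D D'; rewrite z.
move: H; rewrite expr0n/= mulr0.
have := sqr_ge0 (nrm (fun x => g1' x - g1 x)); have := sqr_ge0 (nrm (fun x => g2' x - g2 x)).
by move: (_ ^+ 2) (_ ^+ 2) (ip _ _) (ip _ _) (ip _ _) (ip _ _) => *; lra.
Qed.

(** The gradient selected by [weak_gradient] is a choice; uniqueness identifies it with [(g1, g2)]
    almost everywhere, which is all that the norms and integrals see. *)
Lemma dirichlet_data_solution Omega (M : R) w psi g1 g2 : open Omega -> 0 < M ->
  Omega `<=` (ball (0 : plane) M : set plane) ->
  dirichlet_data Omega (w \_ Omega) psi g1 g2 -> dirichlet_solution Omega w psi.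
Proof.
move=> oO M0 OM [[lp l1 l2] [z z1 z2] [phi [T [a a1 a2]]] E].
have lphi n := T_L2 (T n); have lp1 n := T_L2 (T_partial1 (T n)).
have lp2 n := T_L2 (T_partial2 (T n)).
have wg : is_weak_gradient Omega psi (g1, g2).
  split; try by apply/Lp_on2P; rewrite patch_id.
  move=> chi Tc; have sc := T_smooth Tc.
  have lc := T_L2 Tc; have lc1 := T_L2 (T_partial1 Tc); have lc2 := T_L2 (T_partial2 Tc).
  rewrite !setI2M !patch_id//; split.
    have h1 := ip_cvg lphi lp lc1 a; have h2 := seq_cvgN (ip_cvg lp1 l1 lc a1).
    apply: (cvg_unique (@Rhausdorff R) h1); move: h2.
    rewrite (_ : (fun n => - _) = (fun n => ip (phi n) (partial1 chi)))//.
    by apply/funext => n; rewrite /ip (ibp1 (T_smooth (T n)) Tc).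
  have h1 := ip_cvg lphi lp lc2 a; have h2 := seq_cvgN (ip_cvg lp2 l2 lc a2).
  apply: (cvg_unique (@Rhausdorff R) h1); move: h2.
  rewrite (_ : (fun n => - _) = (fun n => ip (phi n) (partial2 chi)))//.
  by apply/funext => n; rewrite /ip (ibp2 (T_smooth (T n)) Tc).
have wg' : is_weak_gradient Omega psi (weak_gradient Omega psi).
  by apply: (@getPex _ [set g | is_weak_gradient Omega psi g]); exists (g1, g2).
have [u1 u2] := weak_gradient_unique oO M0 OM wg wg'.
move: u1 u2; rewrite /= (patch_id z1) (patch_id z2) => u1 u2.
have [/Lp_on2P l1' /Lp_on2P l2' _] := wg'.
rewrite /dirichlet_solution /H10; set g := weak_gradient Omega psi in wg' l1' l2' u1 u2 *.
split.
  split => //; first by apply/Lp_on2P; rewrite patch_id.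
  move=> e e0.
  have /cvgrPdist_lt/(_ _ e0)[N1 _ H1] := a.
  have /cvgrPdist_lt/(_ _ e0)[N2 _ H2] := a1.
  have /cvgrPdist_lt/(_ _ e0)[N3 _ H3] := a2.
  pose n := (N1 + N2 + N3)%N; exists (phi n); split => //.
  have {}H1 := H1 n (leq_trans (leq_addr _ _) (leq_addr _ _)).
  have {}H2 := H2 n (leq_trans (leq_addl _ _) (leq_addr _ _)).
  have {}H3 := H3 n (leq_addl _ _).
  move: H1 H2 H3; rewrite /= !sub0r !normrN !ger0_norm ?nrm_ge0// => H1 H2 H3.
  have aux (f f' h : plane -> R) : (forall x, ~ Omega x -> h x = 0) -> L2 (f \_ Omega) -> L2 h ->
      L2 f' -> {ae mu, forall x, f' x = (f \_ Omega) x} ->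
      nrm (fun x => h x - f' x) < e ->
      (Lp_norm_on 2%:E Omega (fun x => (f x - h x)%R) < e%:E)%E.
    move=> h0 lf lh lf' ff H; rewrite Lp_norm_on2; last by rewrite patchB//; exact: L2B.
    rewrite lte_fin patchB//; apply: le_lt_trans H.
    rewrite nrmBC (@nrm_ae _ _ (fun x => h x - f' x))//.
    - exact: mfun2B lh.1 lf.1.
    - exact: mfun2B lh.1 lf'.1.
    by apply: (@filterS _ _ (ae_filter_ringOfSetsType mu) _ _ _ ff) => x ->.
  split.
  - apply: (aux _ psi) H1 => //; [by move=> x; exact: T_out (T n)|by rewrite patch_id|].
    by rewrite patch_id//; exact: aeW.
  - by apply: (aux _ g1) H2 => // x; exact: T_out (T_partial1 (T n)).
  - by apply: (aux _ g2) H3 => // x; exact: T_out (T_partial2 (T n)).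
move=> chi Tc; rewrite [in RHS]setI2M -E//.
have lc1 := T_L2 (T_partial1 Tc); have lc2 := T_L2 (T_partial2 Tc).
rewrite (ip_ae l1 l1' lc1 u1) (ip_ae l2 l2' lc2 u2) /ip -I2D; [|exact: L2_mul|exact: L2_mul].
rewrite setI2; apply: I2_eq => x; rewrite !patchE.
by case: ifP => _ //; rewrite !mul0r addr0.
Qed.

(** [kinetic_energy] goes through two choices, of a solution and of its gradient. The energy is the
    same for all Dirichlet data of [w], so it can be computed from any of them. *)
Lemma kinetic_energyE Omega (M : R) w psi g1 g2 : open Omega -> 0 < M ->
  Omega `<=` (ball (0 : plane) M : set plane) -> L2 (w \_ Omega) ->
  dirichlet_data Omega (w \_ Omega) psi g1 g2 ->
  kinetic_energy Omega w = 2^-1 * (ip g1 g1 + ip g2 g2).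
Proof.
move=> oO M0 OM lw D; have S := dirichlet_data_solution oO M0 OM D.
have S' : dirichlet_solution Omega w (inv_laplacian Omega w).
  by apply: (@getPex _ [set psi | dirichlet_solution Omega w psi]); exists psi.
have D' := dirichlet_solution_data S'.
rewrite /kinetic_energy -(dirichlet_data_unique lw D D'); congr (_ * _).
have [[_ l1 l2] _ _ _] := D'.
rewrite /ip -I2D; [|exact: L2_mul|exact: L2_mul].
rewrite setI2; apply: I2_eq => x; have [Ox|nO] := pselect (Omega x).
  by rewrite !patch_in// -!expr2.
by rewrite !patch_out// mulr0 addr0.
Qed.

End Dirichlet.

(** * Existence for the Dirichlet problem *)

Section DirichletExistence.
Context {R : realType}.
Local Notation plane := (R * R)%type.
Local Notation P := (mplane R).
Local Notation mu := (@leb2 R).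
Implicit Types (f g h w phi chi psi : plane -> R) (Omega : set plane).

Definition dot phi chi := ip (partial1 phi) (partial1 chi) + ip (partial2 phi) (partial2 chi).
(** The functional whose Euler-Lagrange equation is the weak form of [Laplacian psi = w]. *)
Definition dirichlet_functional w phi := 2^-1 * dot phi phi + ip w phi.

Lemma ip_expand f g (t : R) : L2 f -> L2 g ->
  ip (fun x => f x + t * g x) (fun x => f x + t * g x) = ip f f + 2 * t * ip f g + t ^+ 2 * ip g g.
Proof.
move=> lf lg; have lt := L2Z t lg; have ls := L2D lf lt.
rewrite ipDl// !ipDr// !ipZl// !ipZr// [ip g f]ipC.
by move: (ip _ _) (ip _ _) (ip _ _) => *; ring.
Qed.

Lemma partial1_lin Omega phi chi (t : R) : test_function Omega phi -> test_function Omega chi ->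
  partial1 (fun x => phi x + t * chi x) = (fun x => partial1 phi x + t * partial1 chi x).
Proof.
move=> T T'; apply/funext => x; rewrite partial1D; first by rewrite partial1Z//; exact: T_smooth T'.
  exact: T_smooth T.
exact: T_smooth (T_scale t T').
Qed.
Lemma partial2_lin Omega phi chi (t : R) : test_function Omega phi -> test_function Omega chi ->
  partial2 (fun x => phi x + t * chi x) = (fun x => partial2 phi x + t * partial2 chi x).
Proof.
move=> T T'; apply/funext => x; rewrite partial2D; first by rewrite partial2Z//; exact: T_smooth T'.
  exact: T_smooth T.
exact: T_smooth (T_scale t T').
Qed.

Lemma dirichlet_functional_expand Omega w phi chi (t : R) : L2 w -> test_function Omega phi ->
  test_function Omega chi -> dirichlet_functional w (fun x => phi x + t * chi x) =
   dirichlet_functional w phi + t * (dot phi chi + ip w chi) + t ^+ 2 / 2 * dot chi chi.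
Proof.
have id (p1 x1 c1 p2 x2 c2 u v : R) :
    2^-1 * (p1 + 2 * t * x1 + t ^+ 2 * c1 + (p2 + 2 * t * x2 + t ^+ 2 * c2)) + (u + t * v) =
    2^-1 * (p1 + p2) + u + t * (x1 + x2 + v) + t ^+ 2 / 2 * (c1 + c2) by field.
move=> lw T T'; rewrite /dirichlet_functional /dot (partial1_lin t T T') (partial2_lin t T T').
have l := T_L2 T; have l' := T_L2 T'; have lt := L2Z t l'.
have l1 := T_L2 (T_partial1 T); have l2 := T_L2 (T_partial2 T).
have l1' := T_L2 (T_partial1 T'); have l2' := T_L2 (T_partial2 T').
rewrite (ip_expand t l1 l1') (ip_expand t l2 l2') (ipDr l lt lw) (ipZr t l' lw).
exact: id.
Qed.

Lemma dot_ge0 phi : 0 <= dot phi phi.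
Proof. by rewrite /dot !ip_nrm addr_ge0// sqr_ge0. Qed.

Lemma poincare_nrm Omega (M : R) phi : 0 < M -> Omega `<=` (ball (0 : plane) M : set plane) ->
  test_function Omega phi -> nrm phi <= 2 * M * nrm (partial1 phi).
Proof.
move=> M0 OM T; rewrite nrm_le; last by rewrite !mulr_ge0 ?nrm_ge0// ltW.
rewrite exprMn nrm_sqr (_ : (2 * M) ^+ 2 = 4 * M ^+ 2); last by ring.
apply: (poincare M0 _ T) => x /OM/plane_ballP[+ _].
by rewrite /= sub0r normrN => /ltW.
Qed.

(** By Poincare the linear term is at most [2 M |w| |partial1 phi|] in absolute value; completing
    the square against the quadratic term gives the constant. *)
Lemma dirichlet_functional_bound Omega (M : R) w phi : 0 < M ->
  Omega `<=` (ball (0 : plane) M : set plane) -> L2 w -> test_function Omega phi ->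
  - (2 * M * nrm w) ^+ 2 / 2 <= dirichlet_functional w phi.
Proof.
move=> M0 OM lw T; have l := T_L2 T.
have h1 := ip_le lw l; have h2 := poincare_nrm M0 OM T.
have h3 : nrm w * nrm phi <= nrm w * (2 * M * nrm (partial1 phi)) by rewrite ler_wpM2l// nrm_ge0.
have h4 : - (nrm w * (2 * M * nrm (partial1 phi))) <= ip w phi.
  by rewrite lerNl; apply: le_trans h3; apply: le_trans h1; rewrite -normrN ler_norm.
have h5 : nrm (partial1 phi) ^+ 2 <= dot phi phi by rewrite /dot !ip_nrm lerDl sqr_ge0.
rewrite /dirichlet_functional; have h6 := sqr_ge0 (nrm (partial1 phi) - 2 * M * nrm w).
move: h4 h5 h6; clear; move: (nrm (partial1 phi)) (nrm w) (ip _ _) (dot _ _) => a b c d h4 h5 h6.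
lra.
Qed.

(** A nonzero [B] would make the expression negative for small [t] of the opposite sign;
    [- B / (Q + 1)] is small enough. *)
Let linear_quad_eq0 (B Q : R) : 0 <= Q -> (forall t, 0 <= t * B + t ^+ 2 * Q) -> B = 0.
Proof.
move=> Q0 H; have := H (- (Q + 1)^-1 * B).
have q1 : Q + 1 != 0 by rewrite gt_eqF// ltr_wpDl.
have -> : - (Q + 1)^-1 * B * B + (- (Q + 1)^-1 * B) ^+ 2 * Q = - ((B / (Q + 1)) ^+ 2) by field.
rewrite oppr_ge0 => h; apply/eqP.
have /eqP : (B / (Q + 1)) ^+ 2 = 0 by apply/eqP; rewrite eq_le h sqr_ge0.
by rewrite sqrf_eq0 mulf_eq0 invr_eq0 (negbTE q1) orbF.
Qed.

Lemma nrm_patch_cvg Omega (f : nat -> plane -> R) g : @measurable _ P Omega ->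
  (forall n, L2 (f n)) -> L2 g -> (forall n x, ~ Omega x -> f n x = 0) ->
  nrm (fun x => f n x - g x) @[n --> \oo] --> 0 ->
  nrm (fun x => f n x - (g \_ Omega) x) @[n --> \oo] --> 0.
Proof.
move=> mO lf lg f0 c.
apply: (@squeeze_cvgr _ _ _ _ (cst 0) (fun n => nrm (fun x => f n x - g x))) => //; last exact: cvg_cst.
apply: nearW => n; rewrite nrm_ge0/= nrmBC [leRHS]nrmBC -patchB; last exact: f0.
by apply: nrm_patch_le => //; exact: L2B.
Qed.

Lemma inv_lt_ex (e : R) : 0 < e -> exists N : nat, forall n, (N <= n)%N -> n.+1%:R^-1 < e.
Proof.
move=> e0; have [N _ H] := near_infty_natSinv_lt (PosNum e0).
by exists N => n /H.
Qed.

(* Minimising sequences for the Dirichlet functional are Cauchy, by the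
   parallelogram law and the Poincare inequality. *)
Lemma dirichlet_exists Omega (M : R) w : open Omega -> 0 < M ->
  Omega `<=` (ball (0 : plane) M : set plane) -> L2 w ->
  exists psi g1 g2, dirichlet_data Omega w psi g1 g2.
Proof.
move=> oO M0 OM lw; have mO := open_measurable2 oO.
pose J := dirichlet_functional w.
pose E : set R := [set J phi | phi in [set phi | test_function Omega phi]].
have lE : has_lbound E.
  by exists (- (2 * M * nrm w) ^+ 2 / 2) => _ [phi T <-]; exact: dirichlet_functional_bound T.
have iE : has_inf E by split => //; exists (J (cst 0)); exists (cst 0) => //; exact: T_zero.
pose m := inf E.
have mJ phi : test_function Omega phi -> m <= J phi by move=> T; apply: (ge_inf lE); exists phi.
have n0 n : 0 < n.+1%:R^-1 :> R by rewrite invr_gt0.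
have [phi Hphi] : exists phi : nat -> plane -> R, forall n,
    test_function Omega (phi n) /\ J (phi n) < m + n.+1%:R^-1.
  have H n : exists p, test_function Omega p /\ J p < m + n.+1%:R^-1.
    by have [_ [p Tp <-] lt] := inf_adherent (n0 n) iE; exists p.
  by have [f Hf] := choice H; exists f.
have T n : test_function Omega (phi n) by have [] := Hphi n.
pose d i j x := phi i x + -1 * phi j x.
have Td i j : test_function Omega (d i j) by apply: T_add => //; exact: T_scale.
(* The expansions at [t = 1] and at [t = 1/2], where the value at the midpoint is at least [m], give
   the parallelogram estimate. *)
have Q i j : dot (d i j) (d i j) <= 4 * (i.+1%:R^-1 + j.+1%:R^-1).
  have E1 : J (phi i) = J (fun x => phi j x + 1 * d i j x).
    by congr J; apply/funext => x; rewrite /d; ring.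
  have E2 := mJ _ (T_add (T j) (T_scale 2^-1 (Td i j))).
  have [_ Hi] := Hphi i; have [_ Hj] := Hphi j.
  move: E1 E2 Hi Hj; rewrite /J !(dirichlet_functional_expand _ lw (T j) (Td i j)).
  move: (dot (d i j) (d i j)) (dot (phi j) (d i j) + ip w (d i j)) => q b.
  move: (dirichlet_functional w (phi i)) (dirichlet_functional w (phi j)) (i.+1%:R^-1) (j.+1%:R^-1) => ji jj u v.
  by rewrite !mul1r expr1n exprVn => E1 h1 h2 h3; lra.
have Cau (D : nat -> plane -> R) (c : R) : 0 <= c ->
    (forall i j, nrm (fun x => D i x - D j x) ^+ 2 <= c * dot (d i j) (d i j)) ->
    forall e : R, 0 < e -> exists N, forall i j, (N <= i)%N -> (N <= j)%N ->
     nrm (fun x => D i x - D j x) <= e.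
  move=> c0 H e e0; have [N HN] := inv_lt_ex (e := e ^+ 2 / (8 * (c + 1))) ltac:(rewrite divr_gt0 ?exprn_gt0// mulr_gt0// ltr_wpDl//).
  exists N => i j Ni Nj.
  have h : nrm (fun x => D i x - D j x) ^+ 2 <= e ^+ 2.
    apply: le_trans (H i j) _.
    apply: (@le_trans _ _ (c * (4 * (i.+1%:R^-1 + j.+1%:R^-1)))); first exact: ler_wpM2l.
    have := HN _ Ni; have := HN _ Nj; rewrite !ltr_pdivlMr ?mulr_gt0 ?ltr_wpDl// => h1 h2.
    have := n0 i; have := n0 j; move: h1 h2; move: (i.+1%:R^-1) (j.+1%:R^-1) => u v h1 h2 v0 u0.
    have -> : c * (4 * (u + v)) = (v * (8 * (c + 1)) + u * (8 * (c + 1))) / 2 - 4 * (u + v) by field.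
    lra.
  by rewrite -(ler_pXn2r (n := 2))// nnegrE ?nrm_ge0// ltW.
have lphi n := T_L2 (T n); have lp1 n := T_L2 (T_partial1 (T n)).
have lp2 n := T_L2 (T_partial2 (T n)).
have D1 i j : nrm (fun x => partial1 (phi i) x - partial1 (phi j) x) = nrm (partial1 (d i j)).
  by rewrite (partial1_lin _ (T i) (T j)); apply: nrm_eq => x; rewrite mulN1r.
have D2 i j : nrm (fun x => partial2 (phi i) x - partial2 (phi j) x) = nrm (partial2 (d i j)).
  by rewrite (partial2_lin _ (T i) (T j)); apply: nrm_eq => x; rewrite mulN1r.
have D0 i j : nrm (fun x => phi i x - phi j x) = nrm (d i j).
  by apply: nrm_eq => x; rewrite /d mulN1r.
have N1 i j : nrm (partial1 (d i j)) ^+ 2 <= dot (d i j) (d i j).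
  by rewrite /dot !ip_nrm lerDl sqr_ge0.
have N0 i j : nrm (d i j) ^+ 2 <= (2 * M) ^+ 2 * dot (d i j) (d i j).
  apply: le_trans (ler_wpM2l (sqr_ge0 _) (N1 i j)); rewrite -exprMn.
  rewrite ler_pXn2r// ?nnegrE ?nrm_ge0//; last by rewrite mulr_ge0 ?nrm_ge0// mulr_ge0// ltW.
  exact: (poincare_nrm M0 OM (Td i j)).
have C1 := Cau (fun n => partial1 (phi n)) 1 ler01 (fun i j => ltac:(rewrite D1 mul1r; exact: N1)).
have C2 := Cau (fun n => partial2 (phi n)) 1 ler01
  (fun i j => ltac:(rewrite D2 mul1r /dot !ip_nrm lerDr; exact: sqr_ge0)).
have C0 := Cau phi ((2 * M) ^+ 2) (sqr_ge0 _).
have {}C0 := C0 (fun i j => ltac:(rewrite D0; exact: N0)).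
have [psi [lpsi a]] := L2_complete lphi C0.
have [g1 [l1 a1]] := L2_complete lp1 C1; have [g2 [l2 a2]] := L2_complete lp2 C2.
have a' := nrm_patch_cvg mO lphi lpsi (fun n x => T_out (T n)) a.
have a1' := nrm_patch_cvg mO lp1 l1 (fun n x => T_out (T_partial1 (T n))) a1.
have a2' := nrm_patch_cvg mO lp2 l2 (fun n x => T_out (T_partial2 (T n))) a2.
have lpsi' := L2_patch mO lpsi; have l1' := L2_patch mO l1; have l2' := L2_patch mO l2.
exists (psi \_ Omega), (g1 \_ Omega), (g2 \_ Omega); split => //.
- by split=> x; exact: patch_out.
- by exists phi.
move=> chi Tc; have lc1 := T_L2 (T_partial1 Tc); have lc2 := T_L2 (T_partial2 Tc).
suff : ip (g1 \_ Omega) (partial1 chi) + ip (g2 \_ Omega) (partial2 chi) + ip w chi = 0.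
  by move=> /eqP; rewrite addr_eq0 => /eqP.
apply: (@linear_quad_eq0 _ (2^-1 * dot chi chi)); first by rewrite mulr_ge0// dot_ge0.
move=> t.
(* Since [m <= J (phi n + t chi)] and [J (phi n) < m + 1/(n+1)], a quadratic in [t] is nonnegative
   up to [1/(n+1)]; in the limit its linear coefficient is the weak equation. *)
have cB : (fun n => n.+1%:R^-1 + (t * (dot (phi n) chi + ip w chi) + t ^+ 2 * (2^-1 * dot chi chi)))
    @ \oo --> 0 + (t * (ip (g1 \_ Omega) (partial1 chi) + ip (g2 \_ Omega) (partial2 chi) + ip w chi)
      + t ^+ 2 * (2^-1 * dot chi chi)).
  apply: seq_cvgD; first by have := @cvg_harmonic R.
  apply: seq_cvgD; last exact: cvg_cst.
  apply: seq_cvgZ; apply: seq_cvgD; last exact: cvg_cst.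
  by apply: seq_cvgD; exact: ip_cvg.
rewrite -[leRHS]add0r -(cvg_lim (@Rhausdorff R) cB).
apply: limr_ge; first exact: cvgP cB.
apply: nearW => n.
have := mJ _ (T_add (T n) (T_scale t Tc)).
have [_] := Hphi n; rewrite /J (dirichlet_functional_expand t lw (T n) Tc).
move: (n.+1%:R^-1) (dirichlet_functional w (phi n)) (t * (dot _ _ + _)) (dot chi chi) => u j b q.
have -> : t ^+ 2 / 2 * q = t ^+ 2 * (2^-1 * q) by rewrite mulrA.
by move: (t ^+ 2 * _) => z; lra.
Qed.

End DirichletExistence.

(** * Twists as flows, and their action on test functions *)

Section Stationarity.
Context {R : realType}.
Local Notation plane := (R * R)%type.
Local Notation P := (mplane R).
Local Notation mu := (@leb2 R).
Implicit Types (f g h phi chi psi W : plane -> R) (Omega : set plane).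

Lemma smooth1_cos_sin : smooth1 (cos : R -> R) /\ smooth1 (sin : R -> R).
Proof.
have dN k (p : R -> R) : D1 k p -> D1 k (fun x => - p x).
  move=> Dp; rewrite (_ : (fun x => _) = fun x => (cst (-1) x) * p x).
    by apply: D1_mul => //; exact: smooth1_cst.
  by apply/funext => x; rewrite mulN1r.
have H k : D1 k (cos : R -> R) /\ D1 k (sin : R -> R).
  elim: k => [//|k [IHc IHs]]; split; split.
  - by move=> x; case: (is_derive_cos x).
  - rewrite (_ : derive1 _ = fun x => - sin x); first exact: dN.
    by apply/funext => x; apply: derive1P.
  - by move=> x; case: (is_derive_sin x).
  - rewrite (_ : derive1 _ = cos)//.
    by apply/funext => x; apply: derive1P.
by split => k; have [] := H k.
Qed.

Lemma is_derive_curve chi (q1 q2 : R -> R) (s d1 d2 : R) : smooth setT chi ->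
  smooth1 q1 -> smooth1 q2 -> is_derive s (1 : R) q1 d1 -> is_derive s (1 : R) q2 d2 ->
  is_derive s (1 : R) (fun s => chi (q1 s, q2 s))
   (partial1 chi (q1 s, q2 s) * d1 + partial2 chi (q1 s, q2 s) * d2).
Proof.
move=> sc s1 s2 D1 D2.
pose x : plane := (s, 0).
have dd (q : R -> R) : smooth1 q -> differentiable (fun y : plane => q y.1) x.
  by move=> sq; have [] := @Ck_is_diff _ setT 0 _ x openT I (Ck_fst_comp 1 sq).
have dc : differentiable chi (q1 x.1, q2 x.1) by have [] := smooth_diff (q1 x.1, q2 x.1) sc.
have [d e] := @is_derive_comp2 _ chi (fun y => q1 y.1) (fun y => q2 y.1) x (1, 0) dc (dd _ s1) (dd _ s2).
have -> : partial1 chi (q1 s, q2 s) * d1 + partial2 chi (q1 s, q2 s) * d2 =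
    partial1 (fun y : plane => chi (q1 y.1, q2 y.1)) x.
  rewrite [RHS]e.
  have [_ ->] := @is_derive_fst_comp _ q1 x ((1, 0) : plane) (smooth1_derivable s1).
  have [_ ->] := @is_derive_fst_comp _ q2 x ((1, 0) : plane) (smooth1_derivable s2).
  by rewrite /= !mulr1 (derive1P D1) (derive1P D2).
exact: (is_derive_slice1 (f := fun y : plane => chi (q1 y.1, q2 y.1)) d).
Qed.

Variables (p : plane) (b : R -> R) (rho : R).
Hypotheses (sb : smooth1 b) (b0 : forall s, 0 <= b s) (rho0 : 0 < rho)
  (bz : forall s, rho ^+ 2 <= s -> b s = 0).

(** Rotation about [p] by the angle [t b(|x - p|^2)]. The radius is invariant, so these maps form a
    one-parameter group, generated by the field [(vf1, vf2)]. *)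
Definition tw (t : R) : plane -> plane := twist p (fun s => t * b s).
Definition vf1 (x : plane) : R := - (b (sqn (x - p)) * (x - p).2).
Definition vf2 (x : plane) : R := b (sqn (x - p)) * (x - p).1.
Definition lie chi (x : plane) : R := vf1 x * partial1 chi x + vf2 x * partial2 chi x.

Lemma smooth_sqn_shift : smooth setT (fun x : plane => sqn (x - p)).
Proof.
have s1 : smooth setT (fun x : plane => x.1 + - p.1).
  by apply: (@smooth_add _ fst (cst (- p.1))); [exact: smooth_fst|exact: smooth_cst].
have s2 : smooth setT (fun x : plane => x.2 + - p.2).
  by apply: (@smooth_add _ snd (cst (- p.2))); [exact: smooth_snd|exact: smooth_cst].
rewrite /sqn; apply: smooth_add; exact: smooth_mul.
Qed.

(** The ball of the supremum norm contains the Euclidean ball of the same radius. *)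
Lemma sqn_out (x : plane) : ~ (ball p rho : set plane) x -> rho ^+ 2 <= sqn (x - p).
Proof.
move=> nb; rewrite leNgt; apply/negP => h; apply: nb; apply/plane_ballP.
have a2 (a : R) : a ^+ 2 < rho ^+ 2 -> `|a| < rho.
  by move=> ha; rewrite -(ltr_pXn2r (n := 2))// ?nnegrE ?ltW// real_normK ?num_real.
split; rewrite distrC; apply: a2; apply: le_lt_trans h; rewrite /sqn /=.
  by rewrite lerDl sqr_ge0.
by rewrite lerDr sqr_ge0.
Qed.

Lemma smooth_vf : smooth setT vf1 /\ smooth setT vf2.
Proof.
have s1 : smooth setT (fun x : plane => x.1 + - p.1).
  by apply: (@smooth_add _ fst (cst (- p.1))); [exact: smooth_fst|exact: smooth_cst].
have s2 : smooth setT (fun x : plane => x.2 + - p.2).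
  by apply: (@smooth_add _ snd (cst (- p.2))); [exact: smooth_snd|exact: smooth_cst].
have s3 := smooth_comp1 sb smooth_sqn_shift.
split; last exact: smooth_mul.
have := smooth_mul (smooth_cst (-1)) (smooth_mul s3 s2).
by rewrite (_ : (fun x => _) = vf1)//; apply/funext => x; rewrite /= mulN1r.
Qed.

Lemma vf_out (x : plane) : ~ (ball p rho : set plane) x -> vf1 x = 0 /\ vf2 x = 0.
Proof. by move=> /sqn_out/bz h; rewrite /vf1 /vf2 h !mul0r oppr0. Qed.

Lemma L2_vf : L2 vf1 /\ L2 vf2.
Proof.
have [s1 s2] := smooth_vf.
suff T : test_function (ball p (rho + rho + rho) : set plane) vf1 /\
   test_function (ball p (rho + rho + rho) : set plane) vf2 by split; [exact: T_L2 T.1|exact: T_L2 T.2].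
have K : exists K : set plane, [/\ compact K, K `<=` (ball p (rho + rho + rho) : set plane) &
    forall x, ~ K x -> vf1 x = 0 /\ vf2 x = 0].
  exists [set x : plane | `|p.1 - x.1| <= rho /\ `|p.2 - x.2| <= rho]; split.
  - exact: compact_box.
  - move=> x [h1 h2]; apply/plane_ballP.
    by split; [apply: le_lt_trans h1 _|apply: le_lt_trans h2 _]; rewrite -addrA ltrDl addr_gt0.
  - move=> x nK; apply: vf_out => /plane_ballP[h1 h2]; apply: nK; split; exact: ltW.
by have [K0 [cK KO Kz]] := K; split; split => //; exists K0; split => // x /Kz[].
Qed.

Lemma T_lie Omega chi : test_function Omega chi -> test_function Omega (lie chi).
Proof.
move=> T; have [s1 s2] := smooth_vf.
by apply: T_add; apply: T_mul => //; [exact: T_partial1|exact: T_partial2].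
Qed.

Lemma tw_shift t x : tw t x - p = twist0 (fun s => t * b s) (x - p).
Proof. by rewrite /tw /twist addrC addKr. Qed.

Lemma sqn_tw t x : sqn (tw t x - p) = sqn (x - p).
Proof. by rewrite tw_shift sqn_twist0. Qed.

Lemma twD s t x : tw s (tw t x) = tw (s + t) x.
Proof.
rewrite {1}/tw /twist tw_shift twist0D /tw /twist; congr (_ + twist0 _ _).
by apply/funext => u; rewrite mulrDl.
Qed.

Lemma tw0 x : tw 0 x = x.
Proof.
rewrite /tw /twist (_ : (fun s => 0 * b s) = fun=> 0); last by apply/funext => s; rewrite mul0r.
by rewrite twist0_0 addrC subrK.
Qed.

Lemma twK t : cancel (tw t) (tw (- t)).
Proof. by move=> x; rewrite twD addNr tw0. Qed.

Lemma twE t x : tw t x = (p.1 + (cos (b (sqn (x - p)) * t) * (x - p).1 - sin (b (sqn (x - p)) * t) * (x - p).2),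
                          p.2 + (sin (b (sqn (x - p)) * t) * (x - p).1 + cos (b (sqn (x - p)) * t) * (x - p).2)).
Proof. by rewrite /tw /twist /twist0 /planerot ![b _ * t]mulrC. Qed.

Lemma tw_out t x : ~ (ball p rho : set plane) x -> tw t x = x.
Proof.
move=> /sqn_out/bz h; rewrite twE h mul0r cos0 sin0 !mul1r !mul0r subr0 add0r.
by case: x {h} => u v; congr (_, _); rewrite /= addrC subrK.
Qed.

Lemma mpres_tw t : mpres (tw t : P -> P).
Proof. by apply: mpres_twist => //; exact: smooth1_continuous. Qed.

(** Points outside the ball are fixed, and a point of the ball cannot be moved out of it: its image
    would be fixed by the inverse twist. *)
Lemma tw_in Omega t x : (ball p (rho + rho) : set plane) `<=` Omega -> Omega x -> Omega (tw t x).
Proof.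
move=> bO Ox; have [bx|nbx] := pselect ((ball p rho : set plane) x); last by rewrite tw_out.
have [bt|nbt] := pselect ((ball p rho : set plane) (tw t x)).
  by apply: bO; apply: le_ball bt; rewrite lerDl ltW.
by rewrite -(twK t x) tw_out// in bx; rewrite (tw_out (- t) nbt) in bx.
Qed.

Lemma tw_sub Omega t x : (ball p (rho + rho) : set plane) `<=` Omega -> Omega (tw t x) -> Omega x.
Proof. by move=> bO /(tw_in (- t) bO); rewrite twK. Qed.

(** The radius is constant along a trajectory, so the motion is a rotation at the constant angular
    speed [b(|x - p|^2)]. *)
Lemma is_derive_tw chi (x : plane) (s : R) : smooth setT chi ->
  is_derive s (1 : R) (fun s => chi (tw s x)) (lie chi (tw s x)).
Proof.
move=> sc; have [sco ssi] := smooth1_cos_sin.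
set y := x - p; set be := b (sqn y).
pose q1 s := p.1 + (y.1 * cos (be * s + 0) + (- y.2) * sin (be * s + 0)).
pose q2 s := p.2 + (y.1 * sin (be * s + 0) + y.2 * cos (be * s + 0)).
have sC := smooth1_comp sco (smooth1_affine be 0).
have sS := smooth1_comp ssi (smooth1_affine be 0).
have s1 : smooth1 q1.
  apply: smooth1_add; first exact: smooth1_cst.
  by apply: smooth1_add; apply: smooth1_mul => //; exact: smooth1_cst.
have s2 : smooth1 q2.
  apply: smooth1_add; first exact: smooth1_cst.
  by apply: smooth1_add; apply: smooth1_mul => //; exact: smooth1_cst.
have E u : tw u x = (q1 u, q2 u).
  by rewrite twE -/y -/be /q1 /q2 !addr0; congr (_, _); ring.
have dl : is_derive s (1 : R) (fun s => be * s + 0) be.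
  have := derD (derZ be (is_derive_id s (1 : R))) (is_derive_cst (0 : R) s (1 : R)).
  by rewrite mulr1 addr0.
have dC := is_derive1_comp2 (is_derive_cos _) dl.
have dS := is_derive1_comp2 (is_derive_sin _) dl.
have d1 := derD (is_derive_cst p.1 s 1) (derD (derZ y.1 dC) (derZ (- y.2) dS)).
have d2 := derD (is_derive_cst p.2 s 1) (derD (derZ y.1 dS) (derZ y.2 dC)).
have D := is_derive_curve sc s1 s2 d1 d2.
rewrite (_ : (fun s => _) = (fun s => chi (q1 s, q2 s))); last by apply/funext => u; rewrite E.
rewrite (_ : lie chi (tw s x) = partial1 chi (q1 s, q2 s) * (0 + (y.1 * (- sin (be * s + 0) * be) + - y.2 * (cos (be * s + 0) * be)))
  + partial2 chi (q1 s, q2 s) * (0 + (y.1 * (cos (be * s + 0) * be) + y.2 * (- sin (be * s + 0) * be))))//.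
rewrite /lie /vf1 /vf2 sqn_tw -/y -/be E.
move: (partial1 _ _) (partial2 _ _) => d1' d2'; rewrite /q1 /q2 /y /=.
by move: (cos _) (sin _) => d e; ring.
Qed.

Lemma tw_lipschitz Omega chi : test_function Omega chi -> exists2 C, 0 <= C &
  forall t x, `|chi (tw t x) - chi x| <= C * `|t|.
Proof.
move=> T; have [C C0 HC] := T_bounded (T_lie T); exists C => // t x.
have D s := is_derive_tw x s (T_smooth T).
rewrite -{2}[x]tw0.
have [c _ ->] := @MVT_unordered _ (fun s => chi (tw s x)) (fun s => lie chi (tw s x)) 0 t
  (`|t - 0| + 1) (ltac:(by rewrite ltrDl)) (fun s _ => D s).
by rewrite subr0 normrM ler_wpM2r.
Qed.

Lemma T_tw Omega t chi : (ball p (rho + rho) : set plane) `<=` Omega ->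
  test_function Omega chi ->
  exists M r, [/\ 0 < r, forall x, `|chi (tw t x)| <= M & forall x, ~ (ball (0 : plane) r : set plane) x -> chi (tw t x) = 0].
Proof.
move=> bO T; have [M M0 HM] := T_bounded T; have [r r0 Hr] := T_supp T.
exists M, (r + `|p| + rho); split => //; first by rewrite ltr_wpDr ?ltr_wpDr// ltW.
move=> x nb; rewrite tw_out.
  apply: Hr => h; apply: nb; apply: le_ball h; rewrite -addrA lerDl.
  by rewrite addr_ge0 ?normr_ge0// ltW.
move=> h; apply: nb; move: h; rewrite -!ball_normE /= sub0r normrN => h.
have -> : x = p - (p - x) by rewrite opprB addrCA subrr addr0.
apply: le_lt_trans (ler_normB _ _) _; rewrite -addrA; apply: (@lt_le_trans _ _ (`|p| + rho)).
  by rewrite ltrD2l.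
by rewrite lerDr ltW.
Qed.

Lemma tw_step_cvg Omega chi (t : R) : test_function Omega chi -> forall x,
  (fun n : nat => n.+1%:R * (chi (tw (t / n.+1%:R) x) - chi x)) @ \oo --> t * lie chi x.
Proof.
move=> T x.
have [dv dE] := is_derive_tw x 0 (T_smooth T).
have [->|t0] := eqVneq t 0.
  rewrite mul0r (_ : (fun n => _) = cst 0); first exact: cvg_cst.
  by apply/funext => n; rewrite mul0r tw0 subrr mulr0.
rewrite tw0 in dE.
have cD : h^-1 *: (chi (tw (h *: 1 + 0) x) - chi (tw 0 x)) @[h --> 0^'] --> lie chi x.
  by rewrite -dE; exact: dv.
have ct : (fun n : nat => t / n.+1%:R) @ \oo --> 0^'.
  have c0 : (fun n : nat => t / n.+1%:R) @ \oo --> (0 : R).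
    rewrite -[X in _ --> X](mulr0 t); apply: seq_cvgZ; by have := @cvg_harmonic R.
  move=> A A0; have [N _ HN] := c0 _ A0; exists N => // n /= nN; apply: (HN n nN).
  by rewrite mulf_neq0// invr_eq0 pnatr_eq0.
have := @seq_cvgZ R _ _ t (cvg_comp _ _ ct cD).
rewrite (_ : _ \o _ = fun n : nat => n.+1%:R / t * (chi (tw (t / n.+1%:R) x) - chi x)).
  move=> h; apply: cvg_trans h; rewrite (_ : (fun _ => _) = (fun n : nat => n.+1%:R * (chi (tw (t / n.+1%:R) x) - chi x)))//.
  by apply/funext => n; rewrite mulrA mulrCA divff// mulr1.
apply/funext => n /=; rewrite tw0 addr0 invf_div.
by rewrite /GRing.scale/= mulr1.
Qed.

(* Discretising time reduces the estimate to infinitesimal times, the flow being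
   measure preserving. *)
Lemma tw_L1_le Omega chi t : (ball p (rho + rho) : set plane) `<=` Omega ->
  test_function Omega chi ->
  L1 (fun x => chi (tw t x) - chi x) /\
  I2 (fun x => `|chi (tw t x) - chi x|) <= `|t| * I2 (fun x => `|lie chi x|).
Proof.
move=> bO T; have lc := T_L1 T.
have lt s : L1 (fun x => chi (tw s x)) := mpres_L1 (mpres_tw s) lc.
have ld s : L1 (fun x => chi (tw s x) - chi x) by exact: L1B.
split => //.
have step (s : R) n : I2 (fun x => `|chi (tw (n%:R * s) x) - chi x|) <= n%:R * I2 (fun x => `|chi (tw s x) - chi x|).
  elim: n => [|n IH].
    rewrite mul0r (@I2_eq _ _ (fun=> 0)) ?I2_0 ?mul0r// => x.
    by rewrite tw0 subrr normr0.
  apply: (@le_trans _ _ (I2 (fun x => `|chi (tw s (tw (n%:R * s) x)) - chi (tw (n%:R * s) x)| +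
       `|chi (tw (n%:R * s) x) - chi x|))).
    apply: I2_le; first exact: L1_abs.
      apply: L1D; apply: L1_abs => //; apply: L1B => //.
      by apply: L1_eq (lt (s + n%:R * s)) => x; rewrite twD.
    move=> x; rewrite twD (_ : s + n%:R * s = n.+1%:R * s).
      by apply: le_trans (ler_normD _ _); rewrite addrA subrK.
    by rewrite -natr1 mulrDl mul1r addrC.
  rewrite I2D; last 2 first.
  - apply: L1_abs; apply: L1B => //.
    by apply: L1_eq (lt (s + n%:R * s)) => x; rewrite twD.
  - exact: L1_abs.
  rewrite (mpres_I2 (f := fun x => `|chi (tw s x) - chi x|) (mpres_tw (n%:R * s)) (L1_abs (ld s))).
  by rewrite -natr1 mulrDl mul1r addrC lerD2r.
have [C C0 HC] := tw_lipschitz T.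
have [r r0 Hr] := T_supp T.
have [M0 [r1 [r10 _ _]]] := T_tw 0 bO T.
pose G (x : plane) : R := (C * `|t|) * \1_(ball (0 : plane) (r + `|p| + rho) : set plane) x.
have lG : L1 G.
  apply: L1Z; apply: L1_indic; first exact: measurable_plane_ball.
  by rewrite leb2_ball ?ltry//; rewrite !addr_ge0// ltW.
have outx s x : ~ (ball (0 : plane) (r + `|p| + rho) : set plane) x -> chi (tw s x) - chi x = 0.
  move=> nb; rewrite tw_out ?subrr// => h; apply: nb; move: h.
  rewrite -!ball_normE /= sub0r normrN => h.
  have -> : x = p - (p - x) by rewrite opprB addrCA subrr addr0.
  apply: le_lt_trans (ler_normB _ _) _; rewrite -addrA; apply: (@lt_le_trans _ _ (`|p| + rho)).
    by rewrite ltrD2l.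
  by rewrite lerDr ltW.
have [] := @I2_dct _ (fun n x => `|n.+1%:R * (chi (tw (t / n.+1%:R) x) - chi x)|)
  (fun x => `|t * lie chi x|) G.
- move=> n; apply: mfun2_abs; exact: L1_mfun (L1Z n.+1%:R (ld _)).
- exact: lG.
- move=> n x; rewrite normr_id /G.
  have [bx|nb] := pselect ((ball (0 : plane) (r + `|p| + rho) : set plane) x).
    rewrite indicE mem_set// mulr1 normrM ger0_norm//.
    apply: le_trans (ler_wpM2l _ (HC _ _)) _ => //.
    rewrite normrM normfV (ger0_norm (ler0n R n.+1)) mulrCA [n.+1%:R * _]mulrCA divff ?mulr1//.
  by rewrite outx// mulr0 normr0 indicE memNset// mulr0.
- move=> x; apply: (@cvg_norm _ R^o); exact: tw_step_cvg T x.
move=> _ cI.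
have -> : `|t| * I2 (fun x => `|lie chi x|) = I2 (fun x => `|t * lie chi x|).
  rewrite -I2Z; last exact: L1_abs (T_L1 (T_lie T)).
  by apply: I2_eq => x; rewrite normrM.
rewrite -(cvg_lim (@Rhausdorff R) cI); apply: limr_ge; first exact: cvgP cI.
apply: nearW => n; have := step (t / n.+1%:R) n.+1.
rewrite mulrCA divff ?mulr1// => h; apply: le_trans h _.
rewrite -I2Z; last exact: L1_abs.
by rewrite le_eqVlt; apply/orP; left; apply/eqP; apply: I2_eq => x; rewrite normrM ger0_norm.
Qed.

End Stationarity.

(** * Stationarity of energy minimisers under twists *)

Section MinimisersAreStationary.
Context {R : realType}.
Local Notation plane := (R * R)%type.
Local Notation P := (mplane R).
Local Notation mu := (@leb2 R).
Implicit Types (f g h phi chi psi W : plane -> R) (Omega : set plane).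

Variables (p : plane) (b : R -> R) (rho : R).
Hypotheses (sb : smooth1 b) (b0 : forall s, 0 <= b s) (rho0 : 0 < rho)
  (bz : forall s, rho ^+ 2 <= s -> b s = 0).
Local Notation tw := (tw p b).
Local Notation vf1 := (vf1 p b).
Local Notation vf2 := (vf2 p b).
Local Notation lie := (lie p b).

Variables (Omega : set plane) (M B : R) (W : plane -> R).
Hypotheses (oO : open Omega) (M0 : 0 < M) (OM : Omega `<=` (ball (0 : plane) M : set plane))
  (bO : (ball p (rho + rho) : set plane) `<=` Omega)
  (mW : mfun2 W) (WB : forall x, `|W x| <= B) (W0 : forall x, ~ Omega x -> W x = 0).

Let B0 : 0 <= B. Proof. exact: le_trans (WB 0). Qed.

Let lW : L2 W.
Proof. by apply: (L2_bounded_supp mW WB (x := 0) (r := M)) => y nb; apply: W0 => /OM. Qed.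

Let lWt t : L2 (fun x => W (tw t x)).
Proof.
apply: (L2_bounded_supp _ (fun x => WB _) (x := 0) (r := M)).
  exact: mfun2_comp mW (mpres_tw p sb b0 t).1.
by move=> y nb; apply: W0 => /(tw_sub rho0 bz bO)/OM.
Qed.

Let mulW (h : plane -> R) : L1 h -> L1 (fun x => W x * h x).
Proof.
move=> lh; apply: (L1_dom (mfun2M mW (L1_mfun lh)) (L1Z B (L1_abs lh))) => x.
by rewrite normrM ler_wpM2r.
Qed.

(** The twist preserves area, so it can be moved, with reversed time, from the merely bounded [W] to
    the smooth [chi]. *)
Lemma tw_diff_pair t chi : test_function Omega chi ->
  ip (fun x => W (tw t x) - W x) chi = I2 (fun x => W x * (chi (tw (- t) x) - chi x)).
Proof.
move=> T; have lc := T_L1 T.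
have ld : L1 (fun x => chi (tw (- t) x)) := mpres_L1 (mpres_tw p sb b0 (- t)) lc.
rewrite ipBl//; last exact: T_L2 T.
rewrite (@I2_eq _ (fun x => W x * (chi _ - chi x)) (fun x => W x * chi (tw (- t) x) - W x * chi x)); last first.
  by move=> x; rewrite mulrBr.
rewrite I2B; [|exact: mulW|exact: mulW]; congr (_ - _).
have := mpres_I2 (mpres_tw p sb b0 t) (mulW ld) => <-.
by apply: I2_eq => x /=; rewrite twK.
Qed.

(** The perturbation of the vorticity is O(t) as a functional for the gradient norm. The quadratic
    term of the energy expansion is therefore O(t^2). *)
Lemma tw_diff_le t chi : test_function Omega chi ->
  `|ip (fun x => W (tw t x) - W x) chi| <=
     `|t| * (B * (nrm vf1 + nrm vf2)) * (nrm (partial1 chi) + nrm (partial2 chi)).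
Proof.
move=> T; rewrite (tw_diff_pair t T).
have [ld le] := tw_L1_le sb b0 rho0 bz (- t) bO T.
have [l1 l2] := L2_vf p sb rho0 bz.
have lp1 := T_L2 (T_partial1 T); have lp2 := T_L2 (T_partial2 T).
apply: (le_trans (I2_abs (mulW ld))).
apply: (@le_trans _ _ (I2 (fun x => B * `|chi (tw (- t) x) - chi x|))).
  apply: I2_le; [exact: L1_abs (mulW ld)|exact: L1Z (L1_abs ld)|].
  by move=> x; rewrite normrM ler_wpM2r.
rewrite I2Z; last exact: L1_abs.
apply: (le_trans (ler_wpM2l B0 le)); rewrite normrN.
have la1 := L2_abs l1; have la2 := L2_abs l2.
have lb1 := L2_abs lp1; have lb2 := L2_abs lp2.
have h : I2 (fun x => `|lie chi x|) <= nrm vf1 * nrm (partial1 chi) + nrm vf2 * nrm (partial2 chi).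
  apply: (@le_trans _ _ (ip (fun x => `|vf1 x|) (fun x => `|partial1 chi x|) +
      ip (fun x => `|vf2 x|) (fun x => `|partial2 chi x|))).
    rewrite /ip -I2D; [|exact: L2_mul|exact: L2_mul].
    apply: I2_le; first exact: L1_abs (T_L1 (T_lie p sb T)).
      by apply: L1D; exact: L2_mul.
    by move=> x; apply: le_trans (ler_normD _ _) _; rewrite !normrM.
  apply: lerD.
    by have := ip_le la1 lb1; rewrite !nrm_abs; apply: le_trans; exact: ler_norm.
  by have := ip_le la2 lb2; rewrite !nrm_abs; apply: le_trans; exact: ler_norm.
have h2 : I2 (fun x => `|lie chi x|) <= (nrm vf1 + nrm vf2) * (nrm (partial1 chi) + nrm (partial2 chi)).
  have key (x y z w : R) : 0 <= x -> 0 <= y -> 0 <= z -> 0 <= w -> x * z + y * w <= (x + y) * (z + w).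
    move=> x0 y0 z0 w0; rewrite (_ : (x + y) * _ = x * z + y * w + (x * w + y * z)); last by ring.
    by rewrite lerDl addr_ge0// mulr_ge0.
  apply: (le_trans h); exact: key (nrm_ge0 _) (nrm_ge0 _) (nrm_ge0 _) (nrm_ge0 _).
rewrite mulrCA -!mulrA; apply: ler_wpM2l => //; apply: ler_wpM2l => //.
Qed.

(** The first variation of the pairing; the minus sign comes from the reversed time. *)
Lemma tw_diff_cvg (s : R) chi : test_function Omega chi ->
  (fun n : nat => n.+1%:R * ip (fun x => W (tw (s / n.+1%:R) x) - W x) chi) @ \oo -->
    - s * I2 (fun x => W x * lie chi x).
Proof.
move=> T; have lc := T_L1 T.
have [C C0 HC] := tw_lipschitz p sb T.
have [M1 [r [r0 _ out]]] := T_tw rho0 bz 0 bO T.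
have lt u : L1 (fun x => chi (tw u x) - chi x) by have [] := tw_L1_le sb b0 rho0 bz u bO T.
have [r1 r10 Hr1] := T_supp T.
pose rr := r1 + `|p| + rho.
have outx u x : ~ (ball (0 : plane) rr : set plane) x -> chi (tw u x) - chi x = 0.
  move=> nb; rewrite (tw_out rho0 bz) ?subrr// => h; apply: nb; move: h.
  rewrite -!ball_normE /= sub0r normrN => h.
  have -> : x = p - (p - x) by rewrite opprB addrCA subrr addr0.
  apply: le_lt_trans (ler_normB _ _) _; rewrite /rr -addrA; apply: (@lt_le_trans _ _ (`|p| + rho)).
    by rewrite ltrD2l.
  by rewrite lerDr ltW.
have [] := @I2_dct _ (fun n x => n.+1%:R * (W x * (chi (tw (- s / n.+1%:R) x) - chi x)))
  (fun x => - s * (W x * lie chi x)) (fun x => B * (C * `|s|) * \1_(ball (0 : plane) rr : set plane) x).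
- move=> n; exact: L1_mfun (L1Z _ (mulW (lt _))).
- apply: L1Z; apply: L1_indic; first exact: measurable_plane_ball.
  by rewrite leb2_ball ?ltry//; rewrite !addr_ge0// ltW.
- move=> n x; have [bx|nb] := pselect ((ball (0 : plane) rr : set plane) x); last first.
    by rewrite outx// !mulr0 normr0 indicE memNset// mulr0.
  rewrite indicE mem_set// mulr1 mulrCA normrM.
  apply: ler_pM => //; rewrite normrM (ger0_norm (ler0n R n.+1)).
  apply: le_trans (ler_wpM2l _ (HC _ _)) _ => //.
  by rewrite normrM normfV (ger0_norm (ler0n R n.+1)) mulrCA [n.+1%:R * _]mulrCA divff ?mulr1// normrN.
- move=> x; rewrite mulrCA.
  have c := @tw_step_cvg R p b Omega chi (- s) T x.
  have := @seq_cvgZ R _ _ (W x) c.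
  by under eq_fun do rewrite mulrCA.
move=> l; rewrite I2Z; last exact: mulW (T_L1 (T_lie p sb T)).
move=> c; apply: cvg_trans c.
rewrite (_ : (fun n => I2 _) = fun n : nat => n.+1%:R * ip (fun x => W (tw (s / n.+1%:R) x) - W x) chi)//.
apply/funext => n; rewrite I2Z; last exact: mulW.
by rewrite (tw_diff_pair _ T) mulNr.
Qed.

Variables (psi g1 g2 : plane -> R).
Hypothesis D : dirichlet_data Omega W psi g1 g2.

Let nrm_cvg_sub (f : nat -> plane -> R) g h : (forall n, L2 (f n)) -> L2 g -> L2 h ->
  nrm (fun x => f n x - g x) @[n --> \oo] --> 0 ->
  nrm (fun x => f n x - h x) @[n --> \oo] --> nrm (fun x => g x - h x).
Proof.
move=> lf lg lh c; apply: nrm_cvg_sqr; [by move=> n; exact: L2B|exact: L2B|].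
rewrite (_ : (fun n => _) = fun n => nrm (fun x => f n x - g x))//.
by apply/funext => n; apply: nrm_eq => x; ring.
Qed.

(** The bound for test functions passes to [psi - chi] by density. After division by [|t|] it
    controls, uniformly in [t], the error of replacing [psi] by a test function. *)
Lemma tw_diff_data_le t chi : test_function Omega chi ->
  `|ip (fun x => W (tw t x) - W x) (fun x => psi x - chi x)| <=
     `|t| * (B * (nrm vf1 + nrm vf2)) *
       (nrm (fun x => g1 x - partial1 chi x) + nrm (fun x => g2 x - partial2 chi x)).
Proof.
move=> T; have [[lp l1 l2] _ [phi [Tp [a a1 a2]]] _] := D.
have lphi n := T_L2 (Tp n); have lp1 n := T_L2 (T_partial1 (Tp n)).
have lp2 n := T_L2 (T_partial2 (Tp n)).
have lc := T_L2 T; have lc1 := T_L2 (T_partial1 T); have lc2 := T_L2 (T_partial2 T).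
have ld : L2 (fun x => W (tw t x) - W x) by exact: L2B.
have c0 : ip (fun x => W (tw t x) - W x) (fun x => phi n x + -1 * chi x) @[n --> \oo] -->
    ip (fun x => W (tw t x) - W x) (fun x => psi x - chi x).
  rewrite ipC; under eq_fun do rewrite ipC.
  apply: ip_cvg => //.
  - by move=> n; apply: L2D => //; exact: L2Z.
  - exact: L2B.
  rewrite (_ : (fun n => _) = fun n => nrm (fun x => phi n x - psi x))//.
  by apply/funext => n; apply: nrm_eq => x; ring.
have h1 : `|ip (fun x => W (tw t x) - W x) (fun x => phi n x + -1 * chi x)| @[n --> \oo] -->
    `|ip (fun x => W (tw t x) - W x) (fun x => psi x - chi x)|.
  by apply: (@cvg_norm _ R^o).
have h2 := @seq_cvgZ R _ _ (`|t| * (B * (nrm vf1 + nrm vf2)))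
  (seq_cvgD (nrm_cvg_sub lp1 l1 lc1 a1) (nrm_cvg_sub lp2 l2 lc2 a2)).
apply: (ler_cvg_to h1 h2); apply: nearW => n.
have := tw_diff_le t (T_add (Tp n) (T_scale (-1) T)).
rewrite (partial1_lin (-1) (Tp n) T) (partial2_lin (-1) (Tp n) T).
have e1 : nrm (fun x => partial1 (phi n) x + -1 * partial1 chi x) =
    nrm (fun x => partial1 (phi n) x - partial1 chi x) by apply: nrm_eq => x; rewrite mulN1r.
have e2 : nrm (fun x => partial2 (phi n) x + -1 * partial2 chi x) =
    nrm (fun x => partial2 (phi n) x - partial2 chi x) by apply: nrm_eq => x; rewrite mulN1r.
by rewrite e1 e2.
Qed.

(** By minimality the linear term of the energy expansion is at most [(|t| A)^2]. Dividing by [|t|]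
    for both signs of [t], and replacing [psi] by test functions up to a small error, makes the
    first variation vanish. *)
Lemma minimiser_stationary :
  (forall t psi' g1' g2', dirichlet_data Omega (fun x => W (tw t x)) psi' g1' g2' ->
     ip g1 g1 + ip g2 g2 <= ip g1' g1' + ip g2' g2') ->
  I2 (fun x => W x * (vf1 x * g1 x + vf2 x * g2 x)) = 0.
Proof.
move=> Hmin.
have [[lp l1 l2] _ [phi [Tp [a a1 a2]]] _] := D.
have lphi n := T_L2 (Tp n); have lp1 n := T_L2 (T_partial1 (Tp n)).
have lp2 n := T_L2 (T_partial2 (Tp n)).
have [lv1 lv2] := L2_vf p sb rho0 bz.
pose A := B * (nrm vf1 + nrm vf2).
have A0 : 0 <= A by rewrite mulr_ge0// addr_ge0// nrm_ge0.
have F t : ip (fun x => W (tw t x) - W x) psi <= (`|t| * A) ^+ 2.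
  have [psi' [g1' [g2' D']]] := dirichlet_exists oO M0 OM (lWt t).
  have := dirichlet_energy_diff lW (lWt t) D D'.
  have := @dirichlet_diff_le _ _ _ _ _ _ _ _ _ _ (`|t| * A) lW (lWt t) _ D D' (tw_diff_le t).
  rewrite mulr_ge0// => /(_ isT); have := Hmin _ _ _ _ D'.
  move: (ip g1 g1) (ip g2 g2) (ip g1' g1') (ip g2' g2') (ip _ psi) => e1 e2 e3 e4 q.
  by move: (nrm _ ^+ 2) (nrm _ ^+ 2) ((_ * _) ^+ 2) => u v z; lra.
have lWv1 : L2 (fun x => W x * vf1 x).
  apply: L2_dom (mfun2M mW lv1.1) (L2Z B (L2_abs lv1)) _ => x.
  by rewrite normrM ler_wpM2r.
have lWv2 : L2 (fun x => W x * vf2 x).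
  apply: L2_dom (mfun2M mW lv2.1) (L2Z B (L2_abs lv2)) _ => x.
  by rewrite normrM ler_wpM2r.
have split (h1 h2 : plane -> R) : L2 h1 -> L2 h2 ->
    I2 (fun x => W x * (vf1 x * h1 x + vf2 x * h2 x)) =
    ip h1 (fun x => W x * vf1 x) + ip h2 (fun x => W x * vf2 x).
  move=> lh1 lh2; rewrite /ip -I2D; [|exact: L2_mul|exact: L2_mul].
  by apply: I2_eq => x; ring.
have cA : (fun n => I2 (fun x => W x * lie (phi n) x)) @ \oo -->
    I2 (fun x => W x * (vf1 x * g1 x + vf2 x * g2 x)).
  rewrite split//; under eq_fun do rewrite split//.
  by apply: seq_cvgD; exact: ip_cvg.
have cd : (fun n => A * (nrm (fun x => g1 x - partial1 (phi n) x) + nrm (fun x => g2 x - partial2 (phi n) x)))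
    @ \oo --> 0.
  rewrite -[X in _ --> X](mulr0 A); apply: seq_cvgZ; rewrite -[X in _ --> X]addr0.
  by apply: seq_cvgD; [under eq_fun do rewrite nrmBC|under eq_fun do rewrite nrmBC].
(* Only [s = 1] and [s = -1] matter. The times are [s / (n+1)], and [n] tends to infinity before [k]
   does. *)
have key (s : R) : `|s| = 1 -> - s * I2 (fun x => W x * (vf1 x * g1 x + vf2 x * g2 x)) <= 0.
  move=> s1; have cs := @seq_cvgZ R _ _ (- s) cA.
  apply: (ler_cvg_to cs cd); apply: nearW => k.
  set de := A * _.
  have c1 := @tw_diff_cvg s (phi k) (Tp k).
  have c2 : (fun n : nat => de + A ^+ 2 * n.+1%:R^-1) @ \oo --> de.
    rewrite -[X in _ --> X]addr0; apply: seq_cvgD; first exact: cvg_cst.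
    by rewrite -[X in _ --> X](mulr0 (A ^+ 2)); apply: seq_cvgZ; have := @cvg_harmonic R.
  apply: (ler_cvg_to c1 c2); apply: nearW => n.
  have n0 : 0 < n.+1%:R :> R by [].
  have nt : `|s / n.+1%:R| = n.+1%:R^-1.
    by rewrite normrM s1 mul1r normfV ger0_norm.
  have h1 := F (s / n.+1%:R); have h2 := tw_diff_data_le (s / n.+1%:R) (Tp k).
  rewrite nt in h1 h2.
  have ld : L2 (fun x => W (tw (s / n.+1%:R) x) - W x) by exact: L2B.
  rewrite ipBr// in h2.
  rewrite -ler_pdivlMl// mulrDr.
  have h3 : n.+1%:R^-1 * (A ^+ 2 * n.+1%:R^-1) = (n.+1%:R^-1 * A) ^+ 2 :> R by ring.
  rewrite h3.
  have h4 : n.+1%:R^-1 * de = n.+1%:R^-1 * (B * (nrm vf1 + nrm vf2)) *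
       (nrm (fun x => g1 x - partial1 (phi k) x) + nrm (fun x => g2 x - partial2 (phi k) x)).
    by rewrite /de /A mulrA.
  rewrite h4; move: h2; rewrite ler_norml => /andP[h2 _].
  by move: h1 h2; move: (ip _ _) (ip _ _) (_ ^+ 2) (_ * _ * _) => u v z y; lra.
apply/eqP; rewrite eq_le; apply/andP; split.
  by have := key (-1); rewrite normrN normr1 opprK mul1r; apply.
by have := key 1; rewrite normr1 mulN1r oppr_le0; apply.
Qed.

End MinimisersAreStationary.

(** * Volume-preserving diffeomorphisms *)

Section VolumePreservingDiffeomorphisms.
Context {R : realType}.
Local Notation plane := (R * R)%type.
Local Notation P := (mplane R).
Local Notation mu := (@leb2 R).
Implicit Types (f g : plane -> R) (Omega : set plane) (eta zeta : plane -> plane).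

Lemma smooth_comp_map Omega f eta : open Omega -> (forall x, Omega x -> Omega (eta x)) ->
  smooth Omega f -> smooth_map Omega eta -> smooth Omega (f \o eta).
Proof.
move=> oO eO sf [s1 s2] k.
have := @Ck_comp _ Omega Omega k f (fun x => (eta x).1) (fun x => (eta x).2) oO oO.
have -> : (fun x => f ((eta x).1, (eta x).2)) = f \o eta.
  by apply/funext => x /=; case: (eta x).
by apply => // x Ox; rewrite -surjective_pairing; exact: eO.
Qed.

Lemma smooth_map_measurable Omega eta : open Omega -> smooth_map Omega eta ->
  measurable_fun (Omega : set P) (eta : P -> P).
Proof.
move=> oO [s1 s2].
have m1 : measurable_fun (Omega : set P) (fun x : P => (eta x).1 : mline R).
  apply: open_continuous_measurable2; [exact: oO|move=> x Ox; exact: (Ck_continuous (s1 0%N) Ox)].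
have m2 : measurable_fun (Omega : set P) (fun x : P => (eta x).2 : mline R).
  apply: open_continuous_measurable2; [exact: oO|move=> x Ox; exact: (Ck_continuous (s2 0%N) Ox)].
have mO := open_measurable2 oO.
have n1 := (measurable_restrictT _ mO).1 m1; have n2 := (measurable_restrictT _ mO).1 m2.
have := measurable_funTS (D := Omega) (@plane_pair_measurable R _ _ n1 n2).
by apply: eq_measurable_fun => x Ox; rewrite !patchE Ox -surjective_pairing.
Qed.

(** Within [Omega] the image is the preimage under the inverse, which is measurable there. *)
Lemma vol_diffeo_image_measurable Omega eta zeta (A : set plane) : open Omega ->
  vol_diffeo Omega eta zeta -> @measurable _ P A -> A `<=` Omega ->
  @measurable _ P (eta @` A).
Proof.
move=> oO [[_ sz] [eO zO] [ze ez] _] mA AO.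
have -> : eta @` A = Omega `&` zeta @^-1` A.
  apply/seteqP; split => [_ [x Ax <-]|y [Oy Ay]]; first by split; [exact/eO/AO|rewrite /= ze//; exact: AO].
  by exists (zeta y) => //; exact: ez.
by apply: (smooth_map_measurable oO sz) => //; exact: open_measurable2.
Qed.

Lemma vol_diffeo_comp Omega eta zeta eta' zeta' : open Omega -> vol_diffeo Omega eta zeta ->
  vol_diffeo Omega eta' zeta' -> vol_diffeo Omega (eta' \o eta) (zeta \o zeta').
Proof.
move=> oO V [[se' sz'] [eO' zO'] [ze' ez'] m'].
have [[se sz] [eO zO] [ze ez] m] := V.
split.
- split; split.
  + exact: (smooth_comp_map oO eO se'.1 se).
  + exact: (smooth_comp_map oO eO se'.2 se).
  + exact: (smooth_comp_map oO zO' sz.1 sz').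
  + exact: (smooth_comp_map oO zO' sz.2 sz').
- by split=> x Ox /=; [exact/eO'/eO|exact/zO/zO'].
- split=> x Ox /=; first by rewrite ze' ?ze//; exact: eO.
  by rewrite ez ?ez'//; exact: zO'.
move=> A mA AO; rewrite -image_comp m'; first exact: m.
- exact: vol_diffeo_image_measurable V mA AO.
- by move=> _ [x Ax <-]; exact/eO/AO.
Qed.

(** The inverse is time reversal: the image of [A] under [tw (- t)] is its preimage under [tw t],
    whose measure is known. *)
Lemma vol_diffeo_tw Omega (p : plane) (b : R -> R) (rho t : R) : smooth1 b ->
  (forall s, 0 <= b s) -> 0 < rho -> (forall s, rho ^+ 2 <= s -> b s = 0) ->
  (ball p (rho + rho) : set plane) `<=` Omega ->
  vol_diffeo Omega (tw p b (- t)) (tw p b t).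
Proof.
move=> sb b0 rho0 bz bO.
have st s : smooth_map Omega (tw p b s).
  have [sC sS] := @smooth1_cos_sin R.
  have s1 : smooth setT (fun x : plane => x.1 + - p.1).
    by apply: (@smooth_add _ fst (cst (- p.1))); [exact: smooth_fst|exact: smooth_cst].
  have s2 : smooth setT (fun x : plane => x.2 + - p.2).
    by apply: (@smooth_add _ snd (cst (- p.2))); [exact: smooth_snd|exact: smooth_cst].
  have s3 : smooth setT (fun x : plane => b (sqn (x - p)) * s).
    apply: (@smooth_mul _ _ (cst s)); last exact: smooth_cst.
    exact: smooth_comp1 sb (smooth_sqn_shift p).
  have s4 := smooth_comp1 sC s3; have s5 := smooth_comp1 sS s3.
  have N1 : smooth setT (cst (-1) : plane -> R) by exact: smooth_cst.
  split.
    rewrite (_ : (fun x => _) = (fun x : plane => cst p.1 x + (cos (b (sqn (x - p)) * s) * (x.1 + - p.1) +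
      cst (-1) x * (sin (b (sqn (x - p)) * s) * (x.2 + - p.2))))); last first.
      by apply/funext => x; rewrite twE /= mulN1r.
    move=> k; apply: Ck_sub (@subsetT _ _) _; move: k.
    apply: smooth_add; first exact: smooth_cst.
    by apply: smooth_add; [exact: smooth_mul|apply: smooth_mul => //; exact: smooth_mul].
  rewrite (_ : (fun x => _) = (fun x : plane => cst p.2 x + (sin (b (sqn (x - p)) * s) * (x.1 + - p.1) +
    (cos (b (sqn (x - p)) * s) * (x.2 + - p.2))))); last first.
    by apply/funext => x; rewrite twE.
  move=> k; apply: Ck_sub (@subsetT _ _) _; move: k.
  apply: smooth_add; first exact: smooth_cst.
  by apply: smooth_add; exact: smooth_mul.
split.
- by split; exact: st.
- by split=> x; exact: (tw_in rho0 bz).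
- split=> x _; last by rewrite twK.
  by rewrite -{2}(twK p b (- t) x) opprK.
move=> A mA AO; have [mt pt] := mpres_tw p sb b0 t.
rewrite -(pt A mA); congr (mu _); apply/seteqP; split => [_ [x Ax <-]|x Ax] /=.
  by rewrite -{1}[t]opprK twK.
by exists (tw p b t x) => //; rewrite twK.
Qed.

End VolumePreservingDiffeomorphisms.

(** * Interchange of integrals *)

Section Swap.
Context {R : realType}.
Local Notation plane := (R * R)%type.
Local Notation P := (mplane R).
Local Notation mu := (@leb2 R).

(** A name for [leb2] to which the structure of sigma-finite measure, required by Fubini's theorem,
    can be attached. *)
Definition leb2_fun : set P -> \bar R := mu.
HB.instance Definition _ := Measure.on leb2_fun.

Let leb2_sigma_finite : sigma_finite setT leb2_fun.
Proof.
exists (fun n => ball (0 : plane) n.+1%:R : set P).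
  apply/esym/seteqP; split => // x _.
  pose n := Num.truncn `|x : plane|; exists n => //; rewrite -ball_normE /= sub0r normrN.
  by have /andP[] := truncn_itv (normr_ge0 (x : plane)).
move=> n; split; first exact: measurable_plane_ball.
by rewrite /leb2_fun leb2_ball ?ltry.
Qed.

HB.instance Definition _ := Measure_isSigmaFinite.Build _ _ _ leb2_fun leb2_sigma_finite.

Let leb2s : {sigma_finite_measure set P -> \bar R} := leb2_fun.

(** The product bound makes [F] integrable on the product space. *)
Lemma I2_swap (F : plane -> plane -> R) (f g : plane -> R) :
  measurable_fun (setT : set (P * P)%type) (fun z : (P * P)%type => F z.1 z.2 : mline R) ->
  L1 f -> L1 g -> (forall x, 0 <= f x) -> (forall x, 0 <= g x) ->
  (forall x y, `|F x y| <= f x * g y) ->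
  I2 (fun x => I2 (fun y => F x y)) = I2 (fun y => I2 (fun x => F x y)).
Proof.
move=> mF lf lg f0 g0 Ffg.
have mE : measurable_fun (setT : set (P * P)%type) (fun z : (P * P)%type => (F z.1 z.2)%:E).
  exact/measurable_EFinP.
have sec x : measurable_fun (setT : set P) (fun y => (F x y)%:E).
  exact: (measurableT_comp mE (pair1_measurable x)).
have mA : measurable_fun (setT : set (P * P)%type) (fun z : (P * P)%type => `|(F z.1 z.2)%:E|%E).
  exact: measurableT_comp.
have mT : measurable_fun (setT : set P) (fun x => \int[mu]_y `|(F x y)%:E|)%E.
  have A0 (z : (P * P)%type) : (0 <= `|(F z.1 z.2)%:E|)%E by exact: abse_ge0.
  exact: (@measurable_fun_fubini_tonelli_F _ _ P P R leb2s _ mA A0).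
have iF : (leb2s \x leb2s)%E.-integrable setT (fun z : (P * P)%type => (F z.1 z.2)%:E).
  apply/(integrable12ltyP leb2s leb2s mE).
  change (\int[mu]_x \int[mu]_y `|(F x y)%:E| < +oo)%E.
  have le x : (\int[mu]_y `|(F x y)%:E| <= (f x * I2 g)%:E)%E.
    have -> : ((f x * I2 g)%:E = \int[mu]_y (f x * g y)%:E)%E.
      rewrite -I2Z// /I2 /Rintegral fineK//; exact: (integrable_fin_num measurableT (L1Z (f x) lg)).
    apply: ge0_le_integral => //.
    - exact: measurableT_comp.
    - by apply: mfun2_EFin; exact: L1_mfun (L1Z (f x) lg).
    - by move=> y _ /=; rewrite lee_fin.
  apply: (@le_lt_trans _ _ (\int[mu]_x (f x * I2 g)%:E)%E).
    apply: ge0_le_integral => //.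
    - by move=> x _; exact: integral_ge0.
    - by apply: mfun2_EFin; apply: (@mfun2M _ f (cst (I2 g))); [exact: L1_mfun|exact: mfun2_cst].
  have lfI : L1 (fun x => f x * I2 g) by apply: L1_eq (L1Z (I2 g) lf) => x; rewrite mulrC.
  have /integrableP[_] := lfI; apply: le_lt_trans; apply: ge0_le_integral => //.
  - by move=> x _; rewrite lee_fin mulr_ge0// I2_ge0.
  - by apply: mfun2_EFin; exact: L1_mfun lfI.
  - by apply: measurableT_comp => //; apply: mfun2_EFin; exact: L1_mfun lfI.
  - by move=> x _ /=; rewrite lee_fin ler_norm.
have l1 x : L1 (F x).
  by apply: (L1_dom _ (L1Z (f x) lg)) => //; apply/measurable_EFinP; exact: sec.
have l2 y : L1 (F^~ y).
  apply: (L1_dom _ (L1Z (g y) lf)) => [|x]; last by rewrite mulrC.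
  by apply/measurable_EFinP; exact: (measurableT_comp mE (pair2_measurable y)).
have E1 x : (\int[mu]_y (F x y)%:E = (I2 (F x))%:E)%E.
  by rewrite /I2 /Rintegral fineK//; exact: (integrable_fin_num measurableT (l1 x)).
have E2 y : (\int[mu]_x (F x y)%:E = (I2 (F^~ y))%:E)%E.
  by rewrite /I2 /Rintegral fineK//; exact: (integrable_fin_num measurableT (l2 y)).
have := Fubini iF => /= H; rewrite /I2 /Rintegral; congr fine.
transitivity (\int[mu]_x \int[mu]_y (F x y)%:E)%E.
  by apply: eq_integral => x _; rewrite E1.
rewrite [LHS]H; by apply: eq_integral => y _; rewrite E2.
Qed.

End Swap.

(** * Radial functions and their Laplacians *)

Section Radial.
Context {R : realType}.
Local Notation plane := (R * R)%type.
Local Notation P := (mplane R).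
Local Notation mu := (@leb2 R).
Implicit Types (f : R -> R) (g : plane -> R) (Omega : set plane) (q x : plane).

Definition radial (f : R -> R) q (x : plane) : R := f (sqn (x - q)).

Lemma smooth_radial f q : smooth1 f -> smooth setT (radial f q).
Proof. by move=> sf; exact: smooth_comp1 sf (smooth_sqn_shift q). Qed.

Lemma T_radial Omega f q (rho : R) : smooth1 f -> 0 < rho ->
  (forall s, rho ^+ 2 <= s -> f s = 0) -> (ball q (rho + rho) : set plane) `<=` Omega ->
  test_function Omega (radial f q).
Proof.
move=> sf rho0 fz bO; split; first exact: smooth_radial.
exists [set x : plane | `|q.1 - x.1| <= rho /\ `|q.2 - x.2| <= rho]; split.
- exact: compact_box.
- move=> x [h1 h2]; apply: bO; apply/plane_ballP.
  by split; [apply: le_lt_trans h1 _|apply: le_lt_trans h2 _]; rewrite ltrDl.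
move=> x nK; apply: fz; apply: (@sqn_out _ _ _ rho0) => /plane_ballP[h1 h2].
by apply: nK; split; exact: ltW.
Qed.

Lemma is_derive_sqn_shift q (x : plane) :
  partial1 (fun y => sqn (y - q)) x = 2 * (x - q).1 /\
  partial2 (fun y => sqn (y - q)) x = 2 * (x - q).2.
Proof.
have D1 (a : R) (t : R) : is_derive t (1 : R) (fun u => (u - a) ^+ 2) (2 * (t - a)).
  have d := derD (is_derive_id t (1 : R)) (is_derive_cst (- a) t (1 : R)).
  have := derM d d; rewrite /= addr0 !mulr1.
  by rewrite (_ : (t - a) + (t - a) = 2 * (t - a)); [under eq_fun do rewrite -expr2|ring].
have s := smooth_sqn_shift q.
split.
  have e := @is_derive_slice1 _ (fun y => sqn (y - q)) x.1 x.2 (smooth_derivable s).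
  have e' := derD (D1 q.1 x.1) (is_derive_cst ((x.2 - q.2) ^+ 2) x.1 (1 : R)).
  have := derive1P e; rewrite -[(x.1, x.2)]surjective_pairing => <-.
  by rewrite (derive1P e') addr0.
have e := @is_derive_slice2 _ (fun y => sqn (y - q)) x.1 x.2 (smooth_derivable s).
have e' := derD (is_derive_cst ((x.1 - q.1) ^+ 2) x.2 (1 : R)) (D1 q.2 x.2).
have := derive1P e; rewrite -[(x.1, x.2)]surjective_pairing => <-.
by rewrite (derive1P e') add0r.
Qed.

Lemma partial_comp1 (f : R -> R) g (x v : plane) : smooth1 f -> smooth setT g ->
  'D_v (fun y => f (g y)) x = derive1 f (g x) * 'D_v g x.
Proof.
move=> sf sg.
have df : differentiable (fun y : plane => f y.1) (g x, 0).
  by have [] := @Ck_is_diff _ setT 0 _ (g x, 0) openT I (Ck_fst_comp 1 sf).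
have dg : differentiable g x by have [] := smooth_diff x sg.
have [_ ->] := @is_derive_comp2 _ (fun y : plane => f y.1) g (cst 0) x v df dg (differentiable_cst _ _).
have [_ E1] := is_derive_fst_comp (x := (g x, 0)) ((1, 0) : plane) (smooth1_derivable sf).
by rewrite /partial1 E1 derive_cst mulr0 addr0 mulr1.
Qed.

Lemma partial1_radial f q x : smooth1 f ->
  partial1 (radial f q) x = 2 * (x - q).1 * radial (derive1 f) q x.
Proof.
move=> sf; rewrite /partial1 partial_comp1//; last exact: smooth_sqn_shift.
by have [E _] := is_derive_sqn_shift q x; rewrite /partial1 in E; rewrite E mulrC.
Qed.
Lemma partial2_radial f q x : smooth1 f ->
  partial2 (radial f q) x = 2 * (x - q).2 * radial (derive1 f) q x.
Proof.
move=> sf; rewrite /partial2 partial_comp1//; last exact: smooth_sqn_shift.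
by have [_ E] := is_derive_sqn_shift q x; rewrite /partial2 in E; rewrite E mulrC.
Qed.

Lemma smooth_coord (q : plane) : smooth setT (fun x : plane => 2 * (x - q).1) /\
  smooth setT (fun x : plane => 2 * (x - q).2).
Proof.
split; apply: (@smooth_mul _ (cst 2)); try exact: smooth_cst.
- apply: (@smooth_add _ fst (cst (- q.1))); [exact: smooth_fst|exact: smooth_cst].
- apply: (@smooth_add _ snd (cst (- q.2))); [exact: smooth_snd|exact: smooth_cst].
Qed.

Lemma partial_coord (q x : plane) : partial1 (fun x : plane => 2 * (x - q).1) x = 2 /\
  partial2 (fun x : plane => 2 * (x - q).2) x = 2.
Proof.
have L1' : (fun x : plane => 2 * (x - q).1) = (fun x => lin2 2 0 x + cst (- (2 * q.1)) x).
  by apply/funext => y; rewrite /lin2 /=; ring.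
have L2' : (fun x : plane => 2 * (x - q).2) = (fun x => lin2 0 2 x + cst (- (2 * q.2)) x).
  by apply/funext => y; rewrite /lin2 /=; ring.
have s a b : smooth setT (lin2 a b : plane -> R) by move=> k; exact: Ck_lin2.
split.
  rewrite L1' partial1D//; last exact: smooth_cst.
  by rewrite partial1_cst addr0 /partial1; have [_ ->] := is_derive_lin2 2 0 x (1, 0); rewrite /lin2 /=; ring.
rewrite L2' partial2D//; last exact: smooth_cst.
by rewrite partial2_cst addr0 /partial2; have [_ ->] := is_derive_lin2 0 2 x (0, 1); rewrite /lin2 /=; ring.
Qed.

Lemma laplacian_radial f q x : smooth1 f ->
  partial1 (partial1 (radial f q)) x + partial2 (partial2 (radial f q)) x =
  4 * (derive1 f (sqn (x - q)) + sqn (x - q) * derive1 (derive1 f) (sqn (x - q))).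
Proof.
move=> sf; have sf' := smooth1_derive sf.
have [s1 s2] := smooth_coord q; have [c1 c2] := partial_coord q x.
have -> : partial1 (radial f q) = (fun x => 2 * (x - q).1 * radial (derive1 f) q x).
  by apply/funext => y; exact: partial1_radial.
have -> : partial2 (radial f q) = (fun x => 2 * (x - q).2 * radial (derive1 f) q x).
  by apply/funext => y; exact: partial2_radial.
rewrite partial1M//; last exact: smooth_radial.
rewrite partial2M//; last exact: smooth_radial.
rewrite c1 c2 partial1_radial// partial2_radial// /radial {5 6}/sqn.
by move: (derive1 _ _) (derive1 _ _) => a d; rewrite /sqn; ring.
Qed.

End Radial.

(** * Convolution with test functions *)

Section Convolution.
Context {R : realType}.
Local Notation plane := (R * R)%type.
Local Notation P := (mplane R).
Local Notation mu := (@leb2 R).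
Implicit Types (f g h phi chi psi W : plane -> R) (Omega : set plane) (q : plane).

(** The kernel is evaluated at [x - q], not [q - x]: radial kernels do not see the difference, but a
    derivative in [q] brings a minus sign. *)
Definition convol h f q := I2 (fun x => h x * f (x - q)).

Lemma partial_shift f q (x v : plane) : smooth setT f ->
  'D_v (fun y => f (y - q)) x = 'D_v f (x - q).
Proof.
move=> sf; rewrite /derive (_ : (fun h : R => _) =
  (fun h : R => h^-1 *: ((f \o shift (x - q)) (h *: v) - f (x - q))))//.
by apply/funext => h /=; rewrite addrA.
Qed.

Lemma smooth_shift f q : smooth setT f -> smooth setT (fun y => f (y - q)).
Proof.
move=> sf k.
rewrite (_ : (fun y => f (y - q)) = fun y => f (y.1 + - q.1, y.2 + - q.2))//.
apply: (Ck_comp openT openT (fun x _ => I)); first exact: sf.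
  by apply: (@smooth_add _ fst (cst (- q.1))); [exact: smooth_fst|exact: smooth_cst].
by apply: (@smooth_add _ snd (cst (- q.2))); [exact: smooth_snd|exact: smooth_cst].
Qed.

Lemma T_lipschitz Omega f : test_function Omega f -> exists2 L : R, 0 <= L &
  forall x y, `|f x - f y| <= L * `|x - y|.
Proof.
move=> T; have sf := T_smooth T.
have [M1 M10 H1] := T_bounded (T_partial1 T); have [M2 M20 H2] := T_bounded (T_partial2 T).
exists (M1 + M2); first exact: addr_ge0.
move=> x y.
pose v := x - y.
have D s := smooth_is_derive_line y v s sf.
have lt : `|1 - 0 : R| < 2 by rewrite subr0 normr1; lra.
have [c _] := @MVT_unordered _ (fun s : R => f (y + s *: v)) (fun s => 'D_v f (y + s *: v)) 0 1 2 lt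
  (fun s _ => D s).
have -> : y + (1 : R) *: v = x by rewrite scale1r /v addrC subrK.
rewrite scale0r addr0 subr0 mulr1 => ->.
rewrite smooth_derive//; apply: le_trans (ler_normD _ _) _; rewrite !normrM mulrDl.
have /plane_norm_le[h1 h2] := lexx `|x - y|.
by apply: lerD; apply: ler_pM.
Qed.

Lemma conv_L1 Omega h f q : L1 h -> test_function Omega f -> L1 (fun x => h x * f (x - q)).
Proof.
move=> lh T; have [M M0 HM] := T_bounded T.
apply: (L1_dom _ (L1Z M (L1_abs lh))).
  apply: mfun2M; first exact: L1_mfun.
  by apply: smooth_mfun2; apply: smooth_shift; exact: T_smooth T.
by move=> x; rewrite normrM mulrC ler_wpM2r.
Qed.

Lemma conv_lipschitz Omega h f : L1 h -> test_function Omega f -> exists2 L : R, 0 <= L &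
  forall q q', `|convol h f q - convol h f q'| <= L * `|q - q'|.
Proof.
move=> lh T; have [L L0 HL] := T_lipschitz T.
exists (L * I2 (fun x => `|h x|)); first by rewrite mulr_ge0// I2_ge0.
move=> q q'; rewrite /convol -I2B; [|exact: conv_L1 T|exact: conv_L1 T].
apply: le_trans (I2_abs _) _; first by apply: L1B; exact: conv_L1 T.
rewrite mulrAC -I2Z; last exact: L1_abs.
apply: I2_le.
- by apply: L1_abs; apply: L1B; exact: conv_L1 T.
- exact: L1Z (L1_abs lh).
move=> x; rewrite -mulrBr normrM mulrC ler_wpM2r//.
apply: le_trans (HL _ _) _.
by rewrite opprB addrC addrA subrK distrC.
Qed.

Lemma conv_continuous Omega h f : L1 h -> test_function Omega f -> continuous (convol h f).
Proof.
move=> lh T q; have [L L0 HL] := conv_lipschitz lh T.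
apply/cvgrPdist_le => e e0.
have B : nbhs q (ball q (e / (L + 1)) : set plane).
  by apply: nbhsx_ballx; rewrite divr_gt0// ltr_wpDl.
apply: filterS B => y; rewrite -ball_normE /= => h1; apply: le_trans (HL _ _) _.
move: h1; rewrite ltr_pdivlMr ?ltr_wpDl// => /ltW h1.
by apply: le_trans h1; rewrite mulrC ler_wpM2l// lerDl.
Qed.

(** Differentiation under the integral sign along the line [q + t v], dominated by a multiple of
    [|h|]. *)
Lemma is_derive_conv Omega h f q (v : plane) : L1 h -> test_function Omega f ->
  test_function Omega ('D_v f) -> is_derive q v (convol h f) (- convol h ('D_v f) q).
Proof.
move=> lh T TD; have sf := T_smooth T.
have [M M0 HM] := T_bounded TD.
pose F (t : R) (x : P) : R := h x * f ((x : plane) - q + t *: (- v)).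
have I0 : `]-1, 1[%classic (0 : R) by rewrite /= in_itv/=; apply/andP; split; lra.
have dF (t : R) (x : P) : is_derive t (1 : R) (fun s : R => F s x) (h x * 'D_(- v) f ((x : plane) - q + t *: - v)).
  by apply: derZ; exact: smooth_is_derive_line.
have DN (y : plane) : 'D_(- v) f y = - 'D_v f y.
  by rewrite !smooth_derive//=; ring.
have FE t x : F t x = h x * f ((x : plane) - (q + t *: v)).
  by rewrite /F scalerN opprD addrA.
have intF t : `]-1, 1[%classic t -> mu.-integrable setT (EFin \o F t).
  move=> _; apply: (@L1_eq _ (fun x => h x * f (x - (q + t *: v)))); first by move=> x; rewrite -FE.
  exact: conv_L1 T.
have derF t (y : P) : `]-1, 1[%classic t -> [set: P] y -> derivable (F^~ y) t 1.
  by move=> _ _; case: (dF t y).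
pose G (x : P) : R := M * `|h x|.
have G0 y : 0 <= G y by rewrite mulr_ge0.
have intG : mu.-integrable setT (EFin \o G) by exact: (L1Z M (L1_abs lh)).
have D1E t y : partial1of2 F t y = h y * 'D_(- v) f ((y : plane) - q + t *: - v).
  by rewrite /partial1of2; exact: derive1P (dF t y).
have Gub t (y : P) : `]-1, 1[%classic t -> [set: P] y -> `|partial1of2 F t y| <= G y.
  by move=> _ _; rewrite D1E normrM /G mulrC ler_wpM2r// DN normrN.
have E := @differentiation_under_integral _ _ _ mu F setT measurableT 0 (-1) 1 I0
  intF derF G G0 intG Gub.
have dv := @derivable_under_integral _ _ _ mu F setT measurableT 0 (-1) 1 I0
  intF derF G G0 intG Gub.
have line : (fun t : R => \int[mu]_y F t y) = (fun t : R => convol h f (q + t *: v)).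
  by apply/funext => t; apply: I2_eq => x; exact: FE.
rewrite line in E dv.
have dl := derivable_is_derive1 dv.
have val : derive1 (fun t : R => convol h f (q + t *: v)) 0 = - convol h ('D_v f) q.
  rewrite E /convol -I2N; last exact: conv_L1 TD.
  by apply: I2_eq => x; rewrite D1E DN scale0r addr0 mulrN.
rewrite val in dl; case: dl => dl1 dl2.
have EE : (fun t : R => t^-1 *: (convol h f (t *: v + q) - convol h f q)) =
   (fun t : R => t^-1 *: (convol h f (q + (t *: 1 + 0) *: v) - convol h f (q + 0 *: v))).
  by apply/funext => t; rewrite scale0r !addr0 [_ *: v + q]addrC /GRing.scale/= mulr1.
split; first by rewrite /derivable EE.
by rewrite /derive EE.
Qed.

End Convolution.

(** * Dyadic mollifiers *)

Section Mollifiers.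
Context {R : realType}.
Local Notation plane := (R * R)%type.
Local Notation P := (mplane R).
Local Notation mu := (@leb2 R).
Implicit Types (g h phi chi psi W : plane -> R) (Omega : set plane) (q x : plane).

Definition dyad (n : nat) : R := 2^-1 ^+ n.

Lemma dyad_gt0 n : 0 < dyad n. Proof. by rewrite exprn_gt0. Qed.
Lemma dyad_le m n : (m <= n)%N -> dyad n <= dyad m.
Proof. by move=> mn; rewrite /dyad ler_wiXn2l//; lra. Qed.
Lemma dyad_sqr n : 4 ^+ n * dyad n ^+ 2 = 1.
Proof. by rewrite /dyad exprAC -exprMn (_ : 4 * 2^-1 ^+ 2 = 1) ?expr1n//; field. Qed.
Lemma dyad_two n : 2 ^+ n * dyad n = 1.
Proof. by rewrite /dyad -exprMn divff ?expr1n. Qed.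
Lemma dyad_cvg0 : dyad @ \oo --> (0 : R).
Proof. by apply: cvg_expr; rewrite ger0_norm//; lra. Qed.
Lemma dyad_small (e : R) : 0 < e -> exists N, forall n, (N <= n)%N -> dyad n < e.
Proof.
move=> e0; have /cvgrPdist_lt/(_ _ e0)[N _ H] := dyad_cvg0.
by exists N => n /H; rewrite sub0r normrN ger0_norm// ltW// dyad_gt0.
Qed.
Lemma dyadS n : dyad n.+1 = dyad n / 2. Proof. by rewrite /dyad exprSr. Qed.

(** The tail of the geometric series of ratio 1/2 is twice its first term. *)
Lemma geo_cauchy (u : nat -> R) (C : R) N : 0 <= C ->
  (forall n, (N <= n)%N -> `|u n - u n.+1| <= C * dyad n) ->
  cvgn u /\ forall n, (N <= n)%N -> `|u n - limn u| <= 2 * C * dyad n.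
Proof.
move=> C0 H.
have S n k : (N <= n)%N -> `|u n - u (n + k)%N| <= 2 * C * (dyad n - dyad (n + k)%N).
  move=> Nn; elim: k => [|k IH]; first by rewrite addn0 !subrr normr0 mulr0.
  rewrite -(subrK (u (n + k)%N) (u n)) -addrA; apply: le_trans (ler_normD _ _) _.
  have := H (n + k)%N (leq_trans Nn (leq_addr _ _)); move: IH; rewrite addnS dyadS.
  by move: (`|_|) (`|_|) (dyad _) (dyad _) => *; lra.
have cu : cvgn u.
  apply/cauchy_cvgP/cauchy_exP => e e0.
  have c1 : 0 < 2 * C + 1 by rewrite ltr_wpDl// mulr_ge0.
  have [M HM] := dyad_small (divr_gt0 e0 c1).
  exists (u (maxn N M)); exists (maxn N M) => // k /= hk; rewrite -ball_normE /=.
  rewrite -(subnKC hk); apply: le_lt_trans (S _ _ (leq_maxl _ _)) _.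
  have := HM _ (leq_maxr N M); rewrite ltr_pdivlMr//.
  have a0 := dyad_gt0 (maxn N M); have c0 := dyad_gt0 (maxn N M + (k - maxn N M)).
  move: (dyad _) (dyad _) a0 c0 => a c a0 c0.
  have h1 : 0 <= C * a by rewrite mulr_ge0// ltW.
  by move=> h2; lra.
split => // n Nn.
have c1 : (fun k => `|u n - u (n + k)%N|) @ \oo --> `|u n - limn u|.
  apply: (@cvg_norm _ R^o); apply: cvgB; first exact: cvg_cst.
  rewrite (_ : (fun k => u (n + k)%N) = (fun k => u (k + n)%N)).
    by rewrite (cvg_shiftn n u).
  by apply/funext => k; rewrite addnC.
rewrite -(cvg_lim (@Rhausdorff R) c1); apply: limr_le; first exact: cvgP c1.
apply: nearW => k; apply: le_trans (S n k Nn) _.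
by rewrite ler_wpM2l ?mulr_ge0// gerBl ltW// dyad_gt0.
Qed.

Lemma I2_pos_open h (x0 : plane) : continuous h -> L1 h -> (forall x, 0 <= h x) ->
  0 < h x0 -> 0 < I2 h.
Proof.
move=> ch lh h0 hx.
have h20 : 0 < h x0 / 2 by rewrite divr_gt0.
have /cvgrPdist_lt/(_ _ h20)/nbhs_ballP[d /= d0 Hd] := ch x0.
have lb : L1 (fun x => (h x0 / 2) * \1_(ball x0 d : set plane) x).
  apply: L1Z; apply: L1_indic; first exact: measurable_plane_ball.
  by rewrite leb2_ball ?ltry// ltW.
apply: (@lt_le_trans _ _ (I2 (fun x => (h x0 / 2) * \1_(ball x0 d : set plane) x))).
  rewrite I2Z; last first.
    by apply: L1_indic; [exact: measurable_plane_ball|rewrite leb2_ball ?ltry// ltW].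
  rewrite I2_indic; last exact: measurable_plane_ball.
  by rewrite leb2_ball ?ltW//= mulr_gt0 ?divr_gt0// exprn_gt0// mulrn_wgt0.
apply: I2_le => // x; rewrite indicE; case: (boolP (x \in _)) => [|_]; last by rewrite mulr0.
rewrite inE mulr1 => bx; have := Hd _ bx; rewrite ltr_norml => /andP[_].
by move: (h x0) (h x) => u v; lra.
Qed.

Variables (b p : R -> R).
Hypotheses (sb : smooth1 b) (sp : smooth1 p) (b0 : forall s, 0 <= b s) (p0 : forall s, 0 <= p s)
  (bz : forall s, 1 <= s -> b s = 0) (pz : forall s, 1 <= s -> p s = 0)
  (ode : forall s, 4 * (derive1 p s + s * derive1 (derive1 p) s) = b s - 4 * b (4 * s)).

(** Kernel at scale [2^-n], as a function of the squared radius. The factor [4^n] is the planar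
    Jacobian, so all these kernels have the mass of [b]; the potentials [pf n] carry no factor, as
    two derivatives produce it. *)
Definition kf n (s : R) : R := 4 ^+ n * b (4 ^+ n * s + 0).
Definition pf n (s : R) : R := p (4 ^+ n * s + 0).
Definition sq (f : R -> R) (x : plane) : R := f (sqn x).

Lemma smooth1_kf n : smooth1 (kf n).
Proof.
apply: smooth1_mul; first exact: smooth1_cst.
exact: smooth1_comp sb (smooth1_affine _ _).
Qed.
Lemma smooth1_pf n : smooth1 (pf n).
Proof. exact: smooth1_comp sp (smooth1_affine _ _). Qed.

Lemma dyad_out n (s : R) : dyad n ^+ 2 <= s -> 1 <= 4 ^+ n * s + 0.
Proof. by move=> h; rewrite addr0 -[leLHS](dyad_sqr n) ler_wpM2l// exprn_ge0. Qed.

Lemma kf_out n s : dyad n ^+ 2 <= s -> kf n s = 0.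
Proof. by move=> /dyad_out/bz h; rewrite /kf h mulr0. Qed.
Lemma pf_out n s : dyad n ^+ 2 <= s -> pf n s = 0.
Proof. by move=> /dyad_out/pz. Qed.

Lemma derive_pf n s : derive1 (pf n) s = 4 ^+ n * derive1 p (4 ^+ n * s + 0) /\
  derive1 (derive1 (pf n)) s = 4 ^+ n * (4 ^+ n * derive1 (derive1 p) (4 ^+ n * s + 0)).
Proof.
have dl (t : R) : is_derive t (1 : R) (fun s => 4 ^+ n * s + 0) (4 ^+ n).
  have := derD (derZ (4 ^+ n) (is_derive_id t (1 : R))) (is_derive_cst (0 : R) t (1 : R)).
  by rewrite mulr1 addr0.
have E1 t : derive1 (pf n) t = 4 ^+ n * derive1 p (4 ^+ n * t + 0).
  rewrite mulrC; apply: derive1P; apply: (is_derive1_comp2 _ (dl t)).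
  exact: derivable_is_derive1 (smooth1_derivable sp).
split; first exact: E1.
have -> : derive1 (pf n) = (fun t => 4 ^+ n * derive1 p (4 ^+ n * t + 0)).
  by apply/funext => t; exact: E1.
apply: derive1P; apply: derZ; rewrite mulrC; apply: (is_derive1_comp2 _ (dl s)).
exact: derivable_is_derive1 (smooth1_derivable (smooth1_derive sp)).
Qed.

(** The rescaled profile equation. Kernels of consecutive scales thus differ by a Laplacian, which
    the Dirichlet equation can evaluate. *)
Lemma laplacian_pf n q x :
  partial1 (partial1 (radial (pf n) q)) x + partial2 (partial2 (radial (pf n) q)) x =
  radial (kf n) q x - radial (kf n.+1) q x.
Proof.
rewrite laplacian_radial; last exact: smooth1_pf.
have [-> ->] := derive_pf n (sqn (x - q)); rewrite /radial /kf; move: (sqn _) => s.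
have := ode (4 ^+ n * s + 0).
rewrite exprS (_ : 4 * 4 ^+ n * s + 0 = 4 * (4 ^+ n * s + 0)); last by ring.
move: (derive1 (derive1 p) _) (derive1 p _) (b (4 * _)) (b _) => d2 d1 b2 b1 E.
transitivity (4 ^+ n * (4 * (d1 + (4 ^+ n * s + 0) * d2))); first by ring.
by rewrite E; ring.
Qed.

Lemma T_sq f (rho : R) : smooth1 f -> 0 < rho -> (forall s, rho ^+ 2 <= s -> f s = 0) ->
  test_function setT (sq f).
Proof.
move=> sf rho0 fz; have := @T_radial _ setT f 0 rho sf rho0 fz (@subsetT _ _).
by rewrite (_ : radial f 0 = sq f)//; apply/funext => x; rewrite /radial subr0.
Qed.

Lemma T_sq_kf n : test_function setT (sq (kf n)).
Proof. exact: T_sq (smooth1_kf n) (dyad_gt0 n) (@kf_out n). Qed.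
Lemma T_sq_pf n : test_function setT (sq (pf n)).
Proof. exact: T_sq (smooth1_pf n) (dyad_gt0 n) (@pf_out n). Qed.

Lemma sq_scale (f : R -> R) n x : f (4 ^+ n * sqn x + 0) = sq f (0 + (2 ^+ n) *: x).
Proof.
by rewrite add0r addr0 /sq; congr f; rewrite /sqn /= !exprMn -!exprM mulnC !exprM -mulrDr; congr (_ ^+ n * _); ring.
Qed.

Definition mass := I2 (sq b).

Lemma I2_sq_scale (f : R -> R) n : L1 (sq f) ->
  I2 (fun x => f (4 ^+ n * sqn x + 0)) = dyad n ^+ 2 * I2 (sq f).
Proof.
move=> lf; rewrite (I2_eq (fun x => sq_scale f n x)) I2_scale ?exprn_gt0//; congr (_ * _).
by rewrite /dyad !exprVn.
Qed.

Lemma T_sq_b : test_function setT (sq b).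
Proof. by apply: (@T_sq _ 1 sb) => // s; rewrite expr1n; exact: bz. Qed.
Lemma T_sq_p : test_function setT (sq p).
Proof. by apply: (@T_sq _ 1 sp) => // s; rewrite expr1n; exact: pz. Qed.

Lemma I2_kf n : I2 (sq (kf n)) = mass.
Proof.
rewrite (I2Z (4 ^+ n) (f := fun x => b (4 ^+ n * sqn x + 0))); last first.
  apply: (L1_eq (fun x => esym (sq_scale b n x))).
  by apply: L1_scale; [rewrite exprn_gt0|exact: T_L1 T_sq_b].
by rewrite (@I2_sq_scale b n (T_L1 T_sq_b)) mulrA dyad_sqr mul1r.
Qed.

Lemma I2_pf n : I2 (sq (pf n)) = dyad n ^+ 2 * I2 (sq p).
Proof. by apply: I2_sq_scale; exact: T_L1 T_sq_p. Qed.

(** The kernel is supported in a square of side [2 * dyad n], whence the area [4 * dyad n ^+ 2]. *)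
Lemma conv_bound W f (B C : R) n q : mfun2 W -> (forall x, `|W x| <= B) -> mfun2 f ->
  (forall x, `|f x| <= C) -> (forall x, ~ (ball (0 : plane) (dyad n) : set plane) x -> f x = 0) ->
  `|convol W f q| <= B * C * (4 * dyad n ^+ 2).
Proof.
move=> mW WB mf fC fz.
have B0 : 0 <= B by exact: le_trans (WB 0).
have -> : B * C * (4 * dyad n ^+ 2) = (B * C) * (dyad n *+ 2) ^+ 2 by rewrite -mulr_natl; ring.
apply: (@I2_bounded_supp _ _ (B * C) q (dyad n)); first by rewrite ltW ?dyad_gt0.
- apply: mfun2M => //; apply: (@mfun2_comp _ f (fun x : P => (x : plane) - q)) => //.
  by have [] := mpres_ext (fun x : P => addrC _ _) (mpres_translation (- q)).
- by move=> x; rewrite normrM ler_pM.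
move=> x nb; rewrite fz ?mulr0// => /plane_ballP[]; rewrite /= !sub0r !normrN => h1 h2.
by apply: nb; apply/plane_ballP; rewrite ![`|q.1 - _|]distrC ![`|q.2 - _|]distrC.
Qed.

Lemma sq_out f n x : (forall s, dyad n ^+ 2 <= s -> f s = 0) ->
  ~ (ball (0 : plane) (dyad n) : set plane) x -> sq f x = 0.
Proof.
by move=> fz nb; apply: fz; have := sqn_out (dyad_gt0 n) nb; rewrite subr0.
Qed.

Lemma conv_pf_bound : exists2 C : R, 0 <= C & forall W (B : R) n q, mfun2 W ->
  (forall x, `|W x| <= B) -> `|convol W (sq (pf n)) q| <= B * C * dyad n ^+ 2.
Proof.
have [C C0 HC] := T_bounded T_sq_p.
exists (C * 4); first exact: mulr_ge0.
move=> W B n q mW WB; have := @conv_bound W (sq (pf n)) B C n q mW WB.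
rewrite !mulrA => -> //.
- exact: smooth_mfun2 (T_smooth (T_sq_pf n)).
- by move=> x; have := HC (0 + 2 ^+ n *: x); rewrite -sq_scale.
- by move=> x; apply: sq_out; exact: pf_out.
Qed.

(** At [t = 1] the vanishing follows from the right, by continuity of the derivative. *)
Lemma derive1_out (t : R) : 1 <= t -> derive1 p t = 0.
Proof.
have c : continuous (derive1 p) by exact: smooth1_continuous (smooth1_derive sp).
have z u : 1 < u -> derive1 p u = 0.
  move=> u1; apply: derive1P; apply: is_derive_near0.
  by near=> y; apply: pz; apply: ltW; near: y; exact: lt_nbhsr.
rewrite le_eqVlt => /predU1P[<-|/z//].
have s n : 1 < 1 + n.+1%:R^-1 :> R by rewrite ltrDl.
have cs : (fun n => 1 + n.+1%:R^-1 : R) @ \oo --> (1 : R).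
  rewrite -[X in _ --> X]addr0; apply: seq_cvgD; [exact: cvg_cst|by have := @cvg_harmonic R].
have h := cvg_comp _ _ cs (c 1).
rewrite -(cvg_lim (@Rhausdorff R) h); apply/cvg_lim => //.
rewrite (_ : _ \o _ = cst 0); first exact: cvg_cst.
by apply/funext => n; exact: z.
Unshelve. all: by end_near. Qed.

Lemma partial_sq_pf n x : partial1 (sq (pf n)) x = 2 ^+ n * partial1 (sq p) (2 ^+ n *: x) /\
  partial2 (sq (pf n)) x = 2 ^+ n * partial2 (sq p) (2 ^+ n *: x).
Proof.
have E f : sq f = radial f 0 by apply/funext => y; rewrite /radial subr0.
have s1 := smooth1_pf n.
rewrite !E !partial1_radial// !partial2_radial// !subr0 /radial !subr0 (derive_pf n _).1.
have -> : derive1 p (4 ^+ n * sqn x + 0) = derive1 p (sqn (2 ^+ n *: x)).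
  by rewrite (sq_scale (derive1 p)) add0r.
have -> : (4 : R) ^+ n = 2 ^+ n * 2 ^+ n by rewrite -exprMn; congr (_ ^+ n); ring.
by set d := derive1 p _; rewrite /= /GRing.scale /=; split; ring.
Qed.

(** A derivative costs a factor [2^n], so one power of [dyad n] remains: still summable, which is
    what makes the gradients converge. *)
Lemma conv_partial_pf_bound : exists2 C : R, 0 <= C & forall W (B : R) n q, mfun2 W ->
  (forall x, `|W x| <= B) -> `|convol W (partial1 (sq (pf n))) q| <= B * C * dyad n /\
    `|convol W (partial2 (sq (pf n))) q| <= B * C * dyad n.
Proof.
have [C1 C10 H1] := T_bounded (T_partial1 T_sq_p); have [C2 C20 H2] := T_bounded (T_partial2 T_sq_p).
exists ((C1 + C2) * 4 ); first by rewrite mulr_ge0// addr_ge0.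
move=> W B n q mW WB.
have B0 : 0 <= B by exact: le_trans (WB 0).
have key (f : plane -> R) (C : R) : 0 <= C -> C <= C1 + C2 -> mfun2 f -> (forall x, `|f x| <= 2 ^+ n * C) ->
    (forall x, ~ (ball (0 : plane) (dyad n) : set plane) x -> f x = 0) ->
    `|convol W f q| <= B * ((C1 + C2) * 4) * dyad n.
  move=> C0 CC mf fC fz; apply: le_trans (conv_bound q mW WB mf fC fz) _.
  have -> : B * (2 ^+ n * C) * (4 * dyad n ^+ 2) = (B * 4 * dyad n) * C * (2 ^+ n * dyad n) by ring.
  have -> : B * ((C1 + C2) * 4) * dyad n = (B * 4 * dyad n) * (C1 + C2) by ring.
  by rewrite dyad_two mulr1 ler_wpM2l// !mulr_ge0// ltW// dyad_gt0.
have E f : sq f = radial f 0 by apply/funext => y; rewrite /radial subr0.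
have s1 := smooth1_pf n.
have dz s : dyad n ^+ 2 <= s -> derive1 (pf n) s = 0.
  move=> h; rewrite (derive_pf n s).1; have := dyad_out h; move: (_ + 0) => t t1.
  suff -> : derive1 p t = 0 by rewrite mulr0.
  exact: derive1_out.
split.
  apply: (key _ C1) => //.
  - by rewrite lerDl.
  - exact: smooth_mfun2 (T_smooth (T_partial1 (T_sq_pf n))).
  - by move=> x; rewrite (partial_sq_pf n x).1 normrM ger0_norm ?exprn_ge0// ler_wpM2l// exprn_ge0.
  - move=> x nb; rewrite E partial1_radial// /radial dz ?mulr0// subr0.
    by have := sqn_out (dyad_gt0 n) nb; rewrite subr0.
apply: (key _ C2) => //.
- by rewrite lerDr.
- exact: smooth_mfun2 (T_smooth (T_partial2 (T_sq_pf n))).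
- by move=> x; rewrite (partial_sq_pf n x).2 normrM ger0_norm ?exprn_ge0// ler_wpM2l// exprn_ge0.
- move=> x nb; rewrite E partial2_radial// /radial dz ?mulr0// subr0.
  by have := sqn_out (dyad_gt0 n) nb; rewrite subr0.
Qed.

End Mollifiers.

(** * Identification of limits of mollifications almost everywhere *)

Section InteriorRegularity.
Context {R : realType}.
Local Notation plane := (R * R)%type.
Local Notation P := (mplane R).
Local Notation mu := (@leb2 R).
Implicit Types (g h phi chi psi W H : plane -> R) (Omega V : set plane) (q x : plane).

(** Lindelof: countably many rational squares suffice to cover [Omega], and a countable union of
    null sets is null. *)
Lemma ae_cover Omega (Q : plane -> Prop) : open Omega ->
  (forall q, Omega q -> exists2 r : R, 0 < r & {ae mu, forall x : P, (ball q r : set plane) x -> Q x}) ->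
  {ae mu, forall x : P, Omega x -> Q x}.
Proof.
move=> oO H.
pose Bt (t : rat * rat * nat) : set plane := ball (ratr t.1.1 : R, ratr t.1.2 : R) (t.2.+1%:R^-1).
pose A i : P -> Prop := fun x => if (unpickle i : option (rat * rat * nat)) is Some t then
   (if `[< {ae mu, forall x : P, Bt t x -> Q x} >] then (Bt t x -> Q x) else True) else True.
have aeA i : {ae mu, forall x, A i x}.
  rewrite /A; case: (unpickle i) => [t|]; last exact: aeW.
  by case: asboolP => // _; exact: aeW.
have := @ae_foralln _ _ _ mu A aeA.
apply: (@filterS _ _ (ae_filter_ringOfSetsType mu)) => x Ax Ox.
have [r r0 Hr] := H x Ox.
have oB : open (ball x r : set plane) by exact: ball_open.
have [t [tO tx]] := rat_ball_basis oB (ballxx x r0).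
have := Ax (pickle t); rewrite /A pickleK asboolT; first exact.
apply: (@filterS _ _ (ae_filter_ringOfSetsType mu) _ _ _ Hr) => y Hy By; apply/Hy/tO.
by apply: le_ball By; rewrite lerDl invr_ge0.
Qed.

Lemma dirichlet_data_weak Omega W psi g1 g2 chi : dirichlet_data Omega W psi g1 g2 ->
  test_function Omega chi ->
  ip psi (partial1 chi) = - ip g1 chi /\ ip psi (partial2 chi) = - ip g2 chi.
Proof.
move=> [[lp l1 l2] _ [phi [T [a a1 a2]]] _] Tc.
have lphi n := T_L2 (T n); have lp1 n := T_L2 (T_partial1 (T n)).
have lp2 n := T_L2 (T_partial2 (T n)); have lc := T_L2 Tc.
have lc1 := T_L2 (T_partial1 Tc); have lc2 := T_L2 (T_partial2 Tc).
split.
  have h1 := ip_cvg lphi lp lc1 a; have h2 := seq_cvgN (ip_cvg lp1 l1 lc a1).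
  apply: (cvg_unique (@Rhausdorff R) h1); move: h2.
  rewrite (_ : (fun n => - _) = (fun n => ip (phi n) (partial1 chi)))//.
  by apply/funext => n; rewrite /ip (ibp1 (T_smooth (T n)) Tc).
have h1 := ip_cvg lphi lp lc2 a; have h2 := seq_cvgN (ip_cvg lp2 l2 lc a2).
apply: (cvg_unique (@Rhausdorff R) h1); move: h2.
rewrite (_ : (fun n => - _) = (fun n => ip (phi n) (partial2 chi)))//.
by apply/funext => n; rewrite /ip (ibp2 (T_smooth (T n)) Tc).
Qed.

Lemma convol_partial h (f : R -> R) q : smooth1 f ->
  convol h (partial1 (sq f)) q = ip h (partial1 (radial f q)) /\
  convol h (partial2 (sq f)) q = ip h (partial2 (radial f q)).
Proof.
move=> sf; have s : smooth setT (sq f).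
  have := @smooth_radial _ f 0 sf.
  by rewrite (_ : radial f 0 = sq f)//; apply/funext => x; rewrite /radial subr0.
by split; apply: I2_eq => x; congr (_ * _); exact/esym/(@partial_shift R (sq f) q x _ s).
Qed.

Variables (b p : R -> R).
Hypotheses (sb : smooth1 b) (sp : smooth1 p) (b0 : forall s, 0 <= b s) (p0 : forall s, 0 <= p s)
  (bz : forall s, 1 <= s -> b s = 0) (pz : forall s, 1 <= s -> p s = 0)
  (ode : forall s, 4 * (derive1 p s + s * derive1 (derive1 p) s) = b s - 4 * b (4 * s)).

Local Notation J n h q := (convol h (sq (kf b n)) q).

Section Identification.
Variables (h H : plane -> R) (V : set plane) (C : R) (N : nat) (M : R).
Hypotheses (lh : L1 h) (oV : open V) (C0 : 0 <= C) (VM : V `<=` (ball (0 : plane) M : set plane))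
  (JH : forall q n, V q -> (N <= n)%N -> `|J n h q - H q| <= C * dyad n)
  (cH : forall q, V q -> {for q, continuous H}).

Let k n : plane -> R := sq (kf b n).
Let Tk n : test_function setT (k n) := T_sq_kf sb bz n.
Let k0 n x : 0 <= k n x. Proof. by rewrite /k /sq /kf mulr_ge0// exprn_ge0. Qed.

(** A Lipschitz function varies by O(2^-n) on the support of the kernel, uniformly in its centre. *)
Let conv_k chi : test_function V chi -> exists2 L, 0 <= L &
  forall n x, `|I2 (fun q => k n (x - q) * chi q) - mass b * chi x| <= L * dyad n.
Proof.
move=> T; have [L L0 HL] := T_lipschitz T; have mass0 : 0 <= mass b by apply: I2_ge0 => y; exact: b0.
exists (L * mass b); first exact: mulr_ge0.
move=> n x; have lchi := T_L1 T.
have [Mk Mk0 HMk] := T_bounded (Tk n).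
have ks q : k n (x - q) = k n (q - x) by rewrite /k /sq /sqn /= -opprB sqrrN -[x.2 - _]opprB sqrrN.
have lk : L1 (fun q => k n (q - x)).
  by apply: (T_L1 (Omega := setT)); split; [exact: smooth_shift (T_smooth (Tk n))|];
    have [_ [K [cK _ Kz]]] := T_radial (q := x) (Omega := setT) (smooth1_kf sb n) (dyad_gt0 n) (kf_out bz (n := n)) (@subsetT _ _);
    exists K; split.
have Ik : I2 (fun q => k n (q - x)) = mass b.
  rewrite -(I2_kf sb bz n) -(mpres_I2 (mpres_translation (- x)) (T_L1 (Tk n))).
  by apply: I2_eq => q /=; rewrite addrC.
have lkc : L1 (fun q => k n (x - q) * chi q).
  apply: (L1_dom _ (L1Z Mk (L1_abs lchi))) => [|q].
    apply: mfun2M; last exact: L1_mfun.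
    by rewrite (_ : (fun q => _) = fun q => k n (q - x)); [exact: L1_mfun|apply/funext].
  by rewrite normrM ler_wpM2r.
have E1 : mass b * chi x = I2 (fun q => chi x * k n (q - x)) by rewrite I2Z// Ik mulrC.
have E2 : L * mass b * dyad n = I2 (fun q => L * dyad n * k n (q - x)) by rewrite I2Z// Ik mulrAC.
have lB : L1 (fun q => k n (x - q) * chi q - chi x * k n (q - x)) by apply: L1B => //; exact: L1Z.
rewrite E1 E2 -I2B//; last exact: L1Z.
apply: le_trans (I2_abs lB) _; apply: I2_le; [exact: L1_abs lB|exact: L1Z|].
move=> q; rewrite ks [chi x * _]mulrC -mulrBr normrM ger0_norm// mulrC.
have [bq|nb] := pselect ((ball (0 : plane) (dyad n) : set plane) (q - x)); last first.
  have -> : k n (q - x) = 0 by apply: (sq_out (kf_out bz (n := n))).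
  by rewrite !mulr0.
rewrite ler_wpM2r//; apply: le_trans (HL _ _) _; rewrite ler_wpM2l//.
by move: bq; rewrite -ball_normE /= sub0r normrN => /ltW.
Qed.

(** Paired with a test function, the mollifications tend to [mass b * h] after Fubini, and to [H] by
    uniform convergence; the fundamental lemma identifies the two. *)
Lemma convol_limit_ae : {ae mu, forall x : P, V x -> mass b * h x = H x}.
Proof.
have mV := open_measurable2 oV.
have [Mk Mk0 HMk] := T_bounded (Tk N).
have lN q : `|J N h q| <= Mk * I2 (fun x => `|h x|).
  apply: le_trans (I2_abs (conv_L1 q lh (Tk N))) _.
  rewrite -I2Z; last exact: L1_abs.
  apply: I2_le; [exact: L1_abs (conv_L1 q lh (Tk N))|exact: L1Z (L1_abs lh)|].
  by move=> x; rewrite normrM mulrC ler_wpM2r.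
have mH : mfun2 (H \_ V).
  apply/(measurable_restrictT _ mV); exact: open_continuous_measurable2.
have HB x : `|(H \_ V) x| <= C * dyad N + Mk * I2 (fun x => `|h x|).
  have nn : 0 <= C * dyad N + Mk * I2 (fun x => `|h x|).
    apply: addr_ge0; apply: mulr_ge0 => //; first by rewrite ltW// dyad_gt0.
    by apply: I2_ge0 => y.
  have [Vx|nV] := pselect (V x); last by rewrite patch_out// normr0.
  rewrite patch_in// -(subrK (J N h x) (H x)); apply: le_trans (ler_normD _ _) _.
  by rewrite lerD// distrC JH.
have lH : L1 (H \_ V).
  by apply: (L1_bounded_supp mH HB (x := 0) (r := M)) => y nb; rewrite patch_out// => /VM.
have lhV : L1 (h \_ V).
  apply: (L1_dom (mfun2_patch mV (L1_mfun lh)) (L1_abs lh)) => x.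
  by rewrite patchE; case: ifP; rewrite ?normr0.
have lf : L1 (fun x => mass b * (h \_ V) x - (H \_ V) x) by apply: L1B => //; exact: L1Z.
have z x : ~ V x -> mass b * (h \_ V) x - (H \_ V) x = 0.
  by move=> nV; rewrite !patch_out// mulr0 subrr.
have := fundamental_lemma oV lf z => F.
apply: (@filterS _ _ (ae_filter_ringOfSetsType mu) _ _ _ (F _)) => [x E Vx|chi T].
  by move: E; rewrite !patch_in// => /eqP; rewrite subr_eq0 => /eqP.
have [L L0 HL] := conv_k T.
have lchi := T_L1 T; have [Mc Mc0 HMc] := T_bounded T.
have mchi : mfun2 chi by exact: L1_mfun.
have bm (f : plane -> R) : L1 f -> L1 (fun x => f x * chi x).
  move=> l; apply: (L1_dom (mfun2M (L1_mfun l) mchi) (L1Z Mc (L1_abs l))) => x.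
  by rewrite normrM mulrC ler_wpM2r.
have hc : I2 (fun x => (h \_ V) x * chi x) = I2 (fun x => h x * chi x).
  apply: I2_eq => x; have [Vx|nV] := pselect (V x); first by rewrite patch_in.
  by rewrite (T_out T nV) !mulr0.
have est n : (N <= n)%N -> `|mass b * I2 (fun x => h x * chi x) - I2 (fun x => (H \_ V) x * chi x)| <=
    (L * I2 (fun x => `|h x|) + C * I2 (fun x => `|chi x|)) * dyad n.
  move=> Nn; have [Mn Mn0 HMn] := T_bounded (Tk n).
  have swap : I2 (fun q => I2 (fun x => h x * k n (x - q) * chi q)) =
      I2 (fun x => I2 (fun q => h x * k n (x - q) * chi q)).
    apply: (I2_swap (F := fun q x => h x * k n (x - q) * chi q) (f := fun q => Mn * `|chi q|) (g := fun x => `|h x|)).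
    - apply: (measurable_funM (measurable_funM _ _) _).
      + exact: (measurableT_comp (L1_mfun lh) measurable_snd).
      + have mk := smooth_mfun2 (T_smooth (Tk n)).
        apply: (measurableT_comp mk).
        have m1 : measurable_fun (setT : set (P * P)%type) (fun z : (P * P)%type => z.2.1 - z.1.1 : mline R).
          apply: measurable_funB; first exact: (measurableT_comp measurable_fst measurable_snd).
          exact: (measurableT_comp measurable_fst measurable_fst).
        have m2 : measurable_fun (setT : set (P * P)%type) (fun z : (P * P)%type => z.2.2 - z.1.2 : mline R).
          apply: measurable_funB; first exact: (measurableT_comp measurable_snd measurable_snd).
          exact: (measurableT_comp measurable_snd measurable_fst).
        exact: (measurable_fun_pair m1 m2).
      + exact: (measurableT_comp mchi measurable_fst).
    - exact: L1Z (L1_abs lchi).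
    - exact: L1_abs.
    - by move=> q; rewrite mulr_ge0.
    - by [].
    - move=> q x; have := HMn (x - q); move: (k n _) => u hu.
      have -> : h x * u * chi q = u * (chi q * h x) by ring.
      by rewrite !normrM -[leRHS]mulrA; apply: ler_wpM2r => //; rewrite mulr_ge0.
  have E1 : I2 (fun q => J n h q * chi q) = I2 (fun q => I2 (fun x => h x * k n (x - q) * chi q)).
    apply: I2_eq => q; rewrite mulrC -I2Z; last exact: conv_L1 (Tk n).
    by apply: I2_eq => x; rewrite mulrC.
  have E2 : I2 (fun x => I2 (fun q => h x * k n (x - q) * chi q)) =
      I2 (fun x => h x * I2 (fun q => k n (x - q) * chi q)).
    apply: I2_eq => x; rewrite -I2Z; first by apply: I2_eq => q; rewrite mulrA.
    apply: (L1_dom _ (L1Z Mn (L1_abs lchi))) => [|q]; last by rewrite normrM ler_wpM2r.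
    apply: mfun2M mchi; apply: (@mfun2_comp _ (k n) (fun q : P => x - (q : plane))).
      exact: smooth_mfun2 (T_smooth (Tk n)).
    apply: continuous_measurable_map => y; apply: cvgB; [exact: cvg_cst|exact: cvg_id].
  have cJ : continuous (fun q => J n h q) by exact: conv_continuous lh (Tk n).
  have JB q : `|J n h q| <= Mn * I2 (fun x => `|h x|).
    apply: le_trans (I2_abs (conv_L1 q lh (Tk n))) _.
    rewrite -I2Z; last exact: L1_abs.
    apply: I2_le; [exact: L1_abs (conv_L1 q lh (Tk n))|exact: L1Z (L1_abs lh)|].
    by move=> x; rewrite normrM mulrC ler_wpM2r.
  have lJ : L1 (fun q => J n h q * chi q).
    apply: (L1_dom (mfun2M (continuous_measurable2 cJ) mchi) (L1Z (Mn * I2 (fun x => `|h x|)) (L1_abs lchi))).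
    by move=> q; rewrite normrM ler_wpM2r.
  have A : `|I2 (fun q => J n h q * chi q) - I2 (fun x => (H \_ V) x * chi x)| <= C * dyad n * I2 (fun x => `|chi x|).
    have lHc := bm _ lH.
    apply: (I2_dist_le lJ lHc (L1_abs lchi)) => x; rewrite -mulrBl normrM; have [Vx|nV] := pselect (V x).
      by rewrite (patch_in _ Vx); apply: (ler_wpM2r (normr_ge0 _)); exact: JH.
    by rewrite (T_out T nV) normr0 !mulr0.
  have lconv : L1 (fun x => h x * I2 (fun q => k n (x - q) * chi q)).
    have ksum x : I2 (fun q => k n (x - q) * chi q) = convol chi (k n) x.
      apply: I2_eq => q; rewrite mulrC; congr (_ * _).
      by rewrite /k /sq /sqn /= -[x.1 - _]opprB sqrrN -[x.2 - _]opprB sqrrN.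
    have cc : continuous (fun x => I2 (fun q => k n (x - q) * chi q)).
      by rewrite (funext ksum); exact: conv_continuous lchi (Tk n).
    apply: (L1_dom (mfun2M (L1_mfun lh) (continuous_measurable2 cc))
      (L1Z (L * dyad n + `|mass b| * Mc) (L1_abs lh))) => x.
    rewrite normrM mulrC ler_wpM2r//.
    rewrite -(subrK (mass b * chi x) (I2 _)); apply: le_trans (ler_normD _ _) _.
    by rewrite lerD// normrM ler_wpM2l.
  have lhc := bm _ lh.
  have B : `|I2 (fun x => h x * I2 (fun q => k n (x - q) * chi q)) - mass b * I2 (fun x => h x * chi x)| <=
      L * dyad n * I2 (fun x => `|h x|).
    rewrite -(I2Z (mass b) lhc); apply: (I2_dist_le lconv (L1Z _ lhc) (L1_abs lh)) => x.
    rewrite (_ : _ - _ = h x * (I2 (fun q => k n (x - q) * chi q) - mass b * chi x)); last by ring.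
    by rewrite normrM mulrC ler_wpM2r.
  rewrite -E2 -swap -E1 in B; move: A B.
  move: (I2 (fun q => J n h q * chi q)) (I2 (fun x => (H \_ V) x * chi x)) (mass b * I2 _) => u v w A B.
  rewrite -(subrK u w) -addrA; apply: le_trans (ler_normD _ _) _.
  by rewrite distrC mulrDl; apply: lerD; [rewrite mulrAC|rewrite mulrAC].
rewrite (@I2_eq _ _ (fun x => mass b * ((h \_ V) x * chi x) - (H \_ V) x * chi x)); last by move=> x; ring.
rewrite I2B; [|exact: L1Z (bm _ lhV)|exact: bm].
rewrite I2Z; last exact: bm.
rewrite hc; apply/eqP; rewrite -normr_le0.
set K := L * _ + _ in est.
have cK : (fun n => K * dyad n) @ \oo --> 0.
  by rewrite -[X in _ --> X](mulr0 K); apply: seq_cvgZ; exact: dyad_cvg0.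
rewrite -(cvg_lim (@Rhausdorff R) cK); apply: limr_ge; first exact: cvgP cK.
by exists N => // n /= Nn; exact: est.
Qed.

End Identification.
End InteriorRegularity.

(** * Interior C^1 regularity of the stream function *)

Section Potential.
Context {R : realType}.
Local Notation plane := (R * R)%type.
Local Notation P := (mplane R).
Local Notation mu := (@leb2 R).
Implicit Types (h H : plane -> R) (q x y v : plane).

Variables (b p : R -> R).
Hypotheses (sb : smooth1 b) (sp : smooth1 p) (b0 : forall s, 0 <= b s) (p0 : forall s, 0 <= p s)
  (bz : forall s, 1 <= s -> b s = 0) (pz : forall s, 1 <= s -> p s = 0)
  (ode : forall s, 4 * (derive1 p s + s * derive1 (derive1 p) s) = b s - 4 * b (4 * s)).
Local Notation J n h q := (convol h (sq (kf b n)) q).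

Variables (Omega : set plane) (M B : R) (W psi g1 g2 : plane -> R).
Hypotheses (oO : open Omega) (M0 : 0 < M) (OM : Omega `<=` (ball (0 : plane) M : set plane))
  (mW : mfun2 W) (WB : forall x, `|W x| <= B) (D : dirichlet_data Omega W psi g1 g2).

(** The factor 4 leaves room for kernels of radius [dyad n], with doubled support, centred at any
    point within [dyad n] of [q]. *)
Definition good n q := (ball q (4 * dyad n) : set plane) `<=` Omega.

Let B0 : 0 <= B. Proof. exact: le_trans (WB 0). Qed.

Let goodS n q : good n q -> good n.+1 q.
Proof.
move=> g x bx; apply: g; apply: le_ball bx; rewrite ler_wpM2l//; exact: dyad_le.
Qed.

Let good_le m n q : (m <= n)%N -> good m q -> good n q.
Proof. by move=> mn; rewrite -(subnK mn); elim: (n - m)%N => // k IH /IH/goodS. Qed.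

Lemma good_in n q : good n q -> Omega q.
Proof. by apply; apply: ballxx; rewrite mulr_gt0// dyad_gt0. Qed.

Lemma good_ex q : Omega q -> exists N, forall y, (ball q (dyad N) : set plane) y ->
  forall n, (N <= n)%N -> good n y.
Proof.
move=> Oq; have /nbhs_ballP[e /= e0 eO] : nbhs q Omega by exact: open_nbhs_nbhs.
(* [y] is within [dyad N] of [q] and [x] within [4 * dyad n] of [y]: in total less than five eighths
   of [e]. *)
have e8 : 0 < e / 8 by rewrite divr_gt0.
have [N HN] := dyad_small e8; exists N => y qy n Nn x yx; apply: eO.
have := HN _ Nn; have := HN _ (leqnn N); have := dyad_gt0 (R := R) n; move: qy yx => /plane_ballP[+ +] /plane_ballP[+ +].
move: (dyad n) (dyad N) => u w; rewrite !ltr_norml => /andP[? ?] /andP[? ?] /andP[? ?] /andP[? ?] ? ? ?.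
by apply/plane_ballP; rewrite !ltr_norml; split; apply/andP; split; lra.
Qed.

Let L1_of h : L2 h -> (forall x, ~ Omega x -> h x = 0) -> L1 h.
Proof. by move=> lh z; apply: (L2_L1_ball M0 lh) => x nb; apply: z => /OM. Qed.

Lemma L1_psi : L1 psi. Proof. by have [[? ? ?] [? ? ?] _ _] := D; exact: L1_of. Qed.
Lemma L1_g1 : L1 g1. Proof. by have [[? ? ?] [? ? ?] _ _] := D; exact: L1_of. Qed.
Lemma L1_g2 : L1 g2. Proof. by have [[? ? ?] [? ? ?] _ _] := D; exact: L1_of. Qed.

Let T_kf n q : (ball q (dyad n + dyad n) : set plane) `<=` Omega -> test_function Omega (radial (kf b n) q).
Proof. exact: T_radial (smooth1_kf sb n) (dyad_gt0 n) (kf_out bz (n := n)). Qed.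
Let T_pf n q : (ball q (dyad n + dyad n) : set plane) `<=` Omega -> test_function Omega (radial (pf p n) q).
Proof. exact: T_radial (smooth1_pf sp n) (dyad_gt0 n) (pf_out pz (n := n)). Qed.

Let near_good n q y : good n q -> (ball q (dyad n) : set plane) y ->
  (ball y (dyad n + dyad n) : set plane) `<=` Omega.
Proof.
move=> g qy x yx; apply: g; move: qy yx => /plane_ballP[+ +] /plane_ballP[+ +].
have := dyad_gt0 (R := R) n; move: (dyad n) => u.
rewrite !ltr_norml => ? /andP[? ?] /andP[? ?] /andP[? ?] /andP[? ?].
by apply/plane_ballP; rewrite !ltr_norml; split; apply/andP; split; lra.
Qed.

Let good2 n q : good n q -> (ball q (dyad n + dyad n) : set plane) `<=` Omega.
Proof. by move=> g; apply: (near_good g); apply: ballxx; exact: dyad_gt0. Qed.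

(** The difference of the kernels is the Laplacian of the test function [radial (pf p n) q]; two
    integrations by parts and the weak equation trade it for [W]. *)
Lemma J_step n q : (ball q (dyad n + dyad n) : set plane) `<=` Omega ->
  J n psi q - J n.+1 psi q = convol W (sq (pf p n)) q.
Proof.
move=> bO; have T := T_pf bO; have [[lp l1 l2] _ _ E] := D.
have T1 := T_partial1 T; have T2 := T_partial2 T.
have [e1 _] := dirichlet_data_weak D T1; have [_ e2] := dirichlet_data_weak D T2.
have eW := E _ T.
have lk n' : L1 (fun x => psi x * radial (kf b n') q x).
  exact: (conv_L1 q L1_psi (T_sq_kf sb bz n')).
transitivity (ip psi (partial1 (partial1 (radial (pf p n) q))) + ip psi (partial2 (partial2 (radial (pf p n) q)))).
  have -> : J n psi q - J n.+1 psi q = I2 (fun x => psi x * radial (kf b n) q x - psi x * radial (kf b n.+1) q x).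
    exact/esym/(I2B (lk n) (lk n.+1)).
  rewrite /ip -I2D; last 2 first.
  - by apply: L2_mul => //; exact: T_L2 (T_partial1 T1).
  - by apply: L2_mul => //; exact: T_L2 (T_partial2 T2).
  by apply: I2_eq => x; rewrite -mulrDr (laplacian_pf sp ode) mulrBr.
have -> : convol W (sq (pf p n)) q = ip W (radial (pf p n) q) by exact: erefl.
exact: (etrans (congr2 +%R e1 e2) (etrans (esym (opprD _ _)) (etrans (congr1 -%R eW) (opprK _)))).
Qed.

(** Mollification commutes with weak differentiation. *)
Lemma is_derive_J n q v : (ball q (dyad n + dyad n) : set plane) `<=` Omega ->
  is_derive q v (fun y => J n psi y) (J n g1 q * v.1 + J n g2 q * v.2).
Proof.
move=> bO; have T := T_kf bO; have Tk := T_sq_kf sb bz n.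
have [e1 e2] := dirichlet_data_weak D T.
have s1 := smooth1_kf sb n.
have TD : test_function setT ('D_v (sq (kf b n))).
  have -> : 'D_v (sq (kf b n)) = (fun x => v.1 * partial1 (sq (kf b n)) x + v.2 * partial2 (sq (kf b n)) x).
    by apply/funext => x; rewrite smooth_derive ?[_ * v.1]mulrC ?[_ * v.2]mulrC//; exact: T_smooth Tk.
  by apply: T_add; apply: T_scale; [exact: T_partial1|exact: T_partial2].
have Dc := is_derive_conv q L1_psi Tk TD.
have E : - convol psi ('D_v (sq (kf b n))) q = J n g1 q * v.1 + J n g2 q * v.2.
  have [c1 c2] := convol_partial psi q s1.
  have -> : convol psi ('D_v (sq (kf b n))) q = v.1 * convol psi (partial1 (sq (kf b n))) q +
      v.2 * convol psi (partial2 (sq (kf b n))) q.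
    have l1 := conv_L1 q L1_psi (T_partial1 Tk); have l2 := conv_L1 q L1_psi (T_partial2 Tk).
    apply: etrans (etrans (I2D (L1Z v.1 l1) (L1Z v.2 l2)) (congr2 +%R (I2Z v.1 l1) (I2Z v.2 l2))).
    by apply: I2_eq => x; rewrite smooth_derive; [ring|exact: T_smooth Tk].
  have id (s t x y : R) : - (s * - x + t * - y) = x * s + y * t by ring.
  rewrite c1 c2 e1 e2; exact: id.
by rewrite -E.
Qed.

(** [J_step] holds on a whole neighbourhood of [q], so it can be differentiated there. *)
Lemma Jg_step n q : good n q ->
  J n g1 q - J n.+1 g1 q = - convol W (partial1 (sq (pf p n))) q /\
  J n g2 q - J n.+1 g2 q = - convol W (partial2 (sq (pf p n))) q.
Proof.
(* [W] is only bounded here; its restriction to [Omega] is integrable and gives the same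
   convolutions near [q]. *)
move=> g; have lW : L1 (W \_ Omega).
  have mO := open_measurable2 oO.
  apply: (L1_bounded_supp (mfun2_patch mO mW) (M := B) (x := 0) (r := M)) => [y|y nb].
    by rewrite patchE; case: ifP => _; rewrite ?normr0.
  by rewrite patch_out// => /OM.
have oV : open (ball q (dyad n) : set plane) by exact: ball_open.
have qV : (ball q (dyad n) : set plane) q by apply: ballxx; exact: dyad_gt0.
have bO := near_good g.
have bO' y : (ball q (dyad n) : set plane) y -> (ball y (dyad n.+1 + dyad n.+1) : set plane) `<=` Omega.
  move=> qy; apply: subset_trans (bO y qy); apply: le_ball.
  by rewrite lerD// dyad_le.
have cW f y : (ball q (dyad n) : set plane) y -> (forall x, ~ (ball (0 : plane) (dyad n) : set plane) x -> f x = 0) ->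
    convol W f y = convol (W \_ Omega) f y.
  move=> qy fz; apply: I2_eq => x; have [Ox|nO] := pselect (Omega x); first by rewrite patch_in.
  rewrite fz ?mulr0// => h; apply: nO; apply: (bO y qy); move: h => /plane_ballP[].
  rewrite /= !sub0r !normrN => h1 h2; have := dyad_gt0 (R := R) n => r0.
  by apply/plane_ballP; rewrite distrC [`|y.2 - _|]distrC; split; [apply: lt_trans h1 _|apply: lt_trans h2 _]; rewrite ltrDl.
have Tp := T_sq_pf sp pz n.
have step y : (ball q (dyad n) : set plane) y -> J n psi y - J n.+1 psi y = convol (W \_ Omega) (sq (pf p n)) y.
  move=> qy; rewrite J_step; last exact: bO.
  by apply: cW => // x; apply: sq_out; exact: pf_out.
have dz s : dyad n ^+ 2 <= s -> derive1 (pf p n) s = 0.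
  move=> h; rewrite (derive_pf sp n s).1 (derive1_out sp pz) ?mulr0//; exact: dyad_out.
have key v c1 c2 : v = (c1, c2) -> v != 0 -> test_function setT ('D_v (sq (pf p n))) ->
    (J n g1 q * c1 + J n g2 q * c2) - (J n.+1 g1 q * c1 + J n.+1 g2 q * c2) = - convol (W \_ Omega) ('D_v (sq (pf p n))) q.
  move=> vE v0 TD.
  have := is_derive_J v (bO q qV); have := is_derive_J v (bO' q qV); rewrite vE /= -vE => d2 d1.
  have d3 := is_derive_conv q lW Tp TD.
  have E := @partial_ext R _ (fun y => J n psi y - J n.+1 psi y) (convol (W \_ Omega) (sq (pf p n))) v q oV qV v0 step.
  have [dd1 ee1] := d1; have [dd2 ee2] := d2; have [_ ee3] := d3.
  by rewrite -ee1 -ee2 -ee3 -E -deriveB.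
have ez f : smooth1 f -> sq f = radial f 0.
  by move=> _; apply/funext => x; rewrite /radial subr0.
have s1 := smooth1_pf sp n.
split.
  have := key (1, 0) 1 0 erefl e1_neq0 (T_partial1 Tp); rewrite !mulr1 !mulr0 !addr0 => ->.
  congr (- _); apply/esym/cW => // x nb.
  rewrite ez// partial1_radial// /radial dz ?mulr0// subr0.
  by have := sqn_out (dyad_gt0 n) nb; rewrite subr0.
have := key (0, 1) 0 1 erefl e2_neq0 (T_partial2 Tp); rewrite !mulr1 !mulr0 !add0r => ->.
congr (- _); apply/esym/cW => // x nb.
rewrite ez// partial2_radial// /radial dz ?mulr0// subr0.
by have := sqn_out (dyad_gt0 n) nb; rewrite subr0.
Qed.

(** A representative defined at every point. The kernels have mass [mass b] instead of 1, so [Lim h]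
    represents [mass b * h]. *)
Definition Lim h := (fun q => limn (fun n => J n h q)) \_ Omega.

Let rate h := exists2 C : R, 0 <= C & forall n q, good n q -> `|J n h q - J n.+1 h q| <= C * dyad n.

Lemma J_rate : [/\ rate psi, rate g1 & rate g2].
Proof.
have [C C0 HC] := conv_pf_bound sp pz; have [C' C'0 HC'] := conv_partial_pf_bound sp pz.
have r1 n : dyad n ^+ 2 <= dyad n :> R.
  have d1 : dyad n <= 1 :> R by apply: exprn_ile1; lra.
  by rewrite expr2 ler_piMl// ltW// dyad_gt0.
split.
- exists (B * C); first exact: mulr_ge0.
  move=> n q g; rewrite (J_step (good2 g)); apply: le_trans (HC W B n q mW WB) _.
  by rewrite ler_wpM2l// mulr_ge0.
- exists (B * C'); first exact: mulr_ge0.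
  move=> n q g; have [E _] := Jg_step g; rewrite E normrN; exact: (HC' W B n q mW WB).1.
- exists (B * C'); first exact: mulr_ge0.
  move=> n q g; have [_ E] := Jg_step g; rewrite E normrN; exact: (HC' W B n q mW WB).2.
Qed.

Lemma Lim_rate h : rate h -> exists2 C : R, 0 <= C & forall n q, good n q ->
  (fun n => J n h q) @ \oo --> Lim h q /\ `|J n h q - Lim h q| <= C * dyad n.
Proof.
move=> [C C0 H]; exists (2 * C); first exact: mulr_ge0.
move=> n q g; have [c e] := @geo_cauchy R (fun n => J n h q) C n C0 (fun m nm => H m q (good_le nm g)).
have E : Lim h q = limn (fun n => J n h q) by rewrite /Lim patch_in//; exact: good_in g.
by rewrite E; split; [exact: c|exact: e].
Qed.

(** The mollifications are continuous and converge uniformly near [q], with a geometric rate. *)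
Lemma Lim_continuous h q : L1 h -> rate h -> Omega q -> {for q, continuous (Lim h)}.
Proof.
have fin (C e u v w d : R) : 0 <= C -> u <= C * d -> v <= C * d -> w <= e / 2 ->
    d * (4 * (C + 1)) < e -> 0 <= d -> u + w + v <= e.
  move=> C0 a1 a2 a3 h3 d0; have : 0 <= C * d by rewrite mulr_ge0.
  rewrite (_ : d * (4 * (C + 1)) = 4 * (C * d) + 4 * d) in h3; last by ring.
  by move: a1 a2 h3; move: (C * d) => z *; lra.
move=> lh /Lim_rate[C C0 HC] Oq; have [N HN] := good_ex Oq.
apply/cvgrPdist_le => e e0.
have C1 : 0 < 4 * (C + 1) by rewrite mulr_gt0// ltr_wpDl.
have [K HK] := dyad_small (divr_gt0 e0 C1).
pose n := maxn N K; have nN : (N <= n)%N := leq_maxl _ _.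
have cn : {for q, continuous (convol h (sq (kf b n)))} by exact: conv_continuous lh (T_sq_kf sb bz n) q.
have e2 : 0 < e / 2 by rewrite divr_gt0.
have /cvgrPdist_le/(_ _ e2) near1 := cn.
have near2 : nbhs q (ball q (dyad N) : set plane) by apply: nbhsx_ballx; exact: dyad_gt0.
apply: filterS2 near1 near2 => y h1 h2.
have [_ a1] := HC n q (HN q (ballxx q (dyad_gt0 N)) n nN).
have [_ a2] := HC n y (HN y h2 n nN).
have := HK n (leq_maxr _ _); rewrite ltr_pdivlMr// => h3.
have Cd : 0 <= dyad n :> R by rewrite ltW// dyad_gt0.
have id (x z w t : R) : x - t = (x - z) + (z - w) + (w - t) by ring.
rewrite (id _ (J n h q) (J n h y)).
apply: le_trans (ler_normD _ _) _.
rewrite (le_trans (lerD (ler_normD _ _) (lexx _)))// [`|Lim h q - _|]distrC.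
exact: fin C0 a1 a2 h1 h3 Cd.
Qed.

Lemma Lim_mfun h : L1 h -> rate h -> mfun2 (Lim h).
Proof.
move=> lh rh; have mO := open_measurable2 oO.
have : mfun2 ((Lim h) \_ Omega).
  apply/(measurable_restrictT _ mO); apply: open_continuous_measurable2 => // q; exact: Lim_continuous.
by rewrite (_ : (Lim h) \_ Omega = Lim h)//; apply: patch_id => x; exact: patch_out.
Qed.

Lemma Lim_ae h : L1 h -> rate h -> {ae mu, forall x : P, Omega x -> mass b * h x = Lim h x}.
Proof.
move=> lh rh; have [C C0 HC] := Lim_rate rh.
apply: (@ae_cover _ Omega (fun x => mass b * h x = Lim h x)) => // q Oq.
have [N HN] := good_ex Oq; exists (dyad N); first exact: dyad_gt0.
have VO : (ball q (dyad N) : set plane) `<=` Omega by move=> y qy; exact: good_in (HN y qy N (leqnn N)).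
apply: (@convol_limit_ae _ b sb b0 bz h (Lim h) (ball q (dyad N)) C N M) => //.
- exact: ball_open.
- exact: subset_trans VO OM.
- by move=> y n qy Nn; have [] := HC n y (HN y qy n Nn).
- by move=> y qy; apply: Lim_continuous => //; exact: VO.
Qed.

(** The mean value theorem is applied to the mollifications, whose gradients are the mollifications
    of [(g1, g2)] and converge uniformly near [q]; the estimate then passes to the limit. *)
Lemma Lim_psi_diff q : Omega q -> is_diff q (Lim psi) (lin2 (Lim g1 q) (Lim g2 q)).
Proof.
move=> Oq; have [r0 r1 r2] := J_rate.
have [C0' C00 H0] := Lim_rate r0; have [C1 C10 H1] := Lim_rate r1; have [C2 C20 H2] := Lim_rate r2.
have [N HN] := good_ex Oq.
apply: frechet_is_diff => e e0.
have e4 : 0 < e / 4 by rewrite divr_gt0.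
have /cvgrPdist_le/(_ _ e4)/nbhs_ballP[d1 /= d10 K1] := Lim_continuous L1_g1 r1 Oq.
have /cvgrPdist_le/(_ _ e4)/nbhs_ballP[d2 /= d20 K2] := Lim_continuous L1_g2 r2 Oq.
exists (Num.min (dyad N / 2) (Num.min d1 d2)).
  by rewrite !lt_min d10 d20 divr_gt0// dyad_gt0.
move=> y; rewrite !lt_min => /and3P[yN y1 y2].
pose v := y - q.
have qv : q + (1 : R) *: v = y by rewrite scale1r /v addrC subrK.
(* The segment is prolonged beyond [t = 1], up to 3/2, because [MVT_unordered] wants a strict
   inequality; the radius [dyad N / 2] allows for it. *)
have inb (t : R) : `|t - 0| < 3 / 2 -> (ball q (dyad N) : set plane) (q + t *: v).
  move=> t2; rewrite -ball_normE /= opprD addNKr normrN normrZ; rewrite subr0 in t2.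
  have := normr_ge0 v; have := normr_ge0 t; move: yN t2; rewrite -/v.
  move: (`|t|) (`|v|) (dyad N) => a c d h1 h2 a0 c0.
  have h3 : a * c <= 3 / 2 * c by rewrite ler_wpM2r// ltW.
  by lra.
have est n : (N <= n)%N -> `|J n psi y - J n psi q - lin2 (Lim g1 q) (Lim g2 q) v| <=
    ((C1 + C2) * dyad n + e / 2) * `|v|.
  move=> Nn.
  have Dt (t : R) : `|t - 0| < 3 / 2 -> is_derive t (1 : R) (fun s => J n psi (q + s *: v))
      (J n g1 (q + t *: v) * v.1 + J n g2 (q + t *: v) * v.2).
    move=> t2; have [d ed] := is_derive_J v (good2 (HN _ (inb t t2) n Nn)).
    by rewrite -ed; exact: is_derive_line.
  have lt : `|1 - 0 : R| < 3 / 2 by rewrite subr0 normr1; lra.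
  have [c + E] := @MVT_unordered _ (fun s : R => J n psi (q + s *: v)) (fun t => J n g1 (q + t *: v) * v.1 + J n g2 (q + t *: v) * v.2)
    0 1 (3 / 2) lt Dt.
  rewrite !subr0 normr1 => c1.
  move: E; rewrite qv scale0r addr0 subr0 mulr1 => ->.
  set z := q + c *: v.
  have zb : (ball q (dyad N) : set plane) z by apply: inb; rewrite subr0; lra.
  have zq : `|q - z| <= `|v|.
    by rewrite /z opprD addNKr normrN normrZ ler_piMl.
  have [_ b1] := H1 n z (HN z zb n Nn); have [_ b2] := H2 n z (HN z zb n Nn).
  have a1 := K1 z; have a2 := K2 z.
  have {}a1 : `|Lim g1 q - Lim g1 z| <= e / 4 by apply: a1; rewrite -ball_normE /=; apply: le_lt_trans zq y1.
  have {}a2 : `|Lim g2 q - Lim g2 z| <= e / 4 by apply: a2; rewrite -ball_normE /=; apply: le_lt_trans zq y2.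
  have /plane_norm_le[v1 v2] := lexx `|v|.
  have id (j1 j2 l1 l2 z1 z2 a c' : R) : j1 * a + j2 * c' - (l1 * a + l2 * c') =
      ((j1 - z1) - (l1 - z1)) * a + ((j2 - z2) - (l2 - z2)) * c' by ring.
  rewrite /lin2 (id _ _ _ _ (Lim g1 z) (Lim g2 z)).
  apply: le_trans (ler_normD _ _) _; rewrite !normrM.
  have -> : ((C1 + C2) * dyad n + e / 2) * `|v| = (C1 * dyad n + e / 4) * `|v| + (C2 * dyad n + e / 4) * `|v| by field.
  by apply: lerD; apply: ler_pM => //; apply: le_trans (ler_normB _ _) _; exact: lerD.
have gy : good N y.
  apply: HN => //; have := inb 1; rewrite qv; apply.
  by rewrite subr0 normr1; lra.
have gq : good N q by apply: HN => //; apply: ballxx; exact: dyad_gt0.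
have [cy _] := H0 N y gy; have [cq _] := H0 N q gq.
have cl : (fun n => `|J n psi y - J n psi q - lin2 (Lim g1 q) (Lim g2 q) v|) @ \oo -->
    `|Lim psi y - Lim psi q - lin2 (Lim g1 q) (Lim g2 q) v|.
  apply: (@cvg_norm _ R^o); apply: seq_cvgD; last exact: cvg_cst.
  exact: (seq_cvgD cy (seq_cvgN cq)).
have cr : (fun n => ((C1 + C2) * dyad n + e / 2) * `|v|) @ \oo --> ((C1 + C2) * 0 + e / 2) * `|v|.
  apply: cvgM; last exact: cvg_cst.
  by apply: seq_cvgD; [apply: seq_cvgZ; exact: dyad_cvg0|exact: cvg_cst].
have : `|Lim psi y - Lim psi q - lin2 (Lim g1 q) (Lim g2 q) v| <= ((C1 + C2) * 0 + e / 2) * `|v|.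
  apply: (ler_cvg_to cl cr); exists N => // n /= Nn; exact: est.
move=> h; apply: le_trans h _; rewrite mulr0 add0r ler_wpM2r//; lra.
Qed.

(** For [W >= 0] the differences in [J_step] are nonnegative, so the mollifications decrease to
    their limit; the first difference is kept. This is a quantitative mean-value inequality for
    functions with nonnegative Laplacian. *)
Lemma J_ge_Lim n q : (forall x, 0 <= W x) -> good n q ->
  Lim psi q + convol W (sq (pf p n)) q <= J n psi q.
Proof.
move=> W0 g; have [r0 _ _] := J_rate; have [C C0 H] := Lim_rate r0.
have [c _] := H n q g.
have cn m : 0 <= convol W (sq (pf p m)) q by apply: I2_ge0 => x; rewrite mulr_ge0// /sq /pf.
have le k : J (n + k.+1)%N psi q + convol W (sq (pf p n)) q <= J n psi q.
  elim: k => [|k IH].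
    by rewrite addn1 -(J_step (good2 g)) addrC subrK.
  apply: le_trans IH; rewrite lerD2r addnS -subr_ge0.
  by rewrite (J_step (good2 (good_le (leq_addr k.+1 n) g))).
have cs : (fun k => J (n + k.+1)%N psi q + convol W (sq (pf p n)) q) @ \oo --> Lim psi q + convol W (sq (pf p n)) q.
  apply: seq_cvgD; last exact: cvg_cst.
  rewrite (_ : (fun k => _) = (fun k => J (k + n.+1)%N psi q)).
    by rewrite (cvg_shiftn n.+1 (fun k => J k psi q)).
  by apply/funext => k; rewrite !addnS addnC.
rewrite -(cvg_lim (@Rhausdorff R) cs); apply: limr_le; first exact: cvgP cs.
by apply: nearW => k; exact: le.
Qed.

End Potential.

(** * Blow-up of the stationarity identity at a regular boundary point *)

Section BlowUp.
Context {R : realType}.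
Local Notation plane := (R * R)%type.
Local Notation P := (mplane R).
Local Notation mu := (@leb2 R).
Implicit Types (q x y : plane).

Variable b : R -> R.
Hypotheses (sb : smooth1 b) (b0 : forall s, 0 <= b s) (bz : forall s, 1 <= s -> b s = 0)
  (bp : forall s, 2^-1 < s < 1 -> 0 < b s).

Let u : plane -> R := sq b.
Let Tu : test_function setT u := T_sq_b sb bz.

Let T_coord : test_function setT (fun y => y.1 * u y) /\ test_function setT (fun y => y.2 * u y).
Proof. by split; apply: T_mul => //; [exact: smooth_fst|exact: smooth_snd]. Qed.

Let mpres_opp : mpres (fun x : P => (- x.1, - x.2) : P).
Proof.
apply: mpres_ext (@mpres_diag R (0, 0) (-1, -1) _); last by rewrite mulN1r opprK normr1.
by move=> x /=; rewrite !add0r !mulN1r.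
Qed.

Let u_opp y : u (- y.1, - y.2) = u y. Proof. by rewrite /u /sq /sqn /= !sqrrN. Qed.
Let u_refl y : u (reflection y) = u y. Proof. by rewrite /u /sq /sqn /= sqrrN. Qed.

Let I2_coord : I2 (fun y => y.1 * u y) = 0 /\ I2 (fun y => y.2 * u y) = 0.
Proof.
have [T1 T2] := T_coord.
have z (c : R) : c = - c -> c = 0 by move=> h; lra.
split; apply: z.
  rewrite -I2N; last exact: T_L1 T1.
  rewrite -[LHS](mpres_I2 mpres_opp (T_L1 T1)).
  by apply: I2_eq => y /=; rewrite u_opp mulNr.
rewrite -I2N; last exact: T_L1 T2.
rewrite -[LHS](mpres_I2 mpres_opp (T_L1 T2)).
by apply: I2_eq => y /=; rewrite u_opp mulNr.
Qed.

Let HP : set plane := [set y | 0 < y.1].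
Let mHP : @measurable _ P HP.
Proof.
apply: open_measurable2; rewrite (_ : HP = (fst : plane -> R) @^-1` [set t | 0 < t])//.
by apply: open_comp; [move=> x _; exact: cvg_fst|exact: open_gt].
Qed.

Let L1_HP h : L1 h -> L1 (fun y => \1_HP y * h y).
Proof.
move=> lh; apply: (L1_dom (mfun2M (mfun2_indic mHP) (L1_mfun lh)) (L1_abs lh)) => y.
by rewrite normrM indicE; case: (_ \in _); rewrite ?normr1 ?normr0 ?mul1r ?mul0r.
Qed.

(** The reflection in the first axis preserves the half-plane and changes the sign of the
    integrand. *)
Let half2 : I2 (fun y => \1_HP y * (y.2 * u y)) = 0.
Proof.
have [_ T2] := T_coord; have l := L1_HP (T_L1 T2).
have z (c : R) : c = - c -> c = 0 by move=> h; lra.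
apply: z; rewrite -I2N// -[LHS](mpres_I2 (mpres_reflection (R := R)) l).
apply: I2_eq => y /=; rewrite u_refl /= mulNr mulrN; congr (- (_ * _)).
Qed.

Let half1 : 0 < I2 (fun y => \1_HP y * (y.1 * u y)).
Proof.
have [T1 _] := T_coord; have l := L1_HP (T_L1 T1).
have E : (fun y => \1_HP y * (y.1 * u y)) = (fun y : plane => Num.max 0 y.1 * u y).
  apply/funext => y; rewrite indicE; have [h|h] := pselect (HP y).
    by rewrite mem_set// mul1r max_r// ltW.
  by rewrite memNset// mul0r max_l ?mul0r// leNgt; apply/negP.
rewrite E in l *.
apply: (@I2_pos_open _ _ (4 / 5, 0)) => //.
- move=> y; apply: cvgM; last exact: (smooth_continuous (T_smooth Tu)).
  apply: (@continuous_comp _ _ _ fst (fun t : R => Num.max 0 t)); first exact: cvg_fst.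
  by apply: continuous_max; [exact: cvg_cst|exact: cvg_id].
- by move=> y; rewrite mulr_ge0// ?le_max ?lexx// /u /sq.
- rewrite /= max_r; last by rewrite divr_ge0.
  rewrite mulr_gt0 ?divr_gt0//; apply: bp; rewrite /sqn /= expr0n addr0.
  by apply/andP; split; lra.
Qed.

Variables (W G1 G2 F : plane -> R) (q : plane) (n1 n2 d G : R).
Hypotheses (mW : mfun2 W) (mG1 : mfun2 G1) (mG2 : mfun2 G2) (d0 : 0 < d)
  (WF : forall x, (ball q d : set plane) x -> W x = if 0 <= F x then 1 else 2)
  (GB : forall x, (ball q d : set plane) x -> `|G1 x| <= G /\ `|G2 x| <= G)
  (cG1 : {for q, continuous G1}) (cG2 : {for q, continuous G2})
  (Fq : F q = 0) (dF : is_diff q F (lin2 n1 n2)) (n0 : n1 ^+ 2 + n2 ^+ 2 != 0).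

Let Phi n x : R := W x * (vf1 q (kf b n) x * G1 x + vf2 q (kf b n) x * G2 x).

Lemma blow_up : (exists N, forall n, (N <= n)%N -> I2 (Phi n) = 0) ->
  n1 * G2 q - n2 * G1 q = 0.
Proof.
move=> [N HN].
have pos_case (z f : R) : 0 < z -> - (z / 2) <= f - z -> 0 <= f by move=> ? ?; lra.
have neg_case (z f : R) : 0 < - z -> f - z <= - z / 2 -> f < 0 by move=> ? ?; lra.
have third (z w : R) : 0 < z -> z < w / 3 -> 2 * z < w by move=> ? ?; lra.
pose e : R := Num.sqrt (n1 ^+ 2 + n2 ^+ 2).
have nn : 0 < n1 ^+ 2 + n2 ^+ 2 by rewrite lt_neqAle eq_sym n0 addr_ge0// sqr_ge0.
have e0 : 0 < e by rewrite sqrtr_gt0.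
have e2 : e ^+ 2 = n1 ^+ 2 + n2 ^+ 2 by rewrite sqr_sqrtr// ltW.
pose c := n1 / e; pose s := n2 / e.
have en : e != 0 by rewrite gt_eqF.
have cs : c ^+ 2 + s ^+ 2 = 1 by rewrite /c /s !exprMn -mulrDl -e2 exprVn divff// sqrf_eq0.
have n1E : n1 = e * c by rewrite /c mulrCA divff// mulr1.
have n2E : n2 = e * s by rewrite /s mulrCA divff// mulr1.
have c1 : `|c| <= 1.
  by rewrite -(ler_pXn2r (n := 2))// ?nnegrE// real_normK ?num_real// expr1n -cs lerDl sqr_ge0.
have s1 : `|s| <= 1.
  by rewrite -(ler_pXn2r (n := 2))// ?nnegrE// real_normK ?num_real// expr1n -cs lerDr sqr_ge0.
clearbody c s.
(* The rotation taking the first axis to the direction of [(n1, n2)]. *)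
pose T (y : plane) : plane := planerot c s y.
have mT : mpres (T : P -> P) := mpres_rot cs.
have Tb (y : plane) : (ball (0 : plane) 1 : set plane) y -> `|(T y).1| <= 2 /\ `|(T y).2| <= 2.
  move=> /plane_ballP[]; rewrite /= !sub0r !normrN => /ltW h1 /ltW h2.
  have k (a a' z z' : R) : `|a| <= 1 -> `|a'| <= 1 -> `|z| <= 1 -> `|z'| <= 1 -> `|a| * `|z| + `|a'| * `|z'| <= 2.
    by move=> ha ha' hz hz'; rewrite (_ : 2 = 1 * 1 + 1 * 1); [rewrite lerD// ler_pM|ring].
  split; rewrite /T /planerot /=.
    apply: le_trans (ler_normB _ _) _. by rewrite !normrM; exact: k.
  by apply: le_trans (ler_normD _ _) _; rewrite !normrM; exact: k.
have d3 : 0 < d / 3 by rewrite divr_gt0.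
have [K HK] := dyad_small d3.
(* Shifted indices, large enough for stationarity and for the rescaled unit square to lie in
   [ball q d]: after rotation it has coordinates at most 2, and [dyad (idx n) < d / 3]. *)
pose idx (n : nat) := (n + maxn N K)%N.
have idxN n : (N <= idx n)%N := leq_trans (leq_maxl _ _) (leq_addl _ _).
have idxK n : dyad (idx n) < d / 3 := HK _ (leq_trans (leq_maxr _ _) (leq_addl _ _)).
have Tz (r : R) (z : plane) : 0 < r -> r < d / 3 -> `|z.1| <= 2 -> `|z.2| <= 2 -> (ball q d : set plane) (q + r *: z).
  move=> r0 rd h1 h2; rewrite -ball_normE /= opprD addNKr normrN normrZ gtr0_norm//.
  have h3 : `|z| <= 2 by apply/plane_norm_le.
  apply: (@le_lt_trans _ _ (r * 2)); first by rewrite ler_wpM2l// ltW.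
  by lra.
pose xn (n : nat) (y : plane) : plane := q + dyad (idx n) *: T y.
have xb n (y : plane) : (ball (0 : plane) 1 : set plane) y -> (ball q d : set plane) (xn n y).
  by move=> /Tb[h1 h2]; apply: Tz => //; exact: dyad_gt0.
have uz (y : plane) : ~ (ball (0 : plane) 1 : set plane) y -> u y = 0.
  by move=> nb; apply: bz; have := sqn_out (ltr01 : 0 < 1 :> R) nb; rewrite expr1n subr0.
(* On the line [y.1 = 0], a null set, the first-order expansion does not decide the sign of [F]. *)
pose A : set plane := [set y : plane | y.1 != 0].
pose f0 (n : nat) (y : plane) : R := W (xn n y) * (u y * (- (T y).2 * G1 (xn n y) + (T y).1 * G2 (xn n y))).
(* The field contributes a factor [dyad] and the kernel a factor [4^n], so one more [dyad] makes the
   rescaled integrand bounded. *)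
have f0E n y : f0 n y = dyad (idx n) * Phi (idx n) (xn n y).
  rewrite /Phi /vf1 /vf2 /xn addrAC subrr add0r.
  have sE : sqn (dyad (idx n) *: T y) = dyad (idx n) ^+ 2 * sqn y.
    have : sqn (T y) = sqn y by exact: sqn_rot.
    by rewrite /sqn => <- /=; rewrite /GRing.scale /=; ring.
  have -> : kf b (idx n) (sqn (dyad (idx n) *: T y)) = 4 ^+ idx n * u y.
    by rewrite sE /kf mulrA dyad_sqr mul1r addr0.
  rewrite -[q + dyad (idx n) *: T y]/(xn n y) /f0.
  have : dyad (idx n) * (4 ^+ idx n * dyad (idx n)) = 1 :> R by rewrite mulrCA -expr2 dyad_sqr.
  have -> : (dyad (idx n) *: T y).1 = dyad (idx n) * (T y).1 by [].
  have -> : (dyad (idx n) *: T y).2 = dyad (idx n) * (T y).2 by [].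
  move: (W _) (G1 _) (G2 _) (u y) ((T y).1) ((T y).2) (4 ^+ _) (dyad _).
  by move=> w x1 x2 uu t1 t2 r4 r h; rewrite -[LHS]mul1r -h; ring.
have lPhi n : L1 (Phi (idx n)).
  have B4 : (ball q (dyad (idx n)) : set plane) `<=` (ball q d : set plane).
    by apply: le_ball; have := idxK n; lra.
  have [k1 k2] := smooth_vf q (smooth1_kf sb (idx n)).
  have kz := kf_out bz (n := idx n).
  have vz x := vf_out (dyad_gt0 (idx n)) kz (x := x) (p := q).
  have [l1 l2] := L2_vf q (smooth1_kf sb (idx n)) (dyad_gt0 (idx n)) kz.
  have lb : L2 (\1_(ball q (dyad (idx n)) : set plane)).
    split; first by apply: mfun2_indic; exact: measurable_plane_ball.
    apply: L1_eq (L1_indic (measurable_plane_ball q (dyad (idx n))) _).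
      by move=> x; rewrite indicE; case: (_ \in _); rewrite ?expr1n ?expr0n.
    by rewrite leb2_ball ?ltry// ltW// dyad_gt0.
  have l12 := L1D (L2_mul (L2_abs l1) lb) (L2_mul (L2_abs l2) lb).
  apply: (L1_dom _ (L1Z (2 * G) l12)).
    apply: mfun2M mW _; apply: mfun2D; apply: mfun2M => //; exact: smooth_mfun2.
  move=> x; have [bx|nb] := pselect ((ball q (dyad (idx n)) : set plane) x); last first.
    rewrite /Phi; have [-> ->] := vz x nb.
    by rewrite !mul0r addr0 mulr0 normr0 indicE memNset// !mulr0 addr0 mulr0.
  rewrite indicE mem_set// !mulr1 /Phi normrM (WF (B4 _ bx)).
  have [g1 g2] := GB (B4 _ bx).
  have W2 : `|(if 0 <= F x then 1 else 2 : R)| <= 2 by case: ifP => _; rewrite ger0_norm// ler1n.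
  rewrite -mulrA; apply: ler_pM => //; apply: le_trans (ler_normD _ _) _.
  have le3 (a a' z z' : R) : `|z| <= G -> `|z'| <= G -> `|a| * `|z| + `|a'| * `|z'| <= G * (`|a| + `|a'|).
    by move=> hz hz'; rewrite mulrDr ![G * _]mulrC lerD// ler_wpM2l.
  by rewrite (normrM (vf1 _ _ _)) (normrM (vf2 _ _ _)); exact: le3.
have If0 n : I2 (f0 n) = 0.
  have lx : L1 (fun y => Phi (idx n) (q + dyad (idx n) *: y)) by apply: L1_scale; [exact: dyad_gt0|].
  rewrite (I2_eq (f0E n)) I2Z; last exact: (mpres_L1 mT lx).
  rewrite (mpres_I2 mT lx) (I2_scale _ (dyad_gt0 _) (lPhi n)) (HN _ (idxN n)).
  by rewrite !mulr0.
have mA : @measurable _ P A.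
  apply: open_measurable2; rewrite (_ : A = (fst : plane -> R) @^-1` [set t | t != 0])//.
  by apply: open_comp; [move=> x _; exact: cvg_fst|exact: open_neq].
have nullA : {ae mu, forall y : P, A y}.
  exists ([set 0 : mline R] `*` setT); split.
  - by apply: measurableX => //; exact: measurable_set1.
  - have E := @leb2X R [set 0] setT (measurable_set1 0) measurableT.
    by apply: (etrans E); rewrite lebesgue_measure_set1 mul0e.
  - by move=> y /= /negP; rewrite negbK => /eqP ->.
pose g (y : plane) : R := (if 0 < y.1 then 1 else 2) * (u y * (- (T y).2 * G1 q + (T y).1 * G2 q)).
pose fn (n : nat) (y : plane) : R := \1_A y * f0 n y.
have mf0 n : mfun2 (f0 n).
  have lx : L1 (fun y => Phi (idx n) (q + dyad (idx n) *: y)) by apply: L1_scale; [exact: dyad_gt0|].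
  have := L1_mfun (L1Z (dyad (idx n)) (mpres_L1 mT lx)).
  by rewrite (_ : (fun x => _) = f0 n)//; apply/funext => y; rewrite f0E.
have [Mu Mu0 HMu] := T_bounded Tu.
have G0 : 0 <= G by have [h _] := GB (ballxx q d0); exact: le_trans h.
have xc (y : plane) : (fun n => xn n y) @ \oo --> q.
  rewrite -[X in _ --> X]addr0; apply: cvgD; first exact: cvg_cst.
  rewrite -[X in _ --> X](scale0r (T y)); apply: cvgZ; last exact: cvg_cst.
  by rewrite /idx (cvg_shiftn (maxn N K) (fun n => dyad n)); exact: dyad_cvg0.
(* [F] at the rescaled point is [dyad * e * y.1] up to half of that size, so its sign is eventually
   that of [y.1]. *)
have Wc (y : plane) : A y -> \forall n \near \oo, (ball (0 : plane) 1 : set plane) y -> W (xn n y) = if 0 < y.1 then 1 else 2.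
  move=> y1; have [by1|nb] := pselect ((ball (0 : plane) 1 : set plane) y); last by apply: nearW.
  have [df ED] := dF.
  have fr := diff_frechet df.
  have y10 : 0 < e * `|y.1| / 4 by rewrite divr_gt0// mulr_gt0// normr_gt0.
  have [de de0 Hde] := fr _ y10.
  have p1 : partial1 F q = n1.
    by rewrite /partial1 deriveE// ED /lin2 /= mulr1 mulr0 addr0.
  have p2 : partial2 F q = n2.
    by rewrite /partial2 deriveE// ED /lin2 /= mulr1 mulr0 add0r.
  rewrite p1 p2 in Hde.
  have [K' HK'] := dyad_small (divr_gt0 de0 (ltr0n _ 3 : 0 < 3)).
  exists K' => // n /= nK' _; rewrite WF; last exact: xb.
  have rd : dyad (idx n) < de / 3 := HK' _ (leq_trans nK' (leq_addr _ _)).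
  have r0 := dyad_gt0 (R := R) (idx n).
  have [t1 t2] := Tb y by1.
  have nT : `|T y| <= 2 by apply/plane_norm_le.
  have xq : xn n y - q = dyad (idx n) *: T y by rewrite /xn addrAC subrr add0r.
  have nx : `|xn n y - q| <= 2 * dyad (idx n) by rewrite xq normrZ gtr0_norm// mulrC ler_wpM2r// ltW.
  have rd2 : 2 * dyad (idx n) < de.
    exact: third rd.
  have := Hde (xn n y) (le_lt_trans nx rd2).
  rewrite Fq subr0 xq.
  have -> : lin2 n1 n2 (dyad (idx n) *: T y) = dyad (idx n) * (e * y.1).
    rewrite /lin2 /= /GRing.scale /= n1E n2E /T /planerot /=.
    transitivity (dyad (idx n) * (e * y.1) * (c ^+ 2 + s ^+ 2)); first by ring.
    by rewrite cs mulr1.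
  rewrite -xq => h.
  have {}h : `|F (xn n y) - dyad (idx n) * (e * y.1)| <= dyad (idx n) * (e * `|y.1|) / 2.
    apply: le_trans h _; apply: le_trans (ler_wpM2l (ltW y10) nx) _.
    by rewrite le_eqVlt; apply/orP; left; apply/eqP; field.
  move: h; rewrite ler_norml => /andP[h1 h2].
  have pos : 0 < dyad (idx n) * (e * `|y.1|) by rewrite !mulr_gt0// normr_gt0.
  have [yp|yn] := ltP 0 y.1.
    rewrite gtr0_norm// in h1 h2 pos; rewrite ifT//.
    exact: pos_case pos h1.
  rewrite ler0_norm// in h1 h2 pos; rewrite ifF//; apply/negbTE; rewrite -ltNge.
  by rewrite !mulrN in h2 pos; exact: neg_case pos h2.
have [] := @I2_dct _ fn (fun y => \1_A y * g y) (fun y => 2 * (Mu * (2 * G + 2 * G)) * \1_(ball (0 : plane) 1 : set plane) y).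
- by move=> n; apply: mfun2M => //; exact: mfun2_indic.
- apply: L1Z; apply: L1_indic; first exact: measurable_plane_ball.
  by rewrite leb2_ball ?ltry.
- move=> n y; rewrite /fn /f0; have [by1|nb] := pselect ((ball (0 : plane) 1 : set plane) y); last first.
    by rewrite uz// mul0r !mulr0 normr0 indicE memNset// mulr0.
  rewrite [\1_(ball _ _) y]indicE mem_set// mulr1 normrM (WF (xb n y by1)).
  have W2 : `|(if 0 <= F (xn n y) then 1 else 2 : R)| <= 2 by case: ifP => _; rewrite ger0_norm// ler1n.
  have [g1 g2] := GB (xb n y by1); have [t1 t2] := Tb y by1.
  apply: (@le_trans _ _ (1 * (2 * (Mu * (2 * G + 2 * G))))); last by rewrite mul1r.
  apply: ler_pM => //; first by rewrite indicE; case: (_ \in _); rewrite ?normr1 ?normr0.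
  rewrite normrM; apply: ler_pM => //; rewrite normrM; apply: ler_pM => //.
  by apply: le_trans (ler_normD _ _) _; rewrite !normrM normrN; apply: lerD; exact: ler_pM.
- move=> y; have [Ay|nA] := pselect (A y); last first.
    rewrite /fn indicE memNset// mul0r; under eq_fun do rewrite mul0r; exact: cvg_cst.
  have [by1|nb] := pselect ((ball (0 : plane) 1 : set plane) y); last first.
    rewrite /fn /f0 /g uz// !mul0r !mulr0.
    by under eq_fun do rewrite mul0r !mulr0; exact: cvg_cst.
  apply: (@seq_cvgZ R); rewrite /f0 /g; apply: cvgM.
    have [K1 _ HK1] := Wc y Ay; apply: cvg_near_cst; exists K1 => // n /= h; exact: HK1.
  apply: (@seq_cvgZ R); apply: seq_cvgD; apply: (@seq_cvgZ R).
    exact: (cvg_comp _ _ (xc y) cG1).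
  exact: (cvg_comp _ _ (xc y) cG2).
move=> _ cI.
have Ig : I2 (fun y => \1_A y * g y) = 0.
  rewrite -(cvg_lim (@Rhausdorff R) cI); apply/cvg_lim => //.
  rewrite (_ : (fun n => _) = cst 0); first exact: cvg_cst.
  apply/funext => n; rewrite -[RHS](If0 n); apply: I2_ae => //.
    by apply: mfun2M => //; exact: mfun2_indic.
  by apply: (@filterS _ _ (ae_filter_ringOfSetsType mu) _ _ _ nullA) => y Ay; rewrite /fn indicE mem_set// mul1r.
(* [al] is the tangential component of the gradient, and [be] the normal one up to sign; the moments
   multiplied by [be] all vanish. *)
pose al := c * G2 q - s * G1 q; pose be := - c * G1 q - s * G2 q.
have [T1 T2] := T_coord; have l1 := T_L1 T1; have l2 := T_L1 T2.
have h1 := L1_HP l1; have h2 := L1_HP l2.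
pose g' (y : plane) : R := al * (2 * (y.1 * u y) - \1_HP y * (y.1 * u y)) + be * (2 * (y.2 * u y) - \1_HP y * (y.2 * u y)).
have lg1 : L1 (fun y => al * (2 * (y.1 * u y) - \1_HP y * (y.1 * u y))) by apply: L1Z; apply: L1B => //; exact: L1Z.
have lg2 : L1 (fun y => be * (2 * (y.2 * u y) - \1_HP y * (y.2 * u y))) by apply: L1Z; apply: L1B => //; exact: L1Z.
have gg (y : plane) : g y = g' y.
  rewrite /g /g' /al /be /T /planerot /= indicE.
  have [hp|hp] := boolP (0 < y.1); first by rewrite mem_set//=; ring.
  by rewrite memNset//=; [ring|apply/negP].
have : I2 g' = 0.
  rewrite -[RHS]Ig; apply: I2_ae.
  - exact: L1_mfun (L1D lg1 lg2).
  - by apply: mfun2M; [exact: mfun2_indic|rewrite (funext gg); exact: L1_mfun (L1D lg1 lg2)].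
  by apply: (@filterS _ _ (ae_filter_ringOfSetsType mu) _ _ _ nullA) => y Ay; rewrite indicE mem_set// mul1r gg.
have [i1 i2] := I2_coord.
rewrite /g' I2D// !I2Z//; try by apply: L1B => //; exact: L1Z.
rewrite !I2B//; try exact: L1Z.
rewrite !I2Z// i1 i2 half2 !mulr0 subr0 mulr0 addr0 sub0r => /eqP.
rewrite mulf_eq0 oppr_eq0 (gt_eqF half1) orbF => /eqP al0.
rewrite n1E n2E (_ : _ - _ = e * al); last by rewrite /al; ring.
by rewrite al0 mulr0.
Qed.

End BlowUp.

(** * Geometry of the lobes and of their boundary arcs *)

Section Curves.
Context {R : realType}.
Local Notation plane := (R * R)%type.
Local Notation P := (mplane R).
Local Notation mu := (@leb2 R).
Implicit Types (q x y a : plane) (f h : plane -> R) (K Omega : set plane).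

Lemma differentiable_curve f (q1 q2 : R -> R) (s d1 d2 : R) :
  differentiable f (q1 s, q2 s) ->
  is_derive s (1 : R) q1 d1 -> is_derive s (1 : R) q2 d2 ->
  is_derive s (1 : R) (fun s => f (q1 s, q2 s))
   (partial1 f (q1 s, q2 s) * d1 + partial2 f (q1 s, q2 s) * d2).
Proof.
move=> df D1 D2; pose x : plane := (s, 0).
have dd (q : R -> R) (d : R) : is_derive s (1 : R) q d -> differentiable (fun y : plane => q y.1) x.
  move=> [dq _]; apply: (@differentiable_comp _ _ _ _ fst q x); last exact/derivable1_diffP.
  by have [] := @Ck_is_diff _ setT 0 _ x openT I (@Ck_fst R setT 1).
have [d e] := @is_derive_comp2 _ f (fun y => q1 y.1) (fun y => q2 y.1) x (1, 0) df (dd _ _ D1) (dd _ _ D2).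
have -> : partial1 f (q1 s, q2 s) * d1 + partial2 f (q1 s, q2 s) * d2 =
    partial1 (fun y : plane => f (q1 y.1, q2 y.1)) x.
  rewrite [RHS]e.
  have [h1 _] := D1; have [h2 _] := D2.
  have [_ ->] := @is_derive_fst_comp _ q1 x ((1, 0) : plane) h1.
  have [_ ->] := @is_derive_fst_comp _ q2 x ((1, 0) : plane) h2.
  by rewrite /= !mulr1 (derive1P D1) (derive1P D2).
exact: (is_derive_slice1 (f := fun y : plane => f (q1 y.1, q2 y.1)) d).
Qed.

Definition graphf (al : R) (Q : R -> R) (x : plane) : R := al * x.1 + Q x.2.

Lemma graphf_diff al (Q : R -> R) x (d : R) : is_derive x.2 (1 : R) Q d ->
  [/\ differentiable (graphf al Q) x, partial1 (graphf al Q) x = al & partial2 (graphf al Q) x = d].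
Proof.
move=> DQ.
have df : differentiable (graphf al Q) x.
  apply: (@differentiableD _ _ _ (fun x : plane => al * x.1) (fun x : plane => Q x.2)).
    apply: (@differentiableM _ _ (cst al) fst); first exact: differentiable_cst.
    by have [] := @Ck_is_diff _ setT 0 _ x openT I (@Ck_fst R setT 1).
  have [dQ _] := DQ; apply: (@differentiable_comp _ _ _ _ snd Q x); last exact/derivable1_diffP.
  by have [] := @Ck_is_diff _ setT 0 _ x openT I (@Ck_snd R setT 1).
have dv (v : plane) : derivable (graphf al Q) x v by exact: diff_derivable.
case: x DQ df dv => x1 x2 /= DQ df dv.
split=> //.
  have e := is_derive_slice1 (dv (1, 0)).
  have e' := derD (derZ al (is_derive_id x1 (1 : R))) (is_derive_cst (Q x2) x1 (1 : R)).
  by have := derive1P e; rewrite (derive1P e') mulr1 addr0.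
have e := is_derive_slice2 (dv (0, 1)).
have e' := derD (is_derive_cst (al * x1) x2 (1 : R)) DQ.
by have := derive1P e; rewrite (derive1P e') add0r.
Qed.

Lemma derive0_const (f : R -> R) (u v : R) : u < v -> (forall t, u <= t <= v -> {for t, continuous f}) ->
  (forall t, u < t < v -> is_derive t (1 : R) f 0) -> f u = f v.
Proof.
move=> uv cf df.
have h1 (t : R) : t \in `]u, v[%R -> is_derive t (1 : R) f ((fun=> 0) t).
  by rewrite in_itv => /= h; exact: df.
have h2 : {within `[u, v], continuous f}.
  by apply: continuous_in_subspaceT => t /set_mem /=; rewrite in_itv => /= h; exact: cf.
have [c _] := MVT uv h1 h2.
by rewrite mul0r => /eqP; rewrite subr_eq0 => /eqP.
Qed.

(* [h] is a local defining function of [K], with nonzero differential [(h1, h2)] at [z]. *)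
Definition regular_boundary K z (h1 h2 : R) := exists h : plane -> R,
  [/\ differentiable h z /\ h z = 0, partial1 h z = h1 /\ partial2 h z = h2, h1 ^+ 2 + h2 ^+ 2 != 0 &
     exists2 r : R, 0 < r & forall x, (ball z r : set plane) x -> K x <-> 0 <= h x].

(** Two lobes, right and left of [a], meeting only at [a]. The vertical edges are at distance [e^4],
    where the quartic arcs reach the heights [e] and [- e]. *)
Definition lobes a (e : R) : set plane :=
  [set x : plane | (x.2 - a.2) ^+ 4 <= `|x.1 - a.1| <= e ^+ 4].

Section Lobes.
Variables (a : plane) (e : R).
Hypothesis e0 : 0 < e.
Local Notation K := (lobes a e).

Let poly4 (x : R) : is_derive x (1 : R) (fun y : R => (y - a.2) ^+ 4) (4 * (x - a.2) ^+ 3).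
Proof.
have d := derD (is_derive_id x (1 : R)) (is_derive_cst (- a.2) x (1 : R)).
have := is_derive1_comp2 (p := fun y : R => y ^+ 4) (q := fun y : R => y + cst (- a.2) y) (derX 4 (x - a.2)) d.
by rewrite addr0 mulr1.
Qed.

Lemma cont4 : continuous (fun x : plane => `|x.1 - a.1| - (x.2 - a.2) ^+ 4) /\
  continuous (fun x : plane => `|x.1 - a.1|).
Proof.
have c1 : continuous (fun x : plane => `|x.1 - a.1|).
  move=> x; apply: (@continuous_comp _ _ _ (fun x : plane => x.1 - a.1) (fun t : R => `|t|)).
    by apply: cvgB; [exact: cvg_fst|exact: cvg_cst].
  exact: norm_continuous.
split=> // x; apply: cvgB; first exact: c1.
apply: (@continuous_comp _ _ _ (fun x : plane => x.2 - a.2) (fun t : R => t ^+ 4)).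
  by apply: cvgB; [exact: cvg_snd|exact: cvg_cst].
exact: exprn_continuous.
Qed.

Lemma lobes_interior z : (z.2 - a.2) ^+ 4 < `|z.1 - a.1| < e ^+ 4 ->
  exists2 r : R, 0 < r & (ball z r : set plane) `<=` K.
Proof.
move=> /andP[h1 h2]; have [c1 c2] := cont4.
have o : open ([set x : plane | 0 < `|x.1 - a.1| - (x.2 - a.2) ^+ 4] `&` [set x : plane | `|x.1 - a.1| < e ^+ 4]).
  apply: openI.
    by apply: (@open_comp _ _ _ [set t : R | 0 < t]) => [x _|]; [exact: c1|exact: open_gt].
  by apply: (@open_comp _ _ _ [set t : R | t < e ^+ 4]) => [x _|]; [exact: c2|exact: open_lt].
have /nbhs_ballP[r /= r0 Hr] : nbhs z ([set x : plane | 0 < `|x.1 - a.1| - (x.2 - a.2) ^+ 4] `&` [set x : plane | `|x.1 - a.1| < e ^+ 4]).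
  by apply: open_nbhs_nbhs; split=> //; split=> //=; rewrite subr_gt0.
by exists r => // x /Hr[/=]; rewrite subr_gt0 /lobes /= => /ltW -> /ltW ->.
Qed.

Lemma lobes_closed : closed K.
Proof.
have [c1 c2] := cont4.
rewrite (_ : K = [set x : plane | 0 <= `|x.1 - a.1| - (x.2 - a.2) ^+ 4] `&` [set x : plane | `|x.1 - a.1| <= e ^+ 4]).
  apply: closedI.
    by apply: (@preimage_closed _ _ (fun x : plane => `|x.1 - a.1| - (x.2 - a.2) ^+ 4) [set t : R | 0 <= t]) => [x _|]; [exact: c1|exact: closed_ge].
  by apply: (@preimage_closed _ _ (fun x : plane => `|x.1 - a.1|) [set t : R | t <= e ^+ 4]) => [x _|]; [exact: c2|exact: closed_le].
by apply/seteqP; split => x; rewrite /lobes /= subr_ge0 => /andP.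
Qed.

Lemma lobes_bound x : e < 1 -> K x -> `|x.1 - a.1| <= e /\ `|x.2 - a.2| <= e.
Proof.
move=> e1 /andP[h1 h2]; split.
  apply: le_trans h2 _; rewrite -[leRHS]expr1 ler_wiXn2l// ?ltW//.
have h3 := le_trans h1 h2.
have : `|x.2 - a.2| ^+ 4 <= e ^+ 4 by rewrite -normrX ger0_norm// exprn_even_ge0.
by rewrite ler_pXn2r// nnegrE// ltW.
Qed.

Let near_ball (Q : plane -> Prop) z : (\forall x \near z, Q x) -> exists2 r : R, 0 < r &
  forall x, (ball z r : set plane) x -> Q x.
Proof. by move=> /nbhs_ballP[r /= r0 H]; exists r. Qed.

(** The sign [s] is 1 or -1 and selects the lobe. The arc and the edge of a lobe share the corners
    [t = e] and [t = - e]. *)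
Definition lobe_arc (s t : R) : plane := (a.1 + s * t ^+ 4, a.2 + t).
Definition lobe_edge (s t : R) : plane := (a.1 + s * e ^+ 4, a.2 + t).

(** [t != 0] avoids [a], where the lobes meet, and [|t| < e] avoids the corners; elsewhere
    [s (x.1 - a.1) - (x.2 - a.2)^4] is a local defining function. *)
Lemma arc_regular (s t : R) : s ^+ 2 = 1 -> t != 0 -> `|t| < e ->
  regular_boundary K (lobe_arc s t) s (- (4 * t ^+ 3)).
Proof.
move=> s2 t0 te.
have t4 : 0 < t ^+ 4 by rewrite exprn_even_gt0//= t0 orbT.
have te4 : t ^+ 4 < e ^+ 4.
  by rewrite -(@ger0_norm _ (t ^+ 4)) ?ltW// normrX ltr_pXn2r ?nnegrE// ltW.
have ns : `|s| = 1 by apply/eqP; rewrite -(eqrXn2 (n := 2))// real_normK ?num_real// s2 expr1n.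
exists (graphf s (fun y : R => - (s * a.1) + - (y - a.2) ^+ 4)).
have := @graphf_diff s (fun y : R => - (s * a.1) + - (y - a.2) ^+ 4) (lobe_arc s t) (- (4 * t ^+ 3)).
case.
  have := derD (is_derive_cst (- (s * a.1)) (lobe_arc s t).2 (1 : R)) (derN (poly4 (lobe_arc s t).2)).
  by rewrite add0r /= addrAC subrr add0r.
move=> D p1 p2; split=> //.
- split=> //; rewrite /graphf /lobe_arc /= (_ : a.2 + t - a.2 = t); last by ring.
  rewrite (_ : _ + _ = (s ^+ 2 - 1) * t ^+ 4); last by ring.
  by rewrite s2 subrr mul0r.
- by rewrite s2 gt_eqF// ltr_wpDr// sqr_ge0.
apply: near_ball.
have n1 : \forall x \near lobe_arc s t, 0 < s * (x.1 - a.1).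
  have c : {for lobe_arc s t, continuous (fun x : plane => s * (x.1 - a.1))}.
    by apply: cvgM; [exact: cvg_cst|apply: cvgB; [exact: cvg_fst|exact: cvg_cst]].
  apply: (cvgr_gt _ c); rewrite /lobe_arc /= addrAC subrr add0r mulrA -expr2 s2 mul1r//.
have n2 : \forall x \near lobe_arc s t, `|x.1 - a.1| < e ^+ 4.
  have [_ c2] := cont4; apply: (cvgr_lt _ (c2 (lobe_arc s t))).
  by rewrite /lobe_arc /= addrAC subrr add0r normrM ns mul1r gtr0_norm.
apply: filterS2 n1 n2 => x h1 h2.
have nx : `|x.1 - a.1| = s * (x.1 - a.1) by rewrite -[LHS]mul1r -ns -normrM gtr0_norm.
rewrite /lobes /= (ltW h2) andbT nx /graphf.
rewrite (_ : s * x.1 + _ = s * (x.1 - a.1) - (x.2 - a.2) ^+ 4) ?subr_ge0//; last by ring.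
Qed.

Lemma edge_regular (s t : R) : s ^+ 2 = 1 -> `|t| < e ->
  regular_boundary K (lobe_edge s t) (- s) 0.
Proof.
move=> s2 te.
have e4 : 0 < e ^+ 4 by rewrite exprn_gt0.
have te4 : t ^+ 4 < e ^+ 4.
  by rewrite -(@ger0_norm _ (t ^+ 4)) ?exprn_even_ge0// normrX ltr_pXn2r ?nnegrE// ltW.
have ns : `|s| = 1 by apply/eqP; rewrite -(eqrXn2 (n := 2))// real_normK ?num_real// s2 expr1n.
exists (graphf (- s) (cst (e ^+ 4 + s * a.1))).
have [D p1 p2] := graphf_diff (- s) (is_derive_cst (e ^+ 4 + s * a.1) (lobe_edge s t).2 (1 : R)).
split=> //.
- split=> //; rewrite /graphf /lobe_edge /= (_ : _ + _ = (1 - s ^+ 2) * e ^+ 4); last by ring.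
  by rewrite s2 subrr mul0r.
- by rewrite sqrrN s2 expr0n addr0 oner_eq0.
apply: near_ball.
have n1 : \forall x \near lobe_edge s t, 0 < s * (x.1 - a.1).
  have c : {for lobe_edge s t, continuous (fun x : plane => s * (x.1 - a.1))}.
    by apply: cvgM; [exact: cvg_cst|apply: cvgB; [exact: cvg_fst|exact: cvg_cst]].
  apply: (cvgr_gt _ c); rewrite /lobe_edge /= addrAC subrr add0r mulrA -expr2 s2 mul1r//.
have n2 : \forall x \near lobe_edge s t, 0 < `|x.1 - a.1| - (x.2 - a.2) ^+ 4.
  have [c1 _] := cont4; apply: (cvgr_gt _ (c1 (lobe_edge s t))).
  rewrite /lobe_edge /= addrAC subrr add0r normrM ns mul1r gtr0_norm//.
  by rewrite (_ : a.2 + t - a.2 = t) ?subr_gt0//; ring.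
apply: filterS2 n1 n2 => x h1; rewrite subr_gt0 => h2.
have nx : `|x.1 - a.1| = s * (x.1 - a.1) by rewrite -[LHS]mul1r -ns -normrM gtr0_norm.
rewrite /lobes /= (ltW h2) /= nx /graphf.
rewrite (_ : - s * x.1 + _ = e ^+ 4 - s * (x.1 - a.1)) ?subr_ge0// /cst; by ring.
Qed.

Lemma is_derive_arc (s t : R) : is_derive t (1 : R) (fun t => (lobe_arc s t).1) (s * (4 * t ^+ 3)) /\
  is_derive t (1 : R) (fun t => (lobe_arc s t).2) 1.
Proof.
split.
  by have := derD (is_derive_cst a.1 t (1 : R)) (derZ s (derX 4 t)); rewrite add0r.
by have := derD (is_derive_cst a.2 t (1 : R)) (is_derive_id t (1 : R)); rewrite add0r.
Qed.
Lemma is_derive_edge (s t : R) : is_derive t (1 : R) (fun t => (lobe_edge s t).1) 0 /\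
  is_derive t (1 : R) (fun t => (lobe_edge s t).2) 1.
Proof.
split; first exact: is_derive_cst.
by have := derD (is_derive_cst a.2 t (1 : R)) (is_derive_id t (1 : R)); rewrite add0r.
Qed.

Lemma lobes_cases z : K z ->
  [\/ exists s t, [/\ s ^+ 2 = 1, `|t| <= e & z = lobe_arc s t],
      exists s t, [/\ s ^+ 2 = 1, `|t| <= e & z = lobe_edge s t] |
      exists2 r : R, 0 < r & (ball z r : set plane) `<=` K].
Proof.
move=> Kz; have /andP[h1 h2] := Kz.
have te : `|z.2 - a.2| <= e.
  have : `|z.2 - a.2| ^+ 4 <= e ^+ 4.
    by rewrite -normrX ger0_norm ?exprn_even_ge0//; exact: le_trans h1 h2.
  by rewrite ler_pXn2r// nnegrE// ltW.
have [s [s2 sz]] : exists s : R, s ^+ 2 = 1 /\ z.1 - a.1 = s * `|z.1 - a.1|.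
  have [h|h] := leP 0 (z.1 - a.1).
    by exists 1; rewrite expr1n mul1r ger0_norm.
  by exists (-1); rewrite sqrrN expr1n mulN1r ltr0_norm ?opprK.
have z1 : z.1 = a.1 + s * `|z.1 - a.1| by rewrite -sz addrC subrK.
have z2 : z.2 = a.2 + (z.2 - a.2) by rewrite addrC subrK.
move: h1; rewrite le_eqVlt => /orP[/eqP h1|h1].
  apply: Or31; exists s, (z.2 - a.2); split=> //.
  by rewrite [LHS]surjective_pairing /lobe_arc h1 -z1 -z2.
move: h2; rewrite le_eqVlt => /orP[/eqP h2|h2].
  apply: Or32; exists s, (z.2 - a.2); split=> //.
  by rewrite [LHS]surjective_pairing /lobe_edge -h2 -z1 -z2.
by apply: Or33; apply: lobes_interior; rewrite h1.
Qed.

(* The complement of the lobes near their common point [a] lies between two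
   quartic graphs, so it is much smaller than a ball. *)
Lemma lobes_complement (s : R) x : s <= e ^+ 4 -> `|x.1 - a.1| < s -> `|x.2 - a.2| < s -> ~ K x ->
  `|x.1 - a.1| < s ^+ 4.
Proof.
move=> se h1 h2 nK.
have h3 : `|x.1 - a.1| <= e ^+ 4 by apply: ltW (lt_le_trans h1 se).
have : `|x.1 - a.1| < (x.2 - a.2) ^+ 4.
  by rewrite ltNge; apply/negP => h4; apply: nK; rewrite /lobes /= h4.
move=> /lt_le_trans; apply.
rewrite -[leLHS]ger0_norm ?exprn_even_ge0// normrX lerXn2r ?nnegrE//; last exact: ltW.
exact: le_trans (normr_ge0 _) (ltW h2).
Qed.

End Lobes.
End Curves.

(** * The contradiction at the common point of the lobes *)

Section Contradiction.
Context {R : realType}.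
Local Notation plane := (R * R)%type.
Local Notation P := (mplane R).
Local Notation mu := (@leb2 R).
Implicit Types (q x y z : plane) (f h : plane -> R).

Lemma differentiable_lipschitz f q : differentiable f q -> exists C d : R, [/\ 0 < C, 0 < d &
  forall x, `|x - q| < d -> `|f x - f q| <= C * `|x - q|].
Proof.
move=> df; have [d d0 H] := diff_frechet df ltr01.
exists (`|partial1 f q| + `|partial2 f q| + 1), d; split; [by rewrite ltr_wpDl// addr_ge0|by []|].
move=> x xd; have h := H x xd; rewrite mul1r in h.
have [v1 v2] : `|(x - q).1| <= `|x - q| /\ `|(x - q).2| <= `|x - q| by apply/plane_norm_le.
rewrite -[f x - f q](subrK (lin2 (partial1 f q) (partial2 f q) (x - q))) addrC.
apply: le_trans (ler_normD _ _) _; rewrite mulrDl mul1r; apply: lerD h.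
rewrite /lin2; apply: le_trans (ler_normD _ _) _; rewrite !normrM mulrDl.
by apply: lerD; exact: ler_wpM2l.
Qed.

Variables (b p : R -> R) (pc : R).
Hypotheses (sb : smooth1 b) (sp : smooth1 p) (b0 : forall s, 0 <= b s) (p0 : forall s, 0 <= p s)
  (bz : forall s, 1 <= s -> b s = 0) (pz : forall s, 1 <= s -> p s = 0)
  (bp : forall s, 2^-1 < s < 1 -> 0 < b s) (pc0 : 0 < pc) (pp : forall s, s <= 8^-1 -> p s = pc)
  (ode : forall s, 4 * (derive1 p s + s * derive1 (derive1 p) s) = b s - 4 * b (4 * s)).
Local Notation J n h q := (convol h (sq (kf b n)) q).

Variables (Omega : set plane) (M : R) (W psi g1 g2 : plane -> R).
Variables (eta zeta : plane -> plane) (a : plane) (e : R).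
Local Notation K := (lobes a e).
Hypotheses (oO : open Omega) (M0 : 0 < M) (OM : Omega `<=` (ball (0 : plane) M : set plane))
  (e0 : 0 < e) (e1 : e < 1) (aO : (ball a (e + e) : set plane) `<=` Omega)
  (VD : vol_diffeo Omega eta zeta) (mW : mfun2 W)
  (WK : forall x, Omega x -> K (zeta x) -> W x = 1)
  (WN : forall x, Omega x -> ~ K (zeta x) -> W x = 2)
  (WO : forall x, ~ Omega x -> W x = 0)
  (D : dirichlet_data Omega W psi g1 g2)
  (stat : forall n q, good Omega n q ->
     I2 (fun x => W x * (vf1 q (kf b n) x * g1 x + vf2 q (kf b n) x * g2 x)) = 0).

Local Notation Psi := (Lim b Omega psi).
Local Notation G1 := (Lim b Omega g1).
Local Notation G2 := (Lim b Omega g2).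

Let W0 x : 0 <= W x.
Proof.
have [Ox|nO] := pselect (Omega x); last by rewrite WO.
by have [k|k] := pselect (K (zeta x)); [rewrite WK|rewrite WN].
Qed.
Let W1 x : Omega x -> 1 <= W x.
Proof. by move=> Ox; have [k|k] := pselect (K (zeta x)); [rewrite WK|rewrite WN// ler1n]. Qed.
Let WB x : `|W x| <= 2.
Proof.
rewrite ger0_norm//.
have [Ox|nO] := pselect (Omega x); last by rewrite WO.
by have [k|k] := pselect (K (zeta x)); [rewrite WK// ler1n|rewrite WN].
Qed.

Let lpsi : L1 psi := L1_psi M0 OM D.
Let lg1 : L1 g1 := L1_g1 M0 OM D.
Let lg2 : L1 g2 := L1_g2 M0 OM D.
Let rates := J_rate sb sp bz pz ode oO M0 OM mW WB D.
Let mPsi : mfun2 Psi. Proof. by have [r _ _] := rates; exact: (Lim_mfun sb bz oO lpsi r). Qed.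
Let mG1 : mfun2 G1. Proof. by have [_ r _] := rates; exact: (Lim_mfun sb bz oO lg1 r). Qed.
Let mG2 : mfun2 G2. Proof. by have [_ _ r] := rates; exact: (Lim_mfun sb bz oO lg2 r). Qed.
Let cG1 q : Omega q -> {for q, continuous G1}.
Proof. by have [_ r _] := rates; exact: (Lim_continuous sb bz oO lg1 r). Qed.
Let cG2 q : Omega q -> {for q, continuous G2}.
Proof. by have [_ _ r] := rates; exact: (Lim_continuous sb bz oO lg2 r). Qed.
Let aeP : {ae mu, forall x : P, Omega x -> mass b * psi x = Psi x}.
Proof. by have [r _ _] := rates; exact: (Lim_ae sb b0 bz oO OM lpsi r). Qed.
Let ae1 : {ae mu, forall x : P, Omega x -> mass b * g1 x = G1 x}.
Proof. by have [_ r _] := rates; exact: (Lim_ae sb b0 bz oO OM lg1 r). Qed.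
Let ae2 : {ae mu, forall x : P, Omega x -> mass b * g2 x = G2 x}.
Proof. by have [_ _ r] := rates; exact: (Lim_ae sb b0 bz oO OM lg2 r). Qed.
Let dPsi q : Omega q -> is_diff q Psi (lin2 (G1 q) (G2 q)).
Proof. exact: (Lim_psi_diff sb sp bz pz ode oO M0 OM mW WB D). Qed.

(** The identity for the weak gradient, multiplied by [mass b], is the identity for the continuous
    representatives. *)
Let stat_Lim n q : good Omega n q ->
  I2 (fun x => W x * (vf1 q (kf b n) x * G1 x + vf2 q (kf b n) x * G2 x)) = 0.
Proof.
move=> gq.
have [k1 k2] := smooth_vf q (smooth1_kf sb n).
have [l1 l2] := L2_vf q (smooth1_kf sb n) (dyad_gt0 n) (kf_out bz (n := n)).
have [[_ L2g1 L2g2] _ _ _] := D.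
have lz := L1D (L2_mul l1 L2g1) (L2_mul l2 L2g2).
have lW : L1 (fun x => W x * (vf1 q (kf b n) x * g1 x + vf2 q (kf b n) x * g2 x)).
  apply: (L1_dom (mfun2M mW (L1_mfun lz)) (L1Z 2 (L1_abs lz))) => x.
  by rewrite normrM ler_wpM2r.
transitivity (I2 (fun x => mass b * (W x * (vf1 q (kf b n) x * g1 x + vf2 q (kf b n) x * g2 x)))); last first.
  by rewrite I2Z// stat// mulr0.
apply: I2_ae.
- by apply: mfun2M => //; apply: mfun2D; apply: mfun2M => //; exact: smooth_mfun2.
- by apply: mfun2M; [exact: mfun2_cst|exact: L1_mfun].
have ff := ae_filter_ringOfSetsType mu.
apply: (@filterS2 _ _ ff _ _ _ _ ae1 ae2) => x h1 h2.
have [Ox|nO] := pselect (Omega x); last by rewrite WO// !mul0r mulr0.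
rewrite -(h1 Ox) -(h2 Ox); move: (vf1 _ _ _) (vf2 _ _ _) (g1 x) (g2 x) (W x) (mass b).
by move=> *; ring.
Qed.

Let Oeta x : Omega x -> Omega (eta x). Proof. by have [_ [h _] _ _] := VD; exact: h. Qed.
Let etaK x : Omega x -> zeta (eta x) = x. Proof. by have [_ _ [h _] _] := VD; exact: h. Qed.
Let zetaK x : Omega x -> eta (zeta x) = x. Proof. by have [_ _ [_ h] _] := VD; exact: h. Qed.

Let deta z : Omega z -> differentiable (fun x => (eta x).1) z /\ differentiable (fun x => (eta x).2) z.
Proof.
move=> Oz; have [[[s1 s2] _] _ _ _] := VD.
by split; [have [] := Ck_is_diff oO Oz (s1 1)|have [] := Ck_is_diff oO Oz (s2 1)].
Qed.
Let dzeta z : Omega z -> differentiable (fun x => (zeta x).1) z /\ differentiable (fun x => (zeta x).2) z.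
Proof.
move=> Oz; have [[_ [s1 s2]] _ _ _] := VD.
by split; [have [] := Ck_is_diff oO Oz (s1 1)|have [] := Ck_is_diff oO Oz (s2 1)].
Qed.

Let zeta_lipschitz q : Omega q -> exists C d : R, [/\ 0 < C, 0 < d &
  forall x, `|x - q| < d -> Omega x /\ `|zeta x - zeta q| <= C * `|x - q|].
Proof.
move=> Oq; have [d1 d2] := dzeta Oq.
have [C1 [r1 [C10 r10 H1]]] := differentiable_lipschitz d1.
have [C2 [r2 [C20 r20 H2]]] := differentiable_lipschitz d2.
have /nbhs_ballP[r /= r0 Hr] : nbhs q Omega by apply: open_nbhs_nbhs.
exists (C1 + C2), (Num.min r (Num.min r1 r2)); split.
- by rewrite addr_gt0.
- by rewrite !lt_min r0 r10.
move=> x; rewrite !lt_min => /and3P[h h1 h2]; split.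
  by apply: Hr; rewrite -ball_normE /= distrC.
have n0 := normr_ge0 (x - q).
apply/plane_norm_le; split => /=.
  by apply: le_trans (H1 x h1) _; rewrite ler_wpM2r// lerDl ltW.
by apply: le_trans (H2 x h2) _; rewrite ler_wpM2r// lerDr ltW.
Qed.

(** The stream function is pulled back by [eta], so that the boundary curves are the explicit arcs
    of [K]. *)
Let Psieta y : R := Psi ((eta y).1, (eta y).2).
Let PsietaE y : Psieta y = Psi (eta y). Proof. by rewrite /Psieta -surjective_pairing. Qed.

Let comp_differentiable f (u1 u2 : plane -> R) z : differentiable f (u1 z, u2 z) ->
  differentiable u1 z -> differentiable u2 z -> differentiable (fun y => f (u1 y, u2 y)) z.
Proof.
move=> df d1 d2.
have dp : differentiable (fun y => (u1 y, u2 y)) z by exact: differentiable_pair.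
by apply: (@differentiable_comp _ _ _ _ (fun y => (u1 y, u2 y)) f).
Qed.

Let dPsieta z : Omega z -> differentiable Psieta z.
Proof.
move=> Oz; have [d1 d2] := deta Oz.
by apply: comp_differentiable => //; rewrite -surjective_pairing; have [] := dPsi (Oeta Oz).
Qed.

Let partialPsi q : Omega q -> partial1 Psi q = G1 q /\ partial2 Psi q = G2 q.
Proof.
move=> Oq; have [df E] := dPsi Oq.
have k (u v : R) : lin2 u v (1, 0) = u /\ lin2 u v (0, 1) = v.
  by rewrite /lin2 /= !mulr1 !mulr0 addr0 add0r.
have [k1 k2] := k (G1 q) (G2 q).
split; [apply: etrans k1|apply: etrans k2].
  by apply: etrans (deriveE _ df) _; rewrite E.
by apply: etrans (deriveE _ df) _; rewrite E.
Qed.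

(** The defining function of [K] composed with [zeta] defines the image of [K] near [eta z]. The
    blow-up makes the tangential derivative of [Psi] vanish there, and the chain rule carries this
    back to [z]. *)
Let tangent z (h1 h2 d1 d2 : R) : Omega z -> regular_boundary K z h1 h2 -> h1 * d1 + h2 * d2 = 0 ->
  partial1 Psieta z * d1 + partial2 Psieta z * d2 = 0.
Proof.
move=> Oz [h [[dh hz] [ph1 ph2] n0 [r r0 Hr]]] hd.
pose q := eta z; have Oq : Omega q := Oeta Oz.
have zq : zeta q = z := etaK Oz.
have zqp : ((zeta q).1, (zeta q).2) = z by rewrite -surjective_pairing.
have [de1 de2] := deta Oz; have [dz1 dz2] := dzeta Oq.
pose F y := h ((zeta y).1, (zeta y).2).
have dF : differentiable F q by apply: comp_differentiable => //; rewrite zqp.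
have Fq : F q = 0 by rewrite /F zqp.
pose n1 := partial1 F q; pose n2 := partial2 F q.
have isF : is_diff q F (lin2 n1 n2) by exact: DiffDef dF (diff_lin2 dF).
have qp : ((eta z).1, (eta z).2) = q by rewrite -surjective_pairing.
have dFq : differentiable F ((eta z).1, (eta z).2) by rewrite qp.
have chain (v : plane) : v != 0 -> 'D_v h z = n1 * 'D_v (fun x => (eta x).1) z + n2 * 'D_v (fun x => (eta x).2) z.
  move=> v0; have [_] := @is_derive_comp2 R F _ _ z v dFq de1 de2; rewrite qp => <-.
  apply: (partial_ext oO Oz v0) => y Oy.
  by rewrite /F -!surjective_pairing etaK.
pose A11 := partial1 (fun x => (eta x).1) z; pose A21 := partial1 (fun x => (eta x).2) z.
pose A12 := partial2 (fun x => (eta x).1) z; pose A22 := partial2 (fun x => (eta x).2) z.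
have E1 : h1 = n1 * A11 + n2 * A21 by rewrite -ph1; exact: chain (@e1_neq0 R).
have E2 : h2 = n1 * A12 + n2 * A22 by rewrite -ph2; exact: chain (@e2_neq0 R).
have nn : n1 ^+ 2 + n2 ^+ 2 != 0.
  apply: contra n0; rewrite paddr_eq0 ?sqr_ge0// !sqrf_eq0 => /andP[/eqP z1 /eqP z2].
  by rewrite E1 E2 z1 z2 !mul0r addr0 expr0n addr0.
have [C [d [C0 d0 Hd]]] := zeta_lipschitz Oq.
have near1 : \forall x \near q, `|G1 x| <= `|G1 q| + 1 /\ `|G2 x| <= `|G2 q| + 1.
  have /cvgrPdist_le/(_ _ ltr01) k1 := cG1 Oq; have /cvgrPdist_le/(_ _ ltr01) k2 := cG2 Oq.
  have tri (u v : R) : `|u - v| <= 1 -> `|v| <= `|u| + 1.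
    by move=> uv; rewrite -[v](subrK u) addrC (le_trans (ler_normD _ _))// lerD2l distrC.
  by apply: filterS2 k1 k2 => x h1' h2'; split; [exact: (tri _ _ h1')|exact: (tri _ _ h2')].
have /nbhs_ballP[d' /= d'0 Hd'] := near1.
pose d3 := Num.min (Num.min d (r / C)) d'.
have b3 x : (ball q d3 : set plane) x -> [/\ `|x - q| < d, `|x - q| < r / C & (ball q d' : set plane) x].
  by rewrite -ball_normE /= distrC !lt_min => /andP[/andP[-> ->] ->].
have WF x : (ball q d3 : set plane) x -> W x = if 0 <= F x then 1 else 2.
  move=> /b3[xd xr _]; have [Ox hx] := Hd x xd.
  have bx : (ball z r : set plane) (zeta x).
    rewrite -ball_normE /= distrC; rewrite zq in hx; apply: le_lt_trans hx _.
    by rewrite mulrC -ltr_pdivlMr.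
  have [k1 k2] := Hr _ bx; have Fx : F x = h (zeta x) by rewrite /F -surjective_pairing.
  case: ifP => hF.
    by apply: WK => //; apply: k2; rewrite -Fx.
  by apply: WN => // /k1; rewrite -Fx hF.
have GB x : (ball q d3 : set plane) x -> `|G1 x| <= `|G1 q| + `|G2 q| + 1 /\ `|G2 x| <= `|G1 q| + `|G2 q| + 1.
  move=> /b3[_ _ /Hd'[k1 k2]]; split.
    by apply: le_trans k1 _; rewrite lerD2r lerDl.
  by apply: le_trans k2 _; rewrite lerD2r lerDr.
have d30 : 0 < d3 by rewrite !lt_min d0 divr_gt0.
have [N HN] := good_ex oO Oq.
have bu := blow_up sb b0 bz bp mW mG1 mG2 d30 WF GB (cG1 Oq) (cG2 Oq) Fq isF nn.
have {}bu : n1 * G2 q - n2 * G1 q = 0.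
  by apply: bu; exists N => n nN; apply: stat_Lim; apply: HN => //; apply: ballxx; exact: dyad_gt0.
have dP : differentiable Psi ((eta z).1, (eta z).2) by rewrite qp; have [] := dPsi Oq.
have [q1 q2] := partialPsi Oq.
have P1 : partial1 Psieta z = G1 q * A11 + G2 q * A21.
  by have [_] := @is_derive_comp2 R Psi _ _ z (1, 0) dP de1 de2; rewrite qp q1 q2.
have P2 : partial2 Psieta z = G1 q * A12 + G2 q * A22.
  by have [_] := @is_derive_comp2 R Psi _ _ z (0, 1) dP de1 de2; rewrite qp q1 q2.
rewrite P1 P2; rewrite E1 E2 in hd; move: nn hd bu; clearbody A11 A12 A21 A22 n1 n2.
move: (G1 q) (G2 q) => x1 x2 nn hd bu; apply: (mulfI nn); rewrite mulr0.
(* The gradient is decomposed along the normal [(n1, n2)] and its rotation by a right angle: the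
   first part is killed by [hd], the second by [bu]. *)
transitivity ((n1 * x1 + n2 * x2) * ((n1 * A11 + n2 * A21) * d1 + (n1 * A12 + n2 * A22) * d2) +
  (n1 * x2 - n2 * x1) * (n1 * (A21 * d1 + A22 * d2) - n2 * (A11 * d1 + A12 * d2))); first by ring.
by rewrite hd bu mulr0 mul0r addr0.
Qed.

Let K_in x : `|x.1 - a.1| <= e -> `|x.2 - a.2| <= e -> Omega x.
Proof.
move=> h1 h2; apply: aO; apply/plane_ballP; rewrite ![`|_ - x.1|]distrC ![`|_ - x.2|]distrC.
by split; [apply: le_lt_trans h1 _|apply: le_lt_trans h2 _]; rewrite ltrDl.
Qed.
Let KO x : K x -> Omega x. Proof. by move=> /(lobes_bound e0 e1)[h1 h2]; exact: K_in. Qed.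

Let e4e : e ^+ 4 <= e. Proof. by rewrite -[leRHS]expr1 ler_wiXn2l// ?ltW. Qed.
Let s1E (s : R) : s ^+ 2 = 1 -> `|s| = 1.
Proof. by move=> s2; apply/eqP; rewrite -(eqrXn2 (n := 2))// real_normK ?num_real// s2 expr1n. Qed.
Let O_arc (s t : R) : s ^+ 2 = 1 -> `|t| <= e -> Omega (lobe_arc a s t).
Proof.
move=> /s1E s1 te; apply: K_in => /=; last by rewrite (_ : a.2 + t - a.2 = t)//; ring.
rewrite addrAC subrr add0r normrM s1 mul1r normrX; apply: le_trans e4e.
by rewrite lerXn2r// nnegrE// ltW.
Qed.
Let O_edge (s t : R) : s ^+ 2 = 1 -> `|t| <= e -> Omega (lobe_edge a e s t).
Proof.
move=> /s1E s1 te; apply: K_in => /=; last by rewrite (_ : a.2 + t - a.2 = t)//; ring.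
by rewrite addrAC subrr add0r normrM s1 mul1r ger0_norm// exprn_ge0// ltW.
Qed.

Let curve_const (q1 q2 d1 d2 : R -> R) (u v : R) : u <= v ->
  (forall t, u <= t <= v -> Omega (q1 t, q2 t)) ->
  (forall t, is_derive t (1 : R) q1 (d1 t)) -> (forall t, is_derive t (1 : R) q2 (d2 t)) ->
  (forall t, u < t < v -> exists h1 h2 : R, regular_boundary K (q1 t, q2 t) h1 h2 /\ h1 * d1 t + h2 * d2 t = 0) ->
  Psieta (q1 u, q2 u) = Psieta (q1 v, q2 v).
Proof.
rewrite le_eqVlt => /orP[/eqP ->//|uv] Oq D1 D2 Hreg.
have dc t : u <= t <= v -> is_derive t (1 : R) (fun t => Psieta (q1 t, q2 t))
    (partial1 Psieta (q1 t, q2 t) * d1 t + partial2 Psieta (q1 t, q2 t) * d2 t).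
  by move=> /Oq Ot; apply: differentiable_curve; first exact: dPsieta.
apply: (derive0_const (f := fun t => Psieta (q1 t, q2 t)) uv).
  by move=> t /dc[dt _]; apply: differentiable_continuous; exact/derivable1_diffP.
move=> t /andP[ut tv]; have utv : u <= t <= v by rewrite !ltW.
have [h1 [h2 [reg E]]] := Hreg t (introT andP (conj ut tv)).
by rewrite -(tangent (Oq _ utv) reg E); exact: dc.
Qed.

Let c0 := Psieta a.

(** The arc is not regular at [t = 0], so its halves are treated apart. Each of them ends at [a],
    which is how the constants of both lobes agree. *)
Let arc_const (s t : R) : s ^+ 2 = 1 -> `|t| <= e -> Psieta (lobe_arc a s t) = c0.
Proof.
move=> s2 te; have a0 : lobe_arc a s 0 = a by rewrite /lobe_arc expr0n mulr0 !addr0 -surjective_pairing.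
have D1 u := (is_derive_arc a s u).1; have D2 u := (is_derive_arc a s u).2.
have E (u v : R) : u <= v -> `|u| <= e -> `|v| <= e -> (0 <= u \/ v <= 0) -> Psieta (lobe_arc a s u) = Psieta (lobe_arc a s v).
  move=> uv ue ve uv0; apply: (curve_const uv _ D1 D2) => w.
    move=> /andP[uw wv]; apply: (O_arc s2); move: ue ve; rewrite !ler_norml => /andP[? ?] /andP[? ?].
    by apply/andP; split; lra.
  move=> /andP[uw wv]; exists s, (- (4 * w ^+ 3)); split; last first.
    by rewrite (_ : _ + _ = (s ^+ 2 - 1) * (4 * w ^+ 3)); [rewrite s2 subrr mul0r|ring].
  apply: arc_regular => //.
    by case: uv0 => h; [rewrite gt_eqF//; exact: le_lt_trans uw|rewrite lt_eqF//; exact: lt_le_trans wv h].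
  move: ue ve; rewrite ler_norml ltr_norml ler_norml => /andP[? ?] /andP[? ?].
  by apply/andP; split; lra.
have e0' : `|0 : R| <= e by rewrite normr0 ltW.
rewrite /c0 -[in RHS]a0; have [h|h] := leP 0 t.
  by rewrite (E 0 t h e0' te)//; left.
by apply: E => //; [exact: ltW|right].
Qed.

(** The edge meets the arc at the corner [t = e]; constancy along a curve needs regularity only
    strictly between its end points. *)
Let edge_const (s t : R) : s ^+ 2 = 1 -> `|t| <= e -> Psieta (lobe_edge a e s t) = c0.
Proof.
move=> s2 te; have ee : `|e| <= e by rewrite gtr0_norm.
rewrite -(arc_const s2 ee) -[lobe_arc a s e]/(lobe_edge a e s e).
have D1 u := (is_derive_edge a e s u).1; have D2 u := (is_derive_edge a e s u).2.
have te' : t <= e by rewrite (le_trans _ te)// ler_norm.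
move: te; rewrite ler_norml => /andP[t1 t2].
apply: (curve_const te' _ D1 D2) => w /andP[h1 h2].
  by apply: O_edge => //; rewrite ler_norml; apply/andP; split; lra.
exists (- s), 0; split; last by ring.
by apply: edge_regular => //; rewrite ltr_norml; apply/andP; split; lra.
Qed.

Let mass_gt0 : 0 < mass b.
Proof.
have T := T_sq_b sb bz.
apply: (@I2_pos_open _ _ (4 / 5, 0)) => //.
- exact: smooth_continuous (T_smooth T).
- exact: T_L1 T.
- by move=> x; exact: b0.
by apply: bp; rewrite /sqn /= expr0n addr0; apply/andP; split; lra.
Qed.

Let Ip_gt0 : 0 < I2 (sq p).
Proof.
have T := T_sq_p sp pz.
apply: (@I2_pos_open _ _ 0) => //.
- exact: smooth_continuous (T_smooth T).
- exact: T_L1 T.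
- by move=> x; exact: p0.
by rewrite /sq /sqn /= expr0n addr0 pp// invr_ge0.
Qed.

Let ball_good n q : good Omega n q -> (ball q (dyad n) : set plane) `<=` Omega.
Proof.
move=> gq x bx; apply: gq; apply: le_ball bx.
by have := dyad_gt0 (R := R) n; move: (dyad n) => d d0; lra.
Qed.

Let kq n q x : R := sq (kf b n) (x - q).
Let kq_out n q x : ~ (ball q (dyad n) : set plane) x -> kq n q x = 0.
Proof. by move=> nb; apply: (kf_out bz); apply: sqn_out => //; exact: dyad_gt0. Qed.
Let kq_ge0 n q x : 0 <= kq n q x.
Proof. by rewrite /kq /sq /kf mulr_ge0// exprn_ge0. Qed.
Let L1_kq n q : L1 (kq n q).
Proof.
have l := T_L1 (T_sq_kf sb bz n).
have l' := mpres_L1 (mpres_translation (- q)) l.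
by apply: L1_eq l' => x; rewrite /= /kq addrC.
Qed.
Let I2_kq n q : I2 (kq n q) = mass b.
Proof.
have l := T_L1 (T_sq_kf sb bz n).
rewrite -(I2_kf sb bz n) -(mpres_I2 (mpres_translation (- q)) l).
by apply: I2_eq => x; rewrite /= /kq addrC.
Qed.

Let J_Psi n q : good Omega n q ->
  L1 (fun x => Psi x * kq n q x) /\ mass b * J n psi q = I2 (fun x => Psi x * kq n q x).
Proof.
move=> gq; have l := conv_L1 q lpsi (T_sq_kf sb bz n).
have mk : mfun2 (fun x => Psi x * kq n q x) by exact: mfun2M mPsi (L1_mfun (L1_kq n q)).
have ae : {ae mu, forall x : P, mass b * (psi x * kq n q x) = Psi x * kq n q x}.
  apply: (@filterS _ _ (ae_filter_ringOfSetsType mu) _ _ _ aeP) => x h.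
  have [bx|nb] := pselect ((ball q (dyad n) : set plane) x); last by rewrite kq_out// !mulr0.
  by rewrite mulrA (h (ball_good gq bx)).
split; first exact: L1_ae mk ae (L1Z _ l).
rewrite /convol -(I2Z _ l); apply: I2_ae => //.
exact: L1_mfun (L1Z _ l).
Qed.

(** [W >= 1] on the ball bounds the kept difference from below by the integral of the potential,
    which scales like the square of the radius. *)
Let J_lower n q : good Omega n q -> Psi q + dyad n ^+ 2 * I2 (sq p) <= J n psi q.
Proof.
move=> gq; apply: le_trans (J_ge_Lim sb sp p0 bz pz ode oO M0 OM mW WB D W0 gq).
rewrite lerD2l -(I2_pf sp pz n).
have l := T_L1 (T_sq_pf sp pz n).
have lq : L1 (fun x => sq (pf p n) (x - q)).
  by apply: L1_eq (mpres_L1 (mpres_translation (- q)) l) => x; rewrite /= addrC.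
rewrite -(mpres_I2 (mpres_translation (- q)) l).
rewrite (I2_eq (g := fun x => sq (pf p n) (x - q))); last by move=> x /=; rewrite addrC.
apply: I2_le => //.
  apply: (L1_dom (mfun2M mW (L1_mfun lq)) (L1Z 2 (L1_abs lq))) => x.
  by rewrite normrM ler_wpM2r.
move=> x; have k0 : 0 <= sq (pf p n) (x - q) by exact: p0.
have [bx|nb] := pselect ((ball q (dyad n) : set plane) x).
  by rewrite ler_peMl//; apply: W1; exact: ball_good gq _ bx.
suff -> : sq (pf p n) (x - q) = 0 by rewrite mulr0.
by apply: (pf_out pz); apply: sqn_out => //; exact: dyad_gt0.
Qed.

Let compact_lobes : compact K.
Proof.
apply: subclosed_compact (@compact_box R a e) _; first exact: lobes_closed.
by move=> x /(lobes_bound e0 e1)[h1 h2]; split; rewrite distrC.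
Qed.

Let Ka : K a.
Proof. by rewrite /lobes /= !subrr expr0n normr0 lexx exprn_ge0// ltW. Qed.

(** The pulled-back stream function attains its maximum on the compact [K]. On the arcs and edges
    the value is [c0], and at an interior point the strict mean-value inequality would be
    violated. *)
Let Psi_le z : K z -> Psieta z <= c0.
Proof.
have [z0 /set_mem Kz0 max] : exists2 z0, z0 \in K & forall t, t \in K -> Psieta t <= Psieta z0.
  apply: compact_EVT_max => //; first by exists a.
  apply: continuous_in_subspaceT => t /set_mem Kt.
  by apply: differentiable_continuous; apply: dPsieta; exact: KO.
move=> Kz; apply: le_trans (max z (mem_set Kz)) _.
have [[s [t [s2 te ->]]]|[s [t [s2 te ->]]]|[r r0 rK]] := lobes_cases e0 Kz0.
- by rewrite arc_const.
- by rewrite edge_const.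
have Oz0 := KO Kz0; pose q := eta z0; have Oq : Omega q := Oeta Oz0.
exfalso; have [C [d [C0 d0 Hd]]] := zeta_lipschitz Oq.
have d1 : 0 < Num.min d (r / C) by rewrite lt_min d0 divr_gt0.
have [N HN] := dyad_small d1; have [N' HN'] := good_ex oO Oq.
pose n := maxn N N'.
have gq : good Omega n q by apply: HN'; [apply: ballxx; exact: dyad_gt0|exact: leq_maxr].
have := HN n (leq_maxl _ _); rewrite lt_min => /andP[nd nr].
have [lP JP] := J_Psi gq.
have up : mass b * J n psi q <= Psi q * mass b.
  have lk := L1_kq n q.
  have -> : Psi q * mass b = I2 (fun x => Psi q * kq n q x) by rewrite (I2Z _ lk) I2_kq.
  rewrite JP; apply: (I2_le lP (L1Z _ lk)) => x.
  have [bx|nb] := pselect ((ball q (dyad n) : set plane) x); last by rewrite (kq_out nb) !mulr0.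
  apply: ler_wpM2r => //.
  have xq : `|x - q| < dyad n by move: bx; rewrite -ball_normE /= distrC.
  have [Ox hx] := Hd x (lt_trans xq nd).
  have Kx : K (zeta x).
    apply: rK; rewrite -ball_normE /= distrC -[z0](etaK Oz0); apply: le_lt_trans hx _.
    by rewrite mulrC -ltr_pdivlMr//; exact: lt_trans xq nr.
  by have := max _ (mem_set Kx); rewrite !PsietaE zetaK.
have lo := J_lower gq.
have : Psi q + dyad n ^+ 2 * I2 (sq p) <= Psi q.
  by apply: le_trans lo _; rewrite -(ler_pM2l mass_gt0) [leRHS]mulrC.
by rewrite gerDl leNgt mulr_gt0// exprn_gt0// dyad_gt0.
Qed.

Theorem lobes_not_stationary : False.
Proof.
have Oa : Omega a := KO Ka; pose q := eta a; have Oq : Omega q := Oeta Oa.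
have [C [d [C0 d0 Hd]]] := zeta_lipschitz Oq.
have [dP _] := dPsi Oq.
have [L [d' [L0 d'0 Hd']]] := differentiable_lipschitz dP.
have [Cb Cb0 HCb] := T_bounded (T_sq_b sb bz).
have c0E : c0 = Psi q by rewrite /c0 PsietaE.
have e4 : 0 < e ^+ 4 by rewrite exprn_gt0.
have dd : 0 < Num.min (Num.min d d') (e ^+ 4 / C) by rewrite !lt_min d0 d'0 divr_gt0.
have [N HN] := dyad_small dd; have [N' HN'] := good_ex oO Oq.
have [_ _ _ vol] := VD.
have num (u : R) : u ^+ 4 *+ 2 * (u *+ 2) = 4 * u ^+ 5 by rewrite -[u ^+ 4 *+ 2]mulr_natl -[u *+ 2]mulr_natl; ring.
(* Product of three bounds on the part of the ball outside the image of [K]: [Psi - c0] at most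
   [L r], kernel at most [4^n Cb], area at most [4 (C r)^5]. With [4^n r^2 = 1] this is [X r^4]. *)
pose X := 4 * C ^+ 5 * (L * Cb).
have main n : (maxn N N' <= n)%N -> mass b * I2 (sq p) <= X * dyad n.
  rewrite geq_max => /andP[nN nN'].
  have gq : good Omega n q by apply: HN' => //; apply: ballxx; exact: dyad_gt0.
  have := HN n nN; rewrite !lt_min => /andP[/andP[nd nd'] ne].
  set r := dyad n in nd nd' ne *; have r0 : 0 < r := dyad_gt0 n.
  (* [zeta] maps the ball of radius [r] about [q] into the ball of radius [s] about [a]. *)
  pose s := C * r; have s0 : 0 < s by rewrite mulr_gt0.
  have se : s < e ^+ 4 by rewrite /s mulrC -ltr_pdivlMr.
  pose A : set plane := (ball a s : set plane) `\` K.
  have mA : @measurable _ P A.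
    apply: measurableD; first exact: measurable_plane_ball.
    by apply: closed_measurable2; exact: lobes_closed.
  have bO : (ball a s : set plane) `<=` Omega.
    apply: subset_trans aO; apply: le_ball.
    by apply: le_trans (ltW se) _; apply: le_trans e4e _; rewrite lerDl ltW.
  have AO : A `<=` Omega by move=> x [/bO].
  have mE := vol_diffeo_image_measurable oO VD mA AO.
  have muE : (mu (eta @` A) <= (4 * s ^+ 5)%:E)%E.
    rewrite (vol A mA AO).
    (* Near [a] the complement of [K] lies in a box of width [2 s^4] and height [2 s]. *)
    pose B : set plane := ball a.1 (s ^+ 4) `*` ball a.2 s.
    have mB1 : @measurable _ (mline R) (ball a.1 (s ^+ 4)) by exact: measurable_ball.
    have mB2 : @measurable _ (mline R) (ball a.2 s) by exact: measurable_ball.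
    have s40 : 0 <= s ^+ 4 by rewrite exprn_ge0// ltW.
    have EB : mu B = (4 * s ^+ 5)%:E.
      apply: (etrans (leb2X mB1 mB2)).
      rewrite (lebesgue_measure_ball a.1 s40) (lebesgue_measure_ball a.2 (ltW s0)) -EFinM.
      by rewrite num.
    rewrite -EB; apply: le_measure; rewrite ?inE//; first exact: measurableX.
    move=> x [/plane_ballP[h1 h2] nK]; split.
      rewrite -ball_normE /= distrC; apply: (@lobes_complement _ a e s x (ltW se)) => //; by rewrite distrC.
    by rewrite -ball_normE.
  have muE' : (mu (eta @` A) < +oo)%E by apply: le_lt_trans muE _; rewrite ltry.
  have [lP JP] := J_Psi gq.
  have lk := L1_kq n q; have lE := L1_indic mE muE'.
  have up : mass b * J n psi q - c0 * mass b <= L * r * (4 ^+ n * Cb) * (4 * s ^+ 5).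
    rewrite JP -[X in _ - c0 * X](I2_kq n q) -(I2Z c0 lk) -(I2B lP (L1Z c0 lk)).
    have cc : 0 <= L * r * (4 ^+ n * Cb) by rewrite !mulr_ge0// ?exprn_ge0// ltW.
    apply: (@le_trans _ _ (I2 (fun x => L * r * (4 ^+ n * Cb) * \1_(eta @` A) x))); last first.
      rewrite I2Z// ler_wpM2l// I2_indic// -lee_fin fineK//.
      by rewrite ge0_fin_numE.
    apply: (I2_le (L1B lP (L1Z c0 lk)) (L1Z _ lE)) => x.
    have i0 : 0 <= \1_(eta @` A) x :> R by rewrite indicE; case: (_ \in _).
    have [bx|nb] := pselect ((ball q r : set plane) x); last first.
      by rewrite (kq_out nb) !mulr0 subrr mulr_ge0.
    have xq : `|x - q| < r by move: bx; rewrite -ball_normE /= distrC.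
    have [Ox hx] := Hd x (lt_trans xq nd).
    rewrite -mulrBl.
    have [Kx|nK] := pselect (K (zeta x)).
      apply: (@le_trans _ _ 0); last by rewrite mulr_ge0.
      apply: mulr_le0_ge0 => //; rewrite subr_le0.
      by have := Psi_le Kx; rewrite PsietaE zetaK.
    have Ex : (eta @` A) x.
      exists (zeta x); last exact: zetaK.
      split=> //; rewrite -ball_normE /= distrC -[a](etaK Oa); apply: le_lt_trans hx _.
      by rewrite ltr_pM2l.
    rewrite indicE mem_set// mulr1 c0E.
    have k4 : kq n q x <= 4 ^+ n * Cb.
      rewrite /kq /sq /kf ler_wpM2l ?exprn_ge0//.
      have := HCb (2 ^+ n *: (x - q)); rewrite -[2 ^+ n *: (x - q)]add0r -sq_scale => h.
      exact: le_trans (ler_norm _) h.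
    have Pq : Psi x - Psi q <= L * r.
      apply: le_trans (ler_norm _) _; apply: le_trans (Hd' x (lt_trans xq nd')) _.
      by rewrite ler_wpM2l// ltW.
    apply: (le_trans (ler_wpM2r (kq_ge0 n q x) Pq)); apply: ler_wpM2l k4.
    by rewrite mulr_ge0// ltW.
  have lo := J_lower gq.
  have {}lo : mass b * (Psi q + r ^+ 2 * I2 (sq p)) <= mass b * J n psi q by rewrite ler_pM2l.
  have r4 : 4 ^+ n * r ^+ 2 = 1 := dyad_sqr n.
  have E : L * r * (4 ^+ n * Cb) * (4 * s ^+ 5) = X * r ^+ 4 * (4 ^+ n * r ^+ 2) by rewrite /X /s; ring.
  have r1 : r <= 1 by rewrite /r -(expr1n R n) lerXn2r ?nnegrE// invr_le1 ?ler1n ?unitfE.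
  have X0 : 0 <= X by rewrite /X !mulr_ge0// ?exprn_ge0// ltW.
  rewrite E r4 mulr1 c0E in up.
  have fin : r ^+ 2 * (mass b * I2 (sq p)) <= r ^+ 2 * (X * r ^+ 2).
    rewrite (_ : r ^+ 2 * (X * r ^+ 2) = X * r ^+ 4); last by ring.
    apply: le_trans up; rewrite lerBrDr; apply: le_trans lo; rewrite le_eqVlt; apply/orP; left; apply/eqP; ring.
  rewrite ler_pM2l ?exprn_gt0// in fin.
  apply: le_trans fin _; rewrite ler_wpM2l//.
  by rewrite expr2 ler_piMl// ltW.
have pos : 0 < mass b * I2 (sq p) by rewrite mulr_gt0.
have X0 : 0 <= X by rewrite /X !mulr_ge0// ?exprn_ge0// ltW.
(* [X + 1] avoids a division by [X], which is only known to be nonnegative. *)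
have X1 : 0 < X + 1 by rewrite ltr_wpDl.
have [N2 HN2] := dyad_small (divr_gt0 pos X1).
pose n := maxn (maxn N N') N2.
have := main n (leq_maxl _ _); apply/negP; rewrite -ltNge.
apply: (@le_lt_trans _ _ ((X + 1) * dyad n)); first by rewrite ler_wpM2r ?lerDl// ltW// dyad_gt0.
by rewrite mulrC -ltr_pdivlMr//; apply: HN2; exact: leq_maxr.
Qed.

End Contradiction.

(** * Simple connectedness of star-shaped sets *)

Section StarShaped.
Context {R : realType}.
Local Notation plane := (R * R)%type.

Lemma continuous_comp_within (T U : topologicalType) (g : T -> R) (f : R -> U) (A : set R) :
  continuous g -> (forall t, A (g t)) -> {within A, continuous f} -> continuous (f \o g).
Proof.
move=> cg gA /subspace_continuousP cf t.
apply: cvg_comp (cf _ (gA t)) => B; rewrite /= nbhs_simpl /within /= => nB.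
apply: (@filterS _ _ (nbhs_filter t) _ _ _ (cg t _ nB)) => x /=; apply; exact: gA.
Qed.

(** Retraction of the line onto [[0, 1]]; it turns formulas that are piecewise in the parameter into
    continuous maps defined everywhere. *)
Definition clamp (s : R) : R := Num.max 0 (Num.min s 1).

Lemma clamp_itv s : 0 <= clamp s <= 1.
Proof. by rewrite /clamp le_max lexx ge_max ler01 /= ge_min lexx orbT. Qed.

Lemma clamp_id s : 0 <= s <= 1 -> clamp s = s.
Proof. by move=> /andP[h1 h2]; rewrite /clamp min_l// max_r. Qed.

Lemma clamp_le0 s : s <= 0 -> clamp s = 0.
Proof. by move=> h; rewrite /clamp min_l ?max_l//; exact: le_trans ler01. Qed.

Lemma clamp_ge1 s : 1 <= s -> clamp s = 1.
Proof. by move=> h; rewrite /clamp min_r// max_r. Qed.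

Lemma clamp_continuous : continuous clamp.
Proof.
move=> s.
have cm : {for s, continuous (fun s : R => Num.min s 1)}.
  by apply: continuous_min; [exact: cvg_id|exact: cvg_cst].
exact: (@continuous_max _ _ (fun=> 0) (fun s : R => Num.min s 1) s (cvg_cst _) cm).
Qed.

(** Radial contraction to [p] would move the base point, which the definition keeps fixed. The loop
    is therefore first deformed to the path from the base point to [p] and back, and then retracted
    along it. *)
Lemma star_simply_connected (A : set plane) (p : plane) : A p ->
  (forall (x : plane) (m : R), A x -> 0 <= m <= 1 -> A (p + m *: (x - p))) -> simply_connected A.
Proof.
move=> Ap star; have cl := clamp_continuous.
have star1 (x : plane) : p + (1 : R) *: (x - p) = x by rewrite scale1r addrC subrK.
have clf (T : topologicalType) (f : T -> R) (z : T) : {for z, continuous f} -> {for z, continuous (fun z => clamp (f z))}.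
  by move=> cf; apply: (@continuous_comp _ _ _ f clamp); [exact: cf|exact: cl].
split.
  move=> x y Ax Ay.
  (* The path goes straight from [x] to [p], then straight from [p] to [y]. *)
  exists (fun t => p + clamp (1 - 2 * t) *: (x - p) + clamp (2 * t - 1) *: (y - p)); split.
  - apply: continuous_subspaceT => t.
    have c2 : {for t, continuous (fun t : R => 2 * t)} by apply: cvgM; [exact: cvg_cst|exact: cvg_id].
    have c3 : {for t, continuous (fun t : R => 1 - 2 * t)} by apply: cvgB => //; exact: cvg_cst.
    have c4 : {for t, continuous (fun t : R => 2 * t - 1)} by apply: cvgB => //; exact: cvg_cst.
    apply: cvgD.
      apply: cvgD; first exact: cvg_cst.
      apply: cvgZ; last exact: cvg_cst.
      exact: (clf _ _ _ c3).
    apply: cvgZ; last exact: cvg_cst.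
    exact: (clf _ _ _ c4).
  - by rewrite mulr0 subr0 clamp_ge1// clamp_le0 ?subr_le0// scale0r addr0 star1.
  - rewrite mulr1 clamp_le0; last by lra.
    by rewrite clamp_ge1; [rewrite scale0r addr0 star1|lra].
  move=> t _; have [h|h] := leP (2 * t) 1.
    rewrite [clamp (2 * t - 1)]clamp_le0 ?subr_le0// scale0r addr0.
    by apply: star => //; exact: clamp_itv.
  rewrite clamp_le0; last by rewrite subr_le0 ltW.
  by rewrite scale0r addr0; apply: star => //; exact: clamp_itv.
move=> c cc c01 Ac.
(* [k] is 1 on the middle third of the parameter interval and 0 at its ends; [tau] slides the
   parameter so that in the end the loop is run within the middle third. *)
pose k (t : R) : R := clamp (3 * Num.min t (1 - t)).
pose al (u : R) : R := clamp (2 * u).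
pose ga (u : R) : R := clamp (2 * u - 1).
pose tau (t m : R) : R := (1 - m) * t + m * clamp (3 * t - 1).
(* For [u <= 1/2] the middle third of the loop is pulled towards [p] while the two outer thirds
   become segments from the base point; for [u >= 1/2] these segments are retracted. *)
pose H (z : plane) : plane := p + (1 - al z.2 * k z.1) *: (c (clamp (tau z.1 (al z.2))) - p) +
  (ga z.2 * k z.1) *: (c 0 - p).
have itv01 (t m : R) : 0 <= t <= 1 -> 0 <= m <= 1 -> 0 <= tau t m <= 1.
  move=> /andP[t0 t1] /andP[m0 m1]; rewrite /tau; have /andP[s0 s1] := clamp_itv (3 * t - 1).
  apply/andP; split; first by rewrite addr_ge0// mulr_ge0// subr_ge0.
  apply: (@le_trans _ _ ((1 - m) * 1 + m * 1)); last by rewrite !mulr1 subrK.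
  by apply: lerD; apply: ler_wpM2l => //; rewrite subr_ge0.
have k0 : k 0 = 0 by rewrite /k subr0 min_l// mulr0 clamp_le0.
have k1 : k 1 = 0 by rewrite /k subrr min_r// mulr0 clamp_le0.
have al0 : al 0 = 0 by rewrite /al mulr0 clamp_le0.
have al1 : al 1 = 1 by rewrite /al mulr1 clamp_ge1// ler1n.
have ga0 : ga 0 = 0 by rewrite /ga mulr0 sub0r clamp_le0// oppr_le0.
have ga1 : ga 1 = 1 by rewrite /ga mulr1 clamp_ge1//; lra.
exists H; split.
- apply: continuous_subspaceT => z.
  have c1 : {for z, continuous (fst : plane -> R)} by exact: cvg_fst.
  have c2 : {for z, continuous (snd : plane -> R)} by exact: cvg_snd.
  have ccst (r : R) : {for z, continuous (fun _ : plane => r)} by exact: cvg_cst.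
  have ck : {for z, continuous (fun z : plane => k z.1)}.
    apply: clf; apply: cvgM; first exact: ccst.
    have c3 : {for z, continuous (fun z : plane => 1 - z.1)} by apply: cvgB => //; exact: ccst.
    exact: (@continuous_min _ _ fst (fun z : plane => 1 - z.1) z c1 c3).
  have ca : {for z, continuous (fun z : plane => al z.2)}.
    by apply: clf; apply: cvgM => //; exact: ccst.
  have cg : {for z, continuous (fun z : plane => ga z.2)}.
    by apply: clf; apply: cvgB; [apply: cvgM => //; exact: ccst|exact: ccst].
  have ct : {for z, continuous (fun z : plane => tau z.1 (al z.2))}.
    apply: cvgD; first by apply: cvgM => //; apply: cvgB => //; exact: ccst.
    apply: cvgM => //; apply: (clf _ (fun z : plane => 3 * z.1 - 1)); apply: cvgB; last exact: ccst.
    by apply: cvgM => //; exact: ccst.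
  apply: cvgD; last by apply: cvgZ; [exact: cvgM|exact: cvg_cst].
  apply: cvgD; first exact: cvg_cst.
  apply: cvgZ; first by apply: cvgB; [exact: ccst|exact: cvgM].
  apply: cvgB; last exact: cvg_cst.
  apply: (@continuous_comp _ _ _ (fun z : plane => tau z.1 (al z.2)) (c \o clamp)) => //.
  apply: (continuous_comp_within cl _ cc) => t /=; rewrite in_itv /=; exact: clamp_itv.
- move=> t u t01 u01; rewrite /H /=; have a01 := clamp_itv (2 * u).
  have cA : A (c (clamp (tau t (al u)))) by apply: Ac; exact: clamp_itv.
  have A0 : A (c 0) by apply: Ac; rewrite lexx ler01.
  have /andP[kt0 kt1] := clamp_itv (3 * Num.min t (1 - t)).
  have k01 : 0 <= k t <= 1 by exact: clamp_itv.
  have [h|h] := leP (2 * u) 1.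
    rewrite [ga u]clamp_le0 ?subr_le0// mul0r scale0r addr0; apply: star => //.
    have /andP[a0 a1] := a01; rewrite subr_ge0 mulr_ile1//=.
    by rewrite gerBl mulr_ge0.
  have -> : al u = 1 by apply: clamp_ge1; exact: ltW.
  have /andP[g0 g1] : 0 <= ga u <= 1 by exact: clamp_itv.
  rewrite mul1r; have ends : k t = 1 \/ c (clamp (tau t 1)) = c 0.
    rewrite /tau subrr mul0r add0r mul1r.
    have [t1|t1] := leP (3 * t) 1.
      by right; rewrite [clamp (3 * t - 1)]clamp_le0 ?subr_le0// clamp_le0.
    have [t2|t2] := leP 2 (3 * t).
      right; rewrite [clamp (3 * t - 1)]clamp_ge1; last by lra.
      by rewrite clamp_ge1// -c01.
    left; rewrite /k clamp_ge1//.
    by have [h1|h1] := leP t (1 - t); lra.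
  case: ends => [->|->].
    by rewrite subrr scale0r addr0 mulr1; apply: star => //; rewrite g0.
  rewrite -addrA -scalerDl; apply: star => //.
  have h2 : 0 <= ga u * k t by rewrite mulr_ge0.
  have h3 : ga u * k t <= k t by rewrite ler_piMl.
  by move: h2 h3 kt0 kt1; rewrite -/(k t); move: (k t) (ga u * k t) => a b *; apply/andP; split; lra.
- move=> t t01; rewrite /H /= al0 ga0.
  by rewrite !mul0r subr0 scale0r addr0 star1 /tau subr0 mul1r mul0r addr0 clamp_id.
- move=> t t01; rewrite /H /= al1 ga1 !mul1r; have ends : k t = 1 \/ c (clamp (tau t 1)) = c 0.
    rewrite /tau subrr mul0r add0r mul1r.
    have [t1|t1] := leP (3 * t) 1.
      by right; rewrite [clamp (3 * t - 1)]clamp_le0 ?subr_le0// clamp_le0.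
    have [t2|t2] := leP 2 (3 * t).
      right; rewrite [clamp (3 * t - 1)]clamp_ge1; last by lra.
      by rewrite clamp_ge1// -c01.
    left; rewrite /k clamp_ge1//.
    by have [h1|h1] := leP t (1 - t); lra.
  case: ends => [->|->]; first by rewrite subrr scale0r addr0 star1.
  by rewrite -addrA -scalerDl subrK star1.
move=> u u01; split.
  rewrite /H /= k0 !mulr0 subr0 scale0r addr0 star1 /tau !mulr0 add0r sub0r.
  rewrite [clamp (-1)]clamp_le0 ?oppr_le0// mulr0 clamp_le0//.
rewrite /H /= k1 !mulr0 subr0 scale0r addr0 star1 /tau.
rewrite [clamp (3 * 1 - 1)]clamp_ge1; last by lra.
by rewrite -mulrDl subrK mul1r clamp_ge1.
Qed.

(** For [0 <= m <= 1] one has [m^4 <= m], so shrinking towards [a] preserves the quartic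
    inequality. *)
Lemma lobes_simply_connected (a : plane) (e : R) : 0 < e -> simply_connected (lobes a e).
Proof.
move=> e0; apply: (@star_simply_connected _ a).
  by rewrite /lobes /= !subrr expr0n normr0 lexx exprn_ge0// ltW.
move=> x m /andP[h1 h2] /andP[m0 m1]; rewrite /lobes /=.
rewrite ![_ + _ - _]addrAC !subrr !add0r.
have -> : m *: (x.1 - a.1) = m * (x.1 - a.1) by [].
have -> : m *: (x.2 - a.2) = m * (x.2 - a.2) by [].
rewrite normrM ger0_norm// exprMn; apply/andP; split.
  apply: ler_pM => //; [exact: exprn_ge0|exact: exprn_even_ge0|].
  by rewrite exprS ler_piMr// exprn_ile1.
by apply: le_trans h2; rewrite ler_piMl.
Qed.

End StarShaped.

(** * Essential suprema and the closure in L^oo *)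

Section EssentiallyBounded.
Context {R : realType}.
Local Notation plane := (R * R)%type.
Local Notation P := (mplane R).
Local Notation mu := (@leb2 R).
Implicit Types (f g w v : plane -> R) (Omega : set plane).

Let muT_gt0 : (0 < mu setT)%E.
Proof.
apply: (@lt_le_trans _ _ (mu (ball (0 : plane) 1))).
  by rewrite leb2_ball ?lte_fin// exprn_gt0.
by apply: le_measure; rewrite ?inE//; exact: measurable_plane_ball.
Qed.

Let Lnorm_oo f : 'N[mu]_+oo[EFin \o (f : P -> R)]%E = ess_sup mu (fun x => `|(f x)%:E|%E).
Proof. by rewrite unlock /= muT_gt0. Qed.

Lemma Lp_on_oo Omega f (B : R) : mfun2 (f \_ Omega) -> (forall x, `|(f \_ Omega) x| <= B) ->
  Lp_on +oo%E Omega f.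
Proof.
move=> mf bf; rewrite /Lp_on inE; apply/andP; split; rewrite inE//=.
rewrite /finite_norm Lnorm_oo; apply: (@le_lt_trans _ _ B%:E); last exact: ltry.
by apply/ess_supP; apply: nearW => x; rewrite lee_fin.
Qed.

Lemma Lp_norm_on_oo_lt Omega f (e : R) : (Lp_norm_on +oo%E Omega f < e%:E)%E ->
  {ae mu, forall x : P, `|(f \_ Omega) x| < e}.
Proof.
rewrite /Lp_norm_on Lnorm_oo => h.
have := ess_sup_ge mu (fun x : P => `|((f \_ Omega) x)%:E|%E).
by apply: filterS => x hx; rewrite -lte_fin; exact: le_lt_trans hx h.
Qed.

Lemma Lp_norm_on_oo0 Omega : Lp_norm_on +oo%E Omega (fun=> 0 : R) = 0%E.
Proof.
rewrite /Lp_norm_on; have -> : (fun=> 0 : R) \_ Omega = (fun=> 0 : R) :> (plane -> R).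
  by apply/funext => x; rewrite patchE; case: ifP.
exact: (@Lnorm0 _ _ _ mu +oo%E).
Qed.

Lemma Linfty_closure_self Omega (S : set (plane -> R)) v : S v -> Lp_on +oo%E Omega v ->
  Linfty_closure Omega S v.
Proof.
move=> Sv lv; split=> // e e0; exists v; split=> //.
by rewrite (_ : (fun x => (v x - v x)%R) = fun=> 0) ?Lp_norm_on_oo0//; apply/funext => x; rewrite subrr.
Qed.

(* Two elements of [S] taking their values in {1, 2} coincide as soon as they are at distance
   less than 1, so that the closure adds nothing but almost everywhere equal functions. *)
Lemma Linfty_closure_two_valued Omega (S : set (plane -> R)) w :
  (forall v x, S v -> v x = 1 \/ v x = 2) -> Linfty_closure Omega S w ->
  exists2 v, S v & {ae mu, forall x : P, (w \_ Omega) x = (v \_ Omega) x}.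
Proof.
move=> S12 [_ H].
(* The tolerances [1/(n+2)] are at most 1/2, so that every approximant is at distance less than 1
   from the first one. *)
have [v H'] := choice (fun n : nat => H (n.+2%:R^-1) ltac:(by rewrite invr_gt0)).
have Sv n : S (v n) by have [] := H' n.
have ae n : {ae mu, forall x : P, `|((fun x => w x - v n x) \_ Omega) x| < n.+2%:R^-1}.
  by apply: Lp_norm_on_oo_lt; have [] := H' n.
exists (v 0%N) => //.
have {}ae : {ae mu, forall x : P, forall n, `|((fun x => w x - v n x) \_ Omega) x| < n.+2%:R^-1}.
  exact: ae_foralln.
apply: (@filterS _ _ (ae_filter_ringOfSetsType mu) _ _ _ ae) => x hx.
have [Ox|nO] := pselect (Omega x); last by rewrite !patch_out.
rewrite !patch_in//; have {}hx n : `|w x - v n x| < n.+2%:R^-1 by have := hx n; rewrite patch_in.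
have E n : v n x = v 0%N x.
  have h0 := hx 0%N; have hn := hx n.
  have : `|v n x - v 0%N x| < 1.
    rewrite (_ : v n x - v 0%N x = (w x - v 0%N x) - (w x - v n x)); last by ring.
    apply: le_lt_trans (ler_normB _ _) _.
    rewrite (_ : 1 = 2^-1 + 2^-1 :> R); last by field.
    apply: ltrD => //; apply: lt_le_trans hn _.
    by rewrite lef_pV2 ?posrE// ler_nat.
  by have [->|->] := S12 _ x (Sv n); have [->|->] := S12 _ x (Sv 0%N); rewrite ?ltr_norml//; move=> /andP[? ?]; lra.
apply/eqP; rewrite -subr_eq0 -normr_le0 leNgt; apply/negP => h.
have [N HN] := inv_lt_ex h.
have := HN N.+1 (leqnSn N); apply/negP; rewrite -leNgt; apply: ltW.
by have := hx N; rewrite E.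
Qed.

End EssentiallyBounded.

(** * The two-valued vorticity and its orbit *)

Section TwoValuedVorticity.
Context {R : realType}.
Local Notation plane := (R * R)%type.
Local Notation P := (mplane R).
Local Notation mu := (@leb2 R).
Implicit Types (w v psi g : plane -> R) (Omega : set plane) (eta zeta : plane -> plane).

Lemma dirichlet_data_ae Omega w w' psi g1 g2 : L2 w -> L2 w' -> {ae mu, forall x, w x = w' x} ->
  dirichlet_data Omega w psi g1 g2 -> dirichlet_data Omega w' psi g1 g2.
Proof.
move=> lw lw' ww' [l z phi H]; split=> // chi Tc.
by rewrite H// (ip_ae lw lw' (T_L2 Tc) ww').
Qed.

Variables (a : plane) (e : R).

(** Total on the plane, with value 2 off the lobes, so that the boundary value needs no separate
    definition. *)
Definition lobe_vorticity (x : plane) : R := if `[< lobes a e x >] then 1 else 2.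
Local Notation w0 := lobe_vorticity.

Lemma lobe_vorticity_in x : lobes a e x -> w0 x = 1.
Proof. by move=> h; rewrite /w0 asboolT. Qed.
Lemma lobe_vorticity_out x : ~ lobes a e x -> w0 x = 2.
Proof. by move=> h; rewrite /w0 asboolF. Qed.
Lemma lobe_vorticity_values x : w0 x = 1 \/ w0 x = 2.
Proof. by rewrite /w0; case: ifP => _; [left|right]. Qed.

(** The function is twice the indicator of [Omega] minus that of the preimage of the closed set [K]
    in [Omega]. *)
Lemma orbit_mfun Omega zeta : open Omega -> smooth_map Omega zeta -> mfun2 ((w0 \o zeta) \_ Omega).
Proof.
move=> oO sz; have mO := open_measurable2 oO.
have mA : @measurable _ P (Omega `&` zeta @^-1` lobes a e).
  by apply: (smooth_map_measurable oO sz mO); apply: closed_measurable2; exact: lobes_closed.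
have := mfun2B (mfun2M (mfun2_cst 2) (mfun2_indic mO)) (mfun2_indic mA).
congr mfun2; apply/funext => x; rewrite !indicE /cst.
have [Ox|nO] := pselect (Omega x); last first.
  by rewrite patch_out// !memNset ?mulr0 ?subr0//; move=> [].
rewrite patch_in// (mem_set Ox) mulr1 /=.
have [k|k] := pselect (lobes a e (zeta x)).
  by rewrite lobe_vorticity_in// mem_set//=; ring.
by rewrite lobe_vorticity_out// memNset ?subr0//; move=> [].
Qed.

Lemma orbit_bound Omega zeta x : `|((w0 \o zeta) \_ Omega) x| <= 2.
Proof.
have [Ox|nO] := pselect (Omega x); last by rewrite patch_out// normr0.
rewrite patch_in//=; have [->|->] := lobe_vorticity_values (zeta x).
  by rewrite normr1 ler1n.
by rewrite ger0_norm.
Qed.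

Lemma orbit_L2 Omega (M : R) zeta : open Omega -> Omega `<=` (ball (0 : plane) M : set plane) ->
  smooth_map Omega zeta -> L2 ((w0 \o zeta) \_ Omega).
Proof.
move=> oO OM sz; apply: (@L2_bounded_supp R _ 2 0 M (orbit_mfun oO sz) (@orbit_bound Omega zeta)) => y nb.
by apply: patch_out => /OM.
Qed.

(** A minimiser [w] in the closure need not lie in the orbit, but it has the energy of an orbit
    element [v]. The twists of [v] are again in the orbit, so [v] is stationary under all the dyadic
    twists supported well inside [Omega]. *)
Lemma lobe_orbit_no_minimizer Omega (M : R) w : open Omega -> 0 < M ->
  Omega `<=` (ball (0 : plane) M : set plane) -> 0 < e -> e < 1 ->
  (ball a (e + e) : set plane) `<=` Omega ->
  ~ global_minimizer (Linfty_closure Omega (coadjoint_orbit Omega w0)) (kinetic_energy Omega) w.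
Proof.
move=> oO M0 OM e0 e1 aO [Cw min].
have [v [eta [zeta [VD vE]]] wv] : exists2 v, coadjoint_orbit Omega w0 v &
    {ae mu, forall x : P, (w \_ Omega) x = (v \_ Omega) x}.
  apply: Linfty_closure_two_valued Cw => v x [eta [zeta [_ ->]]]; exact: lobe_vorticity_values.
have [[_ sz] [_ Oz] _ _] := VD.
pose W := v \_ Omega; have lW : L2 W by rewrite /W vE; exact: orbit_L2 oO OM sz.
have mO := open_measurable2 oO.
have lw : L2 (w \_ Omega).
  apply: L2_ae _ lW.
    by have [+ _] := Cw; rewrite /Lp_on inE => /andP[]; rewrite inE.
  by apply: filterS wv => x ->.
have [psi [g1 [g2 D]]] := dirichlet_exists oO M0 OM lW.
have Dw : dirichlet_data Omega (w \_ Omega) psi g1 g2.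
  by apply: dirichlet_data_ae lW lw _ D; apply: filterS wv => x ->.
have Ew := kinetic_energyE oO M0 OM lw Dw.
have [b [p [[sb sp] [b0 p0] [bz pz] [bp [pc pc0 pp]] ode]]] := @mollifier_profile R.
have mW : mfun2 W := L2_mfun lW.
have WB x : `|W x| <= 2 by rewrite /W vE; exact: orbit_bound.
have WO x : ~ Omega x -> W x = 0 by exact: patch_out.
apply: (lobes_not_stationary sb sp b0 p0 bz pz bp pc0 pp ode oO M0 OM e0 e1 aO VD mW _ _ WO D).
- by move=> x Ox k; rewrite /W patch_in// vE /= lobe_vorticity_in.
- by move=> x Ox k; rewrite /W patch_in// vE /= lobe_vorticity_out.
move=> n q gq.
have r0 := dyad_gt0 (R := R) n.
have sk := smooth1_kf sb n.
have k0 s : 0 <= kf b n s by rewrite /kf mulr_ge0// exprn_ge0.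
have kz := kf_out bz (n := n).
have bO : (ball q (dyad n + dyad n) : set plane) `<=` Omega.
  by apply: subset_trans gq; apply: le_ball; lra.
apply: (minimiser_stationary sk k0 r0 kz oO M0 OM bO mW WB WO D) => t psi' g1' g2' D'.
have VT := vol_diffeo_tw t sk k0 r0 kz bO.
have VD' := vol_diffeo_comp oO VD VT.
have [[_ sz'] _ _ _] := VD'.
pose v' := w0 \o (zeta \o tw q (kf b n) t).
have WE : (fun x => W (tw q (kf b n) t x)) = v' \_ Omega.
  apply/funext => x; have [Ox|nO] := pselect (Omega x).
    have Ot := tw_in r0 kz t bO Ox; rewrite /W (patch_in _ Ot) (patch_in _ Ox) vE.
    by [].
  by rewrite /W !patch_out// => /(tw_sub r0 kz bO).
rewrite WE in D'.
have lv' := orbit_L2 oO OM sz'.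
have Ev' := kinetic_energyE oO M0 OM lv' D'.
have Cv' : Linfty_closure Omega (coadjoint_orbit Omega w0) v'.
  apply: Linfty_closure_self; first by exists (tw q (kf b n) (- t) \o eta), (zeta \o tw q (kf b n) t).
  by apply: Lp_on_oo (@orbit_bound Omega _); exact: orbit_mfun.
have := min v' Cv'; rewrite Ew Ev' ler_pM2l//.
Qed.

End TwoValuedVorticity.

Theorem theorem7p3 (R : realType) (Omega : set (R * R))
    (hOmega : bounded_convex_domain Omega) :
  exists w0 : R * R -> R,
    [/\ Lp_on +oo%E Omega w0,
        forall x, closure Omega x -> 0 <= w0 x,
        forall s : R,
          (ereal_inf [set (w0 x)%:E | x in closure Omega] < s%:E)%E ->
          (s%:E < ereal_sup [set (w0 x)%:E | x in closure Omega])%E ->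
          simply_connected [set x | closure Omega x /\ w0 x < s],
        exists c : R, forall x, boundary Omega x -> w0 x = c &
        ~ exists w, global_minimizer
            (Linfty_closure Omega (coadjoint_orbit Omega w0))
            (kinetic_energy Omega) w].
Proof.
have [oO [a Oa] bO _] := hOmega.
have [M M0 OM] : exists2 M : R, 0 < M & Omega `<=` (ball (0 : R * R) M : set (R * R)).
  have [B [_ HB]] := bO; exists (`|B| + 2); first by rewrite ltr_wpDl.
  move=> x Ox; have h : `|x| <= `|B| + 1.
    by apply: HB => //; apply: le_lt_trans (ler_norm B) _; rewrite ltrDl.
  by rewrite -ball_normE /= sub0r normrN; apply: le_lt_trans h _; rewrite ltrD2l ltr1n.
have /nbhs_ballP[r /= r0 Hr] : nbhs a Omega by apply: open_nbhs_nbhs.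
(* [e + e <= r] puts the doubled ball, hence the lobes, inside [Omega]; [e < 1] ensures that
   [e^4 <= e]. *)
pose e := Num.min (r / 2) 2^-1.
have e0 : 0 < e by rewrite lt_min divr_gt0//= invr_gt0 ltr0n.
have e1 : e < 1 by rewrite gt_min invf_lt1// ltr1n orbT.
have aO : (ball a (e + e) : set (R * R)) `<=` Omega.
  apply: subset_trans Hr; apply: le_ball.
  by rewrite [leRHS]splitr; apply: lerD; rewrite ge_min lexx.
have KO x : lobes a e x -> Omega x.
  move=> /(lobes_bound e0 e1)[h1 h2]; apply: aO; apply/plane_ballP; rewrite ![`|_ - x.1|]distrC ![`|_ - x.2|]distrC.
  by split; [apply: le_lt_trans h1 _|apply: le_lt_trans h2 _]; rewrite ltrDl.
exists (lobe_vorticity a e); split.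
- have sid : smooth_map Omega (@id (R * R)) by split=> k; [exact: Ck_fst|exact: Ck_snd].
  exact: Lp_on_oo (orbit_mfun a e oO sid) (@orbit_bound R a e Omega id).
- by move=> x _; have [->|->] := lobe_vorticity_values a e x.
- move=> s h1 h2.
  (* All values are 1 or 2, so [s] lies strictly between them and the sublevel set is exactly the
     lobes. *)
  have s1 : 1 < s.
    rewrite -lte_fin; apply: le_lt_trans h1; apply: le_ereal_inf_tmp => _ [x _ <-].
    by rewrite lee_fin; have [->|->] := lobe_vorticity_values a e x; rewrite ?ler1n.
  have s2 : s < 2.
    rewrite -lte_fin; apply: lt_le_trans h2 _; apply: ge_ereal_sup => _ [x _ <-].
    by rewrite lee_fin; have [->|->] := lobe_vorticity_values a e x; rewrite ?ler1n.
  rewrite (_ : [set x | _] = lobes a e); first exact: lobes_simply_connected.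
  apply/seteqP; split => x /=.
    move=> [_ h]; apply: contrapT => k; move: h; rewrite lobe_vorticity_out// => h.
    by have := lt_trans h s2; rewrite ltxx.
  move=> k; rewrite lobe_vorticity_in//; split=> //.
  by apply: subset_closure; exact: KO.
(* [Omega] is open, so its boundary does not meet it, and hence does not meet the lobes. *)
- exists 2 => x [_ nx]; apply: lobe_vorticity_out => /KO Ox; apply: nx.
  by rewrite (interior_id _).1.
by move=> [w]; exact: (lobe_orbit_no_minimizer oO M0 OM e0 e1 aO).
Qed.
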